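(* Let $M$ be a convex Riemannian manifold of negative sectional curvature bounded above by $-k^2$, where $k>0$, and set $r_0=\frac{1}{k}\log\left(\sqrt{2}+1\right)$. Then for every two distinct points $x,p\in M$, the set of all $q\in M$ such that the geodesic $[p,q]$ meets the ball $B(x,r_0)$ contains the whole half-space $H(x,v_p)$, where $v_p\in T^1_xM$ is the unit tangent vector at $x$ of the geodesic $[p,x]$ (oriented from $p$ to $x$).
   Context: Riemannian manifolds are allowed to have boundary. A Riemannian manifold $M$ is \emph{convex} if any two points $p,q\in M$ are joined by a unique geodesic arc $[p,q]$, whose interior is disjoint from the boundary of $M$. The ball is $B(x,r)=\{y\in M : d(x,y)\leq r\}$. For $x\in M$ and a unit vector $v\in T^1_xM$, the \emph{half-space} $H(x,v)$ consists of all $y\in M$ such that the geodesic $[x,y]$ makes an angle $\leq\frac{\pi}{2}$ with $v$ at $x$ (the point $y=x$ is counted as belonging to $H(x,v)$). *)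

(* Defs.v *)
From HB Require Import structures.
From mathcomp Require Import all_boot all_order all_algebra.
From mathcomp Require Import all_classical all_reals all_analysis.

Set Implicit Arguments.
Unset Strict Implicit.
Unset Printing Implicit Defensive.

Import Order.TTheory GRing.Theory Num.Theory.
Import numFieldNormedType.Exports.

Local Open Scope classical_set_scope.
Local Open Scope ring_scope.

Section Calculus.
Context {R : realType} {V W : normedModType R}.

Fixpoint Ck (k : nat) (U : set V) (f : V -> W) : Prop :=
  (forall x, U x -> {for x, continuous f}) /\
  (if k is k'.+1 then
     forall v, (forall x, U x -> derivable f x v) /\
               Ck k' U (fun x => 'D_v f x)
   else True).

(* C^infinity on a set that need not be open: local C^infinity extensions. *)
Definition smooth_on (A : set V) (f : V -> W) : Prop :=
  forall x, A x -> exists (U : set V) (F : V -> W),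
    [/\ open U, U x, forall k, Ck k U F & forall y, U y -> A y -> F y = f y].

(* Directional derivative in which the increments stay in A, hence one-sided
   where A has an edge. It agrees with 'D_v f x when A is a neighborhood
   of x. *)
Definition dwithin (A : set V) (f : V -> W) (x v : V) : W :=
  lim ((fun h : R => h^-1 *: (f (h *: v + x) - f x))
         @ within [set h | A (h *: v + x)] 0^').

End Calculus.

Definition halfspaceR (R : realType) (n : nat) : set 'rV[R]_n :=
  [set z | forall i : 'I_n, i = 0%N :> nat -> 0 <= z 0 i].

Record chart (R : realType) (n : nat) (M : topologicalType) := Chart {
  dom : set M ;
  cod : set 'rV[R]_n ;
  coord : M -> 'rV[R]_n ;
  param : 'rV[R]_n -> M ;
  chart_open_dom : open dom ;
  chart_open_cod :
    exists2 O : set 'rV[R]_n, open O & cod = O `&` @halfspaceR R n ;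
  chart_coord_cod : forall x, dom x -> cod (coord x) ;
  chart_param_dom : forall z, cod z -> dom (param z) ;
  chart_coordK : forall x, dom x -> param (coord x) = x ;
  chart_paramK : forall z, cod z -> coord (param z) = z ;
  chart_coord_continuous : {within dom, continuous coord} ;
  chart_param_continuous : {within cod, continuous param} }.

Definition overlap (R : realType) (n : nat) (M : topologicalType)
    (a b : chart R n M) : set 'rV[R]_n :=
  cod a `&` param a @^-1` dom b.

Definition transition (R : realType) (n : nat) (M : topologicalType)
    (a b : chart R n M) (z : 'rV[R]_n) : 'rV[R]_n := coord b (param a z).

(* Tangent coordinates are row vectors, so this matrix acts on the right: it
   sends components in the chart a to components in the chart b. *)
Definition transition_jacobian (R : realType) (n : nat) (M : topologicalType)
    (a b : chart R n M) (z : 'rV[R]_n) : 'M[R]_n :=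
  \matrix_(i, j)
    dwithin (overlap a b) (transition a b) z (delta_mx 0 i) 0 j.

(* The interior is locally modelled on the open half-space, and boundary points
   are those with vanishing coordinate of index 0. A tangent vector at x is
   represented by its components in the chart [chart_at x]. The matrix
   [metric a z] is the Gram matrix of the coordinate frame of the chart a at
   the point with coordinates z. *)
Record riemannianManifold (R : realType) (n : nat) := RiemannianManifold {
  space :> topologicalType ;
  space_hausdorff : hausdorff_space space ;
  space_second_countable : @second_countable space ;
  atlas : Type ;
  chart_of : atlas -> chart R n space ;
  index_at : space -> atlas ;
  index_atP : forall x, dom (chart_of (index_at x)) x ;
  transition_smooth : forall a b,
    smooth_on (overlap (chart_of a) (chart_of b))
              (transition (chart_of a) (chart_of b)) ;
  metric : atlas -> 'rV[R]_n -> 'M[R]_n ;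
  metric_smooth : forall a, smooth_on (cod (chart_of a)) (metric a) ;
  metric_sym : forall a z, cod (chart_of a) z -> (metric a z)^T = metric a z ;
  metric_pos : forall a z (u : 'rV[R]_n), cod (chart_of a) z -> u != 0 ->
    0 < (u *m metric a z *m u^T) 0 0 ;
  metric_compat : forall a b x,
    dom (chart_of a) x -> dom (chart_of b) x ->
    let J := transition_jacobian (chart_of a) (chart_of b)
               (coord (chart_of a) x) in
    metric a (coord (chart_of a) x) =
      J *m metric b (coord (chart_of b) x) *m J^T }.

Section Riemannian.
Context {R : realType} {n : nat} (M : riemannianManifold R n).

Implicit Types (a : atlas M) (x y p q : M) (u v w : 'rV[R]_n) (c : R -> M).

Definition chart_at x : chart R n M := chart_of (index_at x).

Definition boundary : set M :=
  [set x | exists2 a, dom (chart_of a) x &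
     exists2 i : 'I_n, i = 0%N :> nat & coord (chart_of a) x 0 i = 0].

Definition inner x u v : R :=
  (u *m metric (index_at x) (coord (chart_at x) x) *m v^T) 0 0.

Definition tnorm x u : R := Num.sqrt (inner x u u).

Definition angle x u v : R := acos (inner x u v / (tnorm x u * tnorm x v)).

Definition partial a (i : 'I_n) (f : 'rV[R]_n -> R) (z : 'rV[R]_n) : R :=
  dwithin (cod (chart_of a)) f z (delta_mx 0 i).

Definition gram a (i j : 'I_n) (z : 'rV[R]_n) : R := metric a z i j.

(* Gamma^l_{ij} *)
Definition christoffel a (l i j : 'I_n) (z : 'rV[R]_n) : R :=
  2^-1 * \sum_m invmx (metric a z) l m *
    (partial a i (gram a j m) z + partial a j (gram a i m) z
     - partial a m (gram a i j) z).

(* Component along d_l of R(d_i, d_j) d_k, with the sign convention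
   R(X, Y) Z = nabla_X nabla_Y Z - nabla_Y nabla_X Z - nabla_[X,Y] Z. *)
Definition riemann a (i j k l : 'I_n) (z : 'rV[R]_n) : R :=
  partial a i (christoffel a l j k) z - partial a j (christoffel a l i k) z
  + \sum_m (christoffel a l i m z * christoffel a m j k z
            - christoffel a l j m z * christoffel a m i k z).

Definition curvature x u v w : 'rV[R]_n :=
  \row_l \sum_i \sum_j \sum_k
    u 0 i * v 0 j * w 0 k * riemann (index_at x) i j k l (coord (chart_at x) x).

Definition sectional x u v : R :=
  inner x (curvature x u v v) u /
    (inner x u u * inner x v v - inner x u v ^+ 2).

Definition sectional_le (K : R) : Prop :=
  forall x u v, row_free (col_mx u v) -> sectional x u v <= K.

(* Parameter values in [0, 1] sent by c into the domain of the chart a. *)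
Definition times a c : set R := `[0, 1] `&` c @^-1` dom (chart_of a).

Definition local_curve a c (t : R) : 'rV[R]_n := coord (chart_of a) (c t).

Definition local_velocity a c (t : R) : 'rV[R]_n :=
  dwithin (times a c) (local_curve a c) t 1.

Definition local_acceleration a c (t : R) : 'rV[R]_n :=
  dwithin (times a c) (local_velocity a c) t 1.

Definition velocity c (t : R) : 'rV[R]_n := local_velocity (index_at (c t)) c t.

Definition smooth_curve c : Prop :=
  {within `[0, 1], continuous c} /\
  forall a, smooth_on (times a c) (local_curve a c).

Definition curve_length c : R :=
  \int[lebesgue_measure]_(t in `[0, 1]) tnorm (c t) (velocity c t).

(* Piecewise smooth curves, as finite concatenations of smooth ones. *)
Inductive joined_by_length : M -> M -> R -> Prop :=
| Joined_nil x : joined_by_length x x 0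
| Joined_cons c y l : smooth_curve c -> joined_by_length (c 1) y l ->
    joined_by_length (c 0) y (curve_length c + l).

Definition dist x y : R := inf [set l | joined_by_length x y l].

Definition rball x (r : R) : set M := [set y | dist x y <= r].

(* Geodesic arcs are parametrized affinely on [0, 1]; only the values of c on
   this interval matter. *)
Definition geodesic_arc p q c : Prop :=
  [/\ smooth_curve c, c 0 = p, c 1 = q &
      forall a t, times a c t -> forall l,
        local_acceleration a c t 0 l +
        \sum_i \sum_j christoffel a l i j (local_curve a c t) *
          local_velocity a c t 0 i * local_velocity a c t 0 j = 0].

Definition convex_manifold : Prop :=
  forall p q,
    (exists c, geodesic_arc p q c) /\
    (forall c c', geodesic_arc p q c -> geodesic_arc p q c' ->
       forall t, t \in `[0, 1] -> c t = c' t) /\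
    (p <> q -> forall c, geodesic_arc p q c ->
       forall t, t \in `]0, 1[ -> ~ boundary (c t)).

Definition segment p q : set M :=
  [set y | exists2 c, geodesic_arc p q c &
     exists2 t, t \in `[0, 1] & y = c t].

Definition halfspace x v : set M :=
  [set y | y = x \/
     exists2 c, geodesic_arc x y c & angle x (velocity c 0) v <= pi / 2].

(* v is the unit tangent vector at x of the geodesic [p, x], oriented from p
   to x. *)
Definition arrival_vector p x v : Prop :=
  exists2 c, geodesic_arc p x c &
    v = (tnorm x (velocity c 1))^-1 *: velocity c 1.

End Riemannian.

(* Main.v *)
From HB Require Import structures.
Require Import Defs.
From mathcomp Require Import all_boot all_order all_algebra.
From mathcomp Require Import all_classical all_reals all_analysis.
From mathcomp Require Import ring lra.

(** Write D(p, q) for the length of the geodesic arc [p, q]. Everything is done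
    with geodesics alone, in coordinates, and at interior points first; the
    convexity of M keeps all arcs but their endpoints away from the boundary,
    and statements pass to boundary points by continuity of D off the diagonal.

    Differentiating the geodesic equation with respect to the initial velocity
    gives Jacobi fields J along an arc. For the curvature bound -k^2, the
    Riccati-type comparison of g(J, J') with coth shows that there are no
    conjugate points, hence that the arrival velocity of [p, y] is a
    differentiable function of y, and that f = cosh (k D(p, .)) satisfies
    f'' >= k^2 |c'|^2 f along every geodesic c that avoids p. Hence f lies below
    the combination of sinh with the same values at the ends of c, and, when the
    angle at x between [x, p] and [x, y] is at least pi / 2,
    cosh kD(p, y) >= cosh kD(p, x) cosh kD(x, y). At a boundary point x the
    derivative of D(p, .) is replaced by a subgradient inequality obtained as a
    limit along [p, x]. For the theorem, bound cosh kD(x, .) along [p, y] by its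
    sinh combination and minimise the latter: its minimum is at most sqrt 2,
    which is cosh k r0. *)

Set Implicit Arguments.
Unset Strict Implicit.
Unset Printing Implicit Defensive.

Import Order.TTheory GRing.Theory Num.Theory.
Import numFieldNormedType.Exports.

Local Open Scope classical_set_scope.
Local Open Scope ring_scope.

(** * Functions of class C^k *)

Section CkGeneral.
Context {R : realType} {V W : normedModType R}.
Implicit Types (f g : V -> W) (U O : set V).

(** Two features of the setting shape the argument. At a boundary point a geodesic cannot be
    prolonged, so the flow of the geodesic equation is used only along arcs free of boundary points,
    end points included; limits towards the boundary rely on bounds that are uniform over the
    interior points of one chart. And [dist], an infimum over all curves, is never computed: a point
    at geodesic distance at most r0 from x lies in the ball because the arc is a competitor, so no
    minimising property of geodesics is proved. Uniqueness of arcs replaces global properties of the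
    exponential map. A local inverse suffices, since the arc that it yields must be the arc of M,
    and this inverse only has to be differentiable at one point at a time, with a quadratic
    remainder, rather than of class C^1. The constant r0 is the distance from the right-angled
    vertex to the opposite side in the triangle of the plane of curvature -k^2 whose other two
    vertices are ideal: there cosh k r0 = 1 / sin (pi / 4). *)

Lemma Ck_cont k U f x : Ck k U f -> U x -> {for x, continuous f}.
Proof. by case: k => [|k] [+ _]; exact. Qed.

Lemma Ck_derivable k U f x v : Ck k.+1 U f -> U x -> derivable f x v.
Proof. by move=> [_ /(_ v)[+ _]]; exact. Qed.

Lemma Ck_derive k U f v : Ck k.+1 U f -> Ck k U (fun x => 'D_v f x).
Proof. by move=> [_ /(_ v)[]]. Qed.

Lemma CkS k U f : Ck k.+1 U f -> Ck k U f.
Proof.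
elim: k f => [|k IH] f; first by move=> [].
by move=> [cf df]; split=> // v; have [d1 d2] := df v; split=> //; exact: IH.
Qed.

Lemma CkW k l U f : (k <= l)%N -> Ck l U f -> Ck k U f.
Proof.
move=> /subnK <-; elim: (l - k)%N => // m IH.
by rewrite addSn => /CkS; exact: IH.
Qed.

Lemma Ck_sub k U O f : O `<=` U -> Ck k U f -> Ck k O f.
Proof.
move=> sub; elim: k f => [|k IH] f [cf df]; split=> //; try by move=> x /sub /cf.
by move=> v; have [d1 d2] := df v; split=> [x /sub /d1//|]; exact: IH.
Qed.

Lemma Ck_eq k U f g : open U -> (forall x, U x -> f x = g x) ->
  Ck k U f -> Ck k U g.
Proof.
move=> oU.
have nfg (f0 g0 : V -> W) x : (forall x, U x -> f0 x = g0 x) ->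
    U x -> \near x, f0 x = g0 x.
  move=> fg Ux; apply: filterS (open_nbhs_nbhs (conj oU Ux)) => y; exact: fg.
have cfg f0 g0 x : (forall x, U x -> f0 x = g0 x) ->
    U x -> {for x, continuous f0} -> {for x, continuous g0}.
  move=> fg Ux cf; rewrite /prop_for /continuous_at -(fg _ Ux).
  by apply: cvg_trans cf; apply: near_eq_cvg; apply: nfg => // y /fg.
elim: k f g => [|k IH] f g fg [cf df].
  by split=> // x Ux; exact: cfg (cf _ Ux).
split=> [x Ux|v]; first exact: cfg (cf _ Ux).
have [d1 d2] := df v; split=> [x Ux|].
  by apply: near_eq_derivable (d1 _ Ux); exact: nfg.
apply: IH d2 => x Ux; exact/near_eq_derive/nfg.
Qed.

(** [Ck] is a conjunction of conditions at single points of the set, with limits taken in the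
    ambient space, so the sets O need not be open. *)
Lemma Ck_local k U f :
  (forall x, U x -> exists2 O, O x & Ck k O f) -> Ck k U f.
Proof.
elim: k f => [|k IH] f H; split=> //; try by move=> x /H [Q Ox] /Ck_cont; apply.
move=> v; split=> [x /H [Q Ox]|]; first by move=> /Ck_derivable; exact.
by apply: IH => x /H [Q Ox] /(Ck_derive v) ?; exists Q.
Qed.

Lemma Ck_cst k U (w : W) : Ck k U (fun=> w).
Proof.
elim: k w => [|k IH] w; split=> //; try by move=> x _; exact: cst_continuous.
move=> v; split=> [x _|]; first exact: derivable_cst.
by under eq_fun do rewrite derive_cst; exact: IH.
Qed.

Lemma CkD k U f g : open U -> Ck k U f -> Ck k U g ->
  Ck k U (fun x => f x + g x).
Proof.
move=> oU; elim: k f g => [|k IH] f g [cf df] [cg dg].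
  by split=> // x Ux; apply: continuousD; [exact: cf|exact: cg].
split=> [x Ux|v]; first by apply: continuousD; [exact: cf|exact: cg].
have [d1 d2] := df v; have [e1 e2] := dg v.
split=> [x Ux|]; first by apply: derivableD; [exact: d1|exact: e1].
apply: Ck_eq (IH _ _ d2 e2) => // x Ux.
by rewrite (@deriveD _ _ _ f g x v (d1 _ Ux) (e1 _ Ux)).
Qed.

Lemma CkZ k U (c : R) f : open U -> Ck k U f -> Ck k U (fun x => c *: f x).
Proof.
move=> oU; elim: k f => [|k IH] f [cf df].
  by split=> // x Ux; apply: continuousZl_tmp; exact: cf.
split=> [x Ux|v]; first by apply: continuousZl_tmp; exact: cf.
have [d1 d2] := df v.
split=> [x Ux|]; first by apply: derivableZ; exact: d1.
apply: Ck_eq (IH _ d2) => // x Ux.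
by rewrite (@deriveZ _ _ _ f c x v (d1 _ Ux)).
Qed.

Lemma CkB k U f g : open U -> Ck k U f -> Ck k U g ->
  Ck k U (fun x => f x - g x).
Proof.
move=> oU cf cg; apply: CkD => //.
by under eq_fun do rewrite -scaleN1r; exact: CkZ.
Qed.

Lemma Ck_sum k U (I : Type) (r : seq I) (P : pred I) (h : I -> V -> W) :
  open U -> (forall i, Ck k U (h i)) -> Ck k U (fun x => \sum_(i <- r | P i) h i x).
Proof.
move=> oU H; elim: r => [|i r IH].
  by under eq_fun do rewrite big_nil; exact: Ck_cst.
under eq_fun do rewrite big_cons; case: (P i) => //; exact: CkD.
Qed.

End CkGeneral.

Lemma Ck_mx (R : realType) (V : normedModType R) (m n k : nat) (U : set V)
    (M : V -> 'M[R]_(m, n)) : open U ->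
  Ck k U M <-> forall i j, Ck k U (fun x => M x i j).
Proof.
move=> oU.
have cM (N : V -> 'M[R]_(m, n)) x : {for x, continuous N} <->
    forall i j, {for x, continuous (fun x => N x i j)}.
  split=> [cN i j|cN].
    apply: (@continuous_comp _ _ _ N (fun A : 'M[R]_(m, n) => A i j)) => //.
    exact: coord_continuous.
  apply/cvgrPdist_le => /= e e0.
  near=> y; rewrite /Num.Def.normr/= mx_normrE (bigmax_le _ (ltW e0))//= => i _.
  rewrite !mxE; move: i; near: y; apply: filter_forall => /= i.
  exact: ((cvgrPdist_le _ _).1 (cN i.1 i.2)).
elim: k M => [|k IH] M.
  split=> [[c _] i j|H]; split=> // x Ux; first exact: ((cM M x).1 (c _ Ux)).
  by apply/cM => i j; have [c _] := H i j; exact: c.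
split=> [[c d] i j|H].
  split=> [x Ux|v]; first exact: ((cM M x).1 (c _ Ux)).
  have [d1 d2] := d v; split=> [x /d1 /derivable_mxP//|].
  move/IH: d2 => /(_ i j); apply: Ck_eq => // x Ux.
  by rewrite derive_mx ?mxE//; exact: d1.
split=> [x Ux|v].
  by apply/cM => i j; have [c _] := H i j; exact: c.
have d1 x : U x -> derivable M x v.
  by move=> Ux; apply/derivable_mxP => i j; apply: Ck_derivable (H i j) Ux.
split=> //; apply/IH => i j; apply: Ck_eq (Ck_derive v (H i j)) => // x Ux.
by rewrite derive_mx ?mxE//; exact: d1.
Unshelve. all: by end_near. Qed.

Section CkScalar.
Context {R : realType} {V : normedModType R}.
Implicit Types (f g : V -> R) (U O : set V).

Lemma CkM k U f g : open U -> Ck k U f -> Ck k U g ->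
  Ck k U (fun x => f x * g x).
Proof.
move=> oU; elim: k f g => [|k IH] f g cf cg.
  by split=> // x Ux; apply: continuousM; [exact: Ck_cont cf Ux|exact: Ck_cont cg Ux].
have [cf0 df] := cf; have [cg0 dg] := cg.
split=> [x Ux|v]; first by apply: continuousM; [exact: cf0|exact: cg0].
have [d1 d2] := df v; have [e1 e2] := dg v.
split=> [x Ux|]; first by apply: derivableM; [exact: d1|exact: e1].
have H := CkD oU (IH _ _ (CkS cf) e2) (IH _ _ (CkS cg) d2).
apply: Ck_eq H => // x Ux.
by rewrite (@deriveM _ _ f g x v (d1 _ Ux) (e1 _ Ux)).
Qed.

Lemma CkV k U f : open U -> (forall x, U x -> f x != 0) -> Ck k U f ->
  Ck k U (fun x => (f x)^-1).
Proof.
move=> oU f0; elim: k => [|k IH] cf.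
  by split=> // x Ux; apply: continuousV; [exact: f0|exact: Ck_cont cf Ux].
split=> [x Ux|v]; first by apply: continuousV; [exact: f0|exact: Ck_cont cf Ux].
have [d1 d2] := cf.2 v.
split=> [x Ux|]; first by apply: derivableV; [exact: f0|exact: d1].
have H := IH (CkS cf).
have H2 := CkZ (-1) oU (CkM oU (CkM oU H H) d2).
apply: Ck_eq H2 => // x Ux.
rewrite (@deriveV _ _ f x v (f0 _ Ux) (d1 _ Ux)) /= -exprVn expr2.
by rewrite scaleN1r scaleNr.
Qed.

Lemma Ck_prod k U (I : Type) (r : seq I) (P : pred I) (h : I -> V -> R) :
  open U -> (forall i, Ck k U (h i)) -> Ck k U (fun x => \prod_(i <- r | P i) h i x).
Proof.
move=> oU H; elim: r => [|i r IH].
  by under eq_fun do rewrite big_nil; exact: Ck_cst.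
under eq_fun do rewrite big_cons; case: (P i) => //; exact: CkM.
Qed.

Lemma Ck_det k U n (M : V -> 'M[R]_n) : open U ->
  (forall i j, Ck k U (fun x => M x i j)) -> Ck k U (fun x => \det (M x)).
Proof.
move=> oU H; apply: Ck_sum => // s; apply: CkM => //; first exact: Ck_cst.
by apply: Ck_prod => // i; exact: H.
Qed.

(** Cramer's rule: where M is invertible, the entry is a cofactor over the determinant, both
    polynomial in the entries of M. *)
Lemma Ck_invmx k U n (M : V -> 'M[R]_n) i j : open U ->
  (forall i j, Ck k U (fun x => M x i j)) ->
  (forall x, U x -> M x \in unitmx) -> Ck k U (fun x => invmx (M x) i j).
Proof.
move=> oU H uM.
have H1 : Ck k U (fun x => (\det (M x))^-1 * ((-1) ^+ (j + i) *
    \det (row' j (col' i (M x))))).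
  apply: CkM => //; first apply: CkV => //.
  - by move=> x /uM; rewrite unitmxE unitfE.
  - exact: Ck_det.
  apply: CkM => //; first exact: Ck_cst.
  by apply: Ck_det => // a b; under eq_fun do rewrite !mxE; exact: H.
by apply: Ck_eq H1 => // x Ux; rewrite /invmx uM// !mxE.
Qed.

Lemma Ck_id k U : @Ck R V V k U id.
Proof.
case: k => [|k]; split=> //; try by move=> x _.
move=> v; split=> [x _|]; first exact: derivable_id.
by under eq_fun do rewrite derive_id; exact: Ck_cst.
Qed.

End CkScalar.

Section Lines.
Context {R : realType} {V W : normedModType R}.
Implicit Types (f : V -> W).

Lemma is_derive_line f (x v : V) (s : R) (df : W) :
  is_derive (s *: v + x) v f df -> is_derive s 1 (fun s => f (s *: v + x)) df.
Proof.
suff E : (fun h : R => h^-1 *: (f (h *: v + (s *: v + x)) - f (s *: v + x))) =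
         (fun h : R => h^-1 *: (f ((h *: 1 + s) *: v + x) - f (s *: v + x))).
  by move=> [d1 d2]; split; [move: d1|move: d2]; rewrite /derivable /derive E.
by apply/funext => h; rewrite /= [h%:A]mulr1 scalerDl addrA.
Qed.

Lemma is_derive_line0 f (x v : V) (df : W) :
  is_derive x v f df <-> is_derive (0 : R) 1 (fun s : R => f (s *: v + x)) df.
Proof.
suff E : (fun h : R => h^-1 *: (f (h *: v + x) - f x)) =
         (fun h : R => h^-1 *: (f ((h *: (1:R) + 0 : R) *: v + x) - f (0 *: v + x))).
  by split=> -[d1 d2]; split; [move: d1|move: d2|move: d1|move: d2];
    rewrite /derivable /derive E.
by apply/funext => h; rewrite /= [h%:A]mulr1 addr0 scale0r add0r.
Qed.

(** Only derivability along v is assumed. On the line through x the claim is the chain rule for s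
    |-> s * c, which also covers c = 0. *)
Lemma is_derive_scale f (x v : V) (c : R) (df : W) :
  is_derive x v f df -> is_derive x (c *: v) f (c *: df).
Proof.
move=> /is_derive_line0 H; apply/is_derive_line0.
have -> : (fun s : R => f (s *: (c *: v) + x)) =
  (fun s : R => f (s *: v + x)) \o (fun s => s * c).
  by apply/funext => s /=; rewrite scalerA.
have d0 : differentiable (fun s : R => f (s *: v + x)) (0 * c).
  by rewrite mul0r; apply/derivable1_diffP; exact: ex_derive.
have d1 : is_derive (0:R) 1 (fun s : R => s * c) c.
  by apply: is_derive_eq; rewrite scaler0 add0r /GRing.scale /= mulr1.
have d1' : differentiable (fun s : R => s * c) 0.
  by apply/derivable1_diffP; exact: ex_derive.
split; first by apply/derivable1_diffP; exact: differentiable_comp.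
rewrite deriveE; last exact: differentiable_comp.
rewrite diff_comp//=.
have -> : 'd (fun s : R => s * c) 0 1 = c *: 1.
  by rewrite -deriveE// derive_val /GRing.scale /= mulr1.
by rewrite linearZ /= mul0r -deriveE ?derive_val// -(mul0r c).
Qed.

End Lines.

(** Only g is differentiable in the Frechet sense; f is derivable along v alone, so everything is
    restricted to the line through x. *)
Lemma is_derive_comp (R : realType) (X V W : normedModType R) (f : X -> V) (g : V -> W) (x v : X)
    (df : V) :
  is_derive x v f df -> differentiable g (f x) ->
  is_derive x v (fun x => g (f x)) ('D_df g (f x)).
Proof.
move=> Hf dg.
have /is_derive_line0 H := Hf.
have F0 : f (0 *: v + x) = f x by rewrite scale0r add0r.
have d0 : differentiable (fun s : R => f (s *: v + x)) 0.
  by apply/derivable1_diffP; exact: ex_derive.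
have dg' : differentiable g ((fun s : R => f (s *: v + x)) 0) by rewrite /= F0.
apply/is_derive_line0.
split; first by apply/derivable1_diffP; exact: differentiable_comp.
rewrite deriveE; last exact: differentiable_comp.
rewrite (_ : (fun s : R => g (f (s *: v + x))) = g \o (fun s : R => f (s *: v + x)))//.
rewrite diff_comp//= F0 -(deriveE _ d0) derive_val.
by rewrite -deriveE.
Qed.

Lemma is_derive_mx (R : realType) (V : normedModType R) (m n : nat)
    (M : V -> 'M[R]_(m, n)) (x v : V) (dM : 'M[R]_(m, n)) :
  is_derive x v M dM <-> forall i j, is_derive x v (fun x => M x i j) (dM i j).
Proof.
split=> [[d1 d2] i j|H].
  by split; [have /derivable_mxP := d1; exact|rewrite -d2 derive_mx// mxE].
have d : derivable M x v by apply/derivable_mxP => i j; exact: ex_derive.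
split=> //; rewrite derive_mx//; apply/matrixP => i j; rewrite mxE.
exact: derive_val.
Qed.

Lemma open_normP (R : realType) (V : normedModType R) (U : set V) x :
  open U -> U x -> exists2 r : R, 0 < r & forall y, `|y - x| < r -> U y.
Proof.
move=> oU Ux; have /nbhs_ballP[r r0 rU] := open_nbhs_nbhs (conj oU Ux).
exists r => // y yx; apply: rU; rewrite -ball_normE /= distrC//.
Qed.

Lemma cvg_normP (R : realType) (V W : normedModType R) (f : V -> W) x :
  {for x, continuous f} -> forall e, 0 < e ->
  exists2 r : R, 0 < r & forall y, `|y - x| < r -> `|f y - f x| < e.
Proof.
move=> /cvgrPdist_lt H e /H /nbhs_ballP[r r0 rU].
exists r => // y yx; rewrite distrC; apply: rU.
by rewrite -ball_normE /= distrC.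
Qed.

(** * Linearity of the derivative, differentiability and remainders of C^1 and C^2 functions *)

Section MVTdir.
Context {R : realType} {V : normedModType R}.
Implicit Types (f : V -> R).

Lemma MVT_dir f (x v : V) (h : R) : 0 <= h ->
  (forall s, 0 <= s <= h -> derivable f (s *: v + x) v) ->
  exists2 s, 0 <= s <= h & f (h *: v + x) - f x = h * 'D_v f (s *: v + x).
Proof.
move=> h0 df.
pose g s := f (s *: v + x).
have dg s : 0 <= s <= h -> is_derive s 1 g ('D_v f (s *: v + x)).
  by move=> /df /derivableP; exact: is_derive_line.
have [||s] := @MVT_segment R g (fun s => 'D_v f (s *: v + x)) 0 h h0.
- by move=> s; rewrite in_itv /= => /andP[s0 sh]; apply: dg; rewrite !ltW.
- apply: derivable_within_continuous => s; rewrite in_itv /= => s0h.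
  by have [] := dg s s0h.
rewrite in_itv /= => s0h E; exists s => //; move: E.
by rewrite /g scale0r add0r subr0 mulrC.
Qed.

(** The increment along [h *: (u + w)] is split at [h *: u + x]. The second piece starts at a moving
    point, so the mean value theorem along w and the continuity of ['D_w f] replace the definition
    of the derivative. *)
Lemma deriveDv f (U : set V) x u w : open U -> Ck 1 U f -> U x ->
  'D_(u + w) f x = 'D_u f x + 'D_w f x.
Proof.
move=> oU cf Ux.
have dU y v : U y -> derivable f y v by move=> Uy; apply: Ck_derivable cf Uy.
have cw : {for x, continuous (fun x => 'D_w f x)}.
  by apply: Ck_cont (Ck_derive w cf) Ux.
have [r r0 rU] := open_normP oU Ux.
have Du := dU x u Ux.
suff H : (fun h : R => h^-1 *: (f (h *: w + (h *: u + x)) - f (h *: u + x))) @ 0^'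
   --> 'D_w f x.
  apply: cvg_lim => //.
  apply: cvg_trans (cvgD Du H); apply: near_eq_cvg; near=> h => /=.
  have -> : h *: (u + w) + x = h *: w + (h *: u + x).
    by rewrite scalerDr addrA [h *: w + _]addrC.
  change (h^-1 *: (f (h *: u + x) - f x) +
    h^-1 *: (f (h *: w + (h *: u + x)) - f (h *: u + x)) =
    h^-1 *: (f (h *: w + (h *: u + x)) - f x)).
  by rewrite -scalerDr addrC subrKA.
apply/cvgrPdist_le => e e0.
have [d d0 dP] := cvg_normP cw e0.
(* For |h| < m, all points [s *: w + (h *: u + x)] with |s| <= |h| are closer to x than both r and
   d. *)
pose m := Num.min r d / (1 + `|u| + `|w|).
have n0 : 0 < 1 + `|u| + `|w| by rewrite ltr_wpDr// ltr_wpDr.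
have m0 : 0 < m by rewrite divr_gt0// lt_min r0.
have Hs (h s : R) : `|h| < m -> `|s| <= `|h| -> `|s *: w + (h *: u + x) - x| < Num.min r d.
  move=> hm sh; rewrite addrA addrK (le_lt_trans (ler_normD _ _))// !normrZ.
  apply: (@le_lt_trans _ _ (`|h| * (1 + `|u| + `|w|))); last by rewrite -ltr_pdivlMr.
  rewrite mulrDr mulrDr mulr1 addrC; apply: lerD; last exact: ler_wpM2r.
  by rewrite lerDr.
near=> h.
have h0 : h != 0 by near: h; exact: nbhs_dnbhs_neq.
have hm : `|h| < m by near: h; exact: dnbhs0_lt.
have [s sh E] : exists2 s, `|s| <= `|h| &
    f (h *: w + (h *: u + x)) - f (h *: u + x) = h * 'D_w f (s *: w + (h *: u + x)).
  have [hp|hn] := ltP 0 h.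
    have [//|s|s /andP[s0 sh] E] := @MVT_dir f (h *: u + x) w h; first exact: ltW.
      move=> /andP[s0 sh]; apply: dU; apply: rU.
      have /(Hs h s hm) : `|s| <= `|h| by rewrite !ger0_norm// ltW.
      by rewrite lt_min => /andP[].
    by exists s => //; rewrite !ger0_norm// ltW.
  (* [MVT_dir] has steps of nonnegative length, so for h <= 0 it is applied along [- w]. *)
  have hp : 0 <= - h by rewrite oppr_ge0.
  have dd s : 0 <= s <= - h -> derivable f (s *: - w + (h *: u + x)) w.
    move=> /andP[s0 sh]; apply: dU; apply: rU.
    have /(Hs h (- s) hm) : `|- s| <= `|h| by rewrite normrN ger0_norm// ler0_norm.
    by rewrite scaleNr -scalerN lt_min => /andP[].
  have dN s : 0 <= s <= - h -> is_derive (s *: - w + (h *: u + x)) (- w) f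
      (- 'D_w f (s *: - w + (h *: u + x))).
    move=> /dd /derivableP dd'.
    by rewrite -[- w]scaleN1r -[- 'D_w _ _]scaleN1r; apply: is_derive_scale;
      rewrite scaleN1r.
  have [s sh|s /andP[s0 sh]] := MVT_dir hp (x := h *: u + x) (v := - w) (f := f).
    by have [] := dN s sh.
  have [_ ->] := dN s (introT andP (conj s0 sh)).
  rewrite mulrNN scaleNr -scalerN opprK => E.
  exists (- s); first by rewrite normrN ger0_norm// ler0_norm.
  by rewrite E scaleNr -scalerN.
rewrite E /GRing.scale /= mulrA mulVf// mul1r distrC.
apply/ltW/dP; have := Hs h s hm sh; by rewrite lt_min => /andP[].
Unshelve. all: by end_near. Qed.

End MVTdir.

Lemma mxnorm_coord (R : realType) (m n : nat) (A : 'M[R]_(m, n)) i j :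
  `|A i j| <= `|A|.
Proof.
rewrite [in leRHS]/Num.Def.normr/= mx_normrE.
exact: (le_bigmax _ (fun i : 'I_m * 'I_n => `|A i.1 i.2|) (i, j)).
Qed.

Lemma mxnorm_le (R : realType) (m n : nat) (A : 'M[R]_(m, n)) (c : R) :
  0 <= c -> (forall i j, `|A i j| <= c) -> `|A| <= c.
Proof.
move=> c0 H; rewrite [in leLHS]/Num.Def.normr/= mx_normrE.
by apply: bigmax_le => // -[i j] _; exact: H.
Qed.

Lemma sum_norm_le (R : realType) (m : nat) (F : 'I_m -> R) (c : R) :
  (forall i, `|F i| <= c) -> `|\sum_i F i| <= m%:R * c.
Proof.
move=> H; rewrite (le_trans (ler_norm_sum _ _ _))//.
rewrite (le_trans (ler_sum _ (fun i _ => H i)))//.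
by rewrite sumr_const card_ord mulr_natl.
Qed.

Lemma mulmx_norm (R : realType) (m n : nat) (v : 'rV[R]_m) (L : 'M[R]_(m, n)) :
  `|v *m L| <= m%:R * `|L| * `|v|.
Proof.
apply: mxnorm_le => [|i j]; first by rewrite !mulr_ge0.
rewrite mxE -mulrA; apply: sum_norm_le => k.
by rewrite normrM mulrC ler_pM// mxnorm_coord.
Qed.

Lemma fin_radius (R : realType) (V : normedModType R) (m : nat)
    (P : 'I_m -> V -> Prop) (x : V) :
  (forall i, exists2 r : R, 0 < r & forall y, `|y - x| < r -> P i y) ->
  exists2 r : R, 0 < r & forall y, `|y - x| < r -> forall i, P i y.
Proof.
move=> H0.
have /choice[r H] : forall i, exists r : R, 0 < r /\ forall y, `|y - x| < r -> P i y.
  by move=> i; have [r ? ?] := H0 i; exists r.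
(* The seed 1 gives a positive radius when m = 0. *)
exists (\big[Num.min/1]_i r i).
  by apply/bigmin_gtP; split=> // i _; have [] := H i.
move=> y /bigmin_gtP[_ yr] i; have [_] := H i; apply; exact: yr.
Qed.

Section C1rV.
Context {R : realType} {m : nat}.
Implicit Types (f : 'rV[R]_m -> R) (U : set 'rV[R]_m).

Local Notation e_ := (delta_mx (0 : 'I_1)).

Lemma derive_coord f U x v : open U -> Ck 1 U f -> U x ->
  'D_v f x = \sum_i v 0 i * 'D_(e_ i) f x.
Proof.
move=> oU cf Ux; rewrite {1}[v]row_sum_delta.
have dU u : derivable f x u by apply: Ck_derivable cf Ux.
elim: (index_enum _) => [|i s IH]; first by rewrite !big_nil derive0.
rewrite !big_cons (deriveDv _ _ oU cf Ux) IH; congr (_ + _).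
by have [_ ->] := is_derive_scale (v 0 i) (derivableP (dU (e_ i))).
Qed.

(** The differential is the map v |-> ['D_v f x], linear by [deriveDv]. The mean value theorem along
    v and the continuity of the m partial derivatives bound the remainder. *)
Lemma C1_differentiable f U x : open U -> Ck 1 U f -> U x ->
  differentiable f x.
Proof.
move=> oU cf Ux.
pose L v := 'D_v f x.
have Llin : linear L.
  move=> c u v; rewrite /L (deriveDv _ _ oU cf Ux); congr (_ + _).
  by have [_ ->] := is_derive_scale c (derivableP (Ck_derivable (v:=u) cf Ux)).
pose Lm := GRing.isLinear.Build R 'rV[R]_m R *:%R L Llin.
pose LL : {linear 'rV[R]_m -> R} := HB.pack L Lm.
have cL : continuous LL.
  have -> : (LL : _ -> _) = fun v => \sum_i v 0 i * 'D_(e_ i) f x.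
    by apply/funext => v; rewrite /LL /= /L (derive_coord _ oU cf Ux).
  move=> v.
  suff : forall i, {for v, continuous (fun v : 'rV[R]_m => v 0 i * 'D_(e_ i) f x)}.
    move=> H; elim: (index_enum _) => [|i s IH].
      by under eq_fun do rewrite big_nil; exact: cst_continuous.
    under eq_fun do rewrite big_cons /=.
    by apply: (@continuousD _ _ _ (fun v : 'rV[R]_m => v 0 i * 'D_(e_ i) f x) _ v).
  move=> i; apply: continuousM; last exact: cst_continuous.
  exact: coord_continuous.
(* By [diff_unique], an expansion with this continuous linear map is the one with the
   differential. *)
suff [H1 H2] : continuous LL /\ f \o shift x = cst (f x) + LL +o_ (0 : 'rV[R]_m) id.
  by apply/diff_locallyP; rewrite (diff_unique cL H2).
split=> //; apply/eqaddoP => _/posnumP[e].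
have [r r0 rU] := open_normP oU Ux.
have ci i : {for x, continuous (fun x => 'D_(e_ i) f x)}.
  by apply: Ck_cont (Ck_derive _ cf) Ux.
(* Dividing by m.+1 rather than m covers m = 0. *)
have e0 : 0 < e%:num / m.+1%:R by rewrite divr_gt0.
have [d d0 dP] := fin_radius (fun i => cvg_normP (ci i) e0).
near=> v.
have v1 : `|v| < Num.min r d.
  near: v; apply/nbhs_ballP; exists (Num.min r d); first by rewrite /= lt_min r0.
  by move=> y; rewrite -ball_normE /= sub0r normrN.
have vs (s : R) : 0 <= s <= 1 -> `|s *: v + x - x| < Num.min r d.
  move=> /andP[s0 s1]; rewrite addrK normrZ ger0_norm// (le_lt_trans _ v1)//.
  by rewrite ler_piMl.
have [//|s /andP[s0 s1]|s s01 E] := @MVT_dir R _ f x v 1.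
  apply: Ck_derivable cf _; apply: rU.
  by have := vs s (introT andP (conj s0 s1)); rewrite lt_min => /andP[].
have := vs s s01; rewrite lt_min => /andP[sr sd].
rewrite -![(_ + _ : _ -> _) _]/(_ + _) -![(- _ : _ -> _) _]/(- _) /= /cst.
rewrite opprD addrA -[X in f (X + x)]scale1r E mul1r /LL /= /L.
rewrite (derive_coord _ oU cf (rU _ sr)) (derive_coord _ oU cf Ux) -sumrB.
apply: (@le_trans _ _ (m%:R * (e%:num / m.+1%:R * `|v|))).
  apply: sum_norm_le => i; rewrite -mulrBr normrM mulrC ler_pM// ?mxnorm_coord//.
  by rewrite ltW// dP.
rewrite mulrA mulrCA ler_wpM2r// ler_piMr// ler_pdivrMr// mul1r ler_nat//.
Unshelve. all: by end_near. Qed.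

Lemma is_derive_comp_C1 (X : normedModType R) (f : X -> 'rV[R]_m) (g : 'rV[R]_m -> R)
    (x v : X) (df : 'rV[R]_m) U : open U -> Ck 1 U g -> U (f x) ->
  is_derive x v f df ->
  is_derive x v (fun x => g (f x)) ('D_df g (f x)).
Proof.
move=> oU cg Uf Hf; apply: is_derive_comp => //; exact: C1_differentiable cg Uf.
Qed.

Lemma Ck_comp (X : normedModType R) (k : nat) (O : set X) (f : X -> 'rV[R]_m) (g : 'rV[R]_m -> R) U :
  open O -> open U -> (forall x, O x -> U (f x)) ->
  Ck k O f -> Ck k U g -> Ck k O (fun x => g (f x)).
Proof.
move=> oO oU fOU; elim: k g => [|k IH] g cf cg.
  by split=> // x Ox; apply: (continuous_comp (Ck_cont cf Ox)); apply: Ck_cont cg _; exact: fOU.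
have cg1 : Ck 1 U g by apply: CkW cg.
split=> [x Ox|v].
  by apply: (continuous_comp (Ck_cont cf Ox)); apply: Ck_cont cg _; exact: fOU.
have D x : O x -> is_derive x v (fun x => g (f x)) ('D_('D_v f x) g (f x)).
  move=> Ox; apply: (is_derive_comp_C1 oU) => //; first exact: fOU.
  by apply/derivableP/(Ck_derivable (v:=v) cf Ox).
split=> [x /D[]//|].
have H : Ck k O (fun x => \sum_i ('D_v f x) 0 i * 'D_(e_ i) g (f x)).
  apply: Ck_sum => // i; apply: CkM => //.
    by have /(Ck_mx k ('D_v f) oO) := Ck_derive v cf; apply.
  by apply: IH (CkS cf) (Ck_derive _ cg).
apply: Ck_eq H => // x Ox; have [_ ->] := D x Ox.
by rewrite (derive_coord _ oU cg1 (fOU _ Ox)).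
Qed.

Lemma derive_bound f U x : open U -> Ck 1 U f -> U x ->
  exists2 r : R, 0 < r & exists2 B : R, 0 <= B & forall y v, `|y - x| < r ->
    U y /\ `|'D_v f y| <= B * `|v|.
Proof.
move=> oU cf Ux; have [r r0 rU] := open_normP oU Ux.
have ci i : {for x, continuous (fun x => 'D_(e_ i) f x)}.
  by apply: Ck_cont (Ck_derive _ cf) Ux.
have [d d0 dP] := fin_radius (fun i => cvg_normP (ci i) ltr01).
pose B := \sum_i `|'D_(e_ i) f x| + 1.
exists (Num.min r d); first by rewrite lt_min r0.
have B0 : 0 <= B by rewrite addr_ge0// sumr_ge0.
exists (m%:R * B); first by rewrite mulr_ge0.
move=> y v; rewrite lt_min => /andP[yr yd]; split; first exact: rU.
rewrite (derive_coord _ oU cf (rU _ yr)) -mulrA; apply: sum_norm_le => i.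
rewrite normrM mulrC ler_pM// ?mxnorm_coord// -(subrK ('D_(e_ i) f x) ('D_(e_ i) f y)).
rewrite (le_trans (ler_normD _ _))// addrC lerD//.
  by rewrite (bigD1 i)//= lerDl sumr_ge0.
by rewrite ltW// dP.
Qed.

(** The base point x of the derivative is unrelated to a and b, as is needed to compare two
    trajectories of a flow with a third. The mean value theorem gives the derivative at a point xi
    of the segment [b, a], and xi - x is a convex combination of a - x and b - x. *)
Lemma C2_quadratic f U x0 : open U -> Ck 2 U f -> U x0 ->
  exists2 r : R, 0 < r & exists2 K : R, 0 <= K & forall x a b : 'rV[R]_m,
    `|x - x0| < r -> `|a - x0| < r -> `|b - x0| < r ->
    `|f a - f b - 'D_(a - b) f x| <= K * (`|a - x| + `|b - x|) * `|a - b|.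
Proof.
move=> oU cf Ux.
have cf1 := CkS cf.
have [r0 r00 r0U] := open_normP oU Ux.
have /choice[rB HrB] : forall i, exists p : R * R, [/\ 0 < p.1, 0 <= p.2 & forall y v,
    `|y - x0| < p.1 -> `|'D_v ('D_(e_ i) f) y| <= p.2 * `|v|].
  move=> i; have [r ? [B ? H]] := derive_bound oU (Ck_derive (e_ i) cf) Ux.
  by exists (r, B); split=> // y v /(H y v)[].
pose B := \sum_i (rB i).2.
have B0 : 0 <= B by apply: sumr_ge0 => i _; have [] := HrB i.
have [r rp rP] : exists2 r : R, 0 < r & forall y, `|y - x0| < r ->
    forall i, `|y - x0| < (rB i).1.
  by apply: fin_radius => i; exists (rB i).1 => //; have [] := HrB i.
exists (Num.min r0 r); first by rewrite lt_min r00.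
exists (m%:R * B); first by rewrite mulr_ge0.
move=> x a b; set ro := Num.min r0 r => xr ar br.
have ballU y : `|y - x0| < ro -> U y.
  by rewrite lt_min => /andP[/r0U].
have ballC y z (s : R) : `|y - x0| < ro -> `|z - x0| < ro -> 0 <= s <= 1 ->
    `|s *: (y - z) + z - x0| < ro.
  move=> yr zr /andP[s0 s1].
  have -> : s *: (y - z) + z - x0 = s *: (y - x0) + (1 - s) *: (z - x0).
    rewrite scalerBl scale1r !scalerBr; apply/rowP => i; rewrite !mxE; ring.
  rewrite (le_lt_trans (ler_normD _ _))// !normrZ (ger0_norm s0) ger0_norm ?subr_ge0//.
  have [->|sn0] := eqVneq s 0; first by rewrite mul0r add0r subr0 mul1r.
  have : s * `|y - x0| < s * ro by rewrite ltr_pM2l// lt_neqAle eq_sym sn0.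
  have : (1 - s) * `|z - x0| <= (1 - s) * ro by rewrite ler_wpM2l ?subr_ge0// ltW.
  by lra.
have [//|s s01|s s01 E] := @MVT_dir R _ f b (a - b) 1.
  by apply: Ck_derivable cf _; apply/ballU/ballC.
move: E; rewrite scale1r subrK mul1r => ->.
set xi := s *: (a - b) + b.
have xir : `|xi - x0| < ro by apply: ballC.
rewrite (derive_coord _ oU cf1 (ballU _ xir)) (derive_coord _ oU cf1 (ballU _ xr)).
rewrite -sumrB -mulrA -mulrA; apply: sum_norm_le => i.
rewrite -mulrBr normrM mulrC mulrA ler_pM// ?mxnorm_coord//.
have [//|t t01|t t01 E] := @MVT_dir R _ ('D_(e_ i) f) x (xi - x) 1.
  by apply: Ck_derivable (Ck_derive _ cf) _; apply/ballU/ballC.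
move: E; rewrite scale1r subrK mul1r => ->.
have [_ _ HB] := HrB i.
apply: (le_trans (HB _ _ _)).
  have := ballC _ _ _ xir xr t01; rewrite lt_min => /andP[_ h].
  exact: rP.
apply: ler_pM => //; first by have [] := HrB i.
  rewrite /B (bigD1 i)//= lerDl sumr_ge0// => j _; by have [] := HrB j.
have -> : xi - x = s *: (a - x) + (1 - s) *: (b - x).
  rewrite /xi scalerBl scale1r !scalerBr; apply/rowP => j; rewrite !mxE; ring.
move: s01 => /andP[s0 s1].
rewrite (le_trans (ler_normD _ _))// !normrZ (ger0_norm s0) ger0_norm ?subr_ge0//.
by apply: lerD; rewrite ler_piMl// lerBlDl lerDr.
Qed.

End C1rV.

Lemma cross_diff (R : realType) (p p' q s t P Q : R) : p = p' ->
  p - q - (s - t) = P -> p' - s - (q - t) = Q -> P = Q.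
Proof. by move=> -> <- <-; ring. Qed.

Lemma dist_le_split (R : realType) (p q s e : R) :
  `|q - p| < e / 2 -> `|q - s| < e / 2 -> `|p - s| <= e.
Proof.
move=> Y Z; rewrite (le_trans (ler_distD q p s))// [leRHS]splitr lerD ?(ltW Z)//.
by rewrite distrC ltW.
Qed.

(** One second difference, divided by [h ^+ 2], equals each of the mixed derivatives at some point
    close to x, according to the order in which the increments are taken ([cross_diff]). *)
Lemma schwarz (R : realType) (V : normedModType R) (f : V -> R) (U : set V)
    (x u w : V) : open U -> Ck 2 U f -> U x ->
  'D_u ('D_w f) x = 'D_w ('D_u f) x.
Proof.
move=> oU cf Ux.
have [r r0 rU] := open_normP oU Ux.
pose n := 1 + `|u| + `|w|.
have n0 : 0 < n by rewrite ltr_wpDr// ltr_wpDr.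
(* The mean value theorem along p, for the difference [F] of f over the step [h *: q], and then
   along q. *)
have key (p q : V) (h : R) : 0 < h -> h * (1 + `|p| + `|q|) < r ->
   exists2 y, `|y - x| <= h * (1 + `|p| + `|q|) &
     f (h *: p + (h *: q + x)) - f (h *: p + x) - (f (h *: q + x) - f x) =
     h * (h * 'D_q ('D_p f) y).
  move=> h0 hr.
  have bd (s t : R) : 0 <= s <= h -> 0 <= t <= h ->
      `|t *: q + (s *: p + x) - x| <= h * (1 + `|p| + `|q|).
    move=> /andP[s0 sh] /andP[t0 th]; rewrite addrA addrK.
    rewrite (le_trans (ler_normD _ _))// !normrZ !ger0_norm//.
    rewrite !mulrDr mulr1 addrC -addrA; apply: ler_wpDl; first exact: ltW.
    by apply: lerD; apply: ler_wpM2r.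
  have dU s t v k (g : V -> R) : Ck k.+1 U g -> 0 <= s <= h -> 0 <= t <= h ->
      derivable g (t *: q + (s *: p + x)) v.
    by move=> cg sh th; apply: Ck_derivable cg _; apply/rU/(le_lt_trans (bd _ _ sh th)).
  have hh : 0 <= h <= h by rewrite (ltW h0) /=.
  have zh : (0:R) <= 0 <= h by rewrite (ltW h0) andbT.
  pose F y := f (h *: q + y) - f y.
  have dF (s : R) : 0 <= s <= h -> is_derive (s *: p + x) p F
      ('D_p f (h *: q + (s *: p + x)) - 'D_p f (s *: p + x)).
    move=> sh; apply: is_deriveB.
      have /is_derive_line0 := derivableP (dU s h p _ _ cf sh hh).
      move=> d; apply/is_derive_line0; move: d; congr is_derive.
      by apply/funext => k; rewrite addrCA.
    have := dU s 0 p _ _ cf sh zh; rewrite scale0r add0r => d; exact: derivableP.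
  have [||s sh E] := @MVT_dir R _ F x p h; first exact: ltW.
    by move=> s /dF[].
  have [_ DE] := dF s sh.
  have [||t th E2] := @MVT_dir R _ ('D_p f) (s *: p + x) q h; first exact: ltW.
    by move=> t th; apply: dU (Ck_derive p cf) sh th.
  exists (t *: q + (s *: p + x)); first exact: bd.
  by rewrite -E2 -DE -E /F addrCA addrAC opprB [RHS]addrC; ring.
apply/eqP; rewrite -subr_eq0 -normr_le0; apply/ler_addgt0Pl => e e0; rewrite addr0.
have e2 : 0 < e / 2 by rewrite divr_gt0.
have c1 : {for x, continuous ('D_u ('D_w f))}.
  by apply: Ck_cont (Ck_derive _ (Ck_derive _ cf)) Ux.
have c2 : {for x, continuous ('D_w ('D_u f))}.
  by apply: Ck_cont (Ck_derive _ (Ck_derive _ cf)) Ux.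
have [d1 d10 H1] := cvg_normP c1 e2.
have [d2 d20 H2] := cvg_normP c2 e2.
pose h := Num.min r (Num.min d1 d2) / 2 / n.
have h0 : 0 < h by rewrite divr_gt0// divr_gt0// !lt_min r0 d10 d20.
have hn : h * n = Num.min r (Num.min d1 d2) / 2 by rewrite /h divfK// gt_eqF.
have hn2 : h * n < Num.min r (Num.min d1 d2).
  by rewrite hn ltr_pdivrMr// ltr_pMr ?ltr1n// !lt_min r0 d10 d20.
move: hn2; rewrite !lt_min => /andP[hr /andP[hd1 hd2]].
have hr' : h * (1 + `|w| + `|u|) < r by rewrite addrAC.
have [y yx Ey] := key w u h h0 hr'.
have [z zx Ez] := key u w h h0 hr.
have hw : h *: w + (h *: u + x) = h *: u + (h *: w + x) by rewrite addrCA.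
have hE : h * (h * 'D_u ('D_w f) y) = h * (h * 'D_w ('D_u f) z).
  exact: (cross_diff (congr1 f hw) Ey Ez).
have hN0 : h != 0 by rewrite gt_eqF.
have E : 'D_u ('D_w f) y = 'D_w ('D_u f) z by exact: (mulfI hN0 (mulfI hN0 hE)).
have Y : `|'D_u ('D_w f) y - 'D_u ('D_w f) x| < e / 2.
  apply: H1; apply: (le_lt_trans yx).
  by rewrite [1 + `|w| + `|u|]addrAC.
have Z : `|'D_w ('D_u f) z - 'D_w ('D_u f) x| < e / 2.
  by apply: H2; apply: (le_lt_trans zx).
by apply: dist_le_split Z; rewrite -E.
Qed.

(** * Ordinary differential equations *)

Section Antiderivative.
Context {R : realType}.
Local Notation mu := (@lebesgue_measure R).

Lemma antiderivative (f : R -> R) (T : R) : 0 < T -> continuous f ->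
  exists F : R -> R, forall t : R, `|t| < T -> is_derive t 1 F (f t).
Proof.
move=> T0 cf.
exists (fun x => \int[mu]_(t in `[- T, x]) f t)%R => t tT.
have fi : mu.-integrable `[- T, T] (EFin \o f).
  apply: continuous_compact_integrable; first exact: segment_compact.
  exact: continuous_subspaceT.
move: tT; rewrite ltr_norml => /andP[tT1 tT2].
have [d1 d2] := continuous_FTC1_closed tT2 fi tT1 (cf t).
by split; [exact: d1|exact: etrans (esym (derive1E _ _)) d2].
Qed.

Lemma antiderivative_rV m (f : R -> 'rV[R]_m) (T : R) : 0 < T -> continuous f ->
  exists F : R -> 'rV[R]_m, forall t : R, `|t| < T -> is_derive t 1 F (f t).
Proof.
move=> T0 cf.
have /choice[F HF] : forall i, exists F : R -> R,
    forall t : R, `|t| < T -> is_derive t 1 F (f t 0 i).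
  move=> i; apply: antiderivative => // t.
  apply: (@continuous_comp _ _ _ f (fun A : 'rV[R]_m => A 0 i)); first exact: cf.
  exact: coord_continuous.
exists (fun t => \row_i F i t) => t tT.
apply/is_derive_mx => i j.
under eq_fun do rewrite mxE.
by rewrite !ord1; exact: HF.
Qed.

End Antiderivative.

Lemma MVI (R : realType) m (g dg : R -> 'rV[R]_m) (a b C : R) : a <= b ->
  {within `[a, b], continuous g} ->
  (forall t : R, a < t < b -> is_derive t 1 g (dg t) /\ `|dg t| <= C) ->
  `|g b - g a| <= C * (b - a).
Proof.
rewrite le_eqVlt => /predU1P[->|ab]; first by rewrite !subrr mulr0 normr0.
move=> cg H.
have C0 : 0 <= C.
  have /H[_] : a < (a + b) / 2 < b by rewrite !midf_lt.
  exact: le_trans.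
apply: mxnorm_le => [|i j]; first by rewrite mulr_ge0// subr_ge0 ltW.
have [|| c cab E] := @MVT R (fun t => g t i j) (fun t => dg t i j) a b ab.
- by move=> t; rewrite in_itv /= => /H[/is_derive_mx + _]; apply.
- move=> t; apply: (@continuous_comp (subspace `[a, b]) _ _ g (fun A : 'rV[R]_m => A i j)).
    exact: cg.
  exact: coord_continuous.
move: cab; rewrite in_itv /= => /H[_ dC].
have ba : 0 <= b - a by rewrite subr_ge0 ltW.
rewrite !mxE E normrM (ger0_norm ba).
by apply: ler_wpM2r; [exact: ba|apply: le_trans dC; exact: mxnorm_coord].
Qed.

(** The interval is so short that no exponential appears: at a maximum s of |g|, |g s| <= |g t1| +
    |g s| / 2 + c * (b - a), and the middle term is absorbed. The time t1 may be anywhere in [a, b],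
    so the bound runs both ways. *)
Lemma gronwall (R : realType) m (g dg : R -> 'rV[R]_m) (a b L c t1 t : R) :
  {within `[a, b], continuous g} -> 0 <= L -> 0 <= c -> L * (b - a) <= 2^-1 ->
  (forall t : R, a < t < b -> is_derive t 1 g (dg t) /\ `|dg t| <= L * `|g t| + c) ->
  a <= t1 <= b -> a <= t <= b ->
  `|g t| <= 2 * `|g t1| + 2 * (b - a) * c.
Proof.
move=> cg L0 c0 Lab H /andP[at1 t1b] /andP[at_ tb].
have ab : a <= b by apply: le_trans at_ tb.
have cn : {within `[a, b], continuous (fun t => `|g t|)}.
  move=> s; apply: (@continuous_comp (subspace `[a, b]) _ _ g (fun A : 'rV[R]_m => `|A|)).
    exact: cg.
  exact: norm_continuous.
have [s sab smax] := EVT_max ab cn.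
move: sab; rewrite in_itv /= => /andP[as_ sb].
have le_max u : a <= u <= b -> `|g u| <= `|g s|.
  by move=> uab; apply: smax; rewrite in_itv.
have HC u : a < u < b -> is_derive u 1 g (dg u) /\ `|dg u| <= L * `|g s| + c.
  move=> uab; have [d1 d2] := H u uab; split=> //; apply: (le_trans d2).
  rewrite lerD2r ler_wpM2l// le_max//; by case/andP: uab => /ltW -> /ltW ->.
have C0 : 0 <= L * `|g s| + c by rewrite addr_ge0// mulr_ge0.
have sub u v : a <= u -> v <= b -> {within `[u, v], continuous g}.
  move=> au vb; apply: continuous_subspaceW cg => w /=; rewrite !in_itv /=.
  by move=> /andP[uw wv]; rewrite (le_trans au uw) (le_trans wv vb).
have D : `|g s - g t1| <= (L * `|g s| + c) * (b - a).
  have [st|/ltW ts] := leP s t1.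
    rewrite distrC; apply: (@le_trans _ _ ((L * `|g s| + c) * (t1 - s))).
      apply: MVI => //; first exact: sub.
      move=> u /andP[u1 u2]; apply: HC.
      by rewrite (le_lt_trans as_ u1) (lt_le_trans u2 t1b).
    by rewrite ler_wpM2l// lerB.
  apply: (@le_trans _ _ ((L * `|g s| + c) * (s - t1))).
    apply: MVI => //; first exact: sub.
    move=> u /andP[u1 u2]; apply: HC.
    by rewrite (le_lt_trans at1 u1) (lt_le_trans u2 sb).
  by rewrite ler_wpM2l// lerB.
have gt : `|g t| <= `|g s| by apply: le_max; rewrite at_.
have := ler_normD (g s - g t1) (g t1); rewrite subrK => T1.
have T2 : L * (b - a) * `|g s| <= 2^-1 * `|g s| by rewrite ler_wpM2r.
nra.
Qed.

Lemma pow2_small (R : realType) (C e : R) : 0 < e ->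
  exists k : nat, C / 2 ^+ k < e.
Proof.
move=> e0; pose k := Num.bound `|C / e|; exists k.
rewrite ltr_pdivrMr ?exprn_gt0// -ltr_pdivrMl// mulrC.
have H : C / e < k%:R by apply: le_lt_trans (ler_norm _) (archi_boundP (normr_ge0 _)).
apply: (lt_le_trans H); rewrite -natrX ler_nat.
by rewrite ltnW// ltn_expl.
Qed.

(** The limit is the supremum of the lower ends [u j - 2 * C / 2 ^+ j]; by telescoping, each of them
    is below every upper end [u k + 2 * C / 2 ^+ k]. *)
Lemma geo_cauchy (R : realType) (u : nat -> R) (C : R) :
  (forall k, `|u k.+1 - u k| <= C / 2 ^+ k) ->
  exists l, forall k, `|u k - l| <= 2 * C / 2 ^+ k.
Proof.
move=> H.
have C0 : 0 <= C by have := H 0%N; rewrite expr0 divr1; apply: le_trans.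
have K k j : `|u (k + j)%N - u k| <= 2 * C / 2 ^+ k - 2 * C / 2 ^+ (k + j).
  elim: j => [|j IH]; first by rewrite addn0 !subrr normr0.
  rewrite addnS -(subrK (u (k + j)%N) (u _.+1)) -addrA.
  rewrite (le_trans (ler_normD _ _))//.
  rewrite (le_trans (lerD (H _) IH))// exprS.
  have p0 : (2 : R) ^+ (k + j) != 0 by rewrite expf_eq0 pnatr_eq0 andbF.
  suff -> : 2 * C / (2 * 2 ^+ (k + j)) = C / 2 ^+ (k + j) by lra.
  by field.
have P k : 0 <= 2 * C / 2 ^+ k by rewrite divr_ge0 ?mulr_ge0// exprn_ge0.
have X j k : u j - 2 * C / 2 ^+ j <= u k + 2 * C / 2 ^+ k.
  have [/subnKC jk|/ltnW/subnKC jk] := leqP j k.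
    have := K j (k - j)%N; rewrite jk ler_norml => /andP[].
    have := P k; lra.
  have := K k (j - k)%N; rewrite jk ler_norml => /andP[].
  have := P j; lra.
pose S := [set x | exists j, x = u j - 2 * C / 2 ^+ j].
exists (sup S) => k.
have S0 : has_sup S.
  split; first by exists (u 0%N - 2 * C / 2 ^+ 0), 0%N.
  by exists (u 0%N + 2 * C / 2 ^+ 0) => _ [j ->].
have h1 : u k - 2 * C / 2 ^+ k <= sup S by apply: sup_upper_bound => //; exists k.
have h2 : sup S <= u k + 2 * C / 2 ^+ k.
  by apply: ge_sup; [have [] := S0|move=> _ [j ->]].
by rewrite ler_norml; lra.
Qed.

Lemma clamp_lip (R : realType) (a b t u : R) :
  `|Num.max a (Num.min b t) - Num.max a (Num.min b u)| <= `|t - u|.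
Proof.
have h1 := ler_norm (t - u); have := ler_norm (- (t - u)); rewrite normrN => h2.
rewrite ler_norml; case: (ltP b t) => ?; case: (ltP b u) => ?;
  rewrite ?(maxEle a); repeat case: ifP => ?; lra.
Qed.

Section Picard.
Context {R : realType} {m : nat}.
Variables (f : R -> 'rV[R]_m -> 'rV[R]_m) (L tau : R).
Hypotheses (tau0 : 0 < tau) (L0 : 0 <= L) (Ltau : L * tau <= 2^-1).
Hypothesis flip : forall t x y, `|f t x - f t y| <= L * `|x - y|.
Hypothesis fcont : forall x, continuous (f ^~ x).

(** Freezing time outside [- tau, tau] keeps the iterates continuous on the whole line. *)
Let clamp (t : R) := Num.max (- tau) (Num.min tau t).

Let clamp_cont : continuous clamp.
Proof.
move=> t; apply/cvgrPdist_lt => /= e e0; near=> u.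
apply: (le_lt_trans (clamp_lip _ _ _ _)).
by near: u; apply/nbhs_ballP; exists e.
Unshelve. all: by end_near. Qed.

Let clamp_norm t : `|clamp t| <= tau.
Proof.
rewrite ler_norml /clamp le_max lexx /= ge_max ge_min lexx/= andbT.
by rewrite (@le_trans _ _ 0)// ?oppr_le0 ltW.
Qed.

Let clamp_id t : `|t| < tau -> clamp t = t.
Proof.
rewrite ltr_norml /clamp => /andP[t1 t2].
by rewrite min_r ?max_r// ltW.
Qed.

Let fcomp (X : R -> 'rV[R]_m) : continuous X -> continuous (fun t => f t (X t)).
Proof.
move=> cX t; apply/cvgrPdist_lt => /= e e0.
have e2 : 0 < e / 2 by rewrite divr_gt0.
have e3 : 0 < e / 2 / (L + 1) by rewrite divr_gt0// ltr_wpDl.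
have [r r0 rP] := cvg_normP (@fcont (X t) t) e2.
have [s s0 sP] := cvg_normP (cX t) e3.
near=> u.
have ur : `|u - t| < Num.min r s.
  rewrite distrC; near: u; apply/nbhs_ballP; exists (Num.min r s).
    by rewrite /= lt_min r0.
  by move=> y.
move: ur; rewrite lt_min => /andP[ur us].
rewrite distrC -(subrKA (f u (X t))) (le_lt_trans (ler_normD _ _))//.
rewrite [ltRHS]splitr ler_ltD ?rP// (le_trans (flip _ _ _))//.
have /ltW := sP u us; rewrite ler_pdivlMr ?ltr_wpDl// => H.
by rewrite (le_trans _ H)// mulrC ler_wpM2l// lerDl.
Unshelve. all: by end_near. Qed.

Let MVI_clamp (g dg : R -> 'rV[R]_m) (C c : R) :
  (forall t : R, `|t| <= tau -> is_derive t 1 g (dg t) /\ `|dg t| <= C) ->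
  `|c| <= tau -> `|g c - g 0| <= C * tau.
Proof.
move=> H ctau.
have C0 : 0 <= C.
  have z0 : `|0 : R| <= tau by rewrite normr0 ltW.
  by have [_] := H 0 z0; exact: le_trans.
have cg a b : - tau <= a -> b <= tau -> {within `[a, b], continuous g}.
  move=> ta bt; apply: derivable_within_continuous => t.
  rewrite in_itv /= => /andP[at_ tb].
  have tt : `|t| <= tau by rewrite ler_norml (le_trans ta at_) (le_trans tb bt).
  by have [[]] := H t tt.
have Hd a b : - tau <= a -> b <= tau -> forall t : R, a < t < b ->
    is_derive t 1 g (dg t) /\ `|dg t| <= C.
  move=> ta bt t /andP[at_ tb]; apply: H.
  by rewrite ler_norml (le_trans ta (ltW at_)) (le_trans (ltW tb) bt).
move: (ctau); rewrite ler_norml => /andP[c1 c2].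
have nt0 : - tau <= 0 by rewrite oppr_le0 ltW.
have [c0|/ltW c0] := leP 0 c.
  rewrite (le_trans (MVI c0 (cg _ _ nt0 c2) (Hd _ _ nt0 c2)))//.
  by rewrite subr0 ler_wpM2l.
rewrite distrC (le_trans (MVI c0 (cg _ _ c1 (ltW tau0)) (Hd _ _ c1 (ltW tau0))))//.
by rewrite sub0r ler_wpM2l// lerNl.
Qed.

(** Since L * tau <= 1 / 2, the iteration halves the distance between successive approximations. A
    bound on f is asked only at y, for the first step, because the linear equations to be solved
    have no bound uniform in the unknown; the last clause therefore carries its own hypothesis. *)
Lemma picard (y : 'rV[R]_m) (B : R) : (forall t, `|f t y| <= B) ->
  exists X : R -> 'rV[R]_m, [/\ X 0 = y, continuous X,
    forall t : R, `|t| < tau -> is_derive t 1 X (f t (X t)) &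
    (forall t x, `|f t x| <= B) -> forall t, `|X t - y| <= B * tau].
Proof.
move=> fB.
have B0 : 0 <= B by apply: le_trans (fB 0).
have t20 : 0 < 2 * tau by rewrite mulr_gt0.
(* Antiderivatives are taken on |t| < 2 * tau so that they are derivable on the closed interval |t|
   <= tau. For a discontinuous X the value of [Phi] is arbitrary. *)
have /choice[Phi PhiP] : forall X : R -> 'rV[R]_m, exists F : R -> 'rV[R]_m,
    continuous X -> forall t : R, `|t| < 2 * tau -> is_derive t 1 F (f t (X t)).
  move=> X; have [cX|] := pselect (continuous X); last by exists (fun=> 0).
  by have [F FP] := antiderivative_rV t20 (fcomp cX); exists F.
pose T X t := y + (Phi X (clamp t) - Phi X 0).
have lt2 (t : R) : `|t| <= tau -> `|t| < 2 * tau.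
  by move=> /le_lt_trans; apply; rewrite ltr_pMl// ltr1n.
have T0 X : T X 0 = y.
  by rewrite /T clamp_id ?normr0// subrr addr0.
have Tc X : continuous X -> continuous (T X).
  move=> cX t.
  apply: (@continuousD _ _ _ (fun=> y) (fun t => Phi X (clamp t) - Phi X 0) t).
    exact: cst_continuous.
  apply: (@continuousB _ _ _ (fun t => Phi X (clamp t)) (fun=> Phi X 0) t); last exact: cst_continuous.
  apply: (@continuous_comp _ _ _ clamp (Phi X)); first exact: clamp_cont.
  apply: differentiable_continuous; apply/derivable1_diffP.
  by have [] := PhiP X cX _ (lt2 _ (clamp_norm t)).
have Td X : continuous X -> forall t : R, `|t| < tau -> is_derive t 1 (T X) (f t (X t)).
  move=> cX t tt.
  have H : is_derive t 1 (fun s => y + (Phi X s - Phi X 0)) (f t (X t)).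
    have D := PhiP X cX t (lt2 t (ltW tt)).
    by apply: is_derive_eq; rewrite add0r subr0.
  apply: near_eq_is_derive H.
  near=> s; rewrite /T clamp_id//.
  near: s; apply/nbhs_ballP; exists (tau - `|t|); first by rewrite /= subr_gt0.
  move=> s; rewrite -ball_normE /= ltrBrDl => H; apply: le_lt_trans H.
  by rewrite -[s in leLHS](subrK t) addrC (le_trans (ler_normD _ _))// lerD2l distrC.
have Tl X X' D : continuous X -> continuous X' -> (forall t, `|X t - X' t| <= D) ->
    forall t, `|T X t - T X' t| <= D / 2.
  move=> cX cX' H t.
  pose g s := Phi X s - Phi X' s.
  have := @MVI_clamp g (fun s => f s (X s) - f s (X' s)) (L * D) (clamp t).
  have -> : g (clamp t) - g 0 = T X t - T X' t.
    rewrite /g /T; apply/rowP => i; rewrite !mxE; ring.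
  have D0 : 0 <= D by apply: le_trans (H 0).
  move=> K; apply: (le_trans (K _ _)) => //.
    move=> s /lt2 s2; split.
      by apply: is_deriveB; [exact: PhiP|exact: PhiP].
    by rewrite (le_trans (flip _ _ _))// ler_wpM2l.
  by rewrite mulrAC mulrC ler_wpM2l.
pose X k := iter k T (fun=> y).
have cX k : continuous (X k).
  by elim: k => [|k IH]; [exact: cst_continuous|exact: Tc].
have d0 t : `|X 1%N t - X 0%N t| <= B * tau.
  have := @MVI_clamp (Phi (fun=> y)) (fun s => f s y) B (clamp t).
  have -> : Phi (fun=> y) (clamp t) - Phi (fun=> y) 0 = X 1%N t - X 0%N t.
    by rewrite /X /= /T addrAC subrr add0r.
  apply => // s /lt2 s2; split => //.
  by apply: (PhiP (fun=> y)) => //; exact: cst_continuous.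
have dk k t : `|X k.+1 t - X k t| <= B * tau / 2 ^+ k.
  elim: k t => [|k IH] t; first by rewrite expr0 divr1.
  rewrite (le_trans (Tl _ _ _ (cX k.+1) (cX k) IH t))//.
  by rewrite exprS invfM [2^-1 * _]mulrC mulrA.
have /choice[l lP] : forall i : 'I_m, exists l : R -> R, forall t k,
    `|X k t 0 i - l t| <= 2 * (B * tau) / 2 ^+ k.
  move=> i; have /choice[l lP] : forall t, exists l, forall k,
      `|X k t 0 i - l| <= 2 * (B * tau) / 2 ^+ k.
    move=> t; apply: geo_cauchy => k; apply: le_trans (dk k t).
    by have := mxnorm_coord (X k.+1 t - X k t) 0 i; rewrite !mxE.
  by exists l.
pose Z t : 'rV[R]_m := \row_i l i t.
have C0 k : 0 <= 2 * (B * tau) / 2 ^+ k.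
  by rewrite divr_ge0 ?exprn_ge0// !mulr_ge0// ltW.
have ZP k t : `|X k t - Z t| <= 2 * (B * tau) / 2 ^+ k.
  by apply: mxnorm_le => // i j; rewrite !mxE ord1; exact: lP.
have cZ : continuous Z.
  move=> t; apply/cvgrPdist_lt => /= e e0.
  have e3 : 0 < e / 3 by rewrite divr_gt0.
  have [k kP] := pow2_small (2 * (B * tau)) e3.
  have [r r0 rP] := cvg_normP (cX k t) e3.
  near=> u.
  have ur : `|u - t| < r.
    by rewrite distrC; near: u; apply/nbhs_ballP; exists r.
  have h1 := le_lt_trans (ZP k t) kP.
  have h2 := le_lt_trans (ZP k u) kP.
  have h3 := rP u ur.
  rewrite -(subrKA (X k t)) (le_lt_trans (ler_normD _ _))//.
  rewrite -(subrKA (X k u) (X k t)) distrC.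
  rewrite (le_lt_trans (lerD (lexx _) (ler_normD _ _)))// distrC (distrC (Z t)).
  by rewrite (distrC (X k t) (X k u)); lra.
have ZE t : Z t = T Z t.
  apply/eqP; rewrite -subr_eq0 -normr_le0; apply/ler_addgt0Pl => e e0.
  rewrite addr0; have e3 : 0 < e / 2 by rewrite divr_gt0.
  have [k kP] := pow2_small (2 * (B * tau)) e3.
  have h1 := Tl _ _ _ (cX k) cZ (ZP k) t.
  have h2 := ZP k.+1 t.
  rewrite -(subrKA (X k.+1 t)) (le_trans (ler_normD _ _))// distrC [leRHS]splitr.
  have p0 : (0:R) < 2 ^+ k by rewrite exprn_gt0.
  have D0 : 0 <= B * tau by rewrite mulr_ge0// ltW.
  apply: lerD; last first.
    apply: (le_trans h1); apply: le_trans (ltW kP).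
    by rewrite ler_pdivrMr// ler_peMr ?C0// ler1n.
  apply: (le_trans h2); apply: le_trans (ltW kP).
  apply: ler_wpM2l; first by rewrite mulr_ge0.
  rewrite lef_pV2 ?posrE ?exprn_gt0//.
  by rewrite exprS ler_peMl ?ler1n// ltW.
exists Z; split=> //; first by rewrite ZE T0.
  move=> t tt; have := Td Z cZ t tt.
  by have -> : T Z = Z by apply/funext => s; rewrite -ZE.
move=> fB' t; rewrite ZE /T addrC addKr.
apply: (@MVI_clamp (Phi Z) (fun s => f s (Z s))) => // s /lt2 s2; split=> //.
exact: PhiP.
Unshelve. all: by end_near. Qed.

End Picard.

(** * Jacobian matrices and differentiability with a quadratic remainder *)

Section Jacobian.
Context {R : realType} {m p : nat}.
Implicit Types (F : 'rV[R]_m -> 'rV[R]_p) (U : set 'rV[R]_m).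

Definition jac F x : 'M[R]_(m, p) :=
  \matrix_(i, j) 'D_(delta_mx 0 i) (fun y => F y 0 j) x.

Lemma jac_mul F U x v : open U -> Ck 1 U F -> U x -> v *m jac F x = 'D_v F x.
Proof.
move=> oU cF Ux; rewrite derive_mx; last exact: Ck_derivable cF Ux.
have /(Ck_mx 1 F oU) cF1 := cF.
apply/rowP => j; rewrite !mxE (derive_coord v oU (cF1 0 j) Ux).
by apply: eq_bigr => i _; rewrite mxE.
Qed.

Lemma jac_quadratic F U x0 : open U -> Ck 2 U F -> U x0 ->
  exists r K : R, [/\ 0 < r, 0 <= K,
    forall x a b : 'rV[R]_m, `|x - x0| < r -> `|a - x0| < r -> `|b - x0| < r ->
      `|F a - F b - (a - b) *m jac F x| <= K * (`|a - x| + `|b - x|) * `|a - b| &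
    forall x : 'rV[R]_m, `|x - x0| < r -> U x /\ `|jac F x| <= K].
Proof.
move=> oU cF Ux.
have cF1 := CkS cF.
have /(Ck_mx 2 F oU) cFj := cF.
have /choice[rK HrK] : forall j, exists q : R * R, [/\ 0 < q.1, 0 <= q.2 &
   forall x a b : 'rV[R]_m, `|x - x0| < q.1 -> `|a - x0| < q.1 -> `|b - x0| < q.1 ->
    `|F a 0 j - F b 0 j - 'D_(a - b) (fun x => F x 0 j) x| <=
       q.2 * (`|a - x| + `|b - x|) * `|a - b|].
  by move=> j; have [r ? [K ? H]] := C2_quadratic oU (cFj 0 j) Ux; exists (r, K).
have /choice[sB HsB] : forall j, exists q : R * R, [/\ 0 < q.1, 0 <= q.2 &
   forall y v, `|y - x0| < q.1 -> U y /\ `|'D_v (fun x => F x 0 j) y| <= q.2 * `|v|].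
  by move=> j; have [r ? [K ? H]] := derive_bound oU (CkS (cFj 0 j)) Ux; exists (r, K).
have [r r0 rP] := open_normP oU Ux.
have [s s0 sP] : exists2 r : R, 0 < r & forall y, `|y - x0| < r ->
    forall j, `|y - x0| < (rK j).1 /\ `|y - x0| < (sB j).1.
  apply: fin_radius => j; exists (Num.min (rK j).1 (sB j).1).
    by rewrite lt_min; have [-> _ _] := HrK j; have [-> _ _] := HsB j.
  by move=> y; rewrite lt_min => /andP[].
have n0 : 0 <= \sum_j (rK j).2 by apply: sumr_ge0 => j _; have [] := HrK j.
have n1 : 0 <= \sum_j (sB j).2 by apply: sumr_ge0 => j _; have [] := HsB j.
exists (Num.min r s), (\sum_j (rK j).2 + \sum_j (sB j).2); split.
- by rewrite lt_min r0.
- by rewrite addr_ge0.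
- move=> x a b; rewrite !lt_min => /andP[xr xs] /andP[ar as_] /andP[br bs].
  rewrite (jac_mul _ oU cF1 (rP _ xr)) derive_mx; last exact: Ck_derivable cF1 (rP _ xr).
  apply: mxnorm_le => [|i j]; first by rewrite !mulr_ge0// !addr_ge0.
  rewrite !mxE ord1; have [_ Kp H] := HrK j.
  have [x1 _] := sP _ xs j; have [a1 _] := sP _ as_ j; have [b1 _] := sP _ bs j.
  apply: (le_trans (H x a b x1 a1 b1)).
  rewrite -!mulrA; apply: ler_wpM2r; first by rewrite mulr_ge0 ?addr_ge0.
  apply: ler_wpDr => //; rewrite (bigD1 j)//= lerDl sumr_ge0// => k _.
  by have [] := HrK k.
- move=> x; rewrite lt_min => /andP[xr xs]; split; first exact: rP.
  apply: mxnorm_le => [|i j]; first by rewrite addr_ge0.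
  rewrite mxE; have [_ x1] := sP _ xs j; have [_ Bp H] := HsB j.
  have [_ H1] := H x (delta_mx 0 i) x1.
  apply: (le_trans H1).
  have dn : `|delta_mx 0 i : 'rV[R]_m| <= 1.
    apply: mxnorm_le => // k l.
    by rewrite mxE normr_nat lern1 leq_b1.
  apply: (@le_trans _ _ (sB j).2); first by rewrite ler_piMr.
  apply: ler_wpDl => //; rewrite (bigD1 j)//= lerDl sumr_ge0// => k _.
  by have [] := HsB k.
Qed.

Lemma jac_continuous F U i j : open U -> Ck 1 U F -> forall x, U x ->
  {for x, continuous (fun x => jac F x i j)}.
Proof.
move=> oU cF x Ux.
have /(Ck_mx 1 F oU) cFj := cF.
have -> : (fun x => jac F x i j) = 'D_(delta_mx 0 i) (fun y => F y 0 j).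
  by apply/funext => y; rewrite mxE.
by apply: Ck_cont (Ck_derive _ (cFj 0 j)) Ux.
Qed.

(* Stronger than differentiability at x0, in order to pass to inverse functions;
   it assumes nothing about derivatives at the points near x0. *)
Definition Qdiff (x0 : 'rV[R]_m) F (L : 'M[R]_(m, p)) : Prop :=
  exists r C : R, [/\ 0 < r, 0 <= C & forall a b : 'rV[R]_m,
    `|a - x0| < r -> `|b - x0| < r ->
    `|F a - F b - (a - b) *m L| <= C * (`|a - x0| + `|b - x0|) * `|a - b|].

Lemma Qdiff_C2 F U x0 : open U -> Ck 2 U F -> U x0 -> Qdiff x0 F (jac F x0).
Proof.
move=> oU cF Ux; have [r [K [r0 K0 H _]]] := jac_quadratic oU cF Ux.
by exists r, K; split=> // a b ar br; apply: H => //; rewrite subrr normr0.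
Qed.

Lemma Qdiff_lip x0 F L : Qdiff x0 F L ->
  exists r C : R, [/\ 0 < r, 0 <= C & forall a b : 'rV[R]_m,
    `|a - x0| < r -> `|b - x0| < r -> `|F a - F b| <= C * `|a - b|].
Proof.
move=> [r [C [r0 C0 H]]]; exists r, (C * (2 * r) + m%:R * `|L|); split=> //.
  by rewrite addr_ge0// mulr_ge0// mulr_ge0// ltW.
move=> a b ar br.
rewrite -(subrK ((a - b) *m L) (F a - F b)) (le_trans (ler_normD _ _))//.
rewrite mulrDl; apply: lerD; last exact: mulmx_norm.
apply: (le_trans (H a b ar br)); apply: ler_wpM2r => //; apply: ler_wpM2l => //.
by rewrite mulr_natl mulr2n lerD// ltW.
Qed.

Lemma Qdiff_near x0 F G L r : 0 < r ->
  (forall a, `|a - x0| < r -> F a = G a) -> Qdiff x0 F L -> Qdiff x0 G L.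
Proof.
move=> r0 FG [s [C [s0 C0 H]]]; exists (Num.min r s), C; split=> //.
  by rewrite lt_min r0.
move=> a b; rewrite !lt_min => /andP[ar as_] /andP[br bs].
by rewrite -!FG//; exact: H.
Qed.

Lemma Qdiff_derive x0 F L v : Qdiff x0 F L -> is_derive x0 v F (v *m L).
Proof.
move=> [r [C [r0 C0 H]]].
suff K : (fun h : R => h^-1 *: (F (h *: v + x0) - F x0)) @ 0^' --> v *m L.
  split; first by apply/cvg_ex; exists (v *m L).
  by apply/cvg_lim.
apply/cvgrPdist_le => e e0.
pose s := Num.min (r / (1 + `|v|)) (e / (C * `|v| * `|v| + 1)).
have v1 : 0 < 1 + `|v| by rewrite ltr_wpDr.
have c1 : 0 < C * `|v| * `|v| + 1 by rewrite ltr_wpDl// !mulr_ge0.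
have s0 : 0 < s by rewrite lt_min !divr_gt0.
near=> h.
have h0 : h != 0 by near: h; exact: nbhs_dnbhs_neq.
have hs : `|h| < s by near: h; exact: dnbhs0_lt.
move: hs; rewrite lt_min => /andP[h1 h2].
have hv : `|h *: v + x0 - x0| < r.
  rewrite addrK normrZ; move: h1; rewrite ltr_pdivlMr//; apply: le_lt_trans.
  by rewrite ler_wpM2l// lerDr.
have := H _ x0 hv; rewrite subrr normr0 addr0 !addrK => /(_ r0) K.
rewrite distrC.
have -> : h^-1 *: (F (h *: v + x0) - F x0) - v *m L =
    h^-1 *: (F (h *: v + x0) - F x0 - (h *: v) *m L).
  by rewrite [in RHS]scalerBr -scalemxAl scalerA mulVf// scale1r.
rewrite normrZ normfV ler_pdivrMl ?normr_gt0//.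
apply: (le_trans K); rewrite !normrZ.
move: h2; rewrite ltr_pdivlMr// => /ltW h2.
have : `|h| * (`|h| * (C * `|v| * `|v| + 1)) <= `|h| * e by rewrite ler_wpM2l.
have : 0 <= `|h| * `|h| by rewrite mulr_ge0.
nra.
Unshelve. all: by end_near. Qed.

End Jacobian.

Lemma Qdiff_comp (R : realType) m p q (x0 : 'rV[R]_m)
    (F : 'rV[R]_m -> 'rV[R]_p) (G : 'rV[R]_p -> 'rV[R]_q) L M :
  Qdiff x0 F L -> Qdiff (F x0) G M -> Qdiff x0 (fun x => G (F x)) (L *m M).
Proof.
move=> QF [s [D [s0 D0 HG]]].
have [t [K [t0 K0 HK]]] := Qdiff_lip QF.
have [r [C [r0 C0 HF]]] := QF.
have K1 : 0 < K + 1 by rewrite ltr_wpDl.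
exists (Num.min r (Num.min t (s / (K + 1)))), (D * K * K + q%:R * 0 + p%:R * `|M| * C).
split.
- by rewrite !lt_min r0 t0 divr_gt0.
- by rewrite mulr0 addr0 addr_ge0// !mulr_ge0.
move=> a b; rewrite !lt_min => /andP[ar /andP[at_ as_]] /andP[br /andP[bt bs]].
have x00 : `|x0 - x0| < t by rewrite subrr normr0.
have Fa := HK a x0 at_ x00; have Fb := HK b x0 bt x00; have Fab := HK a b at_ bt.
have sa y : `|F y - F x0| <= K * `|y - x0| -> `|y - x0| < s / (K + 1) -> `|F y - F x0| < s.
  move=> h; rewrite ltr_pdivlMr//; apply: le_lt_trans; apply: (le_trans h).
  by rewrite mulrC ler_wpM2l// lerDl.
have H1 := HG _ _ (sa _ Fa as_) (sa _ Fb bs).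
have H2 := HF a b ar br.
rewrite mulmxA.
have -> : G (F a) - G (F b) - (a - b) *m L *m M =
  (G (F a) - G (F b) - (F a - F b) *m M) + (F a - F b - (a - b) *m L) *m M.
  by rewrite (mulmxBl (F a - F b)) addrA subrK.
rewrite (le_trans (ler_normD _ _))//.
have H3 := mulmx_norm (F a - F b - (a - b) *m L) M.
have n1 := normr_ge0 (a - x0); have n2 := normr_ge0 (b - x0); have n3 := normr_ge0 (a - b).
have H4 : D * (`|F a - F x0| + `|F b - F x0|) * `|F a - F b| <=
    D * (K * `|a - x0| + K * `|b - x0|) * (K * `|a - b|).
  by apply: ler_pM => //; rewrite ?mulr_ge0 ?addr_ge0// ler_wpM2l// lerD.
have pM : 0 <= p%:R * `|M| by rewrite mulr_ge0.
have H5 : p%:R * `|M| * `|F a - F b - (a - b) *m L| <= p%:R * `|M| * (C * (`|a - x0| + `|b - x0|) * `|a - b|).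
  by rewrite ler_wpM2l.
apply: (le_trans (lerD (le_trans H1 H4) (le_trans H3 H5))).
rewrite mulr0 addr0 le_eqVlt; apply/orP; left; apply/eqP.
move: (`|a - x0|) (`|b - x0|) (`|a - b|) (p%:R * `|M|) => *; ring.
Qed.

(** * Flows and their dependence on the initial point *)

Section FlowBox.
Context {R : realType} {m : nat}.
Implicit Types (V : 'rV[R]_m -> 'rV[R]_m) (U : set 'rV[R]_m).

Lemma ode_lipschitz V U x0 : open U -> Ck 2 U V -> U x0 ->
  exists r L : R, [/\ 0 < r, 0 < L & forall a b : 'rV[R]_m,
    `|a - x0| < r -> `|b - x0| < r -> `|V a - V b| <= L * `|a - b|].
Proof.
move=> oU cV Ux; have [r [C [r0 C0 H]]] := Qdiff_lip (Qdiff_C2 oU cV Ux).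
exists r, (C + 1); split=> //; first by rewrite ltr_wpDl.
move=> a b ar br; apply: (le_trans (H a b ar br)).
by rewrite ler_wpM2r// lerDl.
Qed.

Lemma ode_unique_local V U x0 : open U -> Ck 2 U V -> U x0 ->
  exists r d : R, [/\ 0 < r, 0 < d & forall (X1 X2 : R -> 'rV[R]_m) (a b t1 : R),
    a <= t1 <= b -> b - a <= d ->
    {within `[a, b], continuous X1} -> {within `[a, b], continuous X2} ->
    (forall t : R, a < t < b -> `|X1 t - x0| < r /\ is_derive t 1 X1 (V (X1 t))) ->
    (forall t : R, a < t < b -> `|X2 t - x0| < r /\ is_derive t 1 X2 (V (X2 t))) ->
    X1 t1 = X2 t1 -> forall t, a <= t <= b -> X1 t = X2 t].
Proof.
move=> oU cV Ux; have [r [L [r0 L0 H]]] := ode_lipschitz oU cV Ux.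
exists r, (2^-1 / L); split=> //; first by rewrite divr_gt0.
move=> X1 X2 a b t1 t1ab; rewrite ler_pdivlMr// mulrC => bad c1 c2 H1 H2 E t tab.
have cc : {within `[a, b], continuous (fun t => X1 t - X2 t)}.
  by move=> s; apply: (@continuousB R _ (subspace `[a, b]) X1 X2 s); [exact: c1|exact: c2].
have := @gronwall R m (fun t => X1 t - X2 t) (fun t => V (X1 t) - V (X2 t)) a b L 0 t1 t
  cc (ltW L0) (lexx _) bad.
rewrite E subrr normr0 !mulr0 addr0 normr_le0 subr_eq0 => K.
apply/eqP/K => // s sab; have [x1 d1] := H1 s sab; have [x2 d2] := H2 s sab.
by split; [exact: is_deriveB|rewrite addr0 H].
Qed.

(** A 1-Lipschitz retraction onto the closed ball of the sup norm around x0: composed with it, a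
    field that is Lipschitz near x0 becomes globally Lipschitz, as [picard] requires. *)
Let clampV (x0 : 'rV[R]_m) (r : R) (x : 'rV[R]_m) : 'rV[R]_m :=
  \row_i Num.max (x0 0 i - r) (Num.min (x0 0 i + r) (x 0 i)).

Let clampV_lip x0 r x y : `|clampV x0 r x - clampV x0 r y| <= `|x - y|.
Proof.
apply: mxnorm_le => // i j; rewrite !mxE (le_trans (clamp_lip _ _ _ _))//.
by have := mxnorm_coord (x - y) 0 j; rewrite !mxE.
Qed.

Let clampV_ball (x0 x : 'rV[R]_m) r : 0 <= r -> `|clampV x0 r x - x0| <= r.
Proof.
move=> r0; apply: mxnorm_le => // i j; rewrite !mxE !ord1 ler_norml.
rewrite lerBlDl lerBrDl le_max lexx /= ge_max ge_min lexx /= andbT.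
by rewrite lerD2l; lra.
Qed.

Let clampV_id (x0 x : 'rV[R]_m) r : `|x - x0| <= r -> clampV x0 r x = x.
Proof.
move=> xr; apply/rowP => i; rewrite !mxE.
have := le_trans (mxnorm_coord (x - x0) 0 i) xr; rewrite !mxE ler_norml.
move=> /andP[h1 h2]; rewrite min_r ?max_r//; lra.
Qed.

(** [Y y] is constructed as the solution of the linearised equation starting at the identity matrix,
    not as a limit of difference quotients; that it is the derivative of the flow in the initial
    point then follows from [gronwall] for the error [EE]. *)
Theorem flowbox V U x0 : open U -> Ck 2 U V -> U x0 ->
  exists (d r : R) (Phi : 'rV[R]_m -> R -> 'rV[R]_m) (Y : 'rV[R]_m -> R -> 'M[R]_m),
  [/\ 0 < d, 0 < r,
    forall y, `|y - x0| < r -> Phi y 0 = y /\ forall t : R, `|t| < d ->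
      U (Phi y t) /\ is_derive t 1 (Phi y) (V (Phi y t)) &
    forall y, `|y - x0| < r -> forall t : R, `|t| < d ->
      Qdiff y (Phi^~ t) (Y y t) /\ is_derive t 1 (Y y) (Y y t *m jac V (Phi y t))].
Proof.
move=> oU cV Ux.
have [R0 [K [R00 K0 HK HJ]]] := jac_quadratic oU cV Ux.
have HU x : `|x - x0| < R0 -> U x by move=> /HJ[].
(* The first term bounds the linearised equation, the first two together bound the Lipschitz
   constant of V ([R0 *+ 2] is a diameter), and 1 keeps L positive. *)
pose L := m%:R * K + K * (R0 *+ 2) + 1.
have mK0 : 0 <= m%:R * K by rewrite mulr_ge0.
have KR0 : 0 <= K * (R0 *+ 2) by rewrite mulr_ge0// mulrn_wge0// ltW.
have L0 : 0 < L by rewrite ltr_wpDl// addr_ge0.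
have HA x (v : 'rV[R]_m) : `|x - x0| < R0 -> `|v *m jac V x| <= m%:R * K * `|v|.
  move=> /HJ[_ jK]; apply: (le_trans (mulmx_norm _ _)).
  by rewrite ler_wpM2r// ler_wpM2l.
have HL a b : `|a - x0| < R0 -> `|b - x0| < R0 -> `|V a - V b| <= L * `|a - b|.
  move=> ar br.
  rewrite -(subrK ((a - b) *m jac V b) (V a - V b)) (le_trans (ler_normD _ _))//.
  have h1 := HK b a b br ar br; have h2 := HA b (a - b) br.
  rewrite subrr normr0 addr0 in h1.
  have h3 : `|a - b| <= R0 *+ 2.
    rewrite (le_trans (ler_distD x0 a b))// mulr2n lerD//; first exact: ltW.
    by rewrite distrC ltW.
  have h4 : K * `|a - b| * `|a - b| <= K * (R0 *+ 2) * `|a - b|.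
    by rewrite ler_wpM2r// ler_wpM2l.
  rewrite (le_trans (lerD (le_trans h1 h4) h2))// /L !mulrDl mul1r.
  by rewrite addrC -[leLHS]addr0 lerD.
pose R1 := R0 / 2.
have R10 : 0 < R1 by rewrite divr_gt0.
have R1R : R1 < R0 by rewrite ltr_pdivrMr// ltr_pMr ?ltr1n.
pose VV x := V (clampV x0 R1 x).
have cb x : `|clampV x0 R1 x - x0| < R0.
  by apply: le_lt_trans R1R; apply: clampV_ball; exact: ltW.
have VVlip x y : `|VV x - VV y| <= L * `|x - y|.
  by apply: (le_trans (HL _ _ (cb _) (cb _))); rewrite ler_pM2l.
pose B := `|V x0| + L * R0.
have B0 : 0 <= B by rewrite addr_ge0// mulr_ge0// ltW.
have VVB x : `|VV x| <= B.
  rewrite -(subrK (V x0) (VV x)) (le_trans (ler_normD _ _))// addrC lerD//.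
  apply: (le_trans (HL _ _ (cb _) _)); first by rewrite subrr normr0.
  by rewrite ler_pM2l// ltW.
(* The second entry keeps a trajectory that starts within R1 / 2 of x0 within R1. The final halving
   serves [gronwall] on [- t', t'], whose length can approach 2 * d. *)
pose d := Num.min (2^-1 / L) (R1 / 2 / (B + 1)) / 2.
have B1 : 0 < B + 1 by rewrite ltr_wpDl.
have dd0 : 0 < Num.min (2^-1 / L) (R1 / 2 / (B + 1)) by rewrite lt_min !divr_gt0.
have d0 : 0 < d by rewrite divr_gt0.
have dd : d *+ 2 = Num.min (2^-1 / L) (R1 / 2 / (B + 1)).
  by rewrite -mulr_natr /d divfK// pnatr_eq0.
have Ld2 : L * (d *+ 2) <= 2^-1.
  by rewrite dd mulrC -ler_pdivlMr// ge_min lexx.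
have Ld : L * d <= 2^-1 by apply: le_trans Ld2; rewrite ler_pM2l// mulr2n lerDl ltW.
have Bd : B * d < R1 / 2.
  apply: (@lt_le_trans _ _ ((B + 1) * d)); first by rewrite ltr_pM2r// ltrDl.
  apply: (@le_trans _ _ ((B + 1) * (d *+ 2))); first by rewrite ler_pM2l// mulr2n lerDl ltW.
  by rewrite mulrC -ler_pdivlMr// dd ge_min lexx orbT.
have /choice[Phi HPhi] : forall y, exists X : R -> 'rV[R]_m, [/\ X 0 = y,
    continuous X, forall t : R, `|t| < d -> is_derive t 1 X (VV (X t)) &
    forall t, `|X t - y| <= B * d].
  move=> y; have [X [X0 cX dX bX]] := @picard R m (fun=> VV) L d d0 (ltW L0) Ld
    (fun _ => VVlip) (fun x => @cst_continuous _ _ (VV x)) y B (fun=> VVB y).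
  by exists X; split=> // t; apply: bX => _ x; exact: VVB.
have PhiB y t : `|y - x0| < R1 / 2 -> `|Phi y t - x0| < R1.
  move=> yr; have [_ _ _ /(_ t) h] := HPhi y.
  rewrite -(subrK y (Phi y t)) -addrA (le_lt_trans (ler_normD _ _))//.
  by rewrite [ltRHS]splitr ltrD// (le_lt_trans h).
have PhiV y t : `|y - x0| < R1 / 2 -> VV (Phi y t) = V (Phi y t).
  by move=> /PhiB h; rewrite /VV clampV_id// ltW.
have PhiR y t : `|y - x0| < R1 / 2 -> `|Phi y t - x0| < R0.
  by move=> yr; apply: lt_trans R1R; exact: PhiB.
have cV1 := CkS cV.
have /choice[Y HY] : forall y, exists Y : R -> 'M[R]_m, `|y - x0| < R1 / 2 ->
    Y 0 = 1%:M /\ forall t : R, `|t| < d ->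
      is_derive t 1 Y (Y t *m jac V (Phi y t)).
  move=> y; have [yr|_] := boolP (`|y - x0| < R1 / 2); last by exists (fun=> 0).
  have [_ cPhi _ _] := HPhi y.
  have lipJ (t : R) (u v : 'rV[R]_m) :
      `|u *m jac V (Phi y t) - v *m jac V (Phi y t)| <= L * `|u - v|.
    rewrite -mulmxBl (le_trans (HA _ _ (PhiR y t yr)))// ler_wpM2r// /L.
    by rewrite -addrA lerDl addr_ge0.
  have cJ (u : 'rV[R]_m) : continuous (fun t => u *m jac V (Phi y t)).
    move=> t; pose W := [set x | `|x - x0| < R0].
    suff : forall M : R -> 'M[R]_m, (forall i j, {for t, continuous (fun t => M t i j)}) ->
        {for t, continuous (fun t => u *m M t)}.
      apply=> i j; apply: (@continuous_comp _ _ _ (Phi y) (fun x => jac V x i j)).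
        exact: cPhi.
      by apply: (jac_continuous oU cV1); exact/HU/PhiR.
    move=> M cM; apply/cvgrPdist_lt => /= e e0.
    have eS : 0 < e / (m%:R * `|u| + 1).
      by rewrite divr_gt0// ltr_wpDl// mulr_ge0.
    have S0 : 0 < m%:R * `|u| + 1 by rewrite ltr_wpDl// mulr_ge0.
    have [r r0 rP] : exists2 r : R, 0 < r & forall s, `|s - t| < r ->
        forall i, forall j, `|M s i j - M t i j| < e / (m%:R * `|u| + 1).
      apply: fin_radius => i; apply: fin_radius => j.
      exact: (cvg_normP (cM i j) eS).
    near=> s.
    have sr : `|s - t| < r by rewrite distrC; near: s; apply/nbhs_ballP; exists r.
    apply: (@le_lt_trans _ _ (m%:R * (`|u| * (e / (m%:R * `|u| + 1))))).
      apply: mxnorm_le => [|i j]; first by rewrite !mulr_ge0// ltW.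
      rewrite !mxE -sumrB; apply: sum_norm_le => k.
      rewrite -mulrBr normrM ler_pM//; first by rewrite ord1 mxnorm_coord.
      by rewrite distrC ltW// rP.
    by rewrite mulrA mulrCA gtr_pMr// ltr_pdivrMr// mul1r ltrDl.
  have /choice[Z HZ] : forall i, exists Z : R -> 'rV[R]_m, Z 0 = delta_mx 0 i /\
      forall t : R, `|t| < d -> is_derive t 1 Z (Z t *m jac V (Phi y t)).
    move=> i; have [Z [Z0 _ dZ _]] := @picard R m (fun t u => u *m jac V (Phi y t)) L d d0
       (ltW L0) Ld lipJ cJ (delta_mx 0 i) _ (fun t => HA _ (delta_mx 0 i) (PhiR y t yr)).
    by exists Z.
  exists (fun t => \matrix_(i, j) Z i t 0 j) => _; split.
    apply/matrixP => i j; have [Z0 _] := HZ i.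
    by rewrite !mxE Z0 mxE eqxx eq_sym.
  move=> t td; apply/is_derive_mx => i j.
  have [_ /(_ t td) /is_derive_mx /(_ 0 j)] := HZ i.
  rewrite !mxE => D.
  have -> : (fun x => (\matrix_(i, j) Z i x 0 j) i j) = (fun x => Z i x 0 j).
    by apply/funext => x; rewrite mxE.
  suff <- : \sum_k Z i t 0 k * jac V (Phi y t) k j =
            \sum_k (\matrix_(i, j) Z i t 0 j) i k * jac V (Phi y t) k j by [].
  by apply: eq_bigr => k _; rewrite mxE.
exists d, (R1 / 2), Phi, Y; split=> //; first by rewrite divr_gt0.
  move=> y yr; have [P0 _ dP _] := HPhi y; split=> // t td; split.
    exact/HU/PhiR.
  by rewrite -PhiV//; exact: dP.
move=> y yr t td; have [Y0 dY] := HY y yr; split; last exact: dY.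
have t2 : `|t| < (`|t| + d) / 2 by rewrite midf_lt.
have t2d : (`|t| + d) / 2 < d by rewrite midf_lt.
set t' := (`|t| + d) / 2 in t2 t2d.
have t'0 : 0 <= t' by apply: le_trans (ltW t2).
have inball (s : R) : - t' <= s <= t' -> `|s| < d.
  by rewrite -ler_norml => /le_lt_trans; apply.
have inball' (s : R) : - t' < s < t' -> `|s| < d.
  by move=> /andP[s1 s2]; apply: inball; rewrite !ltW.
have Lt : L * (t' - - t') <= 2^-1.
  apply: le_trans Ld2; rewrite ler_pM2l// opprK mulr2n lerD// ltW//.
have t0' : - t' <= 0 <= t' by rewrite oppr_le0 t'0.
have tt' : - t' <= t <= t' by rewrite -ler_norml ltW.
have lip a b (s : R) : `|a - x0| < R1 / 2 -> `|b - x0| < R1 / 2 -> - t' <= s <= t' ->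
    `|Phi a s - Phi b s| <= 2 * `|a - b|.
  move=> ar br st; have [a0 ca da _] := HPhi a; have [b0 cb' db _] := HPhi b.
  have := @gronwall R m (fun s => Phi a s - Phi b s)
    (fun s => VV (Phi a s) - VV (Phi b s)) (- t') t' L 0 0 s.
  rewrite a0 b0 mulr0 addr0; apply=> //; last 1 first.
  - move=> u /inball' ut; split; last by rewrite addr0.
    by apply: is_deriveB; [exact: da|exact: db].
  - by apply: continuous_subspaceT => u; apply: continuousB; [exact: ca|exact: cb'].
  - exact: ltW.
have rho0 : 0 < R1 / 2 - `|y - x0| by rewrite subr_gt0.
have rho a : `|a - y| < R1 / 2 - `|y - x0| -> `|a - x0| < R1 / 2.
  rewrite ltrBrDr; apply: le_lt_trans.
  by rewrite (le_trans (ler_distD y _ _)).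
exists (R1 / 2 - `|y - x0|), (2 * (t' - - t') * (K * 2 * 2)); split=> //.
  by rewrite !mulr_ge0// opprK addr_ge0.
move=> a b /rho ar /rho br.
have [a0 ca da _] := HPhi a; have [b0 cb' db _] := HPhi b.
have [y0 cy dy _] := HPhi y.
(* [F] is the derivative of the error [EE]. It has the form [EE s *m J] plus a remainder that is
   quadratic in the distances between the three trajectories, where J is the Jacobian of V along
   that of y; moreover [EE 0 = 0]. *)
pose F s := VV (Phi a s) - VV (Phi b s) - (a - b) *m (Y y s *m jac V (Phi y s)).
pose EE (s : R) := Phi a s - Phi b s - (a - b) *m Y y s.
have dE (s : R) : `|s| < d -> is_derive s 1 EE (F s).
  move=> sd; apply: is_deriveB; first by apply: is_deriveB; [exact: da|exact: db].
  apply/is_derive_mx => i j; rewrite mxE.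
  have -> : (fun x => ((a - b) *m Y y x) i j) = (fun x => \sum_k (a - b) i k * Y y x k j).
    by apply/funext => x; rewrite mxE.
  have H k : is_derive s 1 (fun x => (a - b) i k * Y y x k j)
      ((a - b) i k * (Y y s *m jac V (Phi y s)) k j).
    have /is_derive_mx /(_ k j) D := dY s sd.
    exact: (@is_deriveZ _ _ _ (fun x => Y y x k j) ((a - b) i k) s 1 _ D).
  have := @is_derive_sum R _ _ m (fun k x => (a - b) i k * Y y x k j) s 1
     (fun k => (a - b) i k * (Y y s *m jac V (Phi y s)) k j) H.
  by congr is_derive; apply/funext => x; rewrite fct_sumE.
have cE : {within `[- t', t'], continuous EE}.
  apply: derivable_within_continuous => s; rewrite in_itv /= => /inball sd.
  by have [] := dE s sd.
have c0 : 0 <= K * 2 * 2 * (`|a - y| + `|b - y|) * `|a - b|.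
  by rewrite !mulr_ge0// addr_ge0.
have := @gronwall R m EE F (- t') t' L _ 0 t cE (ltW L0) c0 Lt _ t0' tt'.
have -> : EE 0 = 0 by rewrite /EE a0 b0 Y0 mulmx1 subrr.
rewrite normr0 mulr0 add0r => G.
apply: (le_trans (G _)); last by rewrite -!mulrA.
move=> s st'; have sd := inball' s st'; split; first exact: dE.
have st : - t' <= s <= t' by case/andP: st' => *; rewrite !ltW.
have h1 := HK (Phi y s) (Phi a s) (Phi b s) (PhiR y s yr) (PhiR a s ar) (PhiR b s br).
rewrite /F !PhiV//.
set J := jac V (Phi y s) in h1 *.
have -> : V (Phi a s) - V (Phi b s) - (a - b) *m (Y y s *m J) =
  EE s *m J + (V (Phi a s) - V (Phi b s) - (Phi a s - Phi b s) *m J).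
  have alg (P X Z : 'rV[R]_m) : P - Z *m J = (X - Z) *m J + (P - X *m J).
    by rewrite mulmxBl [RHS]addrC addrA subrK.
  by rewrite mulmxA /EE; exact: alg.
rewrite (le_trans (ler_normD _ _))//; apply: lerD.
  rewrite (le_trans (HA _ _ (PhiR y s yr)))// ler_wpM2r// /L.
  by rewrite -addrA lerDl addr_ge0.
apply: (le_trans h1).
have l1 := lip _ _ s ar yr st; have l2 := lip _ _ s br yr st; have l3 := lip _ _ s ar br st.
have -> : K * 2 * 2 * (`|a - y| + `|b - y|) * `|a - b| =
  K * (2 * `|a - y| + 2 * `|b - y|) * (2 * `|a - b|) by ring.
apply: ler_pM => //; first by rewrite mulr_ge0// addr_ge0.
by rewrite ler_wpM2l// lerD.
Unshelve. all: by end_near. Qed.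

End FlowBox.

Lemma is_derive_cast (R : realType) (V W : normedModType R) (f : V -> W) (x v : V)
  (df df' : W) : is_derive x v f df -> df = df' -> is_derive x v f df'.
Proof. by move=> H <-. Qed.

(** * Bilinear forms with variable coefficients *)

Section Bilinear.
Context {R : realType}.

Definition bf n (A : 'M[R]_n) (u w : 'rV[R]_n) : R := (u *m A *m w^T) 0 0.

Section BfAlgebra.
Context {n : nat}.
Implicit Types (A B : 'M[R]_n) (u v w : 'rV[R]_n) (c : R).

Lemma bfE A u w : bf A u w = \sum_i \sum_j A i j * u 0 i * w 0 j.
Proof.
rewrite /bf mxE exchange_big /=; apply: eq_bigr => j _; rewrite !mxE mulr_suml.
by apply: eq_bigr => i _; rewrite [A i j * _]mulrC.
Qed.

Lemma bfDl A u v w : bf A (u + v) w = bf A u w + bf A v w.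
Proof. by rewrite /bf !mulmxDl mxE. Qed.
Lemma bfDr A u v w : bf A w (u + v) = bf A w u + bf A w v.
Proof. by rewrite /bf linearD /= mulmxDr mxE. Qed.
Lemma bfZl A c u w : bf A (c *: u) w = c * bf A u w.
Proof. by rewrite /bf -!scalemxAl mxE. Qed.
Lemma bfZr A c u w : bf A w (c *: u) = c * bf A w u.
Proof. by rewrite /bf linearZ /= -scalemxAr mxE. Qed.
Lemma bfNl A u w : bf A (- u) w = - bf A u w.
Proof. by rewrite -scaleN1r bfZl mulN1r. Qed.
Lemma bfNr A u w : bf A w (- u) = - bf A w u.
Proof. by rewrite -scaleN1r bfZr mulN1r. Qed.
Lemma bfBl A u v w : bf A (u - v) w = bf A u w - bf A v w.
Proof. by rewrite bfDl bfNl. Qed.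
Lemma bfBr A u v w : bf A w (u - v) = bf A w u - bf A w v.
Proof. by rewrite bfDr bfNr. Qed.
Lemma bf0l A w : bf A 0 w = 0.
Proof. by rewrite -(scale0r w) bfZl mul0r. Qed.
Lemma bf0r A w : bf A w 0 = 0.
Proof. by rewrite -(scale0r w) bfZr mul0r. Qed.
Lemma bfC A u w : A^T = A -> bf A u w = bf A w u.
Proof.
move=> sA; transitivity ((w *m A *m u^T)^T 0 0); last by rewrite mxE.
by rewrite !trmx_mul trmxK sA mulmxA.
Qed.
Lemma bf_norm A u w : `|bf A u w| <= n%:R * (n%:R * (`|A| * `|u| * `|w|)).
Proof.
rewrite bfE; apply: sum_norm_le => i; apply: sum_norm_le => j.
by rewrite !normrM !ler_pM ?mulr_ge0// mxnorm_coord.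
Qed.

End BfAlgebra.

Lemma is_derive_mulmx (V : normedModType R) m n p (A : V -> 'M[R]_(m, n))
    (B : V -> 'M[R]_(n, p)) (x v : V) dA dB :
  is_derive x v A dA -> is_derive x v B dB ->
  is_derive x v (fun x => A x *m B x) (dA *m B x + A x *m dB).
Proof.
move=> /is_derive_mx HA /is_derive_mx HB; apply/is_derive_mx => i j.
have -> : (fun x => (A x *m B x) i j) = (fun x => \sum_k A x i k * B x k j).
  by apply/funext => y; rewrite mxE.
have H k : is_derive x v (fun x => A x i k * B x k j)
    (dA i k * B x k j + A x i k * dB k j).
  have D1 := HA i k; have D2 := HB k j.
  have := @is_deriveM R V (fun x => A x i k) (fun x => B x k j) x v (dA i k) (dB k j) D1 D2.
  by move=> D; apply: (is_derive_cast D); rewrite addrC [_ *: dA i k]mulrC.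
have := @is_derive_sum R _ _ n (fun k x => A x i k * B x k j) x v
   (fun k => dA i k * B x k j + A x i k * dB k j) H.
rewrite !mxE big_split /=; congr is_derive.
by apply/funext => y; rewrite fct_sumE.
Qed.

Lemma is_derive_trmx (V : normedModType R) m n (A : V -> 'M[R]_(m, n)) (x v : V) dA :
  is_derive x v A dA -> is_derive x v (fun x => (A x)^T) dA^T.
Proof.
move=> /is_derive_mx H; apply/is_derive_mx => i j; rewrite mxE.
by have := H j i; congr is_derive; apply/funext => y; rewrite mxE.
Qed.

Lemma is_derive_bf_aux (V : normedModType R) n (A : V -> 'M[R]_n) (u w : V -> 'rV[R]_n)
    (x v : V) dA du dw :
  is_derive x v A dA -> is_derive x v u du -> is_derive x v w dw ->
  is_derive x v (fun x => bf (A x) (u x) (w x))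
    (bf dA (u x) (w x) + (bf (A x) du (w x) + bf (A x) (u x) dw)).
Proof.
move=> HA Hu Hw.
have := is_derive_mulmx (is_derive_mulmx Hu HA) (is_derive_trmx Hw).
move=> /is_derive_mx /(_ 0 0) D; apply: (is_derive_cast D).
by rewrite /bf mulmxDl !mxE addrAC addrC addrA.
Qed.

Lemma is_derive_mxcomp (V : normedModType R) m n p (A : 'rV[R]_n -> 'M[R]_(m, p)) U
    (z : V -> 'rV[R]_n) (x v : V) dz :
  open U -> Ck 1 U A -> U (z x) -> is_derive x v z dz ->
  is_derive x v (fun x => A (z x)) ('D_dz A (z x)).
Proof.
move=> oU cA Uz Hz; have /(Ck_mx 1 A oU) cAj := cA.
apply/is_derive_mx => i j.
have := is_derive_comp_C1 oU (cAj i j) Uz Hz; move=> D; apply: (is_derive_cast D).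
by rewrite derive_mx ?mxE//; exact: Ck_derivable cA Uz.
Qed.

Lemma is_derive_bf (V : normedModType R) n (A : 'rV[R]_n -> 'M[R]_n) U
    (z u w : V -> 'rV[R]_n) (x v : V) dz du dw :
  open U -> Ck 1 U A -> U (z x) -> is_derive x v z dz ->
  is_derive x v u du -> is_derive x v w dw ->
  is_derive x v (fun x => bf (A (z x)) (u x) (w x))
    (bf ('D_dz A (z x)) (u x) (w x) +
      (bf (A (z x)) du (w x) + bf (A (z x)) (u x) dw)).
Proof.
move=> oU cA Uz Hz Hu Hw.
exact: is_derive_bf_aux (is_derive_mxcomp oU cA Uz Hz) Hu Hw.
Qed.

Lemma derive_bf n (A : 'rV[R]_n -> 'M[R]_n) U z (e u w : 'rV[R]_n) :
  open U -> Ck 1 U A -> U z -> is_derive z e (fun z => bf (A z) u w) (bf ('D_e A z) u w).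
Proof.
move=> oU cA Uz.
have := @is_derive_bf _ n A U id (fun=> u) (fun=> w) z e e 0 0 oU cA Uz
  (is_derive_id _ _) (is_derive_cst _ _ _) (is_derive_cst _ _ _).
by rewrite bf0l bf0r !addr0.
Qed.

End Bilinear.

Lemma dwithin_interior (R : realType) (V W : normedModType R) (A : set V)
    (f : V -> W) (x v : V) : A° x -> dwithin A f x v = 'D_v f x.
Proof.
move=> Ax; rewrite /dwithin /derive.
suff -> : within [set h : R | A (h *: v + x)] 0^' = 0^' by [].
have nA : \forall h \near (0 : R)^', A (h *: v + x).
  have c : {for (0 : R), continuous (fun h : R => h *: v + x)}.
    apply: continuousD; last exact: cst_continuous.
    by apply: continuousZr_tmp; exact: cvg_id.
  have : nbhs ((fun h : R => h *: v + x) 0) A by rewrite scale0r add0r.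
  by move=> /c; apply: nbhs_dnbhs.
rewrite eqEsubset; split=> P; last exact: cvg_within.
by rewrite /within /= => H; near=> h; apply: (near H h) => //; near: h.
Unshelve. all: by end_near. Qed.

Lemma smooth_on_interior (R : realType) (V W : normedModType R) (A : set V)
    (f : V -> W) k : smooth_on A f -> Ck k A° f.
Proof.
move=> sf; apply: Ck_local => x Ax.
have [U [F [oU Ux cF FE]]] := sf x (interior_subset Ax).
exists (U `&` A°); first by split.
apply: (@Ck_eq _ _ _ _ _ F).
- by apply: openI => //; exact: open_interior.
- by move=> y [Uy /interior_subset Ay]; exact: FE.
- by apply: Ck_sub (cF k) => y [].
Qed.

(** * Geometry in a chart *)

Section ChartGeometry.
Context {R : realType} {n : nat} (M : riemannianManifold R n).
Implicit Types (a b : atlas M) (z u v w : 'rV[R]_n).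

(** The coordinates of the interior points of M (see [ocodP]). The calculus takes place here, where
    derivatives within [cod] are two-sided. *)
Definition ocod a : set 'rV[R]_n := (cod (chart_of a))°.

Lemma ocod_open a : open (ocod a).
Proof. exact: open_interior. Qed.
Arguments ocod_open : clear implicits.

Lemma ocod_cod a z : ocod a z -> cod (chart_of a) z.
Proof. exact: interior_subset. Qed.

Lemma metric_Ck k a : Ck k (ocod a) (metric a).
Proof. exact: (smooth_on_interior k (@metric_smooth R n M a)). Qed.
Arguments metric_Ck : clear implicits.

Lemma gram_Ck k a i j : Ck k (ocod a) (gram a i j).
Proof.
by have /(Ck_mx k _ (ocod_open a)) := metric_Ck k a; exact.
Qed.
Arguments gram_Ck : clear implicits.

Lemma partialE a i f z : ocod a z -> partial a i f z = 'D_(delta_mx 0 i) f z.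
Proof. exact: dwithin_interior. Qed.

Lemma partial_Ck k a i f : Ck k.+1 (ocod a) f -> Ck k (ocod a) (partial a i f).
Proof.
move=> cf; apply: (Ck_eq (ocod_open a)) (Ck_derive (delta_mx 0 i) cf) => z /=.
by move=> /partialE ->.
Qed.

Definition gG a z u w : R := bf (metric a z) u w.

Lemma gGC a z u w : cod (chart_of a) z -> gG a z u w = gG a z w u.
Proof. by move=> cz; apply: bfC; rewrite Defs.metric_sym. Qed.

Lemma gG_gt0 a z u : cod (chart_of a) z -> u != 0 -> 0 < gG a z u u.
Proof. by move=> cz u0; exact: metric_pos. Qed.

Lemma gG_ge0 a z u : cod (chart_of a) z -> 0 <= gG a z u u.
Proof.
move=> cz; have [->|u0] := eqVneq u 0; first by rewrite /gG bf0l.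
by rewrite ltW// gG_gt0.
Qed.

Lemma gG_eq0 a z u : cod (chart_of a) z -> gG a z u u = 0 -> u = 0.
Proof.
move=> cz; have [->//|u0] := eqVneq u 0.
by have := gG_gt0 cz u0 => /[swap] ->; rewrite ltxx.
Qed.

Lemma gG_inj a z u w : cod (chart_of a) z ->
  (forall v, gG a z u v = gG a z w v) -> u = w.
Proof.
move=> cz H; apply/eqP; rewrite -subr_eq0; apply/eqP/(gG_eq0 cz).
by rewrite /gG bfBl; apply/eqP; rewrite subr_eq0; exact/eqP/H.
Qed.

Lemma metric_unit a z : cod (chart_of a) z -> metric a z \in unitmx.
Proof.
move=> cz; rewrite -row_free_unit -kermx_eq0; apply/eqP/row_matrixP => i.
rewrite row0; apply: (gG_eq0 cz).
have := mulmx_ker (metric a z) => /(congr1 (row i)).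
by rewrite row_mul row0 => k0; rewrite /gG /bf k0 mul0mx mxE.
Qed.

Lemma christoffel_Ck k a l i j : Ck k (ocod a) (christoffel a l i j).
Proof.
have oU := ocod_open a.
have P p q r : Ck k (ocod a) (partial a p (gram a q r)).
  by apply: partial_Ck; exact: gram_Ck.
apply: CkM => //; first exact: Ck_cst.
apply: Ck_sum => // m; apply: CkM => //.
  apply: Ck_invmx => // [p q|z /ocod_cod]; last exact: metric_unit.
  exact: gram_Ck.
by apply: CkB => //; apply: CkD.
Qed.
Arguments christoffel_Ck : clear implicits.

Definition Chr a l z : 'M[R]_n := \matrix_(i, j) christoffel a l i j z.

Lemma Chr_Ck k a l : Ck k (ocod a) (Chr a l).
Proof.
apply/(Ck_mx k _ (ocod_open a)) => i j.
by apply: (Ck_eq (ocod_open a)) (christoffel_Ck k a l i j) => z _; rewrite mxE.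
Qed.
Arguments Chr_Ck : clear implicits.

(** The Christoffel symbols as a vector-valued bilinear form: the covariant derivative of w along u
    is D_u w + [Gam a z u w]. *)
Definition Gam a z u w : 'rV[R]_n := \row_l bf (Chr a l z) u w.

Lemma GamDr a z u v w : Gam a z w (u + v) = Gam a z w u + Gam a z w v.
Proof. by apply/rowP => l; rewrite !mxE bfDr. Qed.
Lemma GamZl a z c u w : Gam a z (c *: u) w = c *: Gam a z u w.
Proof. by apply/rowP => l; rewrite !mxE bfZl. Qed.
Lemma GamZr a z c u w : Gam a z w (c *: u) = c *: Gam a z w u.
Proof. by apply/rowP => l; rewrite !mxE bfZr. Qed.
Lemma GamNr a z u w : Gam a z w (- u) = - Gam a z w u.
Proof. by rewrite -scaleN1r GamZr scaleN1r. Qed.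
Lemma Gam0l a z w : Gam a z 0 w = 0.
Proof. by have := GamZl a z 0 w w; rewrite !scale0r. Qed.
Lemma Gam0r a z w : Gam a z w 0 = 0.
Proof. by have := GamZr a z 0 w w; rewrite !scale0r. Qed.

Lemma christoffelC a l i j z : ocod a z -> christoffel a l i j z = christoffel a l j i z.
Proof.
move=> oz; rewrite /christoffel; congr (_ * _); apply: eq_bigr => m _.
congr (_ * _); rewrite [X in X - _]addrC; congr (_ - _).
rewrite !partialE//; apply: near_eq_derive.
apply: filterS (open_nbhs_nbhs (conj (ocod_open a) oz)) => y /ocod_cod cy.
by rewrite /gram -{1}(Defs.metric_sym cy) mxE.
Qed.

Lemma GamC a z u w : ocod a z -> Gam a z u w = Gam a z w u.
Proof.
move=> oz; apply/rowP => l; rewrite !mxE; apply: bfC.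
by apply/matrixP => i j; rewrite !mxE christoffelC.
Qed.

(* twice the lowered Christoffel symbol of u, w, as a covector *)
Let low a z u w : 'rV[R]_n :=
  \row_m \sum_i \sum_j (partial a i (gram a j m) z + partial a j (gram a i m) z
     - partial a m (gram a i j) z) * u 0 i * w 0 j.

Let Gam_low a z u w : cod (chart_of a) z ->
  Gam a z u w = 2^-1 *: (low a z u w *m invmx (metric a z)).
Proof.
move=> cz; apply/rowP => l; rewrite !mxE bfE.
under eq_bigr => i _ do under eq_bigr => j _ do
  rewrite mxE /christoffel -!mulrA mulr_suml.
under eq_bigr => i _ do rewrite -mulr_sumr exchange_big /=.
rewrite -mulr_sumr exchange_big /=; congr (_ * _).
apply: eq_bigr => m _; rewrite mxE mulr_suml; apply: eq_bigr => i _.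
rewrite mulr_suml; apply: eq_bigr => j _.
have -> : invmx (metric a z) m l = invmx (metric a z) l m.
  by rewrite -[in LHS](Defs.metric_sym cz) -trmx_inv mxE.
by rewrite -!mulrA mulrC -!mulrA.
Qed.

Let D1 a z e u w : ocod a z -> 'D_e (fun z => gG a z u w) z =
  \sum_i e 0 i * \sum_j \sum_k partial a i (gram a j k) z * u 0 j * w 0 k.
Proof.
move=> oz; have oU := ocod_open a; have cM := metric_Ck 1 a.
have [_ ->] := derive_bf e u w oU cM oz.
rewrite derive_mx; last exact: Ck_derivable cM oz.
rewrite bfE.
under eq_bigr => j _ do under eq_bigr => k _ do
  rewrite mxE (derive_coord e oU (gram_Ck 1 a j k) oz) !mulr_suml.
under eq_bigr => j _ do rewrite exchange_big /=.
rewrite exchange_big /=; apply: eq_bigr => i _; rewrite mulr_sumr.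
apply: eq_bigr => j _; rewrite mulr_sumr; apply: eq_bigr => k _.
by rewrite partialE// !mulrA.
Qed.

(** The Koszul formula for fields with constant coefficients, whose brackets vanish. *)
Lemma Gam_lowered a z u w v : ocod a z -> 2 * gG a z (Gam a z u w) v =
  'D_u (fun z => gG a z w v) z + 'D_w (fun z => gG a z u v) z
  - 'D_v (fun z => gG a z u w) z.
Proof.
move=> oz; have cz := ocod_cod oz.
rewrite (Gam_low _ _ cz) /gG bfZl mulrA divff ?pnatr_eq0// mul1r {1}/bf.
rewrite -(mulmxA (low a z u w)) mulVmx ?metric_unit// mulmx1 !D1// mxE.
have E m : low a z u w 0 m * v^T m 0 =
   \sum_i \sum_j (partial a i (gram a j m) z * u 0 i * w 0 j * v 0 m)
   + \sum_i \sum_j (partial a j (gram a i m) z * u 0 i * w 0 j * v 0 m)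
   - \sum_i \sum_j (partial a m (gram a i j) z * u 0 i * w 0 j * v 0 m).
  rewrite !mxE mulr_suml -big_split -sumrB /=; apply: eq_bigr => i _.
  rewrite mulr_suml -big_split -sumrB /=; apply: eq_bigr => j _.
  by rewrite !mulrDl !mulNr.
under eq_bigr => m _ do rewrite E.
rewrite sumrB big_split /=; congr (_ + _ - _).
- rewrite exchange_big /=; apply: eq_bigr => i _.
  rewrite exchange_big /= mulr_sumr; apply: eq_bigr => j _.
  by rewrite mulr_sumr; apply: eq_bigr => k _; ring.
- rewrite exchange_big /=.
  under eq_bigr => i _ do rewrite exchange_big /=.
  rewrite exchange_big /=; apply: eq_bigr => j _; rewrite mulr_sumr.
  apply: eq_bigr => i _; rewrite mulr_sumr; apply: eq_bigr => k _; ring.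
- apply: eq_bigr => k _; rewrite mulr_sumr; apply: eq_bigr => i _.
  by rewrite mulr_sumr; apply: eq_bigr => j _; ring.
Qed.

Let DC a z e u w : ocod a z ->
  'D_e (fun z => gG a z u w) z = 'D_e (fun z => gG a z w u) z.
Proof.
move=> oz; apply: near_eq_derive.
apply: filterS (open_nbhs_nbhs (conj (ocod_open a) oz)) => y /ocod_cod cy.
exact: gGC.
Qed.

(** Two Koszul formulas are added, with u and w exchanged: all derivatives except those along e
    cancel. *)
Lemma metric_compatible a z e u w : ocod a z ->
  bf ('D_e (metric a) z) u w = gG a z (Gam a z e u) w + gG a z u (Gam a z e w).
Proof.
move=> oz; have cz := ocod_cod oz.
have [_ <-] := derive_bf e u w (ocod_open a) (metric_Ck 1 a) oz.
rewrite [gG a z u _]gGC//.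
have h1 := Gam_lowered e u w oz; have h2 := Gam_lowered e w u oz.
rewrite (DC e w u oz) in h2.
by move: h1 h2; rewrite /gG; lra.
Qed.

(** Leibniz' rule: [du + Gam a (z x) dz (u x)] is the covariant derivative of u along z in the
    direction e. The space V is the time axis for a curve and the parameter space for a family. *)
Lemma is_derive_gG (V : normedModType R) a (z u w : V -> 'rV[R]_n) (x e : V) dz du dw :
  ocod a (z x) -> is_derive x e z dz -> is_derive x e u du -> is_derive x e w dw ->
  is_derive x e (fun x => gG a (z x) (u x) (w x))
   (gG a (z x) (du + Gam a (z x) dz (u x)) (w x) +
    gG a (z x) (u x) (dw + Gam a (z x) dz (w x))).
Proof.
move=> oz Hz Hu Hw.
have H := is_derive_bf (ocod_open a) (metric_Ck 1 a) oz Hz Hu Hw.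
apply: (is_derive_cast H); rewrite metric_compatible// /gG bfDl bfDr; ring.
Qed.

Definition DGam a e z u w : 'rV[R]_n := \row_l bf ('D_e (Chr a l) z) u w.

Lemma is_derive_Gam (V : normedModType R) a (z u w : V -> 'rV[R]_n) (x e : V) dz du dw :
  ocod a (z x) -> is_derive x e z dz -> is_derive x e u du -> is_derive x e w dw ->
  is_derive x e (fun x => Gam a (z x) (u x) (w x))
   (DGam a dz (z x) (u x) (w x) +
     (Gam a (z x) du (w x) + Gam a (z x) (u x) dw)).
Proof.
move=> oz Hz Hu Hw; apply/is_derive_mx => i l.
have H := is_derive_bf (ocod_open a) (Chr_Ck 1 a l) oz Hz Hu Hw.
rewrite !mxE; move: H; congr is_derive.
by apply/funext => y; rewrite mxE.
Qed.

(** R(J, v) v in the sign convention of [riemann], for J and v with constant coefficients. *)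
Definition Riem a z J v : 'rV[R]_n :=
  DGam a J z v v - DGam a v z J v + Gam a z J (Gam a z v v)
  - Gam a z v (Gam a z J v).

Let DE a l z e p q : ocod a z -> bf ('D_e (Chr a l) z) p q =
  \sum_i \sum_j \sum_k e 0 i * p 0 j * q 0 k * partial a i (christoffel a l j k) z.
Proof.
move=> oz; have oU := ocod_open a.
rewrite derive_mx; last exact: Ck_derivable (Chr_Ck 1 a l) oz.
rewrite bfE.
have E j k : (fun z => Chr a l z j k) = christoffel a l j k.
  by apply/funext => y; rewrite mxE.
under eq_bigr => j _ do under eq_bigr => k _ do
  rewrite mxE E (derive_coord e oU (christoffel_Ck 1 a l j k) oz) !mulr_suml.
under eq_bigr => j _ do rewrite exchange_big /=.
rewrite exchange_big /=; apply: eq_bigr => i _; apply: eq_bigr => j _.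
by apply: eq_bigr => k _; rewrite partialE//; ring.
Qed.

Let CE a l z p u v : bf (Chr a l z) p (Gam a z u v) =
  \sum_i \sum_j \sum_k \sum_m
     p 0 i * u 0 j * v 0 k * (christoffel a l i m z * christoffel a m j k z).
Proof.
rewrite bfE; apply: eq_bigr => i _.
under [RHS]eq_bigr => j _ do rewrite exchange_big /=.
rewrite exchange_big /=; apply: eq_bigr => m _; rewrite !mxE bfE mulr_sumr.
apply: eq_bigr => j _; rewrite mulr_sumr; apply: eq_bigr => k _; rewrite !mxE; ring.
Qed.

Lemma Riem_coord a l z u v : ocod a z -> Riem a z u v 0 l =
  \sum_i \sum_j \sum_k u 0 i * v 0 j * v 0 k * riemann a i j k l z.
Proof.
move=> oz.
have DE2 := DE l v u v oz; rewrite exchange_big /= in DE2.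
have CE2 := CE a l z v u v; rewrite exchange_big /= in CE2.
have -> : Riem a z u v 0 l = bf ('D_u (Chr a l) z) v v - bf ('D_v (Chr a l) z) u v
    + bf (Chr a l z) u (Gam a z v v) - bf (Chr a l z) v (Gam a z u v).
  by rewrite /Riem /DGam [in LHS]/Gam !mxE.
apply: (etrans (congr2 _ (congr2 _ (congr2 _ (DE l u v v oz) (congr1 _ DE2))
   (CE a l z u v v)) (congr1 _ CE2))).
rewrite -sumrB -big_split -sumrB /=; apply: eq_bigr => i _.
rewrite -sumrB -big_split -sumrB /=; apply: eq_bigr => j _.
rewrite -sumrB -big_split -sumrB /=; apply: eq_bigr => k _.
have -> : riemann a i j k l z = partial a i (christoffel a l j k) z -
   partial a j (christoffel a l i k) z +
   (\sum_m christoffel a l i m z * christoffel a m j k z -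
    \sum_m christoffel a l j m z * christoffel a m i k z).
  by rewrite /riemann -sumrB.
rewrite -!mulr_sumr.
set p := partial _ _ _ _; set q := partial _ _ _ _.
set r := \sum_m _; set s := \sum_m _.
by move: p q r s => p q r s; ring.
Qed.

Lemma curvatureE (x : M) u v :
  ocod (index_at x) (Defs.coord (chart_of (index_at x)) x) ->
  curvature x u v v = Riem (index_at x) (Defs.coord (chart_of (index_at x)) x) u v.
Proof.
move=> oz; apply/rowP => l; rewrite mxE.
exact: esym (Riem_coord l u v oz).
Qed.

End ChartGeometry.

Arguments ocod_open {R n M} a.
Arguments metric_Ck {R n M} k a.
Arguments gram_Ck {R n M} k a i j.
Arguments christoffel_Ck {R n M} k a l i j.
Arguments Chr_Ck {R n M} k a l.

(** * Changes of charts *)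

Section Transitions.
Context {R : realType} {n : nat} (M : riemannianManifold R n).
Implicit Types (a b : atlas M) (z u v w : 'rV[R]_n) (x : M).

Local Notation crd a := (Defs.coord (chart_of a)).
Local Notation prm a := (param (chart_of a)).
Local Notation dm a := (dom (chart_of a)).

Lemma within_continuous_at (X Y : topologicalType) (A : set X) (f : X -> Y) (x : X) :
  {within A, continuous f} -> A° x -> {for x, continuous f}.
Proof.
move=> /subspace_continuousP cf Ax P /(cf x (interior_subset Ax)).
rewrite /nbhs /= /within /= => H.
by apply: filterS2 H Ax => y; apply.
Qed.

Lemma param_continuous a z : ocod a z -> {for z, continuous (prm a)}.
Proof. exact/within_continuous_at/chart_param_continuous. Qed.

(** If the coordinate of index 0 vanished at an interior point of [cod], a small step along
    [- delta_mx 0 i] would leave the half-space without leaving [cod]. *)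
Lemma ocodP a z : ocod a z <->
  cod (chart_of a) z /\ forall i : 'I_n, i = 0%N :> nat -> 0 < z 0 i.
Proof.
have [Q oQ codE] := @chart_open_cod _ _ _ (chart_of a).
split=> [oz|[codz zp]].
  split=> [|i i0]; first exact: ocod_cod.
  have codz := ocod_cod oz.
  have z0 : 0 <= z 0 i by move: codz; rewrite codE => -[_]; exact.
  rewrite lt_neqAle z0 andbT eq_sym; apply/eqP => zi.
  have [r r0 rP] := open_normP (ocod_open a) oz.
  have : cod (chart_of a) (z - (r / 2) *: delta_mx 0 i).
    apply/ocod_cod/rP; rewrite addrC addKr normrN normrZ ger0_norm ?divr_ge0 ?ltW//.
    apply: (@le_lt_trans _ _ (r / 2)); last by rewrite ltr_pdivrMr// ltr_pMr ?ltr1n.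
    apply: ler_piMr; first by rewrite divr_ge0// ltW.
    apply: mxnorm_le => // k l.
    by rewrite mxE normr_nat lern1 leq_b1.
  rewrite codE => -[_ /(_ i i0)]; rewrite !mxE !eqxx zi sub0r mulr1 oppr_ge0.
  by rewrite leNgt divr_gt0.
have Qz : Q z by move: codz; rewrite codE => -[].
have [r r0 rP] := open_normP oQ Qz.
have [s s0 sP] : exists2 s : R, 0 < s & forall y, `|y - z| < s ->
    forall i : 'I_n, i = 0%N :> nat -> 0 < y 0 i.
  apply: fin_radius => i; have [i0|ni0] := eqVneq (i : nat) 0%N; last first.
    by exists 1 => // y _ /eqP; rewrite (negbTE ni0).
  exists (z 0 i); first exact: zp.
  move=> y yz _; have := le_lt_trans (mxnorm_coord (y - z) 0 i) yz.
  by rewrite !mxE ltr_norml => /andP[+ _]; rewrite ltrBrDr addNr.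
apply/nbhs_ballP; exists (Num.min r s); first by rewrite /= lt_min r0.
move=> y; rewrite -ball_normE /= distrC lt_min => /andP[yr ys].
rewrite codE; split; first exact: rP.
by move=> i i0; rewrite ltW// sP.
Qed.

Lemma interior_ocod a x : ~ boundary x -> dm a x -> ocod a (crd a x).
Proof.
move=> nb dx; have codz := chart_coord_cod dx.
apply/ocodP; split=> // i i0.
have [Q _ codE] := @chart_open_cod _ _ _ (chart_of a).
have z0 : 0 <= crd a x 0 i by move: codz; rewrite codE => -[_]; exact.
rewrite lt_neqAle z0 andbT eq_sym; apply/eqP => zi; apply: nb.
by exists a => //; exists i.
Qed.

Definition ovl a b : set 'rV[R]_n := ocod a `&` prm a @^-1` dm b.

Local Notation T a b := (transition (chart_of a) (chart_of b)).

Lemma ovl_open a b : open (ovl a b).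
Proof.
rewrite openE => z [oz bz]; rewrite /interior.
have H : nbhs (prm a z) (dm b).
  by apply: open_nbhs_nbhs; split=> //; exact: chart_open_dom.
apply: filterS2 (open_nbhs_nbhs (conj (ocod_open a) oz)) (param_continuous oz H).
by move=> y.
Qed.
Arguments ovl_open : clear implicits.

Lemma ovl_overlap a b : ovl a b `<=` (overlap (chart_of a) (chart_of b))°.
Proof.
move=> z oz; apply: filterS (open_nbhs_nbhs (conj (ovl_open a b) oz)).
by move=> y [/ocod_cod].
Qed.

Lemma transition_Ck k a b : Ck k (ovl a b) (T a b).
Proof.
apply: Ck_sub (@ovl_overlap a b) _.
exact: (smooth_on_interior k (@transition_smooth _ _ M a b)).
Qed.
Arguments transition_Ck : clear implicits.

Lemma transition_jacobianE a b z : ovl a b z ->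
  transition_jacobian (chart_of a) (chart_of b) z = jac (T a b) z.
Proof.
move=> oz; apply/matrixP => i j; rewrite !mxE dwithin_interior; last exact: ovl_overlap.
by rewrite derive_mx ?mxE//; exact: Ck_derivable (transition_Ck 1 a b) oz.
Qed.

Lemma ovl_coord a b x : dm a x -> dm b x -> ocod a (crd a x) -> ovl a b (crd a x).
Proof. by move=> ax bx oz; split=> //; rewrite /preimage /= chart_coordK. Qed.

Lemma transition_coord a b x : dm a x -> T a b (crd a x) = crd b x.
Proof. by move=> ax; rewrite /transition chart_coordK. Qed.

Lemma metric_transition a b z : ovl a b z ->
  metric a z = jac (T a b) z *m metric b (T a b z) *m (jac (T a b) z)^T.
Proof.
move=> oz; have [oa bz] := oz; have codz := ocod_cod oa.
have ax := chart_param_dom codz.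
have := metric_compat ax bz.
by rewrite /= (chart_paramK codz) (transition_jacobianE oz).
Qed.

Lemma gG_transition a b z u w : ovl a b z ->
  gG a z u w = gG b (T a b z) (u *m jac (T a b) z) (w *m jac (T a b) z).
Proof.
by move=> oz; rewrite /gG /bf (metric_transition oz) trmx_mul !mulmxA.
Qed.

(** Invertibility comes from the metrics: the determinant of [metric a z] is a unit and has that of
    the Jacobian as a factor, so the inverse transition need not be considered. *)
Lemma jac_unit a b z : ovl a b z -> jac (T a b) z \in unitmx.
Proof.
move=> oz; have codz := ocod_cod oz.1.
have := metric_unit codz; rewrite (metric_transition oz) !unitmxE !det_mulmx.
by rewrite !unitrM => /andP[/andP[]].
Qed.

Lemma derive_at_min (f : 'rV[R]_n -> R) (U : set 'rV[R]_n) z u :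
  open U -> U z -> (forall y, U y -> derivable f y u) ->
  (forall y, U y -> f z <= f y) -> 'D_u f z = 0.
Proof.
move=> oU Uz df fmin.
have [r r0 rP] := open_normP oU Uz.
have n0 : 0 < 1 + `|u| by rewrite ltr_wpDr.
pose s := r / (1 + `|u|).
have s0 : 0 < s by rewrite divr_gt0.
have HU (t : R) : t \in `](- s), s[ -> U (t *: u + z).
  rewrite in_itv /= -ltr_norml => ts; apply: rP; rewrite addrK normrZ.
  apply: (@le_lt_trans _ _ (`|t| * (1 + `|u|))); first by rewrite ler_wpM2l// lerDr.
  by rewrite -ltr_pdivlMr.
have dg (t : R) : t \in `](- s), s[ -> is_derive t 1 (fun t => f (t *: u + z)) ('D_u f (t *: u + z)).
  by move=> /HU Ut; apply/is_derive_line/derivableP/df.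
have ab : - s < s by rewrite gtrN.
have cab : 0 \in `](- s), s[ by rewrite in_itv /= oppr_lt0 s0.
have := @derive1_at_min R (fun t => f (t *: u + z)) (- s) s 0 (ltW ab).
move=> /(_ _ cab) [].
- by move=> t /dg[].
- by move=> t /HU Ut; rewrite scale0r add0r; exact: fmin.
- move=> _ <-; have [_ ->] := dg 0 cab; by rewrite scale0r add0r.
Qed.

(** Invariance of the boundary: if the image had vanishing coordinate of index 0, this coordinate,
    nonnegative nearby, would be minimal there. Its derivative would vanish, and with it a column of
    an invertible Jacobian. *)
Lemma transition_ocod a b z : ovl a b z -> ocod b (T a b z).
Proof.
move=> oz; have [oa bz] := oz.
have cb y : ovl a b y -> cod (chart_of b) (T a b y).
  by move=> [_ by_]; exact: chart_coord_cod.
have [Q _ codE] := @chart_open_cod _ _ _ (chart_of b).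
apply/ocodP; split=> [|i i0]; first exact: cb.
have pos y : ovl a b y -> 0 <= T a b y 0 i.
  by move=> /cb; rewrite codE => -[_]; exact.
rewrite lt_neqAle pos// andbT eq_sym; apply/eqP => Ti.
have cT : Ck 1 (ovl a b) (fun y => T a b y 0 i).
  by have /(Ck_mx 1 _ (ovl_open a b)) := transition_Ck 1 a b; exact.
have D u : 'D_u (fun y => T a b y 0 i) z = 0.
  apply: (derive_at_min (ovl_open a b) oz).
    by move=> y oy; exact: Ck_derivable cT oy.
  by move=> y oy; rewrite Ti; exact: pos.
have J0 : jac (T a b) z *m delta_mx i (0 : 'I_1) = 0.
  apply/matrixP => k l; rewrite !mxE (bigD1 i)//= !mxE !eqxx ord1 mulr1 D.
  rewrite add0r big1// => j ji; rewrite !mxE (negbTE ji) mulr0//.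
have := mulKmx (jac_unit oz) (delta_mx i (0 : 'I_1)).
rewrite J0 mulmx0 => /matrixP /(_ i 0); rewrite !mxE !eqxx => /eqP.
by rewrite eq_sym oner_eq0.
Qed.

(** [boundary] asks for a single chart; by [transition_ocod] all charts around x agree. *)
Lemma ocod_interior a x : dm a x -> ocod a (crd a x) -> ~ boundary x.
Proof.
move=> ax oa [b bx [i i0 xi]].
have := transition_ocod (ovl_coord ax bx oa); rewrite transition_coord//.
by move=> /ocodP[_ /(_ i i0)]; rewrite xi ltxx.
Qed.

Definition D2T a b z u w : 'rV[R]_n :=
  \row_j 'D_u ('D_w (fun y => T a b y 0 j)) z.

Let Tj_Ck k a b j : Ck k (ovl a b) (fun y => T a b y 0 j).
Proof. by have /(Ck_mx k _ (ovl_open a b)) := transition_Ck k a b; exact. Qed.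

Lemma D2TC a b z u w : ovl a b z -> D2T a b z u w = D2T a b z w u.
Proof.
move=> oz; apply/rowP => j.
apply: etrans (mxE _ _ _ _) (etrans _ (esym (mxE _ _ _ _))).
exact: schwarz (ovl_open a b) (Tj_Ck 2 a b j) oz.
Qed.

Lemma mul_jacE a b z w j : ovl a b z ->
  (w *m jac (T a b) z) 0 j = 'D_w (fun y => T a b y 0 j) z.
Proof.
move=> oz; rewrite (jac_mul _ (ovl_open a b) (transition_Ck 1 a b) oz).
by rewrite derive_mx ?mxE//; exact: Ck_derivable (transition_Ck 1 a b) oz.
Qed.

Lemma is_derive_transition a b z u : ovl a b z ->
  is_derive z u (T a b) (u *m jac (T a b) z).
Proof.
move=> oz; rewrite (jac_mul _ (ovl_open a b) (transition_Ck 1 a b) oz).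
by apply: derivableP; exact: Ck_derivable (transition_Ck 1 a b) oz.
Qed.

Lemma is_derive_mul_jac a b z u w : ovl a b z ->
  is_derive z u (fun y => w *m jac (T a b) y) (D2T a b z u w).
Proof.
move=> oz; apply/is_derive_mx => i j; rewrite ord1 mxE.
have H : is_derive z u ('D_w (fun y => T a b y 0 j)) ('D_u ('D_w (fun y => T a b y 0 j)) z).
  by apply: derivableP; apply: Ck_derivable (Ck_derive w (Tj_Ck 2 a b j)) oz.
apply: near_eq_is_derive H.
apply: filterS (open_nbhs_nbhs (conj (ovl_open a b) oz)) => y oy.
by rewrite mul_jacE.
Qed.

(** Uniqueness of the Levi-Civita connection: [X u w], computed in the chart b, is symmetric and
    satisfies Leibniz' rule for the metric of a, so it obeys the Koszul formula that determines
    [Gam a]. *)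
Lemma Gam_transition a b z u w : ovl a b z ->
  Gam a z u w *m jac (T a b) z =
  D2T a b z u w + Gam b (T a b z) (u *m jac (T a b) z) (w *m jac (T a b) z).
Proof.
move=> oz; have oa := oz.1; have ob := transition_ocod oz.
have cb := ocod_cod ob.
set J := jac (T a b) z.
pose X u w := D2T a b z u w + Gam b (T a b z) (u *m J) (w *m J).
have XC p q : X p q = X q p by rewrite /X D2TC// GamC.
have DG p q v : 'D_p (fun y => gG a y q v) z =
    gG b (T a b z) (X p q) (v *m J) + gG b (T a b z) (q *m J) (X p v).
  have H : is_derive z p (fun y => gG b (T a b y) (q *m jac (T a b) y) (v *m jac (T a b) y))
     (gG b (T a b z) (X p q) (v *m J) + gG b (T a b z) (q *m J) (X p v)).
    apply: (is_derive_gG (dz := p *m J)) => //; first exact: is_derive_transition.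
      exact: is_derive_mul_jac.
    exact: is_derive_mul_jac.
  have [_ <-] := H; apply: near_eq_derive.
  apply: filterS (open_nbhs_nbhs (conj (ovl_open a b) oz)) => y oy.
  exact: gG_transition.
apply: (gG_inj cb) => v.
rewrite -(mulmxKV (jac_unit oz) v) -/J; set v' := v *m invmx J.
have := Gam_lowered u w v' oa; rewrite !DG (gG_transition _ _ oz) -/J.
rewrite (XC w u) (XC v' u) (XC v' w) [gG b _ (w *m J) _]gGC//.
move: (gG b (T a b z) (X u w) (v' *m J)) (gG b (T a b z) (Gam a z u w *m J) (v' *m J)).
move: (gG b (T a b z) (X u v') (w *m J)) (gG b (T a b z) (u *m J) (X w v')).
by move=> p q r s; lra.
Qed.

End Transitions.

Arguments ovl_open {R n M} a b.
Arguments transition_Ck {R n M} k a b.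

(** * Geodesics *)

Section Curves.
Context {R : realType}.

(** The accumulation hypothesis makes the filter in [dwithin] proper, hence its limit unique; f is
    compared with its extension F on A only. *)
Lemma dwithin_curve (W : normedModType R) (A : set R) (f F : R -> W) (s d : R) :
  0 < d -> A s -> (forall e, 0 < e -> exists2 h, 0 < `|h| < e & A (h + s)) ->
  (forall t, A t -> `|t - s| < d -> f t = F t) -> derivable F s 1 ->
  dwithin A f s 1 = 'D_1 F s.
Proof.
move=> d0 As Aacc fF dF; rewrite /dwithin.
have PF : ProperFilter (within [set h : R | A (h *: (1 : R) + s)] 0^').
  split; last exact: (@within_filter R [set h : R | A (h *: (1 : R) + s)] 0^' _).
  rewrite /within /= => /nbhs_ballP[e /= e0 eP].
  have [h /andP[h0 he] Ah] := Aacc e e0.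
  apply: (eP h); rewrite ?/ball /= ?sub0r ?normrN//; first by rewrite -normr_gt0.
  by rewrite [h *: _]mulr1.
apply: cvg_lim => //.
have cF : h^-1 *: (F (h *: (1 : R) + s) - F s) @[h --> 0^'] --> 'D_1 F s by exact: dF.
apply: (@cvg_trans _ (h^-1 *: (F (h *: (1 : R) + s) - F s)
     @[h --> within [set h : R | A (h *: (1 : R) + s)] 0^'])); last first.
  by apply: cvg_trans cF; apply: cvg_fmap2; exact: cvg_within.
apply: near_eq_cvg.
suff : \forall h \near (0 : R)^', A (h *: (1 : R) + s) ->
    h^-1 *: (F (h *: (1 : R) + s) - F s) = h^-1 *: (f (h *: (1 : R) + s) - f s) by [].
near=> h => Ah.
have hd : `|h| < d by near: h; exact: dnbhs0_lt.
rewrite !fF//; first by rewrite subrr normr0.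
by rewrite [h *: _]mulr1 addrK.
Unshelve. all: by end_near. Qed.

Lemma derive_real (W : normedModType R) (f : R -> W) (s v : R) df :
  is_derive s 1 f df -> is_derive s v f (v *: df).
Proof. by move=> /(is_derive_scale v); rewrite [v *: (1 : R)]mulr1. Qed.

Lemma Ck_curve (W : normedModType R) (f df : R -> W) (U : set R) k : open U ->
  (forall s, U s -> is_derive s 1 f (df s)) -> Ck k U df -> Ck k.+1 U f.
Proof.
move=> oU Hf cdf; split=> [s Us|v].
  apply: differentiable_continuous; apply/derivable1_diffP.
  by have [] := Hf s Us.
split=> [s /Hf H|]; first by have [] := derive_real v H.
apply: Ck_eq (CkZ v oU cdf) => // s Us.
by have [_ ->] := derive_real v (Hf s Us).
Qed.

(** Connectedness of [a, b] as a continuation principle: around each t, P passes from any s to any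
    later s' of a neighbourhood, whatever their position relative to t. The supremum of the times
    reached is therefore reached itself and cannot be less than b. *)
Lemma real_induction (P : R -> Prop) (a b : R) : a <= b -> P a ->
  (forall t, a <= t <= b -> exists2 d : R, 0 < d & forall s s',
    t - d < s -> s <= s' -> s' < t + d -> a <= s -> s' <= b -> P s -> P s') ->
  P b.
Proof.
move=> ab Pa H.
pose S := [set t | a <= t <= b /\ P t].
have S0 : has_sup S.
  split; first by exists a; split=> //; rewrite lexx.
  by exists b => t [/andP[]].
have Sa : a <= sup S by apply: sup_upper_bound => //; split=> //; rewrite lexx.
have Sb : sup S <= b by apply: ge_sup; [have [] := S0|move=> t [/andP[]]].
have [|d d0 dP] := H (sup S); first by rewrite Sa.
have [s [/andP[as_ sb] Ps] sd] := sup_adherent d0 S0.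
have sS : s <= sup S by apply: sup_upper_bound => //; split=> //; rewrite as_.
pose s' := Num.min b (sup S + d / 2).
have d20 : 0 < d / 2 by rewrite divr_gt0.
have ss' : s <= s' by rewrite le_min sb (le_trans sS)// lerDl ltW.
have s'b : s' <= b by rewrite ge_min lexx.
have s'd : s' < sup S + d.
  have dd : d / 2 < d by rewrite ltr_pdivrMr// ltr_pMr ?ltr1n.
  by rewrite gt_min ltrD2l dd orbT.
have Ps' : P s' := dP s s' sd ss' s'd as_ s'b Ps.
have : s' <= sup S by apply: sup_upper_bound => //; split=> //; rewrite (le_trans as_).
rewrite /s' minEle; case: ifP => bd.
  by move=> bS; move: Ps'; rewrite /s' minEle bd.
by rewrite gerDl leNgt d20.
Qed.

End Curves.

Section Geodesics.
Context {R : realType} {n : nat} (M : riemannianManifold R n).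
Implicit Types (a b : atlas M) (z u v w : 'rV[R]_n) (x p q : M) (c : R -> M).

Local Notation crd a := (Defs.coord (chart_of a)).
Local Notation prm a := (param (chart_of a)).
Local Notation dm a := (dom (chart_of a)).
Local Notation T a b := (transition (chart_of a) (chart_of b)).

Definition lc a c (t : R) : 'rV[R]_n := crd a (c t).
Definition lv a c (t : R) : 'rV[R]_n := 'D_1 (lc a c) t.

(* The geodesic equation at time t with two-sided derivatives, hence at interior
   points only, whereas geodesic_arc takes derivatives within [0, 1]. *)
Definition geoin a c (t : R) : Prop :=
  [/\ ocod a (lc a c t), \forall s \near t, dm a (c s), derivable (lc a c) t 1
    & is_derive t 1 (lv a c) (- Gam a (lc a c t) (lv a c t) (lv a c t))].

Definition geoat c (t : R) : Prop := forall a, dm a (c t) -> geoin a c t.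

Lemma geoin_dom a c (t : R) : geoin a c t -> dm a (c t).
Proof. by move=> [_ /nbhs_singleton]. Qed.

Lemma jac_Ck k a b : Ck k (ovl a b) (jac (T a b)).
Proof.
apply/(Ck_mx k _ (ovl_open a b)) => i j.
have /(Ck_mx k.+1 _ (ovl_open a b)) /(_ 0 j) H := transition_Ck k.+1 a b.
apply: (Ck_eq (ovl_open a b)) (Ck_derive (delta_mx 0 i) H) => y _.
exact: esym (mxE _ _ _ _).
Qed.

Lemma is_derive_mul_jac_curve a b (z w : R -> 'rV[R]_n) (t : R) dz dw :
  ovl a b (z t) -> is_derive t 1 z dz -> is_derive t 1 w dw ->
  is_derive t 1 (fun s => w s *m jac (T a b) (z s))
    (dw *m jac (T a b) (z t) + D2T a b (z t) dz (w t)).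
Proof.
move=> oz Hz Hw.
have H := is_derive_mulmx Hw (is_derive_mxcomp (ovl_open a b) (@jac_Ck 1 a b) oz Hz).
apply: (is_derive_cast H); congr (_ + _).
have HJ : is_derive (z t) dz (jac (T a b)) ('D_dz (jac (T a b)) (z t)).
  by apply: derivableP; apply: Ck_derivable (@jac_Ck 1 a b) oz.
have [_ <-] := is_derive_mul_jac dz (w t) oz.
have [_ ->] := is_derive_mulmx (is_derive_cst (w t) (z t) dz) HJ.
by rewrite mul0mx add0r.
Qed.

Lemma lc_transition a b c (t : R) : (\forall s \near t, dm a (c s)) ->
  \forall s \near t, lc b c s = T a b (lc a c s).
Proof. by apply: filterS => s ds; rewrite /lc transition_coord. Qed.

Lemma dom_near a b c (t : R) : (\forall s \near t, dm a (c s)) -> ocod a (lc a c t) ->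
  dm b (c t) -> derivable (lc a c) t 1 ->
  \forall s \near t, dm a (c s) /\ ovl a b (lc a c s).
Proof.
move=> nd oz bt du.
have ct : {for t, continuous (lc a c)}.
  by apply: differentiable_continuous; apply/derivable1_diffP.
have ot : ovl a b (lc a c t) by apply: ovl_coord => //; exact: nbhs_singleton nd.
have := ct _ (open_nbhs_nbhs (conj (ovl_open a b) ot)).
by apply: filterS2 nd => s.
Qed.

Lemma lv_transition a b c (t : R) : (\forall s \near t, dm a (c s)) -> ocod a (lc a c t) ->
  dm b (c t) -> derivable (lc a c) t 1 ->
  is_derive t 1 (lc b c) (lv a c t *m jac (T a b) (lc a c t)).
Proof.
move=> nd oz bt du.
have ot : ovl a b (lc a c t) by apply: ovl_coord => //; exact: nbhs_singleton nd.
have H : is_derive t 1 (fun s => T a b (lc a c s)) (lv a c t *m jac (T a b) (lc a c t)).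
  have D := is_derive_mxcomp (ovl_open a b) (transition_Ck 1 a b) ot (derivableP du).
  apply: (is_derive_cast D).
  by have [_ ->] := is_derive_transition (lv a c t) ot.
apply: near_eq_is_derive H; have := lc_transition b nd; apply: filterS => s -> //.
Qed.

(** The second derivative of the transition that arises is exactly the term [D2T] of
    [Gam_transition]. The equation is assumed near t because it differentiates the velocity, which
    must be known in the chart b at nearby times. *)
Lemma geoin_change a b c (t : R) : (\forall s \near t, geoin a c s) -> dm b (c t) ->
  geoin b c t.
Proof.
move=> ng bt; have [oz nd du d2u] := nbhs_singleton ng.
have at_ := nbhs_singleton nd.
have ot : ovl a b (lc a c t) by apply: ovl_coord.
have nn := dom_near nd oz bt du.
have nb : \forall s \near t, dm b (c s).
  apply: filterS nn => s [ds [_ bs]].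
  by move: bs; rewrite /preimage /= /lc chart_coordK.
have E : \forall s \near t, lv a c s *m jac (T a b) (lc a c s) = lv b c s.
  apply: filterS2 ng nb => s [os ns dus _] bs.
  by have [_ <-] := lv_transition ns os bs dus.
have [db vb] := lv_transition nd oz bt du.
have cb : lc b c t = T a b (lc a c t) by rewrite /lc transition_coord.
split; [by rewrite cb; exact: transition_ocod|exact: nb|exact: db|].
have H := is_derive_mul_jac_curve ot (derivableP du) d2u.
have H2 : is_derive t 1 (lv b c) _ := near_eq_is_derive E H.
apply: (is_derive_cast H2).
have vb' : lv b c t = lv a c t *m jac (T a b) (lc a c t) := vb.
rewrite vb' cb mulNmx Gam_transition//.
by rewrite opprD addrAC addNr add0r.
Qed.

Lemma geoin_geoat a c (t : R) : (\forall s \near t, geoin a c s) -> geoat c t.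
Proof. by move=> ng b; exact: geoin_change ng. Qed.

Lemma geoat_near a c (t : R) : (\forall s \near t, geoat c s) -> dm a (c t) ->
  \forall s \near t, geoin a c s.
Proof.
move=> ng at_; have [_ nd _ _] := nbhs_singleton ng a at_.
by apply: filterS2 ng nd => s; apply.
Qed.

Lemma near_lc a c c' (t : R) : (\forall s \near t, c s = c' s) ->
  \forall s \near t, lc a c s = lc a c' s.
Proof. by apply: filterS => s E; rewrite /lc E. Qed.

Lemma near_lv a c c' (t : R) : (\forall s \near t, c s = c' s) -> lv a c t = lv a c' t.
Proof. by move=> E; apply: near_eq_derive; exact: near_lc. Qed.

Lemma geoin_eq a c c' (t : R) : (\forall s \near t, c s = c' s) -> geoin a c t -> geoin a c' t.
Proof.
move=> E [oz nd du d2u].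
have Et := nbhs_singleton E.
have El := near_lc a E.
have Ev : \forall s \near t, lv a c s = lv a c' s.
  by apply: filterS (nbhs_interior E) => s Es; exact: near_lv.
split.
- by rewrite /lc -Et.
- by apply: filterS2 E nd => s ->.
- exact: near_eq_derivable El du.
- rewrite -(nbhs_singleton El) -(nbhs_singleton Ev).
  exact: near_eq_is_derive Ev d2u.
Qed.

Lemma geoat_eq c c' (t : R) : (\forall s \near t, c s = c' s) -> geoat c t -> geoat c' t.
Proof.
by move=> E g a; rewrite -(nbhs_singleton E) => /g; exact: geoin_eq.
Qed.

Lemma geoin_cont a c (t : R) : geoin a c t -> {for t, continuous c}.
Proof.
move=> [oz nd du _].
have ct : {for t, continuous (lc a c)}.
  by apply: differentiable_continuous; apply/derivable1_diffP.
have H : {for t, continuous (fun s => prm a (lc a c s))}.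
  by apply: continuous_comp ct _; exact: param_continuous.
rewrite /prop_for /continuous_at /= in H.
have E : \forall s \near t, prm a (lc a c s) = c s.
  by apply: filterS nd => s ds; rewrite /lc chart_coordK.
rewrite /prop_for /continuous_at -(nbhs_singleton E).
by apply: cvg_trans H; exact: near_eq_cvg.
Qed.

Lemma Ck_Gam_curve k a (u w : R -> 'rV[R]_n) (U : set R) : open U ->
  (forall s, U s -> ocod a (u s)) -> Ck k U u -> Ck k U w ->
  Ck k U (fun s => - Gam a (u s) (w s) (w s)).
Proof.
move=> oU Uo cu cw; apply/(Ck_mx k _ oU) => i l.
have cwj j : Ck k U (fun s => w s 0 j) by have /(Ck_mx k _ oU) := cw; exact.
have H : Ck k U (fun s => (-1) *: (\sum_i \sum_j
    christoffel a l i j (u s) * w s 0 i * w s 0 j) : R).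
  apply: CkZ => //; apply: Ck_sum => // p; apply: Ck_sum => // q.
  apply: CkM => //; apply: CkM => //.
  exact: Ck_comp oU (ocod_open a) Uo cu (christoffel_Ck k a l p q).
apply: Ck_eq H => // s _; rewrite ord1 !mxE bfE scaleN1r; congr (- _).
by apply: eq_bigr => p _; apply: eq_bigr => q _; rewrite mxE.
Qed.

(** Bootstrap on position and velocity together: by the geodesic equation, if both are C^k then so
    are their derivatives. *)
Lemma geoin_smooth a c (U : set R) k : open U -> (forall s, U s -> geoin a c s) ->
  Ck k U (lc a c).
Proof.
move=> oU g.
suff H : Ck k U (lc a c) /\ Ck k U (lv a c) by case: H.
elim: k => [|k [IH1 IH2]].
  have cd (f : R -> 'rV[R]_n) s : derivable f s 1 -> {for s, continuous f}.
    by move=> df; apply: differentiable_continuous; apply/derivable1_diffP.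
  split; (split; last exact: I) => s Us; have [_ _ du d2u] := g s Us.
    exact: cd.
  by apply: cd; have [] := d2u.
split.
  apply: (@Ck_curve _ _ _ (lv a c) _ _ oU _ IH2) => s /g[_ _ du _].
  exact: derivableP.
apply: (@Ck_curve _ _ _ (fun s => - Gam a (lc a c s) (lv a c s) (lv a c s)) _ _ oU).
  by move=> s /g[_ _ _]; exact.
by apply: (Ck_Gam_curve oU _ IH1 IH2) => s /g[].
Qed.

Lemma times_acc a c (t : R) : {within `[0, 1]%classic, continuous c} -> times a c t ->
  exists2 d : R, 0 < d & forall s, 0 <= s <= 1 -> `|s - t| < d -> times a c s.
Proof.
move=> cc [t01 at_].
have /subspace_continuousP cc' := cc.
have oD : nbhs (c t) (dm a).
  by apply: open_nbhs_nbhs; split=> //; exact: chart_open_dom.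
have := cc' t t01 _ oD; rewrite /nbhs /= /within /= => /nbhs_ballP[d d0 dP].
exists d => // s s01 sd; split; first by rewrite /= in_itv.
by apply: (dP s); rewrite ?/ball /= ?in_itv //= distrC.
Qed.

Lemma unit_acc (t e : R) : 0 <= t <= 1 -> 0 < e ->
  exists2 h, 0 < `|h| < e & 0 <= h + t <= 1.
Proof.
move=> /andP[t0 t1] e0.
pose m := Num.min (e / 2) (1 / 2).
have m0 : 0 < m by rewrite lt_min !divr_gt0.
have me : m < e by rewrite gt_min ltr_pdivrMr// ltr_pMr ?ltr1n.
have m1 : m <= 1 / 2 by rewrite ge_min lexx orbT.
have [th|th] := leP t (1 / 2).
  by exists m; [rewrite gtr0_norm// m0|apply/andP; split; lra].
exists (- m); first by rewrite normrN gtr0_norm// m0.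
by apply/andP; split; lra.
Qed.

Lemma times_dwithin (W : normedModType R) a c (f F : R -> W) (t d : R) :
  {within `[0, 1]%classic, continuous c} -> times a c t -> 0 < d ->
  (forall s, times a c s -> `|s - t| < d -> f s = F s) -> derivable F t 1 ->
  dwithin (times a c) f t 1 = 'D_1 F t.
Proof.
move=> cc tt d0 fF dF; apply: (dwithin_curve d0) => // e e0.
have [r r0 rP] := times_acc cc tt.
have t01 : 0 <= t <= 1 by move: tt => [/=]; rewrite in_itv.
have m0 : 0 < Num.min e r by rewrite lt_min e0.
have [h /andP[h0]] := unit_acc t01 m0; rewrite lt_min => /andP[he hr] ht.
by exists h; [rewrite h0|apply: rP; rewrite ?addrK].
Qed.

Lemma christoffel_sum a z v l : \sum_i \sum_j christoffel a l i j z * v 0 i * v 0 j =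
  Gam a z v v 0 l.
Proof.
rewrite [RHS]mxE bfE; apply: eq_bigr => i _; apply: eq_bigr => j _.
by rewrite mxE.
Qed.

(** Derivatives within [0, 1] agree with the two-sided ones, which exist at the ends because the
    curve is geodesic slightly beyond them. *)
Lemma geodesic_arc_of c (d : R) : 0 < d ->
  (forall t, - d < t < 1 + d -> geoat c t) -> geodesic_arc (c 0) (c 1) c /\
  forall a t, times a c t -> local_velocity a c t = lv a c t.
Proof.
move=> d0 g.
have g01 (t : R) : 0 <= t <= 1 -> - d < t < 1 + d.
  by move=> /andP[t0 t1]; apply/andP; split; lra.
have oI (t : R) : - d < t < 1 + d -> \forall s \near t, - d < s < 1 + d.
  by move=> tI; have := near_in_itvoo tI; apply: filterS => s; rewrite in_itv.
have cc : {within `[0, 1]%classic, continuous c}.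
  apply/subspace_continuousP => t; rewrite /= in_itv /= => t01.
  apply: cvg_within_filter.
  have := geoin_cont (g t (g01 t t01) (index_at (c t)) (index_atP (c t))).
  exact.
have gn a (t : R) : times a c t -> \forall s \near t, geoin a c s.
  move=> [/=]; rewrite in_itv /= => t01 at_; apply: geoat_near => //.
  by apply: filterS (oI t (g01 t t01)) => s; exact: g.
have lvE a t : times a c t -> local_velocity a c t = lv a c t.
  move=> tt; apply: (times_dwithin (d := 1)) => //.
  by have [] := nbhs_singleton (gn a t tt).
split=> //; split=> //.
- split=> // a t tt.
  have [r /= r0 rP] := (nbhs_ballP _ _).1 (gn a t tt).
  exists (ball t r), (lc a c); split=> //; first exact: ball_open.
    exact: ballxx.
  move=> k; apply: geoin_smooth => //; exact: ball_open.
- move=> a t tt l; rewrite christoffel_sum lvE//.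
  have [_ _ _ [D1 D2]] := nbhs_singleton (gn a t tt).
  have -> : local_acceleration a c t = 'D_1 (lv a c) t.
    by apply: (times_dwithin (d := 1)) => // s ss _; exact: lvE.
  by rewrite D2 [X in X + _]mxE addNr.
Qed.

(** The local extension F provided by [smooth_on] has two-sided derivatives even at the ends of
    [0, 1] and at boundary points. It satisfies the geodesic equation at times of [0, 1] only. *)
Lemma arc_local p q c a t : geodesic_arc p q c -> times a c t ->
  exists (d : R) (F : R -> 'rV[R]_n), [/\ 0 < d, forall k, Ck k (ball t d) F &
   forall s, 0 <= s <= 1 -> `|s - t| < d -> [/\ times a c s, lc a c s = F s,
    local_velocity a c s = 'D_1 F s &
    'D_1 ('D_1 F) s = - Gam a (F s) ('D_1 F s) ('D_1 F s)]].
Proof.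
move=> [[cc sc] _ _ ode] tt.
have [U [F [oU Ut cF FE]]] := sc a t tt.
have [d d0 dP] := times_acc cc tt.
have [r r0 rP] := open_normP oU Ut.
pose e := Num.min d r.
have e0 : 0 < e by rewrite lt_min d0.
have bU : ball t e `<=` U.
  by move=> s; rewrite /ball /= distrC lt_min => /andP[_ /rP].
have ct k : Ck k (ball t e) F by apply: Ck_sub (cF k).
have bb (s : R) : `|s - t| < e -> ball t e s by rewrite /ball /= distrC.
have FE' s : times a c s -> `|s - t| < e -> local_curve a c s = F s.
  by move=> ts se; rewrite FE//; apply/bU/bb.
have T01 s : times a c s -> 0 <= s <= 1 by move=> [/=]; rewrite in_itv.
have tri (s s' : R) : `|s - t| < e -> `|s' - s| < e - `|s - t| -> `|s' - t| < e.
  move=> se; rewrite ltrBrDr; apply: le_lt_trans; exact: ler_distD.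
have lvE s : times a c s -> `|s - t| < e -> local_velocity a c s = 'D_1 F s.
  move=> ts se; apply: (times_dwithin (d := e - `|s - t|)) => //.
  - by rewrite subr_gt0.
  - by move=> s' ts' /(tri _ _ se); exact: FE'.
  - by apply: Ck_derivable (ct 1%N) (bb _ se).
exists e, F; split=> // s s01 se.
have ts : times a c s by apply: dP => //; move: se; rewrite lt_min => /andP[].
split=> //; first exact: FE'.
  exact: lvE.
have laE : local_acceleration a c s = 'D_1 ('D_1 F) s.
  apply: (times_dwithin (d := e - `|s - t|)) => //.
  - by rewrite subr_gt0.
  - by move=> s' ts' /(tri _ _ se); exact: lvE.
  - by apply: Ck_derivable (Ck_derive (1 : R) (ct 2%N)) (bb _ se).
apply/rowP => l; have := ode a s ts l.
rewrite (christoffel_sum a (local_curve a c s) (local_velocity a c s) l).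
rewrite laE (lvE s ts se) (FE' s ts se) => /eqP.
by rewrite addr_eq0 => /eqP ->; rewrite [RHS]mxE.
Qed.

End Geodesics.

Section CkBlocks.
Context {R : realType} {V : normedModType R} {n m : nat}.
Implicit Types (U : set V).

Lemma Ck_row_mx k U (A : V -> 'rV[R]_n) (B : V -> 'rV[R]_m) : open U ->
  Ck k U A -> Ck k U B -> Ck k U (fun x => row_mx (A x) (B x)).
Proof.
move=> oU /(Ck_mx k _ oU) cA /(Ck_mx k _ oU) cB; apply/(Ck_mx k _ oU) => i j.
case: (split_ordP j) => l ->.
  by apply: Ck_eq (cA i l) => // x _; rewrite row_mxEl.
by apply: Ck_eq (cB i l) => // x _; rewrite row_mxEr.
Qed.

Lemma Ck_lsubmx k U (A : V -> 'rV[R]_(n + m)) : open U ->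
  Ck k U A -> Ck k U (fun x => lsubmx (A x)).
Proof.
move=> oU /(Ck_mx k _ oU) cA; apply/(Ck_mx k _ oU) => i j.
by apply: Ck_eq (cA i (lshift m j)) => // x _; rewrite mxE.
Qed.

Lemma Ck_rsubmx k U (A : V -> 'rV[R]_(n + m)) : open U ->
  Ck k U A -> Ck k U (fun x => rsubmx (A x)).
Proof.
move=> oU /(Ck_mx k _ oU) cA; apply/(Ck_mx k _ oU) => i j.
by apply: Ck_eq (cA i (rshift n j)) => // x _; rewrite mxE.
Qed.

Lemma is_derive_row_mx (A : V -> 'rV[R]_n) (B : V -> 'rV[R]_m) x v dA dB :
  is_derive x v A dA -> is_derive x v B dB ->
  is_derive x v (fun x => row_mx (A x) (B x)) (row_mx dA dB).
Proof.
move=> /is_derive_mx HA /is_derive_mx HB; apply/is_derive_mx => i j.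
case: (split_ordP j) => l ->.
  rewrite row_mxEl; have := HA i l; congr is_derive.
  by apply/funext => y; rewrite row_mxEl.
rewrite row_mxEr; have := HB i l; congr is_derive.
by apply/funext => y; rewrite row_mxEr.
Qed.

Lemma is_derive_lsubmx (A : V -> 'rV[R]_(n + m)) x v dA :
  is_derive x v A dA -> is_derive x v (fun x => lsubmx (A x)) (lsubmx dA).
Proof.
move=> /is_derive_mx HA; apply/is_derive_mx => i j; rewrite mxE.
have := HA i (lshift m j); congr is_derive.
by apply/funext => y; rewrite mxE.
Qed.

Lemma is_derive_rsubmx (A : V -> 'rV[R]_(n + m)) x v dA :
  is_derive x v A dA -> is_derive x v (fun x => rsubmx (A x)) (rsubmx dA).
Proof.
move=> /is_derive_mx HA; apply/is_derive_mx => i j; rewrite mxE.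
have := HA i (rshift n j); congr is_derive.
by apply/funext => y; rewrite mxE.
Qed.

End CkBlocks.

Lemma open_lsubmx (R : realType) n m (U : set 'rV[R]_n) : open U ->
  open [set s : 'rV[R]_(n + m) | U (lsubmx s)].
Proof.
move=> oU; rewrite openE => s Us.
have [r r0 rP] := open_normP oU Us.
apply/nbhs_ballP; exists r => // y; rewrite -ball_normE /= distrC => yr.
apply: rP; apply: le_lt_trans yr; rewrite -linearB.
by apply: mxnorm_le => // i j; rewrite mxE mxnorm_coord.
Qed.

Lemma is_derive_shiftr (R : realType) (W : normedModType R) (f : R -> W) (s t0 : R) df :
  is_derive (s - t0) 1 f df -> is_derive s 1 (fun s => f (s - t0)) df.
Proof.
move=> H; have := @is_derive_line R R W f (- t0) 1 s df.
have E (u : R) : u *: (1 : R) = u by exact: mulr1.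
rewrite E => /(_ H); congr is_derive.
by apply/funext => u; rewrite E.
Qed.

Lemma dist_split (R : realType) (V : normedModType R) (x y z : V) (e : R) :
  `|y - x| < e / 2 -> `|y - z| < e / 2 -> `|x - z| <= e.
Proof.
move=> h1 h2; apply: (le_trans (ler_distD y x z)); rewrite (distrC x).
by rewrite [leRHS]splitr; apply: lerD; exact: ltW.
Qed.

Lemma lt_min3 (R : realType) (x a b c : R) : x < Num.min a (Num.min b c) ->
  [/\ x < a, x < b & x < c].
Proof. by rewrite !lt_min => /andP[? /andP[]]. Qed.

(** * Geodesics as integral curves in phase space, and their uniqueness *)

Section States.
Context {R : realType} {n : nat} (M : riemannianManifold R n).
Implicit Types (a b : atlas M) (z u v w : 'rV[R]_n) (x p q : M) (c : R -> M).

Local Notation crd a := (Defs.coord (chart_of a)).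
Local Notation prm a := (param (chart_of a)).
Local Notation dm a := (dom (chart_of a)).
Local Notation T a b := (transition (chart_of a) (chart_of b)).

Definition st a c (t : R) : 'rV[R]_(n + n) := row_mx (lc a c t) (lv a c t).

(** The geodesic spray, on pairs of a position and a velocity. *)
Definition Vf a (s : 'rV[R]_(n + n)) : 'rV[R]_(n + n) :=
  row_mx (rsubmx s) (- Gam a (lsubmx s) (rsubmx s) (rsubmx s)).

Definition Ust a : set 'rV[R]_(n + n) := [set s | ocod a (lsubmx s)].

Lemma Ust_open a : open (Ust a).
Proof. exact: open_lsubmx (ocod_open a). Qed.
Arguments Ust_open : clear implicits.

Lemma Vf_Ck k a : Ck k (Ust a) (Vf a).
Proof.
have oU := Ust_open a.
have cl : Ck k (Ust a) (fun s => lsubmx s) by apply: Ck_lsubmx => //; exact: Ck_id.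
have cr : Ck k (Ust a) (fun s => rsubmx s) by apply: Ck_rsubmx => //; exact: Ck_id.
apply: Ck_row_mx => //; apply/(Ck_mx k _ oU) => i l.
have cwj j : Ck k (Ust a) (fun s => (rsubmx s) 0 j).
  by have /(Ck_mx k _ oU) := cr; exact.
have H : Ck k (Ust a) (fun s => (-1) *: (\sum_i \sum_j
    christoffel a l i j (lsubmx s) * (rsubmx s) 0 i * (rsubmx s) 0 j) : R).
  apply: CkZ => //; apply: Ck_sum => // p; apply: Ck_sum => // q.
  apply: CkM => //; apply: CkM => //.
  apply: (Ck_comp oU (ocod_open a) _ cl (christoffel_Ck k a l p q)).
  by move=> s.
apply: Ck_eq H => // s _; rewrite ord1 [RHS]mxE christoffel_sum scaleN1r.
by [].
Qed.
Arguments Vf_Ck : clear implicits.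

(** The change of charts induced on the tangent bundle. *)
Definition That a b (s : 'rV[R]_(n + n)) : 'rV[R]_(n + n) :=
  row_mx (T a b (lsubmx s)) (rsubmx s *m jac (T a b) (lsubmx s)).

Definition Ovl a b : set 'rV[R]_(n + n) := [set s | ovl a b (lsubmx s)].

Lemma Ovl_open a b : open (Ovl a b).
Proof. exact: open_lsubmx (ovl_open a b). Qed.
Arguments Ovl_open : clear implicits.

Lemma That_Ck k a b : Ck k (Ovl a b) (That a b).
Proof.
have oU := Ovl_open a b.
have cl : Ck k (Ovl a b) (fun s => lsubmx s) by apply: Ck_lsubmx => //; exact: Ck_id.
have cr : Ck k (Ovl a b) (fun s => rsubmx s) by apply: Ck_rsubmx => //; exact: Ck_id.
have sub s : Ovl a b s -> ovl a b (lsubmx s) by [].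
apply: Ck_row_mx => //; apply/(Ck_mx k _ oU) => i l.
  have /(Ck_mx k _ (ovl_open a b)) /(_ i l) cT := transition_Ck k a b.
  exact: (Ck_comp oU (ovl_open a b) sub cl cT).
have H : Ck k (Ovl a b) (fun s => \sum_j rsubmx s i j * jac (T a b) (lsubmx s) j l).
  apply: Ck_sum => // j; apply: CkM => //.
    by have /(Ck_mx k _ oU) := cr; exact.
  have /(Ck_mx k _ (ovl_open a b)) /(_ j l) cJ := @jac_Ck _ _ _ k a b.
  exact: (Ck_comp oU (ovl_open a b) sub cl cJ).
by apply: Ck_eq H => // s _; exact: esym (mxE _ _ _ _).
Qed.
Arguments That_Ck : clear implicits.

Lemma st_change a b c (t : R) : geoin a c t -> dm b (c t) -> st b c t = That a b (st a c t).
Proof.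
move=> g bt; have [oz nd du _] := g.
rewrite /st /That row_mxKl row_mxKr.
have [_ vb] := lv_transition nd oz bt du.
have -> : lc b c t = T a b (lc a c t).
  by rewrite /lc (transition_coord b (geoin_dom g)).
have vb' : lv b c t = lv a c t *m jac (T a b) (lc a c t) := vb.
by rewrite vb'.
Qed.

Lemma is_derive_st a c (t : R) : geoin a c t -> is_derive t 1 (st a c) (Vf a (st a c t)).
Proof.
move=> [_ _ du d2u]; rewrite /Vf /st row_mxKl row_mxKr.
exact: is_derive_row_mx (derivableP du) d2u.
Qed.

Lemma flow_geoin a (X : R -> 'rV[R]_(n + n)) (t : R) :
  (\forall s \near t, Ust a (X s) /\ is_derive s 1 X (Vf a (X s))) ->
  let c := fun s => prm a (lsubmx (X s)) in
  geoin a c t /\ st a c t = X t.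
Proof.
move=> nX c.
have E : \forall s \near t, lc a c s = lsubmx (X s).
  apply: filterS nX => s [Us _]; rewrite /lc /c chart_paramK//; exact: ocod_cod.
have DX : \forall s \near t, is_derive (s : R) 1 (lc a c) (rsubmx (X s)).
  apply: filterS2 (nbhs_interior E) nX => s Es [Us dX].
  have H := is_derive_lsubmx dX; rewrite /Vf row_mxKl in H.
  by apply: near_eq_is_derive H; apply: filterS Es => r ->.
have EV : \forall s \near t, lv a c s = rsubmx (X s).
  by apply: filterS DX => s [].
have [Ut dX] := nbhs_singleton nX.
have st_t : st a c t = X t.
  by rewrite /st (nbhs_singleton E) (nbhs_singleton EV) hsubmxK.
split=> //; split.
- by rewrite (nbhs_singleton E).
- apply: filterS nX => s [Us _]; rewrite /c.
  by apply: chart_param_dom; exact: ocod_cod.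
- by have [] := nbhs_singleton DX.
- rewrite (nbhs_singleton E) (nbhs_singleton EV).
  have H := is_derive_rsubmx dX; rewrite /Vf row_mxKr in H.
  by apply: near_eq_is_derive H; apply: filterS EV => r ->.
Qed.

Lemma st_continuous a c (t : R) : geoin a c t -> {for t, continuous (st a c)}.
Proof.
move=> /is_derive_st[d _].
by apply: differentiable_continuous; apply/derivable1_diffP.
Qed.

Lemma st_inj a c c' (t t' : R) : dm a (c t) -> dm a (c' t') ->
  st a c t = st a c' t' -> c t = c' t' /\ lv a c t = lv a c' t'.
Proof.
move=> d d' /eq_row_mx[E ->]; split=> //.
by rewrite -(chart_coordK d) -(chart_coordK d'); congr (prm a _).
Qed.

Lemma near_dist (t : R) (P : R -> Prop) : (\forall s \near t, P s) ->
  exists2 d : R, 0 < d & forall s, `|s - t| < d -> P s.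
Proof.
move=> /nbhs_ballP[d d0 dP]; exists d => // s sd; apply: dP.
by rewrite /ball /= distrC.
Qed.

Lemma dist_near (t d : R) (P : R -> Prop) : 0 < d ->
  (forall s, `|s - t| < d -> P s) -> \forall s \near t, P s.
Proof.
move=> d0 H; apply/nbhs_ballP; exists d => // s; rewrite /ball /= distrC; exact: H.
Qed.

Lemma geo_unique_local a c c' (t : R) : (\forall s \near t, geoin a c s) ->
  (\forall s \near t, geoin a c' s) -> st a c t = st a c' t ->
  \forall s \near t, c s = c' s.
Proof.
move=> g g' E.
have gt := nbhs_singleton g; have gt' := nbhs_singleton g'.
have Ut : Ust a (st a c t) by rewrite /Ust /= row_mxKl; case: gt.
have [r [d [r0 d0 H]]] := ode_unique_local (Ust_open a) (Vf_Ck 2 a) Ut.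
have [e1 e10 H1] := cvg_normP (st_continuous gt) r0.
have [e2 e20 H2] := cvg_normP (st_continuous gt') r0.
have [e3 e30 H3] := near_dist g; have [e4 e40 H4] := near_dist g'.
pose e := Num.min (Num.min e1 e2) (Num.min (Num.min e3 e4) d) / 2.
have e0 : 0 < e by rewrite divr_gt0// !lt_min e10 e20 e30 e40 d0.
have eE : e *+ 2 = Num.min (Num.min e1 e2) (Num.min (Num.min e3 e4) d).
  by rewrite -mulr_natr /e divfK// pnatr_eq0.
have e2e : e < e *+ 2 by rewrite mulr2n ltrDl.
have bd (s : R) : t - e <= s <= t + e ->
    [/\ `|s - t| < e1, `|s - t| < e2, `|s - t| < e3 & `|s - t| < e4].
  move=> /andP[s1 s2].
  have : `|s - t| < e *+ 2 by apply: le_lt_trans e2e; rewrite ler_norml; lra.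
  by rewrite eE !lt_min => /andP[/andP[? ?] /andP[/andP[? ?] _]].
have cs c0 : (forall s, t - e <= s <= t + e -> geoin a c0 s) ->
    {within `[t - e, t + e]%classic, continuous (st a c0)}.
  move=> gg; apply: derivable_within_continuous => s; rewrite in_itv /= => /gg gs.
  by have [] := is_derive_st gs.
have K := H (st a c) (st a c') (t - e) (t + e) t.
apply: (dist_near e0) => s se.
have sI : t - e <= s <= t + e by move: se; rewrite ltr_norml; lra.
have [i1 i2 i3 i4] := bd s sI.
suff Es : st a c s = st a c' s.
  by have [] := st_inj (geoin_dom (H3 s i3)) (geoin_dom (H4 s i4)) Es.
apply: K; [| |apply: cs|apply: cs| | |exact: E|exact: sI].
- by rewrite gerBl lerDl (ltW e0).
- have : e *+ 2 <= d by rewrite eE !ge_min lexx !orbT.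
  by rewrite mulr2n; lra.
- by move=> u /bd[_ _ u3 _]; exact: H3.
- by move=> u /bd[_ _ _ u4]; exact: H4.
- move=> u /andP[u1 u2]; have [|v1 v2 v3 v4] := bd u; first by rewrite !ltW.
  by split; [exact: H1|apply: is_derive_st; exact: H3].
- move=> u /andP[u1 u2]; have [|v1 v2 v3 v4] := bd u; first by rewrite !ltW.
  by split; [rewrite E; exact: H2|apply: is_derive_st; exact: H4].
Qed.

(** Agreement of velocities is asked in every chart, so that it can be followed along curves that
    leave any given chart. *)
Let same c c' (t : R) := c t = c' t /\ forall b, dm b (c t) -> lv b c t = lv b c' t.

Let same_near c c' (t : R) : (\forall s \near t, geoat c s) ->
  (\forall s \near t, geoat c' s) -> same c c' t ->
  \forall s \near t, same c c' s.
Proof.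
move=> g g' [E Ev]; pose a := index_at (c t).
have at_ : dm a (c t) by exact: index_atP.
have at' : dm a (c' t) by rewrite -E.
have N := geo_unique_local (geoat_near g at_) (geoat_near g' at').
have /nbhs_interior : \forall s \near t, c s = c' s.
  by apply: N; rewrite /st /lc E Ev.
apply: filterS => s Es; split; first exact: nbhs_singleton Es.
by move=> b _; exact: near_lv.
Qed.

(** The Hausdorff property of M makes agreement of positions closed; agreement of velocities then
    follows in each chart by continuity. *)
Let same_closed c c' (t : R) : (\forall s \near t, geoat c s) ->
  (\forall s \near t, geoat c' s) ->
  (forall d : R, 0 < d -> exists2 s : R, `|s - t| < d & same c c' s) -> same c c' t.
Proof.
move=> g g' H; pose a := index_at (c t).
have at_ : dm a (c t) by exact: index_atP.
have ct := geoin_cont (nbhs_singleton (geoat_near g at_)).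
have at' : dm (index_at (c' t)) (c' t) by exact: index_atP.
have ct' := geoin_cont (nbhs_singleton (geoat_near g' at')).
have E : c t = c' t.
  apply: (@space_hausdorff _ _ M) => A B nA nB.
  have [d d0 dP] := near_dist (P := fun s => A (c s)) (ct _ nA).
  have [d' d'0 dP'] := near_dist (P := fun s => B (c' s)) (ct' _ nB).
  have dd0 : 0 < Num.min d d' by rewrite lt_min d0.
  have [s] := H _ dd0; rewrite lt_min => /andP[sd sd'] [Es _].
  by exists (c s); split; [exact: dP|rewrite Es; exact: dP'].
split; [exact: E|move=> b bt].
have bt' : dm b (c' t) by rewrite -E.
have gb := geoat_near g bt; have gb' := geoat_near g' bt'.
have cv := st_continuous (nbhs_singleton gb).
have cv' := st_continuous (nbhs_singleton gb').
suff K : st b c t = st b c' t.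
  by have [] := st_inj bt bt' K.
apply/eqP; rewrite -subr_eq0 -normr_le0; apply/ler_addgt0Pl => e e0; rewrite addr0.
have e2 : 0 < e / 2 by rewrite divr_gt0.
have [d1 d10 H1] := cvg_normP cv e2; have [d2 d20 H2] := cvg_normP cv' e2.
have [d3 d30 H3] := near_dist gb.
have d0 : 0 < Num.min d1 (Num.min d2 d3) by rewrite !lt_min d10 d20.
have [s] := H _ d0; rewrite !lt_min => /andP[s1 /andP[s2 s3]] [Es Ev].
have Est : st b c s = st b c' s.
  by rewrite /st /lc Es Ev//; exact: geoin_dom (H3 s s3).
have h1 := H1 s s1; have h2 := H2 s s2; rewrite Est in h1.
exact: dist_split h1 h2.
Qed.

(** Agreement is open by [same_near] and closed by [same_closed], so near each time it holds
    everywhere or nowhere ([dich]), and it spreads from t1 by [real_induction]. *)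
Lemma geo_unique a c c' (al be t1 : R) : al < t1 < be ->
  (forall t, al < t < be -> geoat c t /\ geoat c' t) ->
  dm a (c t1) -> dm a (c' t1) -> st a c t1 = st a c' t1 ->
  forall t, al < t < be -> c t = c' t.
Proof.
move=> t1I g at_ at' E t tI.
have gn (s : R) : al < s < be ->
    (\forall u \near s, geoat c u) /\ (\forall u \near s, geoat c' u).
  move=> sI; have N : \forall u \near s, al < u < be.
    by have := near_in_itvoo sI; apply: filterS => u; rewrite in_itv.
  by split; apply: filterS N => u /g[].
have S1 : same c c' t1.
  have [N N'] := gn t1 t1I; have ga := geoat_near N at_; have ga' := geoat_near N' at'.
  have := geo_unique_local ga ga' E.
  move=> K; split; first exact: nbhs_singleton K.
  by move=> b _; exact: near_lv.
have dich (s : R) : al < s < be -> exists2 d : R, 0 < d &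
    forall u u' : R, `|u - s| < d -> `|u' - s| < d -> same c c' u -> same c c' u'.
  move=> sI; have [N N'] := gn s sI.
  have [Ss|nS] := pselect (same c c' s).
    have [d d0 dP] := near_dist (same_near N N' Ss).
    exists d; first exact: d0.
    by move=> u u' _ u's _; exact: dP.
  have [d0 [d1 dP]] : exists d : R, 0 < d /\ forall u : R, `|u - s| < d -> ~ same c c' u.
    apply: contrapT => K; apply: nS; apply: (same_closed N N') => d d0.
    apply: contrapT => K2; apply: K; exists d; split; first exact: d0.
    by move=> u ud Su; apply: K2; exists u.
  exists d0; first exact: d1.
  by move=> u u' us _ Su; case: (dP u us Su).
have [t1t|/ltW tt1] := leP t1 t.
  suff [] : same c c' t by [].
  apply: (real_induction (P := same c c') t1t S1) => s /andP[s1 s2].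
  have sI : al < s < be by move: t1I tI => /andP[? ?] /andP[? ?]; apply/andP; split; lra.
  have [d d0 dP] := dich s sI; exists d; first exact: d0.
  move=> u u' u1 uu' u2 _ _.
  by apply: dP; rewrite ltr_norml; lra.
(* Times before t1 are reached by induction after the reflection s |-> - s. *)
suff [] : same c c' (- - t) by rewrite opprK.
have nt : - t1 <= - t by rewrite lerN2.
apply: (real_induction (P := fun s => same c c' (- s)) nt); first by rewrite opprK.
move=> s /andP[s1 s2].
have sI : al < - s < be by move: t1I tI => /andP[? ?] /andP[? ?]; apply/andP; split; lra.
have [d d0 dP] := dich _ sI; exists d; first exact: d0.
move=> u u' u1 uu' u2 _ _.
by apply: dP; rewrite ltr_norml; lra.
Qed.

(* sg w is the state at time t0 of the geodesic g w. *)
Lemma flow_family a s0 (rho : R) : Ust a s0 -> 0 < rho ->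
  exists d r : R, [/\ 0 < d, 0 < r & forall (t0 : R) (sg : 'rV[R]_n -> 'rV[R]_(n + n)) w0 L,
   Qdiff w0 sg L -> `|sg w0 - s0| < r ->
   exists (g : 'rV[R]_n -> R -> M) (e : R) (Lf : R -> 'M[R]_(n, n + n)), [/\ 0 < e,
    forall w, `|w - w0| < e -> forall t : R, `|t - t0| < d ->
      [/\ geoat (g w) t, dm a (g w t) & `|st a (g w) t - s0| < rho],
    forall w, `|w - w0| < e -> st a (g w) t0 = sg w,
    forall t : R, `|t - t0| < d -> forall b, dm b (g w0 t) ->
      (exists2 e' : R, 0 < e' & forall w, `|w - w0| < e' -> dm b (g w t)) /\
      exists L', Qdiff w0 (fun w => st b (g w) t) L' &
    forall t : R, `|t - t0| < d -> Qdiff w0 (fun w => st a (g w) t) (Lf t) /\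
      is_derive t 1 Lf (Lf t *m jac (Vf a) (st a (g w0) t))]].
Proof.
move=> Us rho0.
(* Restricting the field to this ball makes the flow box confine the states to it. *)
pose U := Ust a `&` [set s | `|s - s0| < rho].
have oU : open U.
  apply: openI; first exact: Ust_open.
  rewrite openE => s /= sr; apply/nbhs_ballP; exists (rho - `|s - s0|).
    by rewrite /= subr_gt0.
  move=> y; rewrite -ball_normE /= distrC ltrBrDr; apply: le_lt_trans.
  exact: ler_distD.
have cV : Ck 2 U (Vf a) by apply: Ck_sub (Vf_Ck 2 a) => s [].
have U0 : U s0 by split=> //=; rewrite subrr normr0.
have [d [r [Phi [Y [d0 r0 HPhi HY]]]]] := flowbox oU cV U0.
exists d, r; split=> // t0 sg w0 L QL sgr.
pose g w t := prm a (lsubmx (Phi (sg w) (t - t0))).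
have [r1 [C [r10 C0 HC]]] := Qdiff_lip QL.
(* [sg] is C-Lipschitz near w0, so for |w - w0| < e the state [sg w] stays within r of s0, the
   domain of the flow. *)
pose e := Num.min r1 ((r - `|sg w0 - s0|) / (C + 1)).
have C1 : 0 < C + 1 by rewrite ltr_wpDl.
have e0 : 0 < e by rewrite lt_min r10 divr_gt0// subr_gt0.
have sgb w : `|w - w0| < e -> `|sg w - s0| < r.
  rewrite lt_min => /andP[wr]; rewrite ltr_pdivlMr// ltrBrDr => h.
  have H1 := HC w w0 wr ltac:(by rewrite subrr normr0).
  apply: le_lt_trans h; apply: (le_trans (ler_distD (sg w0) _ _)).
  rewrite lerD2r (le_trans H1)// mulrC ler_wpM2l// lerDl//.
clearbody e.
have flow w : `|w - w0| < e -> forall t : R, `|t - t0| < d ->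
    [/\ geoin a (g w) t, U (Phi (sg w) (t - t0)) & st a (g w) t = Phi (sg w) (t - t0)].
  move=> we t td; have [P0 HP] := HPhi _ (sgb w we).
  have [Ut _] := HP _ td.
  have N : \forall s \near t, Ust a (Phi (sg w) (s - t0)) /\
      is_derive s 1 (fun s => Phi (sg w) (s - t0)) (Vf a (Phi (sg w) (s - t0))).
    have dt : 0 < d - `|t - t0| by rewrite subr_gt0.
    apply: (dist_near dt) => s; rewrite ltrBrDr => sd.
    have sd' : `|s - t0| < d by apply: le_lt_trans sd; exact: ler_distD.
    have [[Us' _] dP] := HP _ sd'; split=> //.
    exact: is_derive_shiftr dP.
  by have [G1 G2] := flow_geoin N.
have w00 : `|w0 - w0| < e by rewrite subrr normr0.
have near_t (t : R) : `|t - t0| < d -> \forall s \near t, `|s - t0| < d.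
  move=> td; have dt : 0 < d - `|t - t0| by rewrite subr_gt0.
  apply: (dist_near dt) => s; rewrite ltrBrDr; apply: le_lt_trans.
  exact: ler_distD.
have FD (t : R) : `|t - t0| < d ->
    Qdiff w0 (fun w => st a (g w) t) (L *m Y (sg w0) (t - t0)).
  move=> td; have [QY _] := HY _ (sgb _ w00) _ td.
  apply: (Qdiff_near e0 _ (Qdiff_comp QL QY)) => w we /=.
  by have [_ _ ->] := flow w we t td.
exists g, e, (fun t => L *m Y (sg w0) (t - t0)); split; first exact: e0.
- move=> w we t td; have [gt [_ rt] E] := flow w we t td; split.
  + apply: (geoin_geoat (a := a)); apply: filterS (near_t t td) => s sd.
    by have [] := flow w we s sd.
  + exact: geoin_dom gt.
  + by rewrite E.
- move=> w we; have t00 : `|t0 - t0| < d by rewrite subrr normr0.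
  have [_ _ ->] := flow w we t0 t00; rewrite subrr.
  by have [] := HPhi _ (sgb w we).
- move=> t td b bt.
  have [gt _ _] := flow w0 w00 t td.
  have [oz _ _ _] := gt; have at_ := geoin_dom gt.
  have Ot : Ovl a b (st a (g w0) t).
    by rewrite /Ovl /= row_mxKl; apply: ovl_coord.
  have [r2 [K [r20 K0 HK]]] := Qdiff_lip (FD t td).
  have [r3 r30 r3P] := open_normP (Ovl_open a b) Ot.
  have K1 : 0 < K + 1 by rewrite ltr_wpDl.
  pose e' := Num.min e (Num.min r2 (r3 / (K + 1))).
  have e'0 : 0 < e' by rewrite !lt_min e0 r20 divr_gt0.
  have bw w : `|w - w0| < e' -> [/\ geoin a (g w) t & dm b (g w t)].
    move=> /lt_min3[we wr2]; rewrite (ltr_pdivlMr _ _ K1) => wr3.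
    have [gw _ _] := flow w we t td; split=> //.
    have : Ovl a b (st a (g w) t).
      apply: r3P; apply: le_lt_trans wr3.
      have h := HK w w0 wr2 ltac:(by rewrite subrr normr0).
      by rewrite (le_trans h)// mulrC ler_wpM2l// lerDl.
    rewrite /Ovl /= row_mxKl => -[_]; rewrite /preimage /= /lc chart_coordK//.
    exact: geoin_dom gw.
  split; first by exists e' => // w /bw[].
  have QT := Qdiff_C2 (Ovl_open a b) (That_Ck 2 a b) Ot.
  exists (L *m Y (sg w0) (t - t0) *m jac (That a b) (st a (g w0) t)).
  apply: (Qdiff_near e'0 _ (Qdiff_comp (FD t td) QT)) => w /bw[gw bgw].
  by rewrite (st_change gw bgw).
- move=> t td; split; first exact: FD.
  have [_ _ E] := flow w0 w00 t td.
  have [_ dY] := HY _ (sgb _ w00) _ td.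
  have H := is_derive_mulmx (is_derive_cst L t 1) (is_derive_shiftr dY).
  by apply: (is_derive_cast H); rewrite mul0mx add0r E mulmxA.
Qed.

End States.

Arguments Ust_open {R n M} a.
Arguments Ovl_open {R n M} a b.
Arguments Vf_Ck {R n M} k a.
Arguments That_Ck {R n M} k a b.

(** * Families of geodesics and Jacobi fields *)

Section Intervals.
Context {R : realType}.
Implicit Types (s t u d e m : R).

Lemma itv_shift s e : 0 <= s -> 0 < e -> - e < s < s + e.
Proof. by move=> ? ?; apply/andP; split; lra. Qed.

Lemma dist_between s s' t u d : t - d < s -> s <= u -> u <= s' -> s' < t + d ->
  `|u - t| < d.
Proof. by move=> ? ? ? ?; rewrite ltr_norml; apply/andP; split; lra. Qed.

Lemma dist_half s s' t d : `|s - t| < d / 2 -> `|s' - t| < d / 2 -> s' - s < d.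
Proof. by rewrite !ltr_norml => /andP[? ?] /andP[? ?]; lra. Qed.

Lemma itv_ball s m : 0 < m -> s - m < s < s + m.
Proof. by move=> ?; apply/andP; split; lra. Qed.

Lemma itv_widen s t m e : s - m < t -> t < s + m -> m <= e -> 0 <= s -> - e < t < s + e.
Proof. by move=> ? ? ? ?; apply/andP; split; lra. Qed.

Lemma dist_widen s t m d : s - m < t -> t < s + m -> m <= d -> `|t - s| < d.
Proof. by move=> ? ? ?; rewrite ltr_norml; apply/andP; split; lra. Qed.

Lemma dist_left s t u m : s < u -> u - t < m -> t <= s -> 0 < m -> s - m < u < s + m.
Proof. by move=> ? ? ? ?; apply/andP; split; lra. Qed.

Lemma dist_right s t u : - (t - s) < u - t -> u <= s -> False.
Proof. by move=> ? ?; lra. Qed.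

Lemma dist_shift s s' t e d : s < t -> t < s' + e -> e <= d - (s' - s) -> `|t - s| < d.
Proof. by move=> ? ? ?; rewrite ltr_norml; apply/andP; split; lra. Qed.

Lemma itv_le s t e e' : - e' < t -> t <= s -> e' <= e -> 0 < e -> - e < t < s + e.
Proof. by move=> ? ? ? ?; apply/andP; split; lra. Qed.

Lemma dist_sub s s' u d : s <= u -> u <= s' -> s' - s < d -> `|u - s| < d.
Proof. by move=> ? ? ?; rewrite ltr_norml; apply/andP; split; lra. Qed.

End Intervals.

Section Perturbation.
Context {R : realType} {n : nat} (M : riemannianManifold R n).
Implicit Types (a b : atlas M) (z w : 'rV[R]_n) (x p q : M) (c : R -> M).

Local Notation crd a := (Defs.coord (chart_of a)).
Local Notation prm a := (param (chart_of a)).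
Local Notation dm a := (dom (chart_of a)).
Local Notation T a b := (transition (chart_of a) (chart_of b)).

Lemma near_st a c c' (t : R) : (\forall s \near t, c s = c' s) -> st a c t = st a c' t.
Proof. by move=> E; rewrite /st (near_lv a E) /lc (nbhs_singleton E). Qed.

(* As st, but with the one-sided velocities of an arc. *)
Definition sta a c (t : R) : 'rV[R]_(n + n) := row_mx (lc a c t) (local_velocity a c t).

Lemma local_velocity_transition p q a b c (t : R) : geodesic_arc p q c ->
  times a c t -> times b c t -> ocod a (lc a c t) ->
  local_velocity b c t = local_velocity a c t *m jac (T a b) (lc a c t).
Proof.
move=> arc ta tb oz.
have [d [F [d0 cF HF]]] := arc_local arc ta.
have [[cc _] _ _ _] := arc.
have t01 : 0 <= t <= 1 by case: ta; rewrite /= in_itv.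
have tt : `|t - t| < d by rewrite subrr normr0.
have [_ E E' _] := HF t t01 tt.
have ot : ovl a b (F t).
  by rewrite -E; apply: ovl_coord => //; [case: ta|case: tb].
have bt : ball t d t by exact: ballxx.
have D : is_derive t 1 (fun s => T a b (F s)) ('D_1 F t *m jac (T a b) (F t)).
  have dF := derivableP (Ck_derivable (v := (1:R)) (cF 1%N) bt).
  have D := is_derive_mxcomp (ovl_open a b) (transition_Ck 1 a b) ot dF.
  apply: (is_derive_cast D).
  by have [_ ->] := is_derive_transition ('D_1 F t) ot.
have [dT ET] := D.
rewrite E' E -ET; apply: (times_dwithin cc tb d0 _ dT) => s [s01 bs] sd.
have s01' : 0 <= s <= 1 by move: s01; rewrite /= in_itv.
have [[_ as_] Es _ _] := HF s s01' sd.
by rewrite -Es /lc transition_coord.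
Qed.

Lemma sta_change p q a b c (t : R) : geodesic_arc p q c ->
  times a c t -> times b c t -> ocod a (lc a c t) -> sta b c t = That a b (sta a c t).
Proof.
move=> arc ta tb oz; rewrite /sta /That row_mxKl row_mxKr.
rewrite (local_velocity_transition arc ta tb oz).
by rewrite {3}/lc transition_coord//; case: ta.
Qed.

Lemma arc_state p q a c (t : R) : geodesic_arc p q c -> times a c t ->
  exists (d : R) (X : R -> 'rV[R]_(n + n)), [/\ 0 < d, {for t, continuous X} &
    forall s, 0 <= s <= 1 -> `|s - t| < d -> [/\ times a c s, sta a c s = X s &
      is_derive s 1 X (Vf a (X s))]].
Proof.
move=> arc ta; have [d [F [d0 cF HF]]] := arc_local arc ta.
exists d, (fun s => row_mx (F s) ('D_1 F s)).
have oB : open (ball t d) by exact: ball_open.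
split; first exact: d0.
  have C : Ck 0 (ball t d) (fun s => row_mx (F s) ('D_1 F s)).
    by apply: Ck_row_mx => //; exact: Ck_derive (cF 1%N).
  by apply: Ck_cont C _; exact: ballxx.
move=> s s01 sd; have [ts E E' E2] := HF s s01 sd.
have bs : ball t d s by rewrite /ball /= distrC.
split; [exact: ts|by rewrite /sta E E'|].
rewrite /Vf row_mxKl row_mxKr -E2.
have D1 := derivableP (Ck_derivable (v := (1:R)) (cF 1%N) bs).
have D2 := derivableP (Ck_derivable (v := (1:R)) (Ck_derive (1:R) (cF 2%N)) bs).
exact: is_derive_row_mx D1 D2.
Qed.

Section Family.
Variables (p q : M) (c0 : R -> M) (a0 : atlas M).
Hypothesis arc : geodesic_arc p q c0.
Hypothesis inter : forall t : R, 0 <= t <= 1 -> ~ boundary (c0 t).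
Hypothesis p0 : dm a0 p.

Let z0 := crd a0 p.
Let w0 := local_velocity a0 c0 0.

(* c w is the geodesic with initial point p and initial velocity w, and c w0
   prolongs the arc c0 on [0, T]. *)
Definition family (T : R) (r d : R) (c : 'rV[R]_n -> R -> M) : Prop :=
  [/\ forall w, `|w - w0| < r -> forall t, - d < t < T + d -> geoat (c w) t,
   forall w, `|w - w0| < r -> dm a0 (c w 0) /\ st a0 (c w) 0 = row_mx z0 w,
   forall t, 0 <= t <= T -> c w0 t = c0 t /\
      forall a, dm a (c0 t) -> st a (c w0) t = sta a c0 t &
   forall t, - d < t < T + d -> forall b, dm b (c w0 t) ->
     (exists2 e : R, 0 < e & forall w, `|w - w0| < e -> dm b (c w t)) /\
     exists L, Qdiff w0 (fun w => st b (c w) t) L].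

Let fam (T : R) := exists (r d : R) (c : 'rV[R]_n -> R -> M), [/\ 0 < r, 0 < d & family T r d c].

Let c00 : c0 0 = p. Proof. by case: arc. Qed.

Let timesP a (t : R) : 0 <= t <= 1 -> dm a (c0 t) -> times a c0 t.
Proof. by move=> t01 at_; split=> //; rewrite /= in_itv. Qed.

Let ocodP0 a (t : R) : 0 <= t <= 1 -> dm a (c0 t) -> ocod a (lc a c0 t).
Proof. by move=> t01 at_; apply: interior_ocod => //; exact: inter. Qed.

Let agree a c (t : R) : 0 <= t <= 1 -> dm a (c0 t) -> geoin a c t ->
  st a c t = sta a c0 t ->
  c t = c0 t /\ forall b, dm b (c0 t) -> st b c t = sta b c0 t.
Proof.
move=> t01 at_ g E.
have E0 : c t = c0 t.
  have /eq_row_mx[El _] := E.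
  by rewrite -(chart_coordK (geoin_dom g)) -(chart_coordK at_); congr (prm a _).
split; first exact: E0.
move=> b bt.
rewrite (sta_change arc (timesP t01 at_) (timesP t01 bt) (ocodP0 t01 at_)) -E.
by apply: st_change => //; rewrite E0.
Qed.

Let fam0 : fam 0.
Proof.
have t01 : 0 <= (0 : R) <= 1 by rewrite lexx ler01.
have at_ : dm a0 (c0 0) by rewrite c00.
have U0 : Ust a0 (row_mx z0 w0).
  by rewrite /Ust /= row_mxKl /z0 -c00; exact: ocodP0.
have [d [r [d0 r0 H]]] := flow_family U0 ltr01.
pose sg w : 'rV[R]_(n + n) := row_mx z0 w.
have QS : Qdiff w0 sg (row_mx 0 1%:M).
  exists 1, 0; split=> // u v _ _.
  by rewrite /sg opp_row_mx add_row_mx subrr mul_mx_row mulmx0 mulmx1 subrr normr0 !mul0r.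
have s0r : `|sg w0 - row_mx z0 w0| < r by rewrite subrr normr0.
have [g [e [Lf [e0 gA gB gC _]]]] := H 0 sg w0 _ QS s0r.
have we : `|w0 - w0| < e by rewrite subrr normr0.
have td (t : R) : - d < t < 0 + d -> `|t - 0| < d by rewrite add0r subr0 ltr_norml.
have zd : `|(0:R) - 0| < d by rewrite subrr normr0.
exists e, d, g; split; [exact: e0|exact: d0|split].
- by move=> w wr t /td tI; have [] := gA w wr t tI.
- by move=> w wr; have [_ h _] := gA w wr 0 zd; split; [exact: h|exact: gB].
- move=> t /le_anti <-.
  have [ga da _] := gA w0 we 0 zd.
  apply: (agree t01 at_ (ga a0 da)); rewrite gB// /sg /sta.
  by rewrite /lc c00.
- by move=> t /td tI b bt; exact: gC.
Qed.

(** Continuation across t1. The flow box is built around the state of c0 at t1, so its size does not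
    depend on s, and it is started at time s from the states of the family already constructed,
    which depend on w in the sense of [Qdiff]. *)
Let fam_step (t1 : R) : 0 <= t1 <= 1 -> exists2 d : R, 0 < d & forall s s',
  t1 - d < s -> s <= s' -> s' < t1 + d -> 0 <= s -> s' <= 1 -> fam s -> fam s'.
Proof.
move=> t01; pose a := index_at (c0 t1).
have at_ : dm a (c0 t1) by exact: index_atP.
have ta := timesP t01 at_.
have [d3 [X [d30 cX HX]]] := arc_state arc ta.
have t11 : `|t1 - t1| < d3 by rewrite subrr normr0.
have [_ E1 _] := HX t1 t01 t11.
pose s0 := X t1.
have U0 : Ust a s0 by rewrite /Ust /= /s0 -E1 row_mxKl; exact: ocodP0.
have [r1 [d1 [r10 d10 HU]]] := ode_unique_local (Ust_open a) (Vf_Ck 2 a) U0.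
have [d [r2 [d0 r20 HF]]] := flow_family U0 r10.
have r120 : 0 < Num.min r1 r2 by rewrite lt_min r10.
have [d4 d40 H4] := cvg_normP cX r120.
exists (Num.min (d / 2) (Num.min (d1 / 2) (Num.min d3 d4))).
  by rewrite !lt_min !divr_gt0// d30.
move=> s s' ts ss' s't s_0 s'1 [r [de [c [r0 de0 [fA fB fC fD]]]]].
have near1 (u : R) : s <= u <= s' ->
    [/\ `|u - t1| < d / 2, `|u - t1| < d1 / 2, `|u - t1| < d3 & `|u - t1| < d4].
  move=> /andP[su us'].
  have /lt_min3[h1 h2] : `|u - t1| < Num.min (d / 2) (Num.min (d1 / 2) (Num.min d3 d4)).
    exact: dist_between ts su us' s't.
  by rewrite lt_min => /andP[].
have u01 (u : R) : s <= u <= s' -> 0 <= u <= 1.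
  by move=> /andP[su us']; rewrite (le_trans s_0 su) (le_trans us' s'1).
have ss : s <= s <= s' by rewrite lexx.
have s's' : s <= s' <= s' by rewrite lexx ss'.
have [n1 n2 n3 n4] := near1 s ss; have [m1 m2 m3 m4] := near1 s' s's'.
have sd : s' - s < d.
  exact: dist_half n1 m1.
have sd1 : s' - s <= d1.
  exact: ltW (dist_half n2 m2).
have [tsa Es _] := HX s (u01 s ss) n3.
have das : dm a (c0 s) by case: tsa.
have s0s : 0 <= s <= s by rewrite s_0 lexx.
have [Ecs Ests] := fC s s0s.
have sI : - de < s < s + de by exact: itv_shift.
have dacs : dm a (c w0 s) by rewrite Ecs.
have [[e2 e20 He2] [L QL]] := fD s sI a dacs.
have sgr : `|st a (c w0) s - s0| < r2.
  by rewrite Ests// Es; have := H4 s n4; rewrite lt_min => /andP[].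
have [g [e [Lf [e0 gA gB gC _]]]] := HF s _ w0 L QL sgr.
(* On a neighbourhood of time s both pieces are geodesics with the same state at s, so they coincide
   there and the gluing creates no corner. *)
pose c' w (t : R) := if t <= s then c w t else g w t.
pose r' := Num.min r (Num.min e e2).
have r'0 : 0 < r' by rewrite !lt_min r0 e0.
pose m := Num.min de d.
have m0 : 0 < m by rewrite lt_min de0.
have mde : m <= de by rewrite ge_min lexx.
have md : m <= d by rewrite ge_min lexx orbT.
clearbody m.
have cg w : `|w - w0| < r' -> forall t, s - m < t < s + m -> c w t = g w t.
  move=> /lt_min3[wr we we2].
  have ss0 : `|s - s| < d by rewrite subrr normr0.
  have [_ dgs _] := gA w we s ss0.
  apply: (geo_unique (t1 := s) (a := a)).
  - exact: itv_ball.
  - move=> t /andP[tl tr]; split.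
      exact: (fA w wr t (itv_widen tl tr mde s_0)).
    have td : `|t - s| < d.
      exact: dist_widen tl tr md.
    by have [] := gA w we t td.
  - exact: He2.
  - exact: dgs.
  - by rewrite gB.
have nearc w (t : R) : `|w - w0| < r' -> t <= s -> \forall u \near t, c w u = c' w u.
  move=> wr tles; apply: (dist_near m0) => u; rewrite ltr_norml => /andP[ul ur].
  rewrite /c'; case: leP => [//|us]; apply: (cg w wr).
  exact: dist_left us ur tles m0.
have nearg w (t : R) : s < t -> \forall u \near t, g w u = c' w u.
  move=> st_; have h : 0 < t - s by rewrite subr_gt0.
  apply: (dist_near h) => u; rewrite ltr_norml => /andP[ul ur].
  rewrite /c'; case: leP => [us|//].
  by case: (dist_right ul us).
pose de' := Num.min de (d - (s' - s)).
have de'0 : 0 < de' by rewrite lt_min de0 subr_gt0.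
have de'1 : de' <= de by rewrite ge_min lexx.
have de'2 : de' <= d - (s' - s) by rewrite ge_min lexx orbT.
clearbody de'.
have w0r : `|w0 - w0| < r' by rewrite subrr normr0.
have gd (t : R) : s < t -> t < s' + de' -> `|t - s| < d.
  by move=> h1 h2; exact: dist_shift h1 h2 de'2.
exists r', de', c'; split; [exact: r'0|exact: de'0|split].
- move=> w wr t /andP[tl tr]; have [wr1 we _] := lt_min3 wr.
  have [ts'|st_] := leP t s.
    apply: (geoat_eq (nearc w t wr ts')); apply: (fA w wr1).
    exact: itv_le tl ts' de'1 de0.
  apply: (geoat_eq (nearg w t st_)).
  by have [] := gA w we t (gd t st_ tr).
- move=> w wr; have [wr1 we _] := lt_min3 wr.
  rewrite -(near_st a0 (nearc w 0 wr s_0)) -(nbhs_singleton (nearc w 0 wr s_0)).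
  exact: fB.
- move=> t /andP[t0 ts']; have [tles|st_] := leP t s.
    rewrite -(nbhs_singleton (nearc w0 t w0r tles)).
    have [|E K] := fC t; first by rewrite t0.
    split; first exact: E.
    by move=> b bt; rewrite -(near_st b (nearc w0 t w0r tles)); exact: K.
  have tI : s <= t <= s' by rewrite ts' ltW.
  have w0e : `|w0 - w0| < e by rewrite subrr normr0.
  have gI (u : R) : s <= u <= s' ->
      [/\ geoin a (g w0) u & `|st a (g w0) u - s0| < r1].
    move=> /andP[su us'].
    have ud : `|u - s| < d.
      exact: dist_sub su us' sd.
    by have [ga da h] := gA w0 w0e u ud; split; [exact: ga|exact: h].
  (* [geo_unique] does not apply to c0, which is a two-sided geodesic only at times strictly between
     0 and 1. Its local extension X solves the equation on all of [s, s'], so uniqueness for the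
     differential equation is used instead. *)
  have K : st a (g w0) t = X t.
    apply: (HU (st a (g w0)) X s s' s); [exact: ss|exact: sd1| | | | | |exact: tI].
    - apply: derivable_within_continuous => u; rewrite in_itv /= => /gI[gu _].
      by have [] := is_derive_st gu.
    - apply: derivable_within_continuous => u; rewrite in_itv /= => uI.
      by have [_ _ u3 _] := near1 u uI; have [_ _ []] := HX u (u01 u uI) u3.
    - move=> u /andP[ul ur]; have uI : s <= u <= s' by rewrite !ltW.
      by have [gu h] := gI u uI; split; [exact: h|exact: is_derive_st].
    - move=> u /andP[ul ur]; have uI : s <= u <= s' by rewrite !ltW.
      have [_ _ u3 u4] := near1 u uI; split.
        by have := H4 u u4; rewrite lt_min => /andP[].
      by have [_ _] := HX u (u01 u uI) u3.
    - by rewrite (gB w0 w0e) (Ests a das).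
  have [_ _ t3 _] := near1 t tI; have [tta Et _] := HX t (u01 t tI) t3.
  have dat : dm a (c0 t) by case: tta.
  rewrite -(nbhs_singleton (nearg w0 t st_)).
  have [gt _] := gI t tI.
  have [E0 E2] := agree (u01 t tI) dat gt (etrans K (esym Et)).
  split; first exact: E0.
  by move=> b bt; rewrite -(near_st b (nearg w0 t st_)); exact: E2.
- move=> t /andP[tl tr] b; have [tles|st_] := leP t s.
    rewrite -(nbhs_singleton (nearc w0 t w0r tles)) => bt.
    have tI : - de < t < s + de.
      exact: itv_le tl tles de'1 de0.
    have [[e3 e30 H3] [L2 Q2]] := fD t tI b bt; split.
      exists (Num.min e3 r'); first by rewrite lt_min e30.
      move=> w; rewrite lt_min => /andP[we3 wr].
      by rewrite -(nbhs_singleton (nearc w t wr tles)); exact: H3.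
    exists L2; apply: (Qdiff_near r'0 _ Q2) => w wr.
    exact: near_st (nearc w t wr tles).
  rewrite -(nbhs_singleton (nearg w0 t st_)) => bt.
  have [[e3 e30 H3] [L2 Q2]] := gC t (gd t st_ tr) b bt; split.
    exists e3; first exact: e30.
    by move=> w we3; rewrite -(nbhs_singleton (nearg w t st_)); exact: H3.
  exists L2; apply: (Qdiff_near r'0 _ Q2) => w wr.
  exact: near_st (nearg w t st_).
Qed.

Theorem family_exists : exists (r d : R) (c : 'rV[R]_n -> R -> M), [/\ 0 < r, 0 < d & family 1 r d c].
Proof. exact: (real_induction (P := fam) ler01 fam0 fam_step). Qed.

End Family.

End Perturbation.

Lemma const_on_itv (R : realType) (f : R -> R) (al be s t : R) :
  (forall u : R, al < u < be -> is_derive u 1 f 0) -> al < s < be -> al < t < be ->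
  f s = f t.
Proof.
move=> H; wlog st : s t / s <= t.
  by move=> W sI tI; have [st|/ltW ts] := leP s t; [exact: W|exact/esym/W].
move=> /andP[s1 s2] /andP[t1 t2].
have D (u : R) : s <= u <= t -> is_derive u 1 f 0.
  by move=> /andP[su ut]; apply: H; rewrite (lt_le_trans s1 su) (le_lt_trans ut t2).
have [||u _] := @MVT_segment R f (fun=> 0) s t st.
- by move=> u; rewrite in_itv /= => /andP[/ltW su /ltW ut]; apply: D; rewrite su.
- apply: derivable_within_continuous => u; rewrite in_itv /= => uI.
  by have [] := D u uI.
by rewrite mul0r => /eqP; rewrite subr_eq0 => /eqP.
Qed.

Lemma itv_ballin (R : realType) (al be t : R) : al < t < be ->
  exists2 m : R, 0 < m & forall s, `|s - t| < m -> al < s < be.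
Proof.
move=> /andP[t1 t2]; exists (Num.min (t - al) (be - t)).
  by rewrite lt_min !subr_gt0 t1.
move=> s; rewrite lt_min !ltr_norml => /andP[/andP[s1 s2] /andP[s3 s4]].
by apply/andP; split; lra.
Qed.

(** * Jacobi fields as derivatives of families of geodesics *)

Section Jacobi.
Context {R : realType} {n : nat} (M : riemannianManifold R n).
Implicit Types (a b : atlas M) (z w : 'rV[R]_n) (x p q : M).

Local Notation crd a := (Defs.coord (chart_of a)).
Local Notation prm a := (param (chart_of a)).
Local Notation dm a := (dom (chart_of a)).
Local Notation T a b := (transition (chart_of a) (chart_of b)).

Lemma Vf_derive a (s u : 'rV[R]_(n + n)) : Ust a s ->
  is_derive s u (Vf a) (row_mx (rsubmx u)
    (- (DGam a (lsubmx u) (lsubmx s) (rsubmx s) (rsubmx s) +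
     (Gam a (lsubmx s) (rsubmx u) (rsubmx s) + Gam a (lsubmx s) (rsubmx s) (rsubmx u))))).
Proof.
move=> Us; have Dl := is_derive_lsubmx (is_derive_id s u).
have Dr := is_derive_rsubmx (is_derive_id s u).
have DG := is_derive_Gam (a := a) Us Dl Dr Dr.
have DN := @is_deriveN _ _ _ _ _ _ _ DG.
exact: is_derive_row_mx Dr DN.
Qed.

Definition energy (c : R -> M) (t : R) : R :=
  gG (index_at (c t)) (lc (index_at (c t)) c t) (lv (index_at (c t)) c t)
     (lv (index_at (c t)) c t).

Lemma energy_chart b (c : R -> M) (t : R) : geoat c t -> dm b (c t) ->
  energy c t = gG b (lc b c t) (lv b c t) (lv b c t).
Proof.
move=> g bt; have [oz nd du _] := g _ (index_atP (c t)).
have ot := ovl_coord (index_atP (c t)) bt oz.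
have [_ E] := lv_transition nd oz bt du.
rewrite /energy (gG_transition _ _ ot) -/(lc _ c t).
have -> : T (index_at (c t)) b (lc (index_at (c t)) c t) = lc b c t.
  by rewrite /lc transition_coord//; exact: index_atP.
have E' : lv b c t = lv (index_at (c t)) c t *m
  jac (T (index_at (c t)) b) (lc (index_at (c t)) c t) := E.
by rewrite -E'.
Qed.

Lemma energy_derive (c : R -> M) (t : R) : (\forall s \near t, geoat c s) ->
  is_derive t 1 (energy c) 0.
Proof.
move=> g; pose b := index_at (c t).
have bt : dm b (c t) by exact: index_atP.
have [oz nd du d2u] := nbhs_singleton g b bt.
have H := is_derive_gG oz (derivableP du) d2u d2u.
have H0 : is_derive t 1 (fun s => gG b (lc b c s) (lv b c s) (lv b c s)) 0.
  by apply: (is_derive_cast H); rewrite addNr /gG bf0l bf0r addr0.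
apply: near_eq_is_derive H0; apply: filterS2 g nd => s gs ds.
by rewrite (energy_chart gs ds).
Qed.

Section Family.
Variables (p : M) (a0 : atlas M) (c : 'rV[R]_n -> R -> M) (w0 z0 : 'rV[R]_n) (r d : R).
Hypotheses (r0 : 0 < r) (d0 : 0 < d).
Hypothesis fgeo : forall w, `|w - w0| < r -> forall t : R, - d < t < 1 + d -> geoat (c w) t.
Hypothesis finit : forall w, `|w - w0| < r -> dm a0 (c w 0) /\ st a0 (c w) 0 = row_mx z0 w.
Hypothesis fQ : forall t : R, - d < t < 1 + d -> forall b, dm b (c w0 t) ->
     (exists2 e : R, 0 < e & forall w, `|w - w0| < e -> dm b (c w t)) /\
     exists L, Qdiff w0 (fun w => st b (c w) t) L.

Let w0r : `|w0 - w0| < r. Proof. by rewrite subrr normr0. Qed.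

Let gnear w (t : R) : `|w - w0| < r -> - d < t < 1 + d ->
  \forall s \near t, geoat (c w) s.
Proof.
move=> wr tI; have [m m0 mP] := itv_ballin tI.
by apply: (dist_near m0) => s /mP; exact: fgeo.
Qed.

(** The hypotheses give differentiability in w at each time separately. How the derivative evolves
    in time is recovered by restarting the flow at t0 from the states of the family itself. *)
Lemma family_linear (t0 : R) b : - d < t0 < 1 + d -> dm b (c w0 t0) ->
  exists (e : R) (Lf : R -> 'M[R]_(n, n + n)), 0 < e /\
    forall s : R, `|s - t0| < e -> [/\ - d < s < 1 + d, dm b (c w0 s),
      Qdiff w0 (fun w => st b (c w) s) (Lf s) &
      is_derive s 1 Lf (Lf s *m jac (Vf b) (st b (c w0) s))].
Proof.
move=> tI bt.
have [[e1 e10 He1] [L QL]] := fQ tI bt.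
have gt := nbhs_singleton (geoat_near (gnear w0r tI) bt).
have Us : Ust b (st b (c w0) t0) by rewrite /Ust /= row_mxKl; case: gt.
have [d1 [r1 [d10 r10 H]]] := flow_family Us ltr01.
have sr : `|st b (c w0) t0 - st b (c w0) t0| < r1 by rewrite subrr normr0.
have [g [e [Lf [e0 gA gB _ gD]]]] := H t0 _ w0 L QL sr.
have [m m0 mP] := itv_ballin tI.
pose m' := Num.min m d1.
have m'0 : 0 < m' by rewrite lt_min m0.
have mm : m' <= m by rewrite ge_min lexx.
have md : m' <= d1 by rewrite ge_min lexx orbT.
pose rr := Num.min r (Num.min e e1).
have rr0 : 0 < rr by rewrite !lt_min r0 e0.
have cg w : `|w - w0| < rr -> forall s, t0 - m' < s < t0 + m' -> c w s = g w s.
  move=> /lt_min3[wr we we1].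
  have tt : `|t0 - t0| < d1 by rewrite subrr normr0.
  have [_ dg _] := gA w we t0 tt.
  apply: (geo_unique (t1 := t0) (a := b)).
  - exact: itv_ball.
  - move=> s /andP[s1 s2]; split.
      by apply: fgeo => //; apply: mP; exact: dist_widen s1 s2 mm.
    by have [] := gA w we s (dist_widen s1 s2 md).
  - exact: He1.
  - exact: dg.
  - by rewrite gB.
have near_cg w (s : R) : `|w - w0| < rr -> `|s - t0| < m' ->
    \forall u \near s, g w u = c w u.
  move=> wr; rewrite ltr_distl => sI.
  have [m2 m20 m2P] := itv_ballin sI.
  by apply: (dist_near m20) => u /m2P /(cg w wr) ->.
exists m', Lf; split; first exact: m'0.
move=> s sm.
have sI : - d < s < 1 + d by apply/mP/(lt_le_trans sm).
have sd : `|s - t0| < d1 by apply: lt_le_trans md.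
have w0rr : `|w0 - w0| < rr by rewrite subrr normr0.
have w0e : `|w0 - w0| < e by rewrite subrr normr0.
have [QD dL] := gD s sd.
have N := near_cg w0 s w0rr sm.
have [_ dg _] := gA w0 w0e s sd.
split; [exact: sI|by rewrite -(nbhs_singleton N)| |].
  apply: (Qdiff_near rr0 _ QD) => w wr.
  exact: near_st (near_cg w s wr sm).
by rewrite -(near_st b N).
Qed.

(* components in the chart b of the variation field in the direction eta, and
   their time derivatives *)
Definition Jf b (eta : 'rV[R]_n) (t : R) : 'rV[R]_n := 'D_eta (fun w => lc b (c w) t) w0.
Definition Kf b (eta : 'rV[R]_n) (t : R) : 'rV[R]_n := 'D_eta (fun w => lv b (c w) t) w0.

Lemma Qdiff_JK b (t : R) L eta : Qdiff w0 (fun w => st b (c w) t) L ->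
  [/\ is_derive w0 eta (fun w => lc b (c w) t) (Jf b eta t),
   is_derive w0 eta (fun w => lv b (c w) t) (Kf b eta t) &
   eta *m L = row_mx (Jf b eta t) (Kf b eta t)].
Proof.
move=> /(Qdiff_derive eta) D.
have D1 : is_derive w0 eta (fun w => lc b (c w) t) (lsubmx (eta *m L)).
  have := is_derive_lsubmx D; congr is_derive.
  by apply/funext => w; rewrite row_mxKl.
have D2 : is_derive w0 eta (fun w => lv b (c w) t) (rsubmx (eta *m L)).
  have := is_derive_rsubmx D; congr is_derive.
  by apply/funext => w; rewrite row_mxKr.
have E1 : Jf b eta t = lsubmx (eta *m L) by have [_] := D1.
have E2 : Kf b eta t = rsubmx (eta *m L) by have [_] := D2.
by rewrite E1 E2 hsubmxK.
Qed.

(** The geodesic equation linearised in coordinates; [Riem_alg] gives it its covariant form. *)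
Lemma J_ode b eta (t : R) : - d < t < 1 + d -> dm b (c w0 t) ->
  let z := lc b (c w0) t in let v := lv b (c w0) t in
  is_derive t 1 (Jf b eta) (Kf b eta t) /\
  is_derive t 1 (Kf b eta) (- (DGam b (Jf b eta t) z v v +
     (Gam b z (Kf b eta t) v + Gam b z v (Kf b eta t)))).
Proof.
move=> tI bt z v.
have [e [Lf [e0 H]]] := family_linear tI bt.
have tt : `|t - t| < e by rewrite subrr normr0.
have gt := nbhs_singleton (geoat_near (gnear w0r tI) bt).
have Us : Ust b (st b (c w0) t) by rewrite /Ust /= row_mxKl; case: gt.
have E s : `|s - t| < e -> eta *m Lf s = row_mx (Jf b eta s) (Kf b eta s).
  by move=> /H[_ _ Q _]; have [_ _ ->] := Qdiff_JK eta Q.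
have [_ _ _ dL] := H t tt.
have D := is_derive_mulmx (is_derive_cst eta t (1:R)) dL.
have D2 : is_derive t 1 (fun s => eta *m Lf s) (row_mx (Kf b eta t)
    (- (DGam b (Jf b eta t) z v v +
     (Gam b z (Kf b eta t) v + Gam b z v (Kf b eta t))))).
  apply: (is_derive_cast D); rewrite mul0mx add0r mulmxA E//.
  rewrite (jac_mul _ (Ust_open b) (Vf_Ck 1 b) Us).
  have [_ ->] := Vf_derive (row_mx (Jf b eta t) (Kf b eta t)) Us.
  by rewrite /st !row_mxKl !row_mxKr.
split.
  have := is_derive_lsubmx D2; rewrite row_mxKl; apply: near_eq_is_derive.
  by apply: (dist_near e0) => s sd; rewrite E// row_mxKl.
have := is_derive_rsubmx D2; rewrite row_mxKr; apply: near_eq_is_derive.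
by apply: (dist_near e0) => s sd; rewrite E// row_mxKr.
Qed.

Lemma J_transition b b' eta (t : R) : - d < t < 1 + d -> dm b (c w0 t) -> dm b' (c w0 t) ->
  Jf b' eta t = Jf b eta t *m jac (T b b') (lc b (c w0) t).
Proof.
move=> tI bt bt'.
have [[e1 e10 He1] [L QL]] := fQ tI bt.
have [D1 _ _] := Qdiff_JK eta QL.
have gt := nbhs_singleton (geoat_near (gnear w0r tI) bt).
have [oz _ _ _] := gt.
have ot : ovl b b' (lc b (c w0) t) by exact: ovl_coord.
have D := @is_derive_mxcomp _ _ _ _ _ (T b b') (ovl b b') (fun w => lc b (c w) t) w0 eta
  _ (ovl_open b b') (transition_Ck 1 b b') ot D1.
have [_ E] := is_derive_transition (Jf b eta t) ot.
rewrite -E; have [_ <-] := D; apply: near_eq_derive.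
apply/nbhs_ballP; exists e1 => // w; rewrite -ball_normE /= distrC => we.
by rewrite /lc transition_coord//; exact: He1.
Qed.

Lemma J_init eta : Jf a0 eta 0 = 0 /\ Kf a0 eta 0 = eta.
Proof.
have E w : `|w - w0| < r -> lc a0 (c w) 0 = z0 /\ lv a0 (c w) 0 = w.
  by move=> /finit[_ /eq_row_mx].
split.
  apply: etrans (derive_cst z0 w0 eta); apply: near_eq_derive.
  apply/nbhs_ballP; exists r => // w; rewrite -ball_normE /= distrC => wr.
  by have [-> _] := E w wr.
apply: etrans (derive_id w0 eta); apply: near_eq_derive.
apply/nbhs_ballP; exists r => // w; rewrite -ball_normE /= distrC => wr.
by have [_ ->] := E w wr.
Qed.

End Family.

End Jacobi.

(** * Hyperbolic functions and comparison *)

Section Hyperbolic.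
Context {R : realType}.
Implicit Types (x t : R).

Lemma is_derive_comp1 (V : normedModType R) (g : V -> R) (f : R -> R) (y w : V) dg df :
  is_derive y w g dg -> is_derive (g y) (1:R) f df ->
  is_derive y w (fun y => f (g y)) (dg * df).
Proof.
move=> Hg Hf.
have df' : differentiable f (g y) by apply/derivable1_diffP; exact: ex_derive.
have D := is_derive_comp Hg df'.
have E : 'D_dg f (g y) = dg * df.
  have /(is_derive_scale dg)[_] := Hf.
  by have -> : dg *: (1 : R) = dg by exact: mulr1.
by rewrite -E.
Qed.

Definition ch x : R := (expR x + expR (- x)) / 2.
Definition sh x : R := (expR x - expR (- x)) / 2.

Let expN x : expR x * expR (- x) = 1.
Proof. by rewrite -expRD subrr expR0. Qed.

Lemma chsh x : ch x ^+ 2 - sh x ^+ 2 = 1.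
Proof. rewrite /ch /sh; have := expN x; nra. Qed.

Lemma ch_ge1 x : 1 <= ch x.
Proof.
rewrite /ch; have h := expN x; have p := expR_gt0 x; have q := expR_gt0 (- x).
move: h p q; set u := expR x; set w := expR (- x) => h p q.
have d := sqr_ge0 (u - w).
have s0 : 0 <= u + w by rewrite addr_ge0// ltW.
by rewrite ler_pdivlMr// mul1r -(@ler_pXn2r _ 2) ?nnegrE//; nra.
Qed.

Lemma ch_gt0 x : 0 < ch x. Proof. exact: lt_le_trans ltr01 (ch_ge1 x). Qed.

Lemma sh0 : sh 0 = 0. Proof. by rewrite /sh oppr0 subrr mul0r. Qed.
Lemma ch0 : ch 0 = 1. Proof. by rewrite /ch oppr0 expR0; lra. Qed.

Lemma sh_gt0 x : 0 < x -> 0 < sh x.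
Proof.
by move=> x0; rewrite /sh divr_gt0// subr_gt0 ltr_expR; lra.
Qed.

Lemma is_derive_exp x : is_derive x (1:R) (@expR R) (expR x).
Proof. exact: is_derive_expR. Qed.

Let dexpN x : is_derive x (1:R) (fun x => expR (- x)) (- expR (- x)).
Proof.
have := @is_derive_comp1 R (fun x => - x) (@expR R) x 1 (- 1) _ _ (is_derive_exp (- x)).
by rewrite mulN1r; apply; exact: is_deriveNid.
Qed.

Lemma is_derive_ch x : is_derive x (1:R) ch (sh x).
Proof.
have D := is_deriveD (is_derive_exp x) (dexpN x).
have := @is_deriveZ _ _ _ _ 2^-1 x 1 _ D; rewrite /GRing.scale /=.
have -> : 2^-1 * (expR x + - expR (- x)) = sh x by rewrite /sh mulrC.
by congr is_derive; apply/funext => y; rewrite /ch mulrC.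
Qed.

Lemma is_derive_sh x : is_derive x (1:R) sh (ch x).
Proof.
have D := is_deriveB (is_derive_exp x) (dexpN x).
have := @is_deriveZ _ _ _ _ 2^-1 x 1 _ D; rewrite /GRing.scale /=.
have -> : 2^-1 * (expR x - - expR (- x)) = ch x by rewrite /ch opprK mulrC.
by congr is_derive; apply/funext => y; rewrite /sh mulrC.
Qed.

Lemma is_derive_affine (a b t : R) : is_derive t (1:R) (fun t => a * t + b) a.
Proof.
have D := @is_deriveZ _ _ _ _ a t 1 _ (is_derive_id t (1:R)).
have D2 := is_deriveD D (is_derive_cst b t (1:R)).
by apply: (is_derive_eq (f := fun t => a * t + b) D2); rewrite addr0; exact: mulr1.
Qed.

Lemma is_derive_ch_affine (a b t : R) :
  is_derive t (1:R) (fun t => ch (a * t + b)) (a * sh (a * t + b)).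
Proof. exact: is_derive_comp1 (is_derive_affine a b t) (is_derive_ch _). Qed.

Lemma is_derive_sh_affine (a b t : R) :
  is_derive t (1:R) (fun t => sh (a * t + b)) (a * ch (a * t + b)).
Proof. exact: is_derive_comp1 (is_derive_affine a b t) (is_derive_sh _). Qed.

Lemma is_derive_mul (f g : R -> R) (t : R) df dg : is_derive t (1:R) f df ->
  is_derive t (1:R) g dg -> is_derive t (1:R) (fun t => f t * g t) (df * g t + f t * dg).
Proof.
move=> D1 D2; have D := is_deriveM D1 D2.
by apply: (is_derive_eq (f := fun t => f t * g t) D); rewrite addrC [_ *: df]mulrC.
Qed.

Lemma is_derive_sub (f g : R -> R) (t : R) df dg : is_derive t (1:R) f df ->
  is_derive t (1:R) g dg -> is_derive t (1:R) (fun t => f t - g t) (df - dg).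
Proof. by move=> D1 D2; exact: is_deriveB D1 D2. Qed.

Lemma is_derive_add (f g : R -> R) (t : R) df dg : is_derive t (1:R) f df ->
  is_derive t (1:R) g dg -> is_derive t (1:R) (fun t => f t + g t) (df + dg).
Proof. by move=> D1 D2; exact: is_deriveD D1 D2. Qed.

Lemma is_derive_scal (f : R -> R) (c t : R) df : is_derive t (1:R) f df ->
  is_derive t (1:R) (fun t => c * f t) (c * df).
Proof. by move=> D; exact: (@is_deriveZ _ _ _ f c t 1 _ D). Qed.

Lemma derive_continuous (f : R -> R) (t : R) df : is_derive t (1:R) f df ->
  {for t, continuous f}.
Proof.
by move=> [d _]; apply: differentiable_continuous; apply/derivable1_diffP.
Qed.

Lemma nondecr (f df : R -> R) (a b : R) : a <= b -> {within `[a, b], continuous f} ->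
  (forall t : R, a < t < b -> is_derive t (1:R) f (df t) /\ 0 <= df t) -> f a <= f b.
Proof.
rewrite le_eqVlt => /predU1P[<-//|ab] cf H.
have [|//|u] := @MVT R f df a b ab.
  by move=> u; rewrite in_itv /= => /H[].
rewrite in_itv /= => /H[_ h] E.
by rewrite -subr_ge0 E mulr_ge0// subr_ge0 ltW.
Qed.

Lemma within_nondecr (f df : R -> R) (a b : R) : a <= b ->
  (forall t : R, a <= t <= b -> is_derive t (1:R) f (df t) /\ 0 <= df t) -> f a <= f b.
Proof.
move=> ab H; apply: (nondecr ab (df := df)).
  apply: derivable_within_continuous => t; rewrite in_itv /= => /H[[]] //.
by move=> t /andP[at_ tb]; apply: H; rewrite !ltW.
Qed.

(* phi = |J|^2 and chi = <J, J'> for a Jacobi field J, whose tangential part has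
   square norm Q t^2. The quotient of the normal parts is compared with
   kap coth (kap (t + e)), which is regular at t = 0, and then e tends to 0. *)
Lemma jacobi_bound (phi chi dchi : R -> R) (Q kap : R) : 0 < kap ->
  (forall t : R, 0 <= t <= 1 -> is_derive t (1:R) phi (2 * chi t)) ->
  (forall t : R, 0 <= t <= 1 -> is_derive t (1:R) chi (dchi t)) ->
  (forall t : R, 0 <= t <= 1 -> forall h,
    2 * h * chi t - h ^+ 2 * phi t + Q * (1 - h * t) ^+ 2
      + kap ^+ 2 * (phi t - Q * t ^+ 2) <= dchi t) ->
  phi 0 = 0 -> chi 0 = 0 ->
  kap * ch kap * (phi 1 - Q) <= sh kap * (chi 1 - Q).
Proof.
move=> k0 dphi dc H phi0 chi0.
have step e : 0 < e -> 0 <= sh (kap * e + kap) * (chi 1 - Q)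
    - kap * ch (kap * e + kap) * (phi 1 - Q).
  move=> e0.
  pose S t := sh (kap * t + kap * e); pose C t := ch (kap * t + kap * e).
  have Sp (t : R) : 0 <= t -> 0 < S t.
    move=> t0; apply: sh_gt0; have k1 : 0 < kap * e by rewrite mulr_gt0.
    by apply: ltr_wpDl k1; rewrite mulr_ge0// ltW.
  (* [h] solves the Riccati equation h' = kap ^+ 2 - h ^+ 2. *)
  pose h t := kap * C t / S t.
  have dh (t : R) : 0 <= t -> is_derive t (1:R) h (kap ^+ 2 - h t ^+ 2).
    move=> t0; have S0 : S t != 0 by rewrite gt_eqF// Sp.
    have dS := is_derive_sh_affine kap (kap * e) t.
    have dC := is_derive_ch_affine kap (kap * e) t.
    have dV : is_derive t (1:R) (fun t => (S t)^-1) (- (S t) ^- 2 * (kap * C t)).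
      have [dS1 dS2] := dS.
      split; first exact: derivableV.
      by rewrite (deriveV S0 dS1) dS2.
    have D := is_derive_mul (is_derive_scal kap dC) dV.
    apply: (is_derive_eq (f := h) D).
    have cs := chsh (kap * t + kap * e).
    rewrite -/(S t) -/(C t) /h in cs *.
    have -> : kap ^+ 2 = kap ^+ 2 * (C t ^+ 2 - S t ^+ 2) by rewrite cs mulr1.
    by rewrite -exprVn; have : S t * (S t)^-1 = 1 := mulfV S0; move: (S t)^-1 => V VE; nra.
  (* The hypothesis taken at [h t] says exactly that the derivative of [Y] at t is nonnegative. *)
  pose Y t := chi t - Q * t - h t * (phi t - Q * t ^+ 2).
  have dQ t : is_derive t (1:R) (fun t => Q * t) Q.
    by have := is_derive_affine Q 0 t; congr is_derive; apply/funext => u; rewrite addr0.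
  have dQ2 t : is_derive t (1:R) (fun t => Q * t ^+ 2) (Q * (2 * t)).
    apply: is_derive_scal; have D := is_derive_mul (is_derive_id t (1:R)) (is_derive_id t (1:R)).
    have : is_derive t (1:R) (fun t => t * t) (2 * t).
      by apply: (is_derive_cast D); rewrite /=; lra.
    by [].
  have dY (t : R) : 0 <= t <= 1 -> is_derive t (1:R) Y
     (dchi t - Q - ((kap ^+ 2 - h t ^+ 2) * (phi t - Q * t ^+ 2) + h t * (2 * chi t - Q * (2 * t)))).
    move=> tI; have t0 : 0 <= t by case/andP: tI.
    have D1 := is_derive_sub (is_derive_sub (dc t tI) (dQ t)) (is_derive_mul (dh t t0)
      (is_derive_sub (dphi t tI) (dQ2 t))).
    exact: D1.
  have Y01 : Y 0 <= Y 1.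
    apply: (within_nondecr ler01 (df := _)) => t tI; split; first exact: dY.
    by have := H t tI (h t); move: (h t) => ht; nra.
  have Y0 : Y 0 = 0 by rewrite /Y phi0 chi0; ring.
  have S1 := Sp 1 ler01.
  have ES : S 1 = sh (kap * e + kap) by rewrite /S mulr1 addrC.
  have EC : C 1 = ch (kap * e + kap) by rewrite /C mulr1 addrC.
  rewrite -ES -EC; set s := S 1 in S1 *; set c := C 1.
  have Y1 : 0 <= chi 1 - Q - kap * c / s * (phi 1 - Q).
    by move: Y01; rewrite Y0 /Y /h -/s -/c expr1n !mulr1.
  have : 0 <= s * (chi 1 - Q - kap * c / s * (phi 1 - Q)).
    by apply: mulr_ge0 Y1; exact: ltW.
  suff -> : s * (chi 1 - Q - kap * c / s * (phi 1 - Q)) =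
     s * (chi 1 - Q) - kap * c * (phi 1 - Q) by [].
  have sn : s != 0 by rewrite gt_eqF.
  by field.
rewrite leNgt -subr_lt0; apply/negP => neg.
pose F e := sh (kap * e + kap) * (chi 1 - Q) - kap * ch (kap * e + kap) * (phi 1 - Q).
have cF : {for 0, continuous F}.
  have D1 := is_derive_mul (is_derive_sh_affine kap kap 0) (is_derive_cst (chi 1 - Q) 0 (1:R)).
  have D2 := is_derive_mul (is_derive_scal kap (is_derive_ch_affine kap kap 0))
    (is_derive_cst (phi 1 - Q) 0 (1:R)).
  exact: derive_continuous (is_derive_sub D1 D2).
have F0 : F 0 < 0 by rewrite /F mulr0 add0r.
have n0 : 0 < - F 0 by rewrite oppr_gt0.
have [r r0 rP] := cvg_normP cF n0.
have r2 : 0 < r / 2 by rewrite divr_gt0.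
have rr : `|r / 2 - 0| < r by rewrite subr0 gtr0_norm// ltr_pdivrMr// ltr_pMr ?ltr1n.
have := rP _ rr; have := step _ r2; rewrite -/(F (r / 2)) ltr_norml => h1 /andP[_ h2].
by lra.
Qed.

End Hyperbolic.

Section Hyperbolic.
Context {R : realType}.

Lemma derive_quotient (f : R -> R) (t d e : R) : is_derive t (1:R) f d -> 0 < e ->
  exists2 r, 0 < r & forall h : R, h != 0 -> `|h| < r ->
    `|d - h^-1 * (f (h + t) - f t)| < e.
Proof.
move=> [df <-] e0.
have C : h^-1 *: (f (h *: (1:R) + t) - f t) @[h --> 0^'] --> 'D_(1:R) f t := df.
have /cvgrPdist_lt /(_ e e0) /nbhs_ballP[r r0 rP] := C.
exists r => // h hn hr; have := rP h.
rewrite -ball_normE /= sub0r normrN => /(_ hr hn).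
by have -> : h *: (1 : R) = h by exact: mulr1.
Qed.

Lemma is_derive_ge0 (f : R -> R) (t d del : R) : 0 < del -> is_derive t (1:R) f d ->
  (forall s : R, t < s < t + del -> f t <= f s) -> 0 <= d.
Proof.
move=> del0 D H; rewrite leNgt; apply/negP => n0.
have e0 : 0 < - d by rewrite oppr_gt0.
have [r r0 rP] := derive_quotient D e0.
pose h := Num.min r del / 2.
have m0 : 0 < Num.min r del by rewrite lt_min r0.
have h0 : 0 < h by rewrite divr_gt0.
have hm : h < Num.min r del by rewrite ltr_pdivrMr// ltr_pMr// ltr1n.
have [hr hd] : h < r /\ h < del by move: hm; rewrite lt_min => /andP.
have := rP h (lt0r_neq0 h0); rewrite gtr0_norm// => /(_ hr).
have ht : t < h + t < t + del by rewrite ltrDr h0 addrC ltrD2l.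
have := H _ ht; rewrite -subr_ge0 => H1.
have : 0 <= h^-1 * (f (h + t) - f t) by rewrite mulr_ge0// invr_ge0 ltW.
move=> q; rewrite ltr_norml => /andP[h1 _]; lra.
Qed.

Lemma is_derive_gt0 (f : R -> R) (t d : R) : is_derive t (1:R) f d -> 0 < d ->
  exists2 r, 0 < r & forall s : R, t < s < t + r -> f t < f s.
Proof.
move=> D d0; have [r r0 rP] := derive_quotient D d0.
exists r => // s /andP[ts sr].
have h0 : 0 < s - t by rewrite subr_gt0.
have := rP (s - t) (lt0r_neq0 h0); rewrite subrK gtr0_norm// ltrBlDl => /(_ sr).
rewrite ltr_norml => /andP[_ h1].
have : 0 < (s - t)^-1 * (f s - f t) by lra.
by rewrite pmulr_rgt0 ?invr_gt0// subr_gt0.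
Qed.

(** Maximum principle: at a positive interior maximum s, f1 vanishes and f2 is positive, so f1 is
    positive just after s and f exceeds its maximum. *)
Lemma convex_max (f f1 f2 : R -> R) (kap : R) : 0 < kap ->
  {within `[0, 1], continuous f} ->
  (forall t : R, 0 < t < 1 -> [/\ is_derive t (1:R) f (f1 t),
     is_derive t (1:R) f1 (f2 t) & kap ^+ 2 * f t <= f2 t]) ->
  f 0 <= 0 -> f 1 <= 0 -> forall t : R, 0 <= t <= 1 -> f t <= 0.
Proof.
move=> k0 cf H f0 f1_ t tI.
have [s + smax] := EVT_max ler01 cf; rewrite in_itv /= => /andP[s0 s1].
suff fs : f s <= 0 by apply: le_trans fs; apply: smax; rewrite in_itv.
rewrite leNgt; apply/negP => fs.
have s0' : 0 < s by rewrite lt_neqAle s0 andbT; apply: contraTneq fs => <-; rewrite -leNgt.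
have s1' : s < 1 by rewrite lt_neqAle s1 andbT; apply: contraTneq fs => ->; rewrite -leNgt.
have sI : 0 < s < 1 by rewrite s0'.
have [D1 D2 K] := H s sI.
have f1s : f1 s = 0.
  have := @derive1_at_max R f 0 1 s ler01.
  have dI : {in `]0, 1[, forall u : R, derivable f u 1}.
    by move=> u; rewrite in_itv /= => /H[[]].
  move=> /(_ dI); rewrite in_itv /= sI => /(_ isT) E.
  have [_ <-] := D1; have [|_ <-//] := E.
  by move=> u; rewrite in_itv /= => /andP[/ltW u0 /ltW u1]; apply: smax; rewrite in_itv /= u0.
have f2s : 0 < f2 s by apply: lt_le_trans K; rewrite mulr_gt0 ?exprn_gt0.
have [r r0 rP] := is_derive_gt0 D2 f2s; rewrite f1s in rP.
have m0 : 0 < Num.min r (1 - s) by rewrite lt_min r0 subr_gt0.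
pose h := Num.min r (1 - s) / 2.
have hm : h < Num.min r (1 - s) by rewrite ltr_pdivrMr// ltr_pMr// ltr1n.
have [hr h1] : h < r /\ h < 1 - s by move: hm; rewrite lt_min => /andP.
have h0 : 0 < h by rewrite divr_gt0.
clearbody h; pose u := s + h.
have su : s < u by rewrite ltrDl.
have u1 : u < 1 by rewrite /u -ltrBrDl.
have ur : u < s + r by rewrite ltrD2l.
have [||w] := @MVT R f f1 s u su.
- move=> w; rewrite in_itv /= => /andP[sw wu].
  by have [] := H w; rewrite ?(lt_trans s0' sw) ?(lt_trans wu u1).
- apply: continuous_subspaceW cf => w /=; rewrite !in_itv /= => /andP[sw wu].
  by rewrite (le_trans s0 sw) (le_trans wu (ltW u1)).
rewrite in_itv /= => /andP[sw wu] E.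
have fw : 0 < f1 w by apply: rP; rewrite sw (lt_trans wu ur).
have : f u <= f s by apply: smax; rewrite in_itv /= (le_trans s0 (ltW su)) ltW.
by apply/negP; rewrite -ltNge -subr_gt0 E mulr_gt0// subr_gt0.
Qed.

Lemma is_derive_lin (g : R -> R) (t d c : R) : is_derive t (1:R) g d ->
  is_derive t (1:R) (fun t => g t * c) (d * c).
Proof.
move=> D; have D' := is_derive_scal c D.
have -> : (fun t => g t * c) = (fun t => c * g t) by apply/funext => u; rewrite mulrC.
by rewrite mulrC.
Qed.

Lemma derivable_within (f : R -> R) (df : R -> R) (a b : R) :
  (forall t : R, is_derive t (1:R) f (df t)) -> {within `[a, b], continuous f}.
Proof. by move=> D; apply: derivable_within_continuous => t _; have [] := D t. Qed.

Lemma sinh_convex (f f1 f2 : R -> R) (kap : R) : 0 < kap ->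
  {within `[0, 1], continuous f} ->
  (forall t : R, 0 < t < 1 -> [/\ is_derive t (1:R) f (f1 t),
     is_derive t (1:R) f1 (f2 t) & kap ^+ 2 * f t <= f2 t]) ->
  forall t : R, 0 <= t <= 1 ->
  f t * sh kap <= f 0 * sh (- kap * t + kap) + f 1 * sh (kap * t + 0).
Proof.
move=> k0 cf H t tI.
(* [g] solves g'' = kap ^+ 2 * g and equals [f * sh kap] at both ends, so [convex_max] applies to
   the difference. The factor [sh kap] avoids a division. *)
pose g (t : R) := sh (- kap * t + kap) * f 0 + sh (kap * t + 0) * f 1.
pose g1 (t : R) := - kap * ch (- kap * t + kap) * f 0 + kap * ch (kap * t + 0) * f 1.
have dg (s : R) : is_derive s (1:R) g (g1 s).
  exact: is_derive_add (is_derive_lin _ (is_derive_sh_affine _ _ s))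
    (is_derive_lin _ (is_derive_sh_affine _ _ s)).
have dg1 (s : R) : is_derive s (1:R) g1 (kap ^+ 2 * g s).
  have D := is_derive_add
     (is_derive_lin (f 0) (is_derive_scal (- kap) (is_derive_ch_affine (- kap) kap s)))
     (is_derive_lin (f 1) (is_derive_scal kap (is_derive_ch_affine kap 0 s))).
  by apply: (is_derive_cast D); rewrite /g; ring.
have := @convex_max (fun t => f t * sh kap - g t) (fun t => f1 t * sh kap - g1 t)
  (fun t => f2 t * sh kap - kap ^+ 2 * g t) kap k0 _ _ _ _ t tI.
have Eg : f 0 * sh (- kap * t + kap) + f 1 * sh (kap * t + 0) = g t.
  by rewrite /g; ring.
move=> X; rewrite Eg -subr_le0.
have shk := sh_gt0 k0.
apply: X.
- have cg := @derivable_within g g1 0 1 dg.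
  move=> s; apply: cvgB; last exact: cg.
  by apply: cvgM; [exact: cf|exact: cvg_cst].
- move=> s sI; have [D1 D2 K] := H s sI; split.
  + exact: is_derive_sub (is_derive_lin _ D1) (dg s).
  + exact: is_derive_sub (is_derive_lin _ D2) (dg1 s).
  + by rewrite mulrBr lerD2r mulrA ler_wpM2r// ltW.
- by rewrite /g !mulr0 !add0r sh0 mul0r addr0 mulrC subrr.
- by rewrite /g !mulr1 addNr sh0 mul0r add0r addr0 mulrC subrr.
Qed.

(** f need not be derivable at 0; the quadratic lower bound stands for f' 0 >= 0. The function [F]
    vanishes at 0 and is nonnegative just after, so its derivative there, kap * (f 1 - f 0 * ch
    kap), is nonnegative. *)
Lemma cosh_growth (f : R -> R) (kap C del : R) : 0 < del -> del <= 1 ->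
  (forall t : R, 0 <= t <= 1 ->
    f t * sh kap <= f 0 * sh (- kap * t + kap) + f 1 * sh (kap * t + 0)) ->
  0 < kap ->
  (forall t : R, 0 < t < del -> f 0 - C * t ^+ 2 <= f t) -> f 0 * ch kap <= f 1.
Proof.
move=> del0 del1 H k0 L.
pose F (t : R) := sh (- kap * t + kap) * f 0 + sh (kap * t + 0) * f 1
   + (t * t) * (C * sh kap) - f 0 * sh kap.
have shk := sh_gt0 k0.
have F0 : F 0 = 0 by rewrite /F !mulr0 !add0r sh0 !mul0r !addr0 mulrC subrr.
have D := is_derive_sub (is_derive_add (is_derive_add
   (is_derive_lin (f 0) (is_derive_sh_affine (- kap) kap 0))
   (is_derive_lin (f 1) (is_derive_sh_affine kap 0 0)))
   (is_derive_lin (C * sh kap) (is_derive_mul (is_derive_id 0 (1:R)) (is_derive_id 0 (1:R)))))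
   (is_derive_cst (f 0 * sh kap) 0 (1:R)).
have : 0 <= kap * (f 1 - f 0 * ch kap).
  have E := is_derive_ge0 del0 D.
  have : forall s : R, 0 < s < 0 + del -> F 0 <= F s.
    move=> s; rewrite add0r => /andP[s0 sd].
    have sI : 0 <= s <= 1 by rewrite ltW//= (le_trans (ltW sd)).
    have := H s sI; have := L s; rewrite s0 sd => /(_ isT) l.
    have : (f 0 - C * s ^+ 2) * sh kap <= f s * sh kap by rewrite ler_wpM2r// ltW.
    rewrite F0 /F; set X := sh (_ + kap); set Y := sh (_ + 0); lra.
  move=> /E; rewrite ?mulr0 ?add0r ?mul0r ch0; lra.
by rewrite pmulr_rge0// subr_ge0.
Qed.

Lemma ch_le (x y : R) : 0 <= x -> 0 <= y -> (ch x <= ch y) = (x <= y).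
Proof.
have mono (u w : R) : 0 <= u -> u <= w -> ch u <= ch w.
  move=> u0 uw; apply: (within_nondecr uw (df := sh)) => t /andP[ut _].
  split; first exact: is_derive_ch.
  have := le_trans u0 ut; rewrite le_eqVlt => /predU1P[<-|/sh_gt0/ltW//].
  by rewrite sh0.
have smono (u w : R) : 0 <= u -> u < w -> ch u < ch w.
  move=> u0 uw.
  have [||t] := @MVT R ch sh u w uw.
  - by move=> t _; exact: is_derive_ch.
  - by apply: derivable_within_continuous => t _; have [] := is_derive_ch t.
  rewrite in_itv /= => /andP[ut _] E; rewrite -subr_gt0 E mulr_gt0 ?subr_gt0//.
  by apply: sh_gt0; exact: le_lt_trans ut.
move=> x0 y0; have [xy|yx] := leP x y; first exact: mono.
by apply/negbTE; rewrite -ltNge; exact: smono.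
Qed.

Lemma ch_tangent (x y : R) : ch x + sh x * (y - x) <= ch y.
Proof.
pose g (t : R) := ch (1 * t + 0) - (sh x * t + (ch x - sh x * x)).
have dg (t : R) : is_derive t (1:R) g (1 * sh (1 * t + 0) - sh x).
  exact: is_derive_sub (is_derive_ch_affine _ _ t) (is_derive_affine _ _ t).
have smono (u w : R) : u <= w -> sh u <= sh w.
  move=> uw; apply: (within_nondecr uw (df := ch)) => t _.
  by split; [exact: is_derive_sh|exact/ltW/ch_gt0].
have gx : g x = 0 by rewrite /g mul1r addr0; ring.
suff : g x <= g y by rewrite gx /g mul1r addr0; lra.
have [xy|/ltW yx] := leP x y.
  apply: (within_nondecr xy (df := _)) => t /andP[xt _]; split; first exact: dg.
  by rewrite subr_ge0 !mul1r addr0 smono.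
suff : - g y <= - g x by lra.
apply: (within_nondecr yx (f := fun t => - g t)
  (df := fun t => - (1 * sh (1 * t + 0) - sh x))) => t /andP[_ tx].
split; first exact: is_deriveN (dg t).
by rewrite oppr_ge0 subr_le0 !mul1r addr0 smono.
Qed.

Lemma sqrt2_gt0 : 0 < Num.sqrt (2 : R). Proof. by rewrite sqrtr_gt0. Qed.

(** The exponential of k * r0 is sqrt 2 + 1, whose inverse is sqrt 2 - 1; their mean is sqrt 2. *)
Lemma ch_r0 (k : R) : 0 < k -> ch (k * (k^-1 * ln (Num.sqrt 2 + 1))) = Num.sqrt 2.
Proof.
move=> k0; rewrite mulrA mulfV ?gt_eqF// mul1r.
have s0 := sqrt2_gt0; have s2 : Num.sqrt 2 ^+ 2 = 2 :> R by rewrite sqr_sqrtr.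
have p0 : 0 < Num.sqrt 2 + 1 :> R by rewrite addr_gt0.
rewrite /ch expRN lnK ?posrE//.
have -> : (Num.sqrt 2 + 1 : R)^-1 = Num.sqrt 2 - 1.
  by apply: (mulfI (lt0r_neq0 p0)); rewrite mulfV ?gt_eqF//; move: s2; set s := Num.sqrt 2 => s2; nra.
by set s := Num.sqrt 2; field.
Qed.

(** The square of the minimum is P * Q = 2 * A * B * ch kap - A ^+ 2 - B ^+ 2. It is at most 2 * A *
    B * (ch kap - 1), hence at most 2 * (ch kap + 1) * (ch kap - 1) = 2 * sh kap ^+ 2. *)
Lemma sinh_min (A B kap : R) : 0 < kap -> 1 <= A -> 1 <= B -> A * B <= ch kap ->
  exists2 t : R, 0 <= t <= 1 &
  A * sh (- kap * t + kap) + B * sh (kap * t + 0) <= Num.sqrt 2 * sh kap.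
Proof.
move=> k0 A1 B1; have shk := sh_gt0 k0; have cs := chsh kap.
have E0 := expR_gt0 kap; have EN := expRN kap.
have E1 : 1 < expR kap by rewrite -[X in X < _]expR0 ltr_expR.
move: cs shk; rewrite /ch /sh EN; set e := expR kap in E0 E1 *; set i := e^-1.
have ei : e * i = 1 by rewrite mulfV ?gt_eqF.
have i0 : 0 < i by rewrite invr_gt0.
have i1 : i < 1 by rewrite invf_lt1.
move=> cs shk AB.
have A0 : 0 < A by lra.
have B0 : 0 < B by lra.
have Ach : A <= (e + i) / 2 by apply: le_trans AB; rewrite ler_peMr// ltW.
have Bch : B <= (e + i) / 2 by apply: le_trans AB; rewrite ler_peMl// ltW.
(* The left-hand side is (P / y + Q * y) / 2 for y = expR (kap * t), and it is
   minimal at y ^+ 2 = P / Q. *)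
pose P := A * e - B; pose Q := B - A * i.
have P0 : 0 < P by rewrite /P; nra.
have Q0 : 0 < Q by rewrite /Q; nra.
(* This inequality and the next place the critical point y in [1, e], hence t in [0, 1]. *)
have QP : Q <= P by rewrite /P /Q; nra.
have PQ : P <= Q * e ^+ 2.
  have h : 2 * A <= B * (e + i) by nra.
  have : 2 * A * e <= B * (e + i) * e by rewrite ler_wpM2r// ltW.
  have -> : B * (e + i) * e = B * e ^+ 2 + B * (e * i) by ring.
  rewrite /P /Q; have -> : (B - A * i) * e ^+ 2 = B * e ^+ 2 - A * e * (e * i) by ring.
  by rewrite ei; lra.
have PQle : P * Q <= 2 * ((e - i) / 2) ^+ 2.
  have -> : P * Q = A * B * (e + i) - A ^+ 2 * (e * i) - B ^+ 2 by rewrite /P /Q; ring.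
  by rewrite ei; nra.
pose y := Num.sqrt (P / Q).
have y1 : 1 <= y by rewrite -sqrtr1 ler_wsqrtr// ler_pdivlMr// mul1r.
have y0 : 0 < y by lra.
have ySQ : y ^+ 2 = P / Q by rewrite sqr_sqrtr// divr_ge0// ltW.
have ye : y <= e.
  by rewrite -(@ler_pXn2r _ 2) ?nnegrE ?(ltW y0) ?(ltW E0)// ySQ ler_pdivrMr// mulrC.
have y0n : y != 0 by rewrite gt_eqF.
have kn : kap != 0 by rewrite gt_eqF.
exists (ln y / kap).
  rewrite divr_ge0 ?ln_ge0 ?(ltW k0)//= ler_pdivrMr// mul1r.
  by rewrite -[X in _ <= X](@expRK R) ler_ln ?posrE.
have E1' : kap * (ln y / kap) = ln y by field.
set j := y^-1; have yj : y * j = 1 by rewrite mulfV.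
have j0 : 0 < j by rewrite invr_gt0.
have -> : A * sh (- kap * (ln y / kap) + kap) + B * sh (kap * (ln y / kap) + 0)
    = (P * j + Q * y) / 2.
  rewrite addr0 mulNr E1' /sh opprD opprK !expRD !expRN lnK ?posrE// -/e -/i -/j.
  by rewrite /P /Q; field.
have PjQy : 0 <= (P * j + Q * y) / 2 by rewrite divr_ge0// ltW// addr_gt0// mulr_gt0.
rewrite -ler_sqr ?nnegrE//; last by rewrite mulr_ge0 ?sqrtr_ge0//; exact: ltW.
rewrite [X in _ <= X]exprMn sqr_sqrtr//.
have QyP : Q * y = P * j.
  apply: (mulIf y0n); rewrite -mulrA -expr2 ySQ -mulrA [j * y]mulrC yj mulr1.
  by rewrite mulrC divfK// gt_eqF.
have -> : ((P * j + Q * y) / 2) ^+ 2 = (P * j) * (Q * y) by rewrite QyP; field.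
have -> : P * j * (Q * y) = P * Q * (y * j) by ring.
by rewrite yj mulr1; exact: PQle.
Qed.

End Hyperbolic.

(** * The exponential map *)

Section InverseFunction.
Context {R : realType} {n : nat}.
Implicit Types (a b w z : 'rV[R]_n).

Lemma geo_cauchy_rV (u : nat -> 'rV[R]_n) (C : R) :
  (forall k, `|u k.+1 - u k| <= C / 2 ^+ k) ->
  exists l, forall k, `|u k - l| <= 2 * C / 2 ^+ k.
Proof.
move=> H.
have C0 : 0 <= C by have := H 0%N; rewrite expr0 divr1; apply: le_trans.
have /choice[l lP] : forall j, exists l, forall k, `|u k 0 j - l| <= 2 * C / 2 ^+ k.
  move=> j; apply: geo_cauchy => k; apply: le_trans (H k).
  by have := mxnorm_coord (u k.+1 - u k) 0 j; rewrite !mxE.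
exists (\row_j l j) => k; apply: mxnorm_le => [|i j].
  by rewrite divr_ge0 ?mulr_ge0 ?exprn_ge0.
by rewrite ord1 !mxE.
Qed.

Lemma vanish_pow2 (V : normedModType R) (x : V) (C : R) :
  (forall k : nat, `|x| <= C / 2 ^+ k) -> x = 0.
Proof.
move=> H; apply/eqP; rewrite -normr_le0 leNgt; apply/negP => x0.
have [k kP] := pow2_small C x0.
by have := le_lt_trans (H k) kP; rewrite ltxx.
Qed.

(** Newton's iteration with the derivative frozen at A. Near w0, [Qdiff] makes the map w - F w *m
    invmx A contract by 1 / 2; differentiability of F at other points is not involved. *)
Lemma local_inverse (F : 'rV[R]_n -> 'rV[R]_n) w0 (A : 'M[R]_n) :
  Qdiff w0 F A -> A \in unitmx ->
  exists (G : 'rV[R]_n -> 'rV[R]_n) (r C : R), [/\ 0 < r, 0 <= C,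
    forall z, `|z - F w0| < r -> F (G z) = z /\ `|G z - w0| <= C * `|z - F w0| &
    Qdiff (F w0) G (invmx A)].
Proof.
move=> [r0 [C0 [r00 C00 H]]] uA.
pose B := n%:R * `|invmx A|.
have B0 : 0 <= B by rewrite mulr_ge0.
have Bn (v : 'rV[R]_n) : `|v *m invmx A| <= B * `|v| := mulmx_norm v (invmx A).
clearbody B; have BC0 : 0 <= B * C0 by rewrite mulr_ge0.
(* This radius makes B * C0 * (|a - w0| + |b - w0|) at most 1 / 2; the added 1 keeps the denominator
   positive. *)
pose rho := Num.min r0 (4 * (B * C0 + 1))^-1.
have q0 : 0 < 4 * (B * C0 + 1) by rewrite mulr_gt0// ltr_wpDl.
have rho0 : 0 < rho by rewrite lt_min r00 invr_gt0.
have key a b : `|a - w0| < rho -> `|b - w0| < rho ->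
    `|(a - b) - (F a - F b) *m invmx A| <= B * C0 * (`|a - w0| + `|b - w0|) * `|a - b|.
  rewrite !lt_min => /andP[ar _] /andP[br _].
  have -> : (a - b) - (F a - F b) *m invmx A = - ((F a - F b - (a - b) *m A) *m invmx A).
    by rewrite [in RHS]mulmxBl mulmxK// opprB.
  rewrite normrN; apply: le_trans (Bn _) _; rewrite -!mulrA ler_wpM2l// !mulrA.
  exact: H.
have half a b : `|a - w0| < rho -> `|b - w0| < rho ->
    `|(a - b) - (F a - F b) *m invmx A| <= 2^-1 * `|a - b|.
  move=> ar br; apply: le_trans (key a b ar br) _; rewrite ler_wpM2r//.
  have : (`|a - w0| + `|b - w0|) <= 2 * (4 * (B * C0 + 1))^-1.
    have h (x : R) : x < rho -> x <= (4 * (B * C0 + 1))^-1.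
      by rewrite lt_min => /andP[_ /ltW].
    by rewrite mulrDl mul1r lerD// h.
  move=> /(ler_wpM2l BC0) /le_trans; apply.
  rewrite mulrA ler_pdivrMr//; move: BC0; lra.
have lip a b : `|a - w0| < rho -> `|b - w0| < rho -> `|a - b| <= 2 * B * `|F a - F b|.
  move=> ar br; have h1 := half a b ar br; have h2 := Bn (F a - F b).
  have : `|a - b| <= `|(a - b) - (F a - F b) *m invmx A| + `|(F a - F b) *m invmx A|.
    by rewrite -[X in `|X| <= _](subrK ((F a - F b) *m invmx A)) ler_normD.
  lra.
pose r := rho / (2 * (B + 1)).
have B1 : 0 < 2 * (B + 1) by rewrite mulr_gt0// ltr_wpDl.
have r_gt0 : 0 < r by rewrite divr_gt0.
have sol z : exists w, `|z - F w0| < r ->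
    [/\ F w = z, `|w - w0| < rho & `|w - w0| <= 2 * B * `|z - F w0|].
  have [zr|zr] := boolP (`|z - F w0| < r); last by exists w0.
  pose dl := B * `|z - F w0|.
  have dl0 : 0 <= dl by rewrite mulr_ge0.
  have dlr : 2 * dl < rho.
    move: zr; rewrite /r ltr_pdivlMr// => zr; apply: le_lt_trans zr; rewrite /dl.
    by have := normr_ge0 (z - F w0); lra.
  pose x := fix x (k : nat) : 'rV[R]_n :=
    if k is k'.+1 then x k' + (z - F (x k')) *m invmx A else w0.
  have xS k : x k.+1 - x k = (z - F (x k)) *m invmx A by rewrite /= addrAC subrr add0r.
  have pk k : 0 < (2 : R) ^+ k by rewrite exprn_gt0.
  have inv k : `|x k.+1 - x k| <= dl / 2 ^+ k /\ `|x k.+1 - w0| <= 2 * dl - dl / 2 ^+ k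
      /\ `|x k - w0| < rho.
    elim: k => [|k [IH1 [IH2 IH3]]].
      have e : x 1%N - x 0%N = (z - F w0) *m invmx A by exact: xS.
      have h : `|(z - F w0) *m invmx A| <= dl by exact: Bn.
      split; first by rewrite e expr0 divr1.
      split; last by rewrite subrr normr0.
      have -> : x 1%N - w0 = (z - F w0) *m invmx A by exact: e.
      by rewrite expr0 divr1; lra.
    have xr : `|x k.+1 - w0| < rho.
      apply: le_lt_trans IH2 _; apply: le_lt_trans dlr.
      by rewrite gerBl divr_ge0// ltW.
    have E : x k.+2 - x k.+1 = (x k.+1 - x k) - (F (x k.+1) - F (x k)) *m invmx A.
      rewrite (xS k.+1) (xS k) -mulmxBl; congr (_ *m _).
      by rewrite opprB addrA subrK.
    have h : `|x k.+2 - x k.+1| <= dl / 2 ^+ k.+1.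
      rewrite E; apply: le_trans (half _ _ xr IH3) _.
      have := pk k; rewrite exprS => p.
      have -> : dl / (2 * 2 ^+ k) = 2^-1 * (dl / 2 ^+ k) by rewrite invfM; lra.
      by rewrite ler_wpM2l// invr_ge0.
    split; first exact: h.
    split; last exact: xr.
    have -> : x k.+2 - w0 = (x k.+2 - x k.+1) + (x k.+1 - w0) by rewrite addrA subrK.
    apply: le_trans (ler_normD _ _) _; move: h IH2; rewrite exprS invfM.
    lra.
  have [l lP] : exists l, forall k, `|x k - l| <= 2 * dl / 2 ^+ k.
    by apply: geo_cauchy_rV => k; have [] := inv k.
  have l0 : `|l - w0| <= 2 * dl by have := lP 0%N; rewrite expr0 divr1 distrC.
  have lr : `|l - w0| < rho by apply: le_lt_trans dlr.
  exists l => _; split; [|exact: lr|by rewrite -mulrA].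
  pose D := n%:R * `|A| + C0 * (2 * rho).
  have D0 : 0 <= D by rewrite addr_ge0 ?mulr_ge0// ltW.
  have lipF a b : `|a - w0| < rho -> `|b - w0| < rho -> `|F a - F b| <= D * `|a - b|.
    move=> ar br; have := H a b.
    have [ar0 br0] : `|a - w0| < r0 /\ `|b - w0| < r0.
      by move: ar br; rewrite !lt_min => /andP[-> _] /andP[-> _].
    move=> /(_ ar0 br0) h; rewrite -[X in `|X|](subrK ((a - b) *m A)).
    apply: le_trans (ler_normD _ _) _; rewrite /D mulrDl addrC; apply: lerD.
      exact: mulmx_norm.
    apply: le_trans h _; rewrite ler_wpM2r// ler_wpM2l// mulrDl mul1r.
    by rewrite lerD// ltW.
  apply/eqP; rewrite -subr_eq0 -opprB oppr_eq0; apply/eqP.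
  apply: (@vanish_pow2 _ _ (n%:R * `|A| * dl + D * (2 * dl))) => k.
  have [h1 [_ h3]] := inv k.
  have -> : z - F l = (z - F (x k)) + (F (x k) - F l) by rewrite addrA subrK.
  apply: le_trans (ler_normD _ _) _; rewrite mulrDl; apply: lerD; last first.
    by apply: le_trans (lipF _ _ h3 lr) _; rewrite -mulrA ler_wpM2l.
  have -> : z - F (x k) = (x k.+1 - x k) *m A by rewrite xS mulmxKV.
  by apply: le_trans (mulmx_norm _ _) _; rewrite -[X in _ <= X]mulrA ler_wpM2l// mulr_ge0.
have /choice[G GP] := sol.
exists G, r, (2 * B); split => //; first by rewrite mulr_ge0.
  by move=> z /GP[].
exists r, (B * C0 * (2 * B) * (2 * B)); split => //; first by rewrite !mulr_ge0.
move=> z z' /[dup] zr /GP[E ar al] /[dup] zr' /GP[E' br bl].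
have := key _ _ ar br; rewrite E E' => /le_trans; apply.
have := lip _ _ ar br; rewrite E E' => h.
have s : 0 <= `|G z - w0| + `|G z' - w0| by rewrite addr_ge0.
have t : `|G z - w0| + `|G z' - w0| <= 2 * B * (`|z - F w0| + `|z' - F w0|).
  by rewrite mulrDr lerD.
have : (`|G z - w0| + `|G z' - w0|) * `|G z - G z'| <=
   2 * B * (`|z - F w0| + `|z' - F w0|) * (2 * B * `|z - z'|) by exact: ler_pM.
move=> /(ler_wpM2l BC0); rewrite !mulrA => h2; apply: le_trans h2 _.
by rewrite le_eqVlt; apply/orP; left; apply/eqP; ring.
Qed.

End InverseFunction.

(** * Gram determinants and the curvature bound *)

Section Gram.
Context {R : realType} {n : nat} (M : riemannianManifold R n).
Implicit Types (a b : atlas M) (z u v w : 'rV[R]_n) (x : M).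

Local Notation crd a := (Defs.coord (chart_of a)).
Local Notation prm a := (param (chart_of a)).
Local Notation dm a := (dom (chart_of a)).
Local Notation T a b := (transition (chart_of a) (chart_of b)).

Lemma gG_comb a z u v (c d : R) : cod (chart_of a) z ->
  gG a z (c *: u - d *: v) (c *: u - d *: v) =
  c ^+ 2 * gG a z u u - 2 * c * d * gG a z u v + d ^+ 2 * gG a z v v.
Proof.
move=> cz; have s := gGC v u cz; move: s; rewrite /gG !bfBl !bfBr !bfZl !bfZr => ->.
ring.
Qed.

Lemma gG_cauchy a z u v : cod (chart_of a) z ->
  gG a z u v ^+ 2 <= gG a z u u * gG a z v v.
Proof.
move=> cz; have [->|v0] := eqVneq v 0.
  by rewrite /gG !bf0r mulr0 expr2 mul0r.
have p := gG_gt0 cz v0.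
have := gG_ge0 (gG a z v v *: u - gG a z u v *: v) cz; rewrite gG_comb//.
set A := gG a z u u; set B := gG a z v v in p *; set C := gG a z u v.
have -> : B ^+ 2 * A - 2 * B * C * C + C ^+ 2 * B = B * (A * B - C ^+ 2) by ring.
by rewrite pmulr_rge0// subr_ge0.
Qed.

Lemma DGam_scale a z u v w (c : R) : ocod a z ->
  DGam a (c *: w) z u v = c *: DGam a w z u v.
Proof.
move=> oz; apply/rowP => l; rewrite !mxE.
have D : is_derive z w (Chr a l) ('D_w (Chr a l) z).
  by apply: derivableP; exact: Ck_derivable (Chr_Ck 1 a l) oz.
have [_ ->] := is_derive_scale c D.
by rewrite bfE bfE mulr_sumr; apply: eq_bigr => i _; rewrite mulr_sumr;
  apply: eq_bigr => j _; rewrite !mxE !mulrA.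
Qed.

Lemma Riem_dep a z v (c : R) : ocod a z -> Riem a z (c *: v) v = 0.
Proof.
move=> oz; rewrite /Riem DGam_scale// !GamZl GamZr.
have -> : DGam a v z (c *: v) v = c *: DGam a v z v v.
  by apply/rowP => l; rewrite !mxE bfZl.
by rewrite subrr add0r subrr.
Qed.

Lemma Riem0 a z u : Riem a z u 0 = 0.
Proof.
have D e w : DGam a e z w 0 = 0 by apply/rowP => l; rewrite mxE bf0r mxE.
by rewrite /Riem !D !Gam0r oppr0 !addr0.
Qed.

(** The left-hand side is the derivative of [K + Gam a z J v] along a geodesic of velocity v, when
    J' = K and K' is given by the linearised equation. The identity is thus the Jacobi equation: the
    second covariant derivative of J is - R(J, v) v. *)
Lemma Riem_alg a z J K v :
  - (DGam a J z v v + (Gam a z K v + Gam a z v K)) +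
  (DGam a v z J v + (Gam a z K v + Gam a z J (- Gam a z v v))) =
  - Riem a z J v - Gam a z v (K + Gam a z J v).
Proof.
rewrite /Riem GamDr GamNr.
move: (DGam a J z v v) (DGam a v z J v) (Gam a z K v) (Gam a z v K)
  (Gam a z J (Gam a z v v)) (Gam a z v (Gam a z J v)) => A B C D E F.
by apply/matrixP => i j; rewrite !mxE; ring.
Qed.

(* completes the square of D - h J - e v *)
Lemma gG_square a z D J v (h e : R) : cod (chart_of a) z ->
  2 * h * gG a z J D - h ^+ 2 * gG a z J J + 2 * e * gG a z D v
    - 2 * h * e * gG a z J v - e ^+ 2 * gG a z v v <= gG a z D D.
Proof.
move=> cz; rewrite -subr_ge0; apply: le_trans (gG_ge0 (D - h *: J - e *: v) cz) _.
have s1 := gGC D J cz; have s2 := gGC v D cz; have s3 := gGC v J cz.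
move: s1 s2 s3; rewrite /gG !bfBl !bfBr !bfZl !bfZr => -> -> ->.
by rewrite le_eqVlt; apply/orP; left; apply/eqP; ring.
Qed.

(** [sectional_le] speaks of independent pairs only. For dependent ones, detected by a vanishing
    Gram determinant, both sides are 0. *)
Lemma Riem_bound (k : R) x u v : sectional_le M (- k ^+ 2) ->
  ocod (index_at x) (crd (index_at x) x) ->
  gG (index_at x) (crd (index_at x) x) (Riem (index_at x) (crd (index_at x) x) u v) u <=
  - k ^+ 2 * (gG (index_at x) (crd (index_at x) x) u u * gG (index_at x) (crd (index_at x) x) v v
     - gG (index_at x) (crd (index_at x) x) u v ^+ 2).
Proof.
move=> curv oz; set g := gG _ _; have cz := ocod_cod oz.
have le0 : g u v ^+ 2 <= g u u * g v v := gG_cauchy u v cz.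
have [v0|vn] := eqVneq v 0.
  by rewrite v0 Riem0 /g /gG !bf0r bf0l mulr0 expr0n subr0 mulr0.
have p : 0 < g v v := gG_gt0 cz vn.
move: le0; rewrite -subr_ge0 le_eqVlt => /predU1P[e|pos].
  rewrite -e mulr0.
  have : gG (index_at x) (crd (index_at x) x) (g v v *: u - g u v *: v) (g v v *: u - g u v *: v) = 0.
    rewrite gG_comb// -/g.
    have -> : g v v ^+ 2 * g u u - 2 * g v v * g u v * g u v + g u v ^+ 2 * g v v =
       g v v * (g u u * g v v - g u v ^+ 2) by ring.
    by rewrite -e mulr0.
  move=> /(gG_eq0 cz)/eqP; rewrite subr_eq0 => /eqP E.
  have -> : u = (g u v / g v v) *: v.
    apply: (scalerI (lt0r_neq0 p)); rewrite E scalerA mulrCA mulfV ?gt_eqF// mulr1 //.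
  by rewrite Riem_dep// /g /gG bf0l.
(* Pairing a linear relation with u and with v gives a system whose determinant is the positive Gram
   determinant. *)
have free : row_free (col_mx u v).
  apply/inj_row_free => w0 E; rewrite -[w0]hsubmxK in E *.
  rewrite mul_row_col in E.
  set al := lsubmx w0 in E *; set be := rsubmx w0 in E *.
  have Eu : al *m u = al 0 0 *: u by rewrite {1}[al]mx11_scalar mul_scalar_mx.
  have Ev : be *m v = be 0 0 *: v by rewrite {1}[be]mx11_scalar mul_scalar_mx.
  rewrite Eu Ev in E.
  have E1 : al 0 0 * g u u + be 0 0 * g u v = 0.
    have := congr1 (fun s => g u s) E; rewrite /g /gG bfDr !bfZr bf0r//.
  have E2 : al 0 0 * g u v + be 0 0 * g v v = 0.
    have := congr1 (fun s => g s v) E; rewrite /g /gG bfDl !bfZl bf0l//.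
  have a0 : al 0 0 = 0.
    have : al 0 0 * (g u u * g v v - g u v ^+ 2) = 0.
      have -> : al 0 0 * (g u u * g v v - g u v ^+ 2) =
        (al 0 0 * g u u + be 0 0 * g u v) * g v v - (al 0 0 * g u v + be 0 0 * g v v) * g u v by ring.
      by rewrite E1 E2 !mul0r subrr.
    by move/eqP; rewrite mulf_eq0 (gt_eqF pos) orbF => /eqP.
  have b0 : be 0 0 = 0.
    by move: E2; rewrite a0 mul0r add0r => /eqP; rewrite mulf_eq0 (gt_eqF p) orbF => /eqP.
  have -> : al = 0 by apply: etrans (mx11_scalar al) _; rewrite a0 raddf0.
  have -> : be = 0 by apply: etrans (mx11_scalar be) _; rewrite b0 raddf0.
  exact: row_mx0.
have := curv x u v free; rewrite /sectional.
by rewrite (curvatureE _ _ oz) -[inner x u u * _ - _]/(g u u * g v v - g u v ^+ 2) ler_pdivrMr.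
Qed.

End Gram.

(** * Inner products along a geodesic and absence of conjugate points *)

Section Scalars.
Context {R : realType} {n : nat} (M : riemannianManifold R n).
Implicit Types (a b : atlas M) (z w eta : 'rV[R]_n) (x p q : M).

Local Notation crd a := (Defs.coord (chart_of a)).
Local Notation prm a := (param (chart_of a)).
Local Notation dm a := (dom (chart_of a)).
Local Notation T a b := (transition (chart_of a) (chart_of b)).

Variables (p : M) (a0 : atlas M) (c : 'rV[R]_n -> R -> M) (w0 z0 : 'rV[R]_n) (r d : R).
Hypotheses (r0 : 0 < r) (d0 : 0 < d).
Hypothesis fgeo : forall w, `|w - w0| < r -> forall t : R, - d < t < 1 + d -> geoat (c w) t.
Hypothesis finit : forall w, `|w - w0| < r -> dm a0 (c w 0) /\ st a0 (c w) 0 = row_mx z0 w.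
Hypothesis fQ : forall t : R, - d < t < 1 + d -> forall b, dm b (c w0 t) ->
     (exists2 e : R, 0 < e & forall w, `|w - w0| < e -> dm b (c w t)) /\
     exists L, Qdiff w0 (fun w => st b (c w) t) L.

Let w0r : `|w0 - w0| < r. Proof. by rewrite subrr normr0. Qed.

Let I01 (t : R) : 0 <= t <= 1 -> - d < t < 1 + d.
Proof. by move=> /andP[? ?]; apply/andP; split; have := d0; lra. Qed.

Let I0 : - d < 0 < 1 + d. Proof. by apply: I01; rewrite lexx ler01. Qed.

Let gnear w (t : R) : `|w - w0| < r -> - d < t < 1 + d ->
  \forall s \near t, geoat (c w) s.
Proof.
move=> wr tI; have [m m0 mP] := itv_ballin tI.
by apply: (dist_near m0) => s /mP; exact: fgeo.
Qed.

Let gin b (t : R) : - d < t < 1 + d -> dm b (c w0 t) -> geoin b (c w0) t.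
Proof. by move=> tI bt; exact: nbhs_singleton (geoat_near (gnear w0r tI) bt). Qed.

Let odm b (t : R) : - d < t < 1 + d -> dm b (c w0 t) -> ocod b (lc b (c w0) t).
Proof. by move=> tI bt; case: (gin tI bt). Qed.

Local Notation Z b t := (lc b (c w0) t).
Local Notation V b t := (lv b (c w0) t).
Local Notation J b eta t := (Jf c w0 b eta t).
(** The covariant derivative of the variation field along [c w0]. *)
Definition DJf b eta t := Kf c w0 b eta t +
  Gam b (lc b (c w0) t) (Jf c w0 b eta t) (lv b (c w0) t).

Let near_dm b (t : R) : - d < t < 1 + d -> dm b (c w0 t) ->
  \forall s \near t, - d < s < 1 + d /\ dm b (c w0 s).
Proof.
move=> tI bt; have [m m0 mP] := itv_ballin tI.
have [_ nd _ _] := gin tI bt.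
by apply: filterS2 (dist_near m0 mP) nd => s ? ?; split.
Qed.

Let dZ b (t : R) : - d < t < 1 + d -> dm b (c w0 t) -> is_derive t 1 (lc b (c w0)) (V b t).
Proof. by move=> tI bt; have [_ _ /derivableP] := gin tI bt. Qed.

Let dV b (t : R) : - d < t < 1 + d -> dm b (c w0 t) ->
  is_derive t 1 (lv b (c w0)) (- Gam b (Z b t) (V b t) (V b t)).
Proof. by move=> tI bt; have [] := gin tI bt. Qed.

Let dJ b eta (t : R) (tI : - d < t < 1 + d) (bt : dm b (c w0 t)) :
  is_derive t 1 (Jf c w0 b eta) (Kf c w0 b eta t) :=
  proj1 (J_ode r0 fgeo fQ eta tI bt).

Let dDJ b eta (t : R) : - d < t < 1 + d -> dm b (c w0 t) ->
  is_derive t 1 (DJf b eta) (- Riem b (Z b t) (J b eta t) (V b t)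
    - Gam b (Z b t) (V b t) (DJf b eta t)).
Proof.
move=> tI bt; have oz := odm tI bt.
have [D1 D2] := J_ode r0 fgeo fQ eta tI bt.
have D3 := is_derive_Gam oz (dZ tI bt) D1 (dV tI bt).
by apply: (is_derive_cast (is_deriveD D2 D3)); exact: Riem_alg.
Qed.

Let dphi b eta (t : R) : - d < t < 1 + d -> dm b (c w0 t) ->
  is_derive t 1 (fun s => gG b (lc b (c w0) s) (Jf c w0 b eta s) (Jf c w0 b eta s))
    (2 * gG b (Z b t) (J b eta t) (DJf b eta t)).
Proof.
move=> tI bt; have oz := odm tI bt.
have D1 := dJ eta tI bt.
apply: (is_derive_cast (is_derive_gG oz (dZ tI bt) D1 D1)).
rewrite (GamC (V b t) _ oz) -/(DJf b eta t) (gGC (DJf b eta t) _ (ocod_cod oz)).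
by rewrite mulrDl !mul1r.
Qed.

Let dchi b eta (t : R) : - d < t < 1 + d -> dm b (c w0 t) ->
  is_derive t 1 (fun s => gG b (lc b (c w0) s) (Jf c w0 b eta s) (DJf b eta s))
    (gG b (Z b t) (DJf b eta t) (DJf b eta t)
      - gG b (Z b t) (Riem b (Z b t) (J b eta t) (V b t)) (J b eta t)).
Proof.
move=> tI bt; have oz := odm tI bt.
have D1 := dJ eta tI bt.
apply: (is_derive_cast (is_derive_gG oz (dZ tI bt) D1 (dDJ eta tI bt))).
rewrite (GamC (V b t) (Jf c w0 b eta t) oz) -/(DJf b eta t) subrK.
by congr (_ + _); rewrite (gGC _ _ (ocod_cod oz)) /gG bfNl.
Qed.

(** Read in the chart chosen at each point of the curve, so as to be functions of t alone;
    [phi_chart] and [chi_chart] give access to a fixed chart, where they can be differentiated. *)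
Let phi eta t := let b := index_at (c w0 t) in gG b (Z b t) (J b eta t) (J b eta t).
Let chi eta t := let b := index_at (c w0 t) in gG b (Z b t) (J b eta t) (DJf b eta t).
Let q0 eta := gG a0 z0 eta w0.
Let l2 := gG a0 z0 w0 w0.

Let V_transition b b' (t : R) : - d < t < 1 + d -> dm b (c w0 t) -> dm b' (c w0 t) ->
  V b' t = V b t *m jac (T b b') (Z b t).
Proof.
move=> tI bt bt'; have [oz nd du _] := gin tI bt.
by have [_ E] := lv_transition nd oz bt' du.
Qed.

Let Z_ovl b b' (t : R) : - d < t < 1 + d -> dm b (c w0 t) -> dm b' (c w0 t) ->
  ovl b b' (Z b t) /\ T b b' (Z b t) = Z b' t.
Proof.
move=> tI bt bt'; split; last exact: transition_coord.
by apply: ovl_coord => //; exact: odm.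
Qed.

Let phi_chart b eta (t : R) : - d < t < 1 + d -> dm b (c w0 t) ->
  phi eta t = gG b (Z b t) (J b eta t) (J b eta t).
Proof.
move=> tI bt; have bt' : dm (index_at (c w0 t)) (c w0 t) by exact: index_atP.
have [ob E] := Z_ovl tI bt bt'.
by rewrite (gG_transition _ _ ob) E -!(J_transition r0 fgeo fQ eta tI bt bt').
Qed.

(** In every chart the expression is half the derivative of [phi], which is already known not to
    depend on the chart. This spares the transformation rule of covariant derivatives. *)
Let chi_chart b eta (t : R) : - d < t < 1 + d -> dm b (c w0 t) ->
  chi eta t = gG b (Z b t) (J b eta t) (DJf b eta t).
Proof.
move=> tI bt; have bt' : dm (index_at (c w0 t)) (c w0 t) by exact: index_atP.
have H b2 : dm b2 (c w0 t) -> is_derive t 1 (phi eta) (2 * gG b2 (Z b2 t) (J b2 eta t) (DJf b2 eta t)).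
  move=> b2t; apply: near_eq_is_derive (dphi eta tI b2t).
  by apply: filterS (near_dm tI b2t) => s [sI b2s]; rewrite (phi_chart eta sI b2s).
have [_ E1] := H _ bt'; have [_ E2] := H _ bt.
have two : (2 : R) != 0 by rewrite pnatr_eq0.
by have := etrans (esym E1) E2; move/(mulfI two).
Qed.

Let dphi' eta (t : R) : - d < t < 1 + d -> is_derive t 1 (phi eta) (2 * chi eta t).
Proof.
move=> tI; have bt : dm (index_at (c w0 t)) (c w0 t) by exact: index_atP.
apply: near_eq_is_derive (dphi eta tI bt).
by apply: filterS (near_dm tI bt) => s [sI bs]; rewrite (phi_chart eta sI bs).
Qed.

Let cRiem eta t := let b := index_at (c w0 t) in gG b (Z b t) (DJf b eta t) (DJf b eta t)
   - gG b (Z b t) (Riem b (Z b t) (J b eta t) (V b t)) (J b eta t).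

Let dchi' eta (t : R) : - d < t < 1 + d -> is_derive t 1 (chi eta) (cRiem eta t).
Proof.
move=> tI; have bt : dm (index_at (c w0 t)) (c w0 t) by exact: index_atP.
apply: near_eq_is_derive (dchi eta tI bt).
by apply: filterS (near_dm tI bt) => s [sI bs]; rewrite (chi_chart eta sI bs).
Qed.

Lemma energy_const w (t : R) : `|w - w0| < r -> - d < t < 1 + d ->
  energy (c w) t = gG a0 z0 w w.
Proof.
move=> wr tI.
have -> : energy (c w) t = energy (c w) 0.
  apply: (const_on_itv (al := - d) (be := 1 + d)) => // u uI.
  by apply: energy_derive; exact: gnear.
have [b0 /eq_row_mx[E1 E2]] := finit wr.
by rewrite (energy_chart (fgeo wr I0) b0) E1 E2.
Qed.

Let cz0 : cod (chart_of a0) z0.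
Proof.
have [b0 /eq_row_mx[E1 E2]] := finit w0r.
by rewrite -E1; apply: ocod_cod; exact: odm.
Qed.

(** By conservation of energy the squared speed of [c w] at time t is [gG a0 z0 w w]; both
    expressions are differentiated in w along eta. *)
Let gDJV b eta (t : R) : - d < t < 1 + d -> dm b (c w0 t) ->
  gG b (Z b t) (DJf b eta t) (V b t) = q0 eta.
Proof.
move=> tI bt; have oz := odm tI bt.
have [[e e0 He] [L QL]] := fQ tI bt.
have [D1 D2 _] := Qdiff_JK eta QL.
have D := is_derive_gG (z := fun w => lc b (c w) t) (x := w0) oz D1 D2 D2.
have D' : is_derive w0 eta (fun w => gG a0 z0 w w) (2 * gG b (Z b t) (DJf b eta t) (V b t)).
  apply: near_eq_is_derive (is_derive_cast D _); last first.
    by rewrite -/(DJf b eta t) (gGC _ (DJf b eta t) (ocod_cod oz)) mulrDl !mul1r.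
  apply/nbhs_ballP; exists (Num.min e r) => /=; first by rewrite lt_min e0.
  move=> w; rewrite -ball_normE /= distrC lt_min => /andP[we wr].
  by rewrite -(energy_const wr tI) (energy_chart (fgeo wr tI) (He w we)).
have D0 : is_derive w0 eta (fun w => gG a0 z0 w w) (2 * q0 eta).
  have H := is_derive_bf_aux (is_derive_cst (metric a0 z0) w0 eta) (is_derive_id w0 eta)
    (is_derive_id w0 eta).
  apply: (is_derive_cast H).
  have -> : bf 0 w0 w0 = 0 :> R by rewrite /bf mulmx0 mul0mx mxE.
  rewrite add0r -/(gG a0 z0 eta w0) -/(gG a0 z0 w0 eta) (gGC w0 eta cz0).
  by rewrite mulrDl !mul1r.
have two : (2 : R) != 0 by rewrite pnatr_eq0.
have [_ F1] := D'; have [_ F2] := D0.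
by have := etrans (esym F1) F2; move/(mulfI two).
Qed.

Let mm eta t := let b := index_at (c w0 t) in gG b (Z b t) (J b eta t) (V b t).

Let mm_chart b eta (t : R) : - d < t < 1 + d -> dm b (c w0 t) ->
  mm eta t = gG b (Z b t) (J b eta t) (V b t).
Proof.
move=> tI bt; have bt' : dm (index_at (c w0 t)) (c w0 t) by exact: index_atP.
have [ob E] := Z_ovl tI bt bt'.
rewrite (gG_transition _ _ ob) E.
have Ej : J b eta t *m jac (T b (index_at (c w0 t))) (Z b t) = J (index_at (c w0 t)) eta t.
  exact/esym/(J_transition r0 fgeo fQ eta tI bt bt').
have Ev : V b t *m jac (T b (index_at (c w0 t))) (Z b t) = V (index_at (c w0 t)) t.
  exact/esym/V_transition.
by rewrite Ej Ev.
Qed.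

Let dmm eta (t : R) : - d < t < 1 + d -> is_derive t 1 (mm eta) (q0 eta).
Proof.
move=> tI; have bt : dm (index_at (c w0 t)) (c w0 t) by exact: index_atP.
have oz := odm tI bt.
have D := is_derive_gG oz (dZ tI bt) (dJ eta tI bt) (dV tI bt).
have D' := is_derive_cast D (df' := q0 eta).
apply: near_eq_is_derive (D' _).
  by apply: filterS (near_dm tI bt) => s [sI bs]; rewrite (mm_chart eta sI bs).
rewrite (GamC (V _ t) (Jf _ _ _ _ _) oz) -/(DJf _ eta t) addNr.
by rewrite [X in _ + X]/gG bf0r addr0 gDJV.
Qed.

Let c00 : dm a0 (c w0 0). Proof. by case: (finit w0r). Qed.

(** The Gauss lemma: the derivative of the left-hand side in t is the constant found in [gDJV], and
    the variation field vanishes at 0. *)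
Lemma JV_linear b eta (t : R) : - d < t < 1 + d -> dm b (c w0 t) ->
  gG b (lc b (c w0) t) (Jf c w0 b eta t) (lv b (c w0) t) = gG a0 z0 eta w0 * t.
Proof.
move=> tI bt; rewrite -[LHS](mm_chart eta tI bt) -/(q0 eta).
have E : mm eta t - q0 eta * t = mm eta 0 - q0 eta * 0.
  apply: (@const_on_itv _ (fun t => mm eta t - q0 eta * t) (- d) (1 + d)) => //.
  move=> u uI; have D := is_derive_sub (dmm eta uI) (is_derive_affine (q0 eta) 0 u).
  have := is_derive_cast D (subrr _); congr is_derive.
  by apply/funext => s; rewrite addr0.
have m0 : mm eta 0 = 0.
  rewrite (mm_chart eta I0 c00).
  by have [-> _] := J_init r0 finit eta; rewrite /gG bf0l.
by move: E; rewrite m0 mulr0 subr0 => /eqP; rewrite subr_eq0 => /eqP.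
Qed.

Section Curved.
Variable (k : R).
Hypothesis k0 : 0 < k.
Hypothesis curv : sectional_le M (- k ^+ 2).
Hypothesis w00 : w0 != 0.

Let l20 : 0 < l2. Proof. exact: gG_gt0. Qed.

(** The hypothesis of [jacobi_bound], for kap ^+ 2 = k ^+ 2 * l2 and Q = q0 eta ^+ 2 / l2.
    [Riem_bound] treats the curvature term and [gG_square] the square of the covariant
    derivative. *)
Let cRiem_ge eta (t : R) (h : R) : - d < t < 1 + d ->
  2 * h * chi eta t - h ^+ 2 * phi eta t + q0 eta ^+ 2 / l2 * (1 - h * t) ^+ 2
   + k ^+ 2 * l2 * (phi eta t - q0 eta ^+ 2 / l2 * t ^+ 2) <= cRiem eta t.
Proof.
move=> tI; pose b := index_at (c w0 t).
have bt : dm b (c w0 t) by exact: index_atP.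
have oz := odm tI bt; have cz := ocod_cod oz.
have E1 := gDJV eta tI bt.
have E2 := JV_linear eta tI bt; rewrite  -/(q0 eta) in E2.
have E3 : gG b (Z b t) (V b t) (V b t) = l2.
  by rewrite /l2 -(energy_const w0r tI) (energy_chart (fgeo w0r tI) bt).
have RB : gG b (Z b t) (Riem b (Z b t) (J b eta t) (V b t)) (J b eta t) <=
    - k ^+ 2 * (phi eta t * l2 - (q0 eta * t) ^+ 2).
  have H : gG b (Z b t) (Riem b (Z b t) (J b eta t) (V b t)) (J b eta t) <=
    - k ^+ 2 * (gG b (Z b t) (J b eta t) (J b eta t) * gG b (Z b t) (V b t) (V b t)
      - gG b (Z b t) (J b eta t) (V b t) ^+ 2) := Riem_bound (J b eta t) (V b t) curv oz.
  by rewrite E3 E2 in H.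
have Ln : l2 != 0 by rewrite gt_eqF.
have H : 2 * h * chi eta t - h ^+ 2 * phi eta t + q0 eta ^+ 2 / l2 * (1 - h * t) ^+ 2
    <= gG b (Z b t) (DJf b eta t) (DJf b eta t).
  (* The last coefficient is that of the tangential part of [DJf - h *: J] along the velocity, the
     best choice in [gG_square]. *)
  apply: le_trans (gG_square (DJf b eta t) (J b eta t) (V b t) h (q0 eta / l2 * (1 - h * t)) cz).
  rewrite E1 E2 E3 -/(chi eta t) -/(phi eta t).
  move: (chi eta t) (phi eta t) (q0 eta) Ln => x y q; move: l2 => l Ln.
  by rewrite le_eqVlt; apply/orP; left; apply/eqP; field.
have -> : k ^+ 2 * l2 * (phi eta t - q0 eta ^+ 2 / l2 * t ^+ 2) =
   k ^+ 2 * (phi eta t * l2 - (q0 eta * t) ^+ 2) by field.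
by apply: lerD H _; move: RB; rewrite mulNr lerNr.
Qed.

Let J0 eta : J a0 eta 0 = 0. Proof. by have [-> _] := J_init r0 finit eta. Qed.

Let phi0 eta : phi eta 0 = 0.
Proof. by rewrite (phi_chart eta I0 c00) J0 /gG bf0l. Qed.

Let chi0 eta : chi eta 0 = 0.
Proof. by rewrite (chi_chart eta I0 c00) J0 /gG bf0l. Qed.

Let I1 : - d < 1 < 1 + d. Proof. by apply: I01; rewrite ler01 lexx. Qed.

Lemma jacobi_comparison b eta (q kap : R) : dm b (c w0 1) ->
  q = gG b (lc b (c w0) 1) (Jf c w0 b eta 1) (lv b (c w0) 1) -> kap = k * Num.sqrt l2 ->
  kap * ch kap * (gG b (lc b (c w0) 1) (Jf c w0 b eta 1) (Jf c w0 b eta 1) - q ^+ 2 / l2)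
  <= sh kap * (gG b (lc b (c w0) 1) (Jf c w0 b eta 1) (DJf b eta 1) - q ^+ 2 / l2).
Proof.
move=> bt Eq Ek; rewrite (JV_linear eta I1 bt) mulr1 -/(q0 eta) in Eq.
rewrite -(phi_chart eta I1 bt) -(chi_chart eta I1 bt) {}Eq.
have kk : kap ^+ 2 = k ^+ 2 * l2 by rewrite Ek exprMn sqr_sqrtr// ltW.
have kap0 : 0 < kap by rewrite Ek mulr_gt0// sqrtr_gt0.
have H := @jacobi_bound R (phi eta) (chi eta) (cRiem eta) (q0 eta ^+ 2 / l2) kap kap0.
apply: H; last 2 first.
- exact: phi0.
- exact: chi0.
- by move=> t /I01; exact: dphi'.
- by move=> t /I01; exact: dchi'.
- by move=> t /I01 tI h; rewrite kk; exact: cRiem_ge.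
Qed.

(** If J vanishes at 1 it is orthogonal to the geodesic, and the curvature bound makes <J, J'>
    nondecreasing. This product vanishes at both ends, hence on [0, 1]; its derivative at 0, the
    squared norm of eta, is then 0 as well. *)
Lemma no_conjugate b eta : dm b (c w0 1) -> Jf c w0 b eta 1 = 0 -> eta = 0.
Proof.
move=> bt J1.
have q00 : q0 eta = 0.
  by have := JV_linear eta I1 bt; rewrite J1 mulr1 [LHS]/gG bf0l -/(q0 eta) => <-.
have chi1 : chi eta 1 = 0 by rewrite (chi_chart eta I1 bt) J1 /gG bf0l.
have phi1 : phi eta 1 = 0 by rewrite (phi_chart eta I1 bt) J1 /gG bf0l.
have phi_ge (t : R) : 0 <= t <= 1 -> 0 <= phi eta t.
  move=> /I01 tI; apply: gG_ge0; apply: ocod_cod; apply: odm => //; exact: index_atP.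
have cR (t : R) : 0 <= t <= 1 -> 0 <= cRiem eta t.
  move=> tI; apply: le_trans (cRiem_ge eta 0 (I01 tI)).
  rewrite [X in _ <= X](_ : _ = k ^+ 2 * l2 * phi eta t); last by rewrite q00; ring.
  by apply: mulr_ge0; [apply: mulr_ge0; [exact: sqr_ge0|exact: ltW]|exact: phi_ge].
have mono (s t : R) : 0 <= s -> s <= t -> t <= 1 -> chi eta s <= chi eta t.
  move=> s0 st_ t1; apply: (within_nondecr st_ (df := cRiem eta)) => u /andP[su ut].
  have uI : 0 <= u <= 1 by rewrite (le_trans s0 su) (le_trans ut t1).
  by split; [exact/dchi'/I01|exact: cR].
have chiE (t : R) : 0 <= t <= 1 -> chi eta t = 0.
  move=> /andP[t0 t1]; apply/eqP; rewrite eq_le; apply/andP; split.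
    by rewrite -[X in _ <= X]chi1 mono.
  by rewrite -[X in X <= _](chi0 eta) mono.
have phiE (t : R) : 0 <= t <= 1 -> phi eta t = 0.
  move=> tI; have /andP[t0 t1] := tI; apply/eqP; rewrite eq_le phi_ge// andbT -[X in _ <= X](phi0 eta).
  rewrite -lerN2; apply: (within_nondecr t0 (f := fun t => - phi eta t)
     (df := fun t => - (2 * chi eta t))) => u /andP[u0 ut].
  have uI : 0 <= u <= 1 by rewrite u0 (le_trans ut t1).
  by split; [exact/is_deriveN/dphi'/I01|rewrite chiE// mulr0 oppr0].
have [_ K0] := J_init r0 finit eta.
have c0E : gG a0 (Z a0 0) (DJf a0 eta 0) (DJf a0 eta 0) <= 0.
  have D : is_derive (0 : R) 1 (chi eta) (gG a0 (Z a0 0) (DJf a0 eta 0) (DJf a0 eta 0)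
      - gG a0 (Z a0 0) (Riem a0 (Z a0 0) (J a0 eta 0) (V a0 0)) (J a0 eta 0)).
    apply: near_eq_is_derive (dchi eta I0 c00).
    by apply: filterS (near_dm I0 c00) => s [sI bs]; rewrite (chi_chart eta sI bs).
  have D' := @is_deriveN _ _ _ _ _ _ _ D.
  have := is_derive_ge0 ltr01 D' _; rewrite J0 [X in _ - X]/gG bf0r subr0 oppr_ge0; apply.
  move=> s; rewrite add0r => /andP[/ltW s0 /ltW s1].
  change (- chi eta 0 <= - chi eta s).
  by rewrite !chiE ?lexx ?ler01// s0 s1.
have DJ0 : DJf a0 eta 0 = eta.
  by rewrite /DJf K0 J0 Gam0l addr0.
rewrite DJ0 in c0E.
have cz : cod (chart_of a0) (Z a0 0) by apply: ocod_cod; exact: odm.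
apply: (gG_eq0 cz); apply/eqP; rewrite eq_le c0E; exact: gG_ge0.
Qed.

End Curved.
End Scalars.

Section QdiffBlocks.
Context {R : realType} {n m q : nat}.

Lemma lsubmx_norm (u : 'rV[R]_(m + q)) : `|lsubmx u| <= `|u|.
Proof. by apply: mxnorm_le => // i j; rewrite mxE; exact: mxnorm_coord. Qed.

Lemma rsubmx_norm (u : 'rV[R]_(m + q)) : `|rsubmx u| <= `|u|.
Proof. by apply: mxnorm_le => // i j; rewrite mxE; exact: mxnorm_coord. Qed.

Lemma Qdiff_lsubmx (x0 : 'rV[R]_n) (F : 'rV[R]_n -> 'rV[R]_(m + q)) L :
  Qdiff x0 F L -> Qdiff x0 (fun x => lsubmx (F x)) (lsubmx L).
Proof.
move=> [r [C [r0 C0 H]]]; exists r, C; split => // a b ar br.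
apply: le_trans (H a b ar br).
by rewrite mulmx_lsub -!raddfB; exact: lsubmx_norm.
Qed.

Lemma Qdiff_rsubmx (x0 : 'rV[R]_n) (F : 'rV[R]_n -> 'rV[R]_(m + q)) L :
  Qdiff x0 F L -> Qdiff x0 (fun x => rsubmx (F x)) (rsubmx L).
Proof.
move=> [r [C [r0 C0 H]]]; exists r, C; split => // a b ar br.
apply: le_trans (H a b ar br).
by rewrite mulmx_rsub -!raddfB; exact: rsubmx_norm.
Qed.

End QdiffBlocks.

Section Fan.
Context {R : realType} {n : nat} (M : riemannianManifold R n).
Implicit Types (a b : atlas M) (z w eta : 'rV[R]_n) (x y p q : M).

Local Notation crd a := (Defs.coord (chart_of a)).
Local Notation prm a := (param (chart_of a)).
Local Notation dm a := (dom (chart_of a)).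

(** [V z] is the arrival velocity at z of the geodesic from p given by a local inverse of w |-> c w
    1, whose derivative is invertible by [no_conjugate]. By the last clause V is, at y, the gradient
    of half its squared norm, and its covariant derivative, the Hessian of that function, obeys the
    Jacobi field comparison. *)
Lemma fan (k : R) p y b (c0 : R -> M) : 0 < k -> sectional_le M (- k ^+ 2) ->
  geodesic_arc p y c0 -> (forall t : R, 0 <= t <= 1 -> ~ boundary (c0 t)) ->
  local_velocity (index_at p) c0 0 != 0 -> dm b y ->
  exists (V : 'rV[R]_n -> 'rV[R]_n) (L : 'M[R]_n) (e : R),
  [/\ 0 < e, V (crd b y) = local_velocity b c0 1,
   forall z, `|z - crd b y| < e -> exists2 c, geodesic_arc p (prm b z) c &
      local_velocity b c 1 = V z,
   Qdiff (crd b y) V L &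
   forall eta v (q kap : R), v = local_velocity b c0 1 -> q = gG b (crd b y) eta v ->
     kap = k * Num.sqrt (gG b (crd b y) v v) ->
     is_derive (crd b y) eta (fun z => gG b z (V z) (V z)) (2 * q) /\
     kap * ch kap * (gG b (crd b y) eta eta - q ^+ 2 / gG b (crd b y) v v) <=
     sh kap * (gG b (crd b y) eta (eta *m L + Gam b (crd b y) eta v)
       - q ^+ 2 / gG b (crd b y) v v)].
Proof.
move=> k0 curv arc inter w0n by_.
have p0 : dm (index_at p) p by exact: index_atP.
have [r [d [c [r0 d0 [fgeo finit fin fQ]]]]] := family_exists arc inter p0.
set a0 := index_at p in p0 w0n fin finit fQ fgeo.
set w0 := local_velocity a0 c0 0 in w0n fin finit fQ fgeo.
set z0 := crd a0 p in finit.
have w0r : `|w0 - w0| < r by rewrite subrr normr0.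
have I01 (t : R) : 0 <= t <= 1 -> - d < t < 1 + d.
  by move=> /andP[? ?]; apply/andP; split; lra.
have I1 : - d < 1 < 1 + d by apply: I01; rewrite ler01 lexx.
have J1 : 0 <= (1 : R) <= 1 by rewrite ler01 lexx.
have [cw1 st1] := fin 1 J1.
have c01 : c0 1 = y by case: arc.
have bt0 : dm b (c0 1) by rewrite c01.
have bt : dm b (c w0 1) by rewrite cw1.
have [[e1 e10 He1] [LS QS]] := fQ 1 I1 b bt.
have [Z1 V1] : lc b (c w0) 1 = crd b y /\ lv b (c w0) 1 = local_velocity b c0 1.
  by have := st1 b bt0; rewrite /st /sta {2}/lc c01 => /eq_row_mx.
pose F w := lc b (c w) 1.
have QF : Qdiff w0 F (lsubmx LS).
  have := Qdiff_lsubmx QS; apply: (Qdiff_near ltr01) => w _.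
  by rewrite row_mxKl.
have JK eta : Jf c w0 b eta 1 = eta *m lsubmx LS /\ Kf c w0 b eta 1 = eta *m rsubmx LS.
  have [_ _ E] := Qdiff_JK eta QS.
  by rewrite mulmx_lsub mulmx_rsub E row_mxKl row_mxKr.
have uA : lsubmx LS \in unitmx.
  rewrite -row_free_unit; apply/inj_row_free => eta E.
  apply: (no_conjugate r0 d0 fgeo finit fQ curv w0n bt).
  by rewrite (JK eta).1 E.
have [G [ri [C [ri0 C0 GP QG]]]] := local_inverse QF uA.
have F0 : F w0 = crd b y by exact: Z1.
rewrite F0 in GP QG.
pose V z := lv b (c (G z)) 1.
have m0 : 0 < Num.min r e1 by rewrite lt_min r0.
pose e := Num.min ri (Num.min r e1 / (C + 1)).
have C1 : 0 < C + 1 by rewrite ltr_wpDl.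
have e0 : 0 < e by rewrite lt_min ri0 divr_gt0.
have Gz z : `|z - crd b y| < e -> [/\ F (G z) = z, `|G z - w0| < r & `|G z - w0| < e1].
  rewrite lt_min => /andP[/GP[E l]] h.
  have : `|G z - w0| < Num.min r e1.
    move: h; rewrite ltr_pdivlMr// => h; apply: le_lt_trans l _; apply: le_lt_trans h.
    by rewrite mulrDr mulr1 mulrC lerDl.
  by rewrite lt_min => /andP[].
have G1 : G (crd b y) = w0.
  have h : `|crd b y - crd b y| < ri by rewrite subrr normr0.
  have [_] := GP _ h; rewrite subrr normr0 mulr0 normr_le0 subr_eq0 => /eqP //.
have QV : Qdiff (crd b y) V (invmx (lsubmx LS) *m rsubmx LS).
  have QS' : Qdiff (G (crd b y)) (fun w => st b (c w) 1) LS by rewrite G1.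
  have := Qdiff_rsubmx (Qdiff_comp QG QS'); rewrite -mulmx_rsub.
  by apply: (Qdiff_near ltr01) => w _; rewrite row_mxKr.
exists V, (invmx (lsubmx LS) *m rsubmx LS), e; split.
- exact: e0.
- by rewrite /V G1 V1.
- move=> z /Gz[E wr we].
  have [ar vel] := geodesic_arc_of d0 (fgeo _ wr).
  exists (c (G z)); last first.
    rewrite vel//; split; first by rewrite /= in_itv /= ler01 lexx.
    exact: He1.
  have [da /eq_row_mx[Ea _]] := finit _ wr.
  have <- : c (G z) 0 = p.
    by rewrite -(chart_coordK da) -[crd a0 (c (G z) 0)]/(lc a0 (c (G z)) 0) Ea chart_coordK.
  have <- : c (G z) 1 = prm b z.
    have db := He1 _ we.
    by rewrite -(chart_coordK db) -[crd b (c (G z) 1)]/(F (G z)) E.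
  exact: ar.
- exact: QV.
- move=> eta v q kap Ev Eq Ek; rewrite -V1 in Ev.
  have L2 : gG b (crd b y) v v = gG a0 z0 w0 w0.
    rewrite -(energy_const d0 fgeo finit w0r I1) (energy_chart (fgeo _ w0r _ I1) bt).
    by rewrite Z1 Ev.
  (* The change of initial velocity whose Jacobi field equals eta at time 1. *)
  pose eta' := eta *m invmx (lsubmx LS).
  have EJ : Jf c w0 b eta' 1 = eta by rewrite (JK eta').1 mulmxKV.
  have EK : Kf c w0 b eta' 1 = eta *m (invmx (lsubmx LS) *m rsubmx LS).
    by rewrite (JK eta').2 mulmxA.
  have JV := JV_linear r0 d0 fgeo finit fQ eta' I1 bt.
  rewrite EJ Z1 -Ev mulr1 -Eq in JV.
  split.
    have DG := Qdiff_derive eta QG.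
    have D := is_derive_bf_aux (is_derive_cst (metric a0 z0) (crd b y) eta) DG DG.
    rewrite G1 in D.
    have cz0 : cod (chart_of a0) z0 by exact: chart_coord_cod.
    have D2 : is_derive (crd b y) eta (fun z => gG a0 z0 (G z) (G z)) (2 * q).
      apply: (is_derive_cast D).
      have -> : bf 0 w0 w0 = 0 :> R by rewrite /bf mulmx0 mul0mx mxE.
      rewrite add0r -/eta' -/(gG a0 z0 eta' w0) -/(gG a0 z0 w0 eta') (gGC w0 eta' cz0) -JV.
      by rewrite mulrDl !mul1r.
    apply: near_eq_is_derive D2; apply/nbhs_ballP; exists e; first exact: e0.
    move=> z.
    rewrite -ball_normE /= distrC => /Gz[E wr we].
    rewrite -(energy_const d0 fgeo finit wr I1) (energy_chart (fgeo _ wr _ I1) (He1 _ we)).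
    have E' : lc b (c (G z)) 1 = z by exact: E.
    rewrite E'; exact: erefl.
  have := jacobi_comparison r0 d0 fgeo finit fQ k0 curv w0n
    (b := b) (eta := eta') (q := q) (kap := kap) bt.
  rewrite EJ Z1 -Ev -L2 -Eq => /(_ erefl Ek).
  by rewrite /DJf EJ EK Z1 -Ev.
Qed.

End Fan.

(** * Geodesic arcs and their lengths *)

Section AffineCurves.
Context {R : realType} {W : normedModType R}.

Lemma is_derive_reparam (F : R -> W) (m s u : R) dF : is_derive (u * m + s) (1 : R) F dF ->
  is_derive u (1 : R) (fun u => F (u * m + s)) (m *: dF).
Proof. by move=> D; exact: is_derive_line (derive_real m D). Qed.

Lemma affine_continuous (m s : R) : continuous (fun u : R => u * m + s).
Proof.
move=> u; apply: (derive_continuous (df := m)).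
have := is_derive_affine m s u; congr is_derive.
by apply/funext => t; rewrite mulrC.
Qed.

Lemma open_affine (U : set R) (m s : R) : open U -> open [set u : R | U (u * m + s)].
Proof. by move=> oU; apply: open_comp => // u _; exact: affine_continuous. Qed.

Lemma Ck_reparam k (F : R -> W) (U : set R) (m s : R) : open U -> Ck k U F ->
  Ck k [set u : R | U (u * m + s)] (fun u => F (u * m + s)).
Proof.
move=> oU; elim: k F => [|k IH] F cF.
  split=> // u Uu; have c1 : {for u * m + s, continuous F} by case: cF => + _; apply.
  apply/cvgrPdist_lt => e e0; have [r r0 rP] := cvg_normP c1 e0.
  have [r' r'0 r'P] := @cvg_normP R R R (fun u : R => u * m + s) u (@affine_continuous m s u) r r0.
  apply/nbhs_ballP; exists r' => // t; rewrite /= distrC => /r'P/rP.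
  by rewrite distrC.
apply: (Ck_curve (df := fun u => m *: 'D_1 F (u * m + s))); first exact: open_affine.
  by move=> u Uu; apply/is_derive_reparam/derivableP; exact: Ck_derivable cF Uu.
have h := IH _ (Ck_derive (1 : R) cF).
by apply: CkZ; [exact: open_affine|exact: h].
Qed.

End AffineCurves.

Section Arcs.
Context {R : realType} {n : nat} (M : riemannianManifold R n).
Implicit Types (a b : atlas M) (z u v w : 'rV[R]_n) (x y p q : M) (c : R -> M).

Local Notation crd a := (Defs.coord (chart_of a)).
Local Notation prm a := (param (chart_of a)).
Local Notation dm a := (dom (chart_of a)).
Local Notation T a b := (transition (chart_of a) (chart_of b)).

Lemma arc_of_local c : {within `[0, 1]%classic, continuous c} ->
  (forall a t, times a c t -> exists (d : R) (F : R -> 'rV[R]_n), [/\ 0 < d,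
     forall k, Ck k (ball t d) F & forall s, 0 <= s <= 1 -> `|s - t| < d ->
       lc a c s = F s /\ 'D_1 ('D_1 F) s = - Gam a (F s) ('D_1 F s) ('D_1 F s)]) ->
  geodesic_arc (c 0) (c 1) c.
Proof.
move=> cc H.
have T01 a s : times a c s -> 0 <= s <= 1 by move=> [/=]; rewrite in_itv.
split=> //; first split=> // a t tt.
  have [d [F [d0 cF FP]]] := H a t tt.
  exists (ball t d), F; split=> //; [exact: ball_open|exact: ballxx|].
  move=> s; rewrite -ball_normE /= distrC => sd /T01 s01.
  by have [E _] := FP s s01 sd; exact: esym E.
move=> a t tt l; have [d [F [d0 cF FP]]] := H a t tt.
have bt : ball t d t by exact: ballxx.
have FE s : times a c s -> `|s - t| < d -> local_curve a c s = F s.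
  by move=> /T01 s01 sd; have [] := FP s s01 sd.
have tri (s s' : R) : `|s - t| < d -> `|s' - s| < d - `|s - t| -> `|s' - t| < d.
  move=> se; rewrite ltrBrDr; apply: le_lt_trans; exact: ler_distD.
have lvE s : times a c s -> `|s - t| < d -> local_velocity a c s = 'D_1 F s.
  move=> ts se; apply: (times_dwithin (d := d - `|s - t|)) => //.
  - by rewrite subr_gt0.
  - by move=> s' ts' /(tri _ _ se); exact: FE.
  - by apply: Ck_derivable (cF 1%N) _; rewrite -ball_normE /= distrC.
have td : `|t - t| < d by rewrite subrr normr0.
have laE : local_acceleration a c t = 'D_1 ('D_1 F) t.
  apply: (times_dwithin (d := d)) => //.
  exact: Ck_derivable (Ck_derive (1 : R) (cF 2%N)) bt.
rewrite christoffel_sum laE (lvE t tt td) (FE t tt td).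
have [_ ->] := FP t (T01 a t tt) td.
by rewrite [X in X + _]mxE addNr.
Qed.

Lemma arc_velocity_eq p q c a (t d : R) (F : R -> 'rV[R]_n) : geodesic_arc p q c ->
  times a c t -> 0 < d -> derivable F t 1 ->
  (forall s : R, 0 <= s <= 1 -> `|s - t| < d -> lc a c s = F s) ->
  local_velocity a c t = 'D_1 F t.
Proof.
move=> [[cc _] _ _ _] tt d0 dF H; apply: (times_dwithin (d := d)) => // s [/=].
by rewrite in_itv /= => s01 _; exact: H.
Qed.

Lemma arc_unique_velocity p q c c' a (t : R) : geodesic_arc p q c -> geodesic_arc p q c' ->
  (forall t : R, t \in `[0, 1] -> c t = c' t) -> times a c t ->
  times a c' t /\ local_velocity a c' t = local_velocity a c t.
Proof.
move=> A A' E tt.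
have t01 : t \in `[0, 1] by case: tt.
have tt' : times a c' t by case: tt => ? ?; split=> //; rewrite /= -E.
split=> //; have [d [F [d0 cF FP]]] := arc_local A tt.
have dF : derivable F t 1 by apply: Ck_derivable (cF 1%N) _; exact: ballxx.
rewrite (arc_velocity_eq A' tt' d0 dF); last first.
  by move=> s s01 sd; have [_ <-] := FP s s01 sd; rewrite /lc E// in_itv.
by rewrite (arc_velocity_eq A tt d0 dF)// => s s01 sd; have [_ <-] := FP s s01 sd.
Qed.

Lemma arc_affine p q c (m s : R) : geodesic_arc p q c -> 0 <= s <= 1 -> 0 <= m + s <= 1 ->
  geodesic_arc (c s) (c (m + s)) (fun u : R => c (u * m + s)) /\
  forall a t, times a (fun u : R => c (u * m + s)) t ->
    times a c (t * m + s) /\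
    local_velocity a (fun u : R => c (u * m + s)) t = m *: local_velocity a c (t * m + s).
Proof.
move=> arc /andP[s0 s1] /andP[m0 m1].
pose c' (u : R) := c (u * m + s).
have AI (u : R) : 0 <= u <= 1 -> 0 <= u * m + s <= 1.
  by move=> /andP[u0 u1]; apply/andP; split; nra.
have mn : `|m| <= 1 by rewrite ler_norml; apply/andP; split; lra.
have Ad (u u' e : R) : `|u - u'| < e -> `|u * m + s - (u' * m + s)| < e.
  have -> : u * m + s - (u' * m + s) = (u - u') * m by ring.
  by apply: le_lt_trans; rewrite normrM ler_piMr.
have cc : {within `[0, 1]%classic, continuous c} by case: arc => [[]].
have cc' : {within `[0, 1]%classic, continuous c'}.
  apply/subspace_continuousP => t; rewrite /= in_itv /= => t01 U /= nU.
  move/subspace_continuousP : cc => /(_ (t * m + s)); rewrite /= in_itv /= => /(_ (AI t t01) U nU).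
  rewrite /within /= => N.
  have N2 : \forall u \near t, u * m + s \in `[0, 1] -> U (c (u * m + s)) :=
    @affine_continuous _ m s t _ N.
  have N3 : \forall u \near t, u \in `[0, 1] -> U (c' u).
    apply: filterS N2 => u H; rewrite in_itv /= => u01; apply: H.
    by rewrite in_itv /=; exact: AI.
  exact: N3.
have tm a t : times a c' t -> times a c (t * m + s).
  by move=> [/=]; rewrite in_itv /= => t01 bt; split=> //=; rewrite in_itv /=; exact: AI.
have loc a t : times a c' t -> exists (d : R) (F : R -> 'rV[R]_n), [/\ 0 < d,
     forall k, Ck k (ball t d) F, forall u : R, 0 <= u <= 1 -> `|u - t| < d ->
       lc a c' u = F u /\ 'D_1 ('D_1 F) u = - Gam a (F u) ('D_1 F u) ('D_1 F u) &
     'D_1 F t = m *: local_velocity a c (t * m + s)].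
  move=> tt; have [d [F [d0 cF FP]]] := arc_local arc (tm a t tt).
  have bb (u : R) : `|u - t| < d -> ball (t * m + s) d (u * m + s).
    by rewrite -ball_normE /= distrC; exact: Ad.
  have dF1 (u : R) : `|u - t| < d ->
      is_derive u 1 (fun u : R => F (u * m + s)) (m *: 'D_1 F (u * m + s)).
    by move=> ud; apply/is_derive_reparam/derivableP; exact: Ck_derivable (cF 1%N) (bb u ud).
  exists d, (fun u : R => F (u * m + s)); split => //.
  - move=> k; apply: Ck_sub (Ck_reparam m s (ball_open _ _) (cF k)) => u.
    by rewrite -ball_normE /= distrC => /bb.
  - move=> u u01 ud; have [_ E1 _ E2] := FP _ (AI u u01) (Ad u t d ud).
    split; first exact: E1.
    have dD : is_derive u 1 ('D_1 (fun u : R => F (u * m + s))) (m *: (m *: 'D_1 ('D_1 F) (u * m + s))).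
      have D : is_derive u 1 (fun u : R => 'D_1 F (u * m + s)) (m *: 'D_1 ('D_1 F) (u * m + s)).
        have D0 : is_derive (u * m + s) (1 : R) ('D_1 F) ('D_1 ('D_1 F) (u * m + s)).
          by apply: derivableP; exact: Ck_derivable (Ck_derive (1 : R) (cF 2%N)) (bb u ud).
        exact: is_derive_reparam D0.
      apply: near_eq_is_derive (is_deriveZ m D).
      have e0 : 0 < d - `|u - t| by rewrite subr_gt0.
      apply: (dist_near e0) => u' u'd.
      have u't : `|u' - t| < d.
        by move: u'd; rewrite ltrBrDr; apply: le_lt_trans; exact: ler_distD.
      by have [_ ->] := dF1 u' u't.
    have [_ ->] := dD; have [_ ->] := dF1 u ud.
    by rewrite E2 GamZl GamZr !scalerN.
  - have td : `|t - t| < d by rewrite subrr normr0.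
    have t01 : 0 <= t <= 1 by case: tt => /=; rewrite in_itv.
    have [_ ->] := dF1 t td.
    by have [_ _ <- _] := FP _ (AI t t01) (Ad t t d td).
have A' : geodesic_arc (c s) (c (m + s)) c'.
  have -> : c s = c' 0 by rewrite /c' mul0r add0r.
  have -> : c (m + s) = c' 1 by rewrite /c' mul1r.
  apply: arc_of_local => // a t /loc[d [F [d0 cF FP _]]].
  by exists d, F; split.
split=> // a t tt; split; first exact: tm.
have [d [F [d0 cF FP <-]]] := loc a t tt.
apply: (arc_velocity_eq A' tt d0); last by move=> u u01 /(FP u u01)[].
by apply: Ck_derivable (cF 1%N) _; exact: ballxx.
Qed.

Lemma arc_geoat p q c (t : R) : geodesic_arc p q c -> 0 < t < 1 ->
  (forall s : R, 0 < s < 1 -> ~ boundary (c s)) ->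
  geoat c t /\ forall a, dm a (c t) -> lv a c t = local_velocity a c t.
Proof.
move=> arc tI inter.
have t01 (s : R) : 0 < s < 1 -> 0 <= s <= 1 by move=> /andP[/ltW -> /ltW ->].
have [m m0 mP] := itv_ballin tI.
have K a : dm a (c t) -> geoin a c t /\ lv a c t = local_velocity a c t.
  move=> at_; have tt : times a c t by split=> //=; rewrite in_itv /=; exact: t01.
  have [d [F [d0 cF FP]]] := arc_local arc tt.
  pose e := Num.min m d.
  have e0 : 0 < e by rewrite lt_min m0.
  have FE (s : R) : `|s - t| < e -> lc a c s = F s /\ dm a (c s).
    rewrite lt_min => /andP[/mP/t01 s01 sd].
    by have [[]] := FP s s01 sd.
  have bb (s : R) : `|s - t| < e -> ball t d s.
    by rewrite -ball_normE /= distrC lt_min => /andP[].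
  have dF (s : R) : `|s - t| < e -> is_derive s 1 (lc a c) ('D_1 F s).
    move=> se; have D : is_derive s 1 F ('D_1 F s).
      by apply: derivableP; exact: Ck_derivable (cF 1%N) (bb s se).
    apply: near_eq_is_derive D.
    have e1 : 0 < e - `|s - t| by rewrite subr_gt0.
    apply: (dist_near e1) => s' s'd; apply/esym/(proj1 (FE s' _)).
    by move: s'd; rewrite ltrBrDr; apply: le_lt_trans; exact: ler_distD.
  have te : `|t - t| < e by rewrite subrr normr0.
  have td : `|t - t| < d by rewrite subrr normr0.
  have [_ E1 E2 E3] := FP t (t01 t tI) td.
  have lvt : lv a c t = 'D_1 F t by have [_] := dF t te.
  split; last by rewrite lvt E2.
  split.
  - by apply: interior_ocod => //; exact: inter.
  - by apply: (dist_near e0) => s /FE[].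
  - by have [] := dF t te.
  - rewrite lvt E1 -E3.
    have D : is_derive t 1 ('D_1 F) ('D_1 ('D_1 F) t).
      by apply: derivableP; exact: Ck_derivable (Ck_derive (1 : R) (cF 2%N)) (bb t te).
    by apply: near_eq_is_derive D; apply: (dist_near e0) => s /dF[].
by split=> [a|a] /K[].
Qed.

End Arcs.

Section RealCurves.
Context {R : realType}.

Lemma derive_lip (W : normedModType R) (f : R -> W) (s : R) df :
  is_derive s (1 : R) f df ->
  exists r K : R, [/\ 0 < r, 0 <= K & forall t : R, `|t - s| < r ->
    `|f t - f s| <= K * `|t - s|].
Proof.
move=> [D _].
have C : h^-1 *: (f (h *: (1 : R) + s) - f s) @[h --> 0^'] --> 'D_1 f s := D.
have /cvgrPdist_lt /(_ 1 ltr01) /nbhs_ballP[r r0 rP] := C.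
exists r, (`|'D_1 f s| + 1); split; [exact: r0|by rewrite addr_ge0|].
move=> t tr; have [->|ts] := eqVneq t s; first by rewrite !subrr !normr0 mulr0.
have h0 : t - s != 0 by rewrite subr_eq0.
have := rP (t - s); rewrite -ball_normE /= sub0r normrN => /(_ tr h0).
have -> : (t - s) *: (1 : R) + s = t by rewrite -[X in X + _]/((t - s) * 1) mulr1 subrK.
set q := _^-1 *: _ => hq.
have -> : f t - f s = (t - s) *: q by rewrite /q scalerA mulfV// scale1r.
rewrite normrZ mulrC ler_wpM2r//.
have : `|q| <= `|'D_1 f s| + `|'D_1 f s - q|.
  by rewrite -[X in `|X| <= _](subrK ('D_1 f s)) addrC -[`|'D_1 f s - q|]distrC ler_normD.
by move/le_trans; apply; rewrite lerD2l ltW.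
Qed.

Lemma is_derive_quad (W : normedModType R) (f : R -> W) (s r C : R) : 0 < r -> 0 <= C ->
  (forall t : R, `|t - s| < r -> `|f t| <= C * `|t - s| ^+ 2) -> is_derive s (1 : R) f 0.
Proof.
move=> r0 C0 H.
have fs : f s = 0.
  by apply/eqP; have := H s; rewrite subrr normr0 expr0n mulr0 normr_le0; apply.
suff K : (fun h : R => h^-1 *: (f (h *: (1 : R) + s) - f s)) @ 0^' --> (0 : W).
  split; first by apply/cvg_ex; exists 0.
  by apply/cvg_lim.
apply/cvgrPdist_le => e e0.
pose d := Num.min r (e / (C + 1)).
have c1 : 0 < C + 1 by rewrite ltr_wpDl.
have d0 : 0 < d by rewrite lt_min r0 divr_gt0.
near=> h.
have h0 : h != 0 by near: h; exact: nbhs_dnbhs_neq.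
have : `|h| < d by near: h; exact: dnbhs0_lt.
rewrite lt_min => /andP[hr he].
have -> : h *: (1 : R) = h by exact: mulr1.
rewrite fs subr0 sub0r normrN normrZ normfV ler_pdivrMl ?normr_gt0//.
have := H (h + s); rewrite addrK => /(_ hr) /le_trans; apply.
rewrite expr2 mulrCA ler_wpM2l//.
move: he; rewrite ltr_pdivlMr// => /ltW; apply: le_trans.
by rewrite mulrC ler_wpM2l// lerDl.
Unshelve. all: by end_near. Qed.

Lemma Qdiff_curve n m (G : 'rV[R]_n -> 'rV[R]_m) L (zt : R -> 'rV[R]_n) (s : R) dz :
  Qdiff (zt s) G L -> is_derive s (1 : R) zt dz ->
  is_derive s (1 : R) (fun t => G (zt t)) (dz *m L).
Proof.
move=> [r [C [r0 C0 H]]] D.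
have [r1 [K [r10 K0 HK]]] := derive_lip D.
have DL := is_derive_mulmx D (is_derive_cst L s (1 : R)).
pose d := Num.min r1 (r / (K + 1)).
have k1 : 0 < K + 1 by rewrite ltr_wpDl.
have d0 : 0 < d by rewrite lt_min r10 divr_gt0.
have DR : is_derive s (1 : R) (fun t => G (zt t) - G (zt s) - (zt t - zt s) *m L) 0.
  apply: (is_derive_quad (C := C * K * K) d0); first by rewrite !mulr_ge0.
  move=> t; rewrite lt_min => /andP[td te].
  have l := HK t td.
  have zr : `|zt t - zt s| < r.
    apply: le_lt_trans l _; move: te; rewrite ltr_pdivlMr//; apply: le_lt_trans.
    by rewrite mulrC ler_wpM2l// lerDl.
  have := H (zt t) (zt s) zr; rewrite subrr normr0 addr0 => /(_ r0) /le_trans; apply.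
  have := ler_pM (normr_ge0 _) (normr_ge0 _) l l => /(ler_wpM2l C0).
  rewrite !mulrA => /le_trans; apply; rewrite le_eqVlt; apply/orP; left; apply/eqP; ring.
have DC := is_derive_cst (G (zt s) - zt s *m L) s (1 : R).
have := is_deriveD (is_deriveD DR DL) DC.
rewrite mulmx0 !addr0 add0r; congr is_derive; apply/funext => t.
rewrite !fctE mulmxBl; set X := G _; set Y := G _; set A := _ *m L; set B := _ *m L.
by apply/matrixP => i j; rewrite !mxE; ring.
Qed.

Lemma continuous_limit (f : R -> R) (t C : R) : {for t, continuous f} ->
  (forall e, 0 < e -> exists2 s : R, `|s - t| < e & f s = C) -> f t = C.
Proof.
move=> cf H; apply/eqP; rewrite -subr_eq0 -normr_le0 leNgt; apply/negP => e0.
have [r r0 rP] := cvg_normP cf e0.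
have [s sr sC] := H r r0; have := rP s sr.
by rewrite sC distrC ltxx.
Qed.

Lemma unit_interior (t e : R) : 0 <= t <= 1 -> 0 < e ->
  exists2 s : R, `|s - t| < e & 0 < s < 1.
Proof.
move=> /andP[t0 t1] e0; pose m := Num.min (e / 2) 2^-1.
have m0 : 0 < m by rewrite lt_min divr_gt0//= invr_gt0.
have me : m < e by rewrite gt_min ltr_pdivrMr// ltr_pMr ?ltr1n.
have m1 : m <= 2^-1 by rewrite ge_min lexx orbT.
have [th|th] := leP t 2^-1.
  exists (t + m * 2^-1); last by apply/andP; split; lra.
  by rewrite addrAC subrr add0r gtr0_norm ?divr_gt0//; lra.
exists (t - m * 2^-1); last by apply/andP; split; lra.
by rewrite addrAC subrr add0r normrN gtr0_norm ?divr_gt0//; lra.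
Qed.

End RealCurves.

(** * The length of the arc between two points *)

Section Distance.
Context {R : realType} {n : nat} (M : riemannianManifold R n).
Implicit Types (a b : atlas M) (z u v w eta : 'rV[R]_n) (x y p q : M) (c : R -> M).

Local Notation crd a := (Defs.coord (chart_of a)).
Local Notation prm a := (param (chart_of a)).
Local Notation dm a := (dom (chart_of a)).
Local Notation T a b := (transition (chart_of a) (chart_of b)).

(* the length of a geodesic arc from p to q, as its constant speed *)
Definition gdist p q : R :=
  xget 0 [set l | exists2 c, geodesic_arc p q c & l = tnorm (c 2^-1) (velocity c 2^-1)].

(** At interior points away from an interior p, this is the gradient of half the squared distance
    from p. In a convex manifold an arc to [prm b z] always exists, so the default 0 is never
    taken. *)
Definition arrival p b z : 'rV[R]_n :=
  xget 0 [set v | exists2 c, geodesic_arc p (prm b z) c & v = local_velocity b c 1].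

Hypothesis conv : convex_manifold M.

Let half_itv : (2^-1 : R) \in `[0, 1].
Proof. by rewrite in_itv /=; apply/andP; split; lra. Qed.

Lemma arc_uniq p q c c' : geodesic_arc p q c -> geodesic_arc p q c' ->
  forall t : R, t \in `[0, 1] -> c t = c' t.
Proof. by move=> A A'; have [_ [H _]] := conv p q; exact: H. Qed.

Lemma gdist_arc p q c : geodesic_arc p q c ->
  gdist p q = tnorm (c 2^-1) (velocity c 2^-1).
Proof.
move=> A; apply: xget_unique; first by exists c.
move=> _ [c' A' ->].
have E := arc_uniq A A'.
have tt : times (index_at (c 2^-1)) c 2^-1 by split; [exact: half_itv|exact: index_atP].
have [_ V] := arc_unique_velocity A A' E tt.
have E2 := E _ half_itv.
by rewrite /velocity -E2 V.
Qed.

Lemma gdist_ge0 p q : 0 <= gdist p q.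
Proof. by have [[c A] _] := conv p q; rewrite (gdist_arc A) sqrtr_ge0. Qed.

Lemma arrival_arc p b z c : cod (chart_of b) z -> geodesic_arc p (prm b z) c ->
  arrival p b z = local_velocity b c 1.
Proof.
move=> cz A; apply: xget_unique; first by exists c.
move=> _ [c' A' ->].
have c1 : c 1 = prm b z by case: A.
have tt : times b c 1.
  split; first by rewrite /= in_itv /= ler01 lexx.
  by rewrite /= c1; exact: chart_param_dom.
by have [_ V] := arc_unique_velocity A A' (arc_uniq A A') tt.
Qed.

Lemma arc_interior p q c : p <> q -> geodesic_arc p q c ->
  forall t : R, 0 < t < 1 -> ~ boundary (c t).
Proof. by move=> pq A t tI; have [_ [_ H]] := conv p q; apply: (H pq c A); rewrite in_itv. Qed.

Lemma times_in c b (t : R) : times b c t -> 0 <= t <= 1.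
Proof. by move=> [/=]; rewrite in_itv. Qed.

Lemma arc_energy_interior p q c b (t : R) : p <> q -> geodesic_arc p q c -> 0 < t < 1 ->
  dm b (c t) -> gG b (lc b c t) (local_velocity b c t) (local_velocity b c t) = gdist p q ^+ 2.
Proof.
move=> pq A tI bt.
have inter := arc_interior pq A.
have G (s : R) : 0 < s < 1 -> geoat c s by move=> sI; have [] := arc_geoat A sI inter.
have [gt V] := arc_geoat A tI inter.
have hI : 0 < (2^-1 : R) < 1 by apply/andP; split; lra.
have E : energy c t = energy c 2^-1.
  apply: (const_on_itv (al := 0) (be := 1)) => // u uI; apply: energy_derive.
  have [m m0 mP] := itv_ballin uI.
  by apply: (dist_near m0) => s /mP; exact: G.
rewrite -(V b bt) -(energy_chart gt bt) E (gdist_arc A).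
have [_ V2] := arc_geoat A hI inter.
have hE : energy c 2^-1 = inner (c 2^-1) (velocity c 2^-1) (velocity c 2^-1).
  by rewrite /velocity -(V2 _ (index_atP _)).
have h0 : 0 <= energy c 2^-1.
  by apply: gG_ge0; apply: chart_coord_cod; exact: index_atP.
rewrite hE in h0 *; exact/esym/sqr_sqrtr.
Qed.

(** At times 0 and 1 the arc may lie on the boundary. Smooth local extensions of the arc and of the
    metric make the squared speed a continuous function of time, and it is constant at the times in
    between. *)
Lemma arc_energy p q c b (t : R) : p <> q -> geodesic_arc p q c -> times b c t ->
  gG b (lc b c t) (local_velocity b c t) (local_velocity b c t) = gdist p q ^+ 2.
Proof.
move=> pq A tt; have t01 := times_in tt.
have [d [F [d0 cF FP]]] := arc_local A tt.
have td : `|t - t| < d by rewrite subrr normr0.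
have [_ E1 E2 _] := FP t t01 td.
have bt : ball t d t by exact: ballxx.
have ct : cod (chart_of b) (F t) by rewrite -E1; apply: chart_coord_cod; case: tt.
have [U [Mt [oU Ut cM ME]]] := metric_smooth ct.
have dF : is_derive t 1 F ('D_1 F t) by apply: derivableP; exact: Ck_derivable (cF 1%N) bt.
have dF2 : is_derive t 1 ('D_1 F) ('D_1 ('D_1 F) t).
  by apply: derivableP; exact: Ck_derivable (Ck_derive (1 : R) (cF 2%N)) bt.
have D := is_derive_bf oU (cM 1%N) Ut dF dF2 dF2.
have cphi := derive_continuous D.
have [r r0 rP] := open_normP oU Ut.
have [e e0 eP] := cvg_normP (proj1 (cF 0%N) t bt) r0.
rewrite E1 E2 /gG -(ME _ Ut ct).
apply: (continuous_limit (f := fun s => bf (Mt (F s)) ('D_1 F s) ('D_1 F s)) cphi) => e' e'0.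
have m0 : 0 < Num.min d (Num.min e e') by rewrite !lt_min d0 e0.
have [s /lt_min3[sd se se'] sI] := unit_interior t01 m0.
exists s => //; have s01 : 0 <= s <= 1 by case/andP: sI => /ltW -> /ltW ->.
have [[_ bs] F1 F2 _] := FP s s01 sd.
have cs : cod (chart_of b) (F s) by rewrite -F1; exact: chart_coord_cod.
rewrite (ME _ (rP _ (eP _ se)) cs) -F1 -F2.
exact: (arc_energy_interior pq A sI bs).
Qed.

Lemma arc_tnorm p q c (t : R) : p <> q -> geodesic_arc p q c -> 0 <= t <= 1 ->
  tnorm (c t) (velocity c t) = gdist p q.
Proof.
move=> pq A t01; have tt : times (index_at (c t)) c t.
  by split; [rewrite /= in_itv|exact: index_atP].
have E : inner (c t) (velocity c t) (velocity c t) = gdist p q ^+ 2 := arc_energy pq A tt.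
by rewrite /tnorm E sqrtr_sqr ger0_norm// gdist_ge0.
Qed.

Lemma arc_end p q c (t0 : R) (y : M) : geodesic_arc p q c -> 0 <= t0 <= 1 ->
  (forall t : R, 0 < t < 1 -> c t = y) -> c t0 = y.
Proof.
move=> A t01 H; pose b := index_at (c t0).
have bt : dm b (c t0) by exact: index_atP.
have tt : times b c t0 by split=> //; rewrite /= in_itv.
have [d [F [d0 cF FP]]] := arc_local A tt.
have dF : is_derive t0 1 F ('D_1 F t0).
  by apply: derivableP; apply: Ck_derivable (cF 1%N) _; exact: ballxx.
have td : `|t0 - t0| < d by rewrite subrr normr0.
have [s0 sd sI] := unit_interior t01 d0.
have T01 (s : R) : 0 < s < 1 -> 0 <= s <= 1 by case/andP => /ltW -> /ltW ->.
have [[_ bs] _ _ _] := FP s0 (T01 _ sI) sd.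
have by_ : dm b y by rewrite -(H s0 sI).
have Fy : F t0 = crd b y.
  apply/rowP => j.
  have cj : {for t0, continuous (fun t => F t 0 j)}.
    by move/is_derive_mx : dF => /(_ 0 j); exact: derive_continuous.
  apply: (continuous_limit (f := fun t => F t 0 j) cj) => e e0.
  have m0 : 0 < Num.min d e by rewrite lt_min d0.
  have [s] := unit_interior t01 m0; rewrite lt_min => /andP[sd' se] sI'.
  exists s => //; have [_ <- _ _] := FP s (T01 _ sI') sd'.
  by rewrite /lc (H s sI').
have [_ E _ _] := FP t0 t01 td.
by rewrite -(chart_coordK bt) -[crd b _]/(lc b c t0) E Fy chart_coordK.
Qed.

(** An arc of speed 0 has the same state at its midpoint as a constant curve, which is also a
    geodesic; by uniqueness the arc is constant, up to its ends. *)
Lemma gdist_gt0 p q : p <> q -> 0 < gdist p q.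
Proof.
move=> pq; rewrite lt_neqAle gdist_ge0 andbT; apply/eqP => g0; apply: pq.
have [[c A] _] := conv p q; apply: contrapT => pq.
have inter := arc_interior pq A.
have G (s : R) : 0 < s < 1 -> geoat c s by move=> sI; have [] := arc_geoat A sI inter.
have hI : 0 < (2^-1 : R) < 1 by apply/andP; split; lra.
pose y := c 2^-1; pose b := index_at y.
have by_ : dm b y by exact: index_atP.
have V0 a (t : R) : 0 < t < 1 -> dm a (c t) -> lv a c t = 0.
  move=> tI at_; have [_ ->] := arc_geoat A tI inter => //.
  have ct : cod (chart_of a) (lc a c t) by exact: chart_coord_cod.
  by apply: (gG_eq0 ct); rewrite (arc_energy_interior pq A tI at_) -g0 expr0n.
have lvy a (s : R) : lv a (fun=> y) s = 0 by exact: (derive_cst (crd a y) s (1 : R)).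
have gy (t : R) : geoat (fun=> y) t.
  have oy : ~ boundary y by exact: inter.
  move=> a ay.
  split; [exact: interior_ocod|by apply: (dist_near ltr01)| |].
    exact: derivable_cst.
  rewrite lvy Gam0l oppr0; have -> : lv a (fun=> y) = (fun=> 0).
    by apply/funext => s; exact: lvy.
  exact: is_derive_cst.
have gg (s : R) : 0 < s < 1 -> geoat c s /\ geoat (fun=> y) s.
  by move=> sI; split; [exact: G|exact: gy].
have Est : st b c 2^-1 = st b (fun=> y) 2^-1 by rewrite /st (V0 b _ hI by_) lvy.
have U (t : R) : 0 < t < 1 -> c t = y := geo_unique hI gg by_ by_ Est (t := t).
have [_ c0 c1 _] := A.
have I0 : 0 <= (0 : R) <= 1 by rewrite lexx ler01.
have I1 : 0 <= (1 : R) <= 1 by rewrite lexx ler01.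
by apply: pq; rewrite -c0 -c1 (arc_end A I0 U) (arc_end A I1 U).
Qed.

Lemma tnormZ x (m : R) v : tnorm x (m *: v) = `|m| * tnorm x v.
Proof.
rewrite /tnorm.
have -> : inner x (m *: v) (m *: v) = m ^+ 2 * inner x v v.
  by rewrite -[LHS]/(bf _ _ _) -[inner x v v]/(bf _ _ _) bfZl bfZr expr2 mulrA.
by rewrite sqrtrM ?sqr_ge0// sqrtr_sqr.
Qed.

Lemma gdist_sub p q c (m s : R) : p <> q -> geodesic_arc p q c -> 0 <= s <= 1 ->
  0 <= m + s <= 1 -> gdist (c s) (c (m + s)) = `|m| * gdist p q.
Proof.
move=> pq A s01 ms01; have [A' V] := arc_affine A s01 ms01.
rewrite (gdist_arc A').
have h01 : 0 <= 2^-1 * m + s <= 1.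
  by move: s01 ms01 => /andP[? ?] /andP[? ?]; apply/andP; split; lra.
rewrite -(arc_tnorm pq A h01) -tnormZ.
congr tnorm; have tt : times (index_at (c (2^-1 * m + s))) (fun u : R => c (u * m + s)) 2^-1.
  by split; [exact: half_itv|exact: index_atP].
by have [_] := V _ _ tt.
Qed.

Lemma gdistC p q : gdist p q = gdist q p.
Proof.
have [->//|pq] := pselect (p = q).
have [[c A] _] := conv p q; have [_ c0 c1 _] := A.
have s1 : 0 <= (1 : R) <= 1 by rewrite ler01 lexx.
have s0 : 0 <= - 1 + (1 : R) <= 1 by rewrite addNr lexx ler01.
have := gdist_sub pq A s1 s0; rewrite addNr c0 c1 => ->.
by rewrite normrN normr1 mul1r.
Qed.

Lemma arc_from p q c (t : R) : geodesic_arc p q c -> 0 <= t <= 1 ->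
  geodesic_arc p (c t) (fun u : R => c (u * t + 0)) /\
  forall b, dm b (c t) ->
    local_velocity b (fun u : R => c (u * t + 0)) 1 = t *: local_velocity b c t.
Proof.
move=> A t01; have s0 : 0 <= (0 : R) <= 1 by rewrite lexx ler01.
have t0 : 0 <= t + 0 <= 1 by rewrite addr0.
have [A' V] := arc_affine A s0 t0; have [_ c0 _ _] := A.
split; first by move: A'; rewrite c0 addr0.
move=> b bt; have tt : times b (fun u : R => c (u * t + 0)) 1.
  by split; [rewrite /= in_itv /= ler01 lexx|rewrite /= mul1r addr0].
by have [_ ->] := V b 1 tt; rewrite mul1r addr0.
Qed.

Lemma arrival_sub p q c b (t : R) : geodesic_arc p q c -> 0 <= t <= 1 -> dm b (c t) ->
  arrival p b (crd b (c t)) = t *: local_velocity b c t.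
Proof.
move=> A t01 bt; have [A' V] := arc_from A t01.
rewrite -(V b bt); apply: arrival_arc; first exact: chart_coord_cod.
by rewrite chart_coordK.
Qed.

End Distance.

(** * Convexity of the distance *)

Lemma is_derive_inv (R : realType) (f : R -> R) (t df : R) : is_derive t (1 : R) f df ->
  f t != 0 -> is_derive t (1 : R) (fun t => (f t)^-1) (- (f t) ^- 2 * df).
Proof.
move=> [D <-] f0; split; first exact: derivableV.
by rewrite (deriveV f0 D).
Qed.

Section DistanceDerivatives.
Context {R : realType} {n : nat} (M : riemannianManifold R n).
Implicit Types (a b : atlas M) (z u v w eta : 'rV[R]_n) (x y p q : M) (c : R -> M).

Local Notation crd a := (Defs.coord (chart_of a)).
Local Notation prm a := (param (chart_of a)).
Local Notation dm a := (dom (chart_of a)).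

Hypothesis conv : convex_manifold M.

Lemma near_regular p b z : ocod b z -> p <> prm b z ->
  exists2 r : R, 0 < r & forall z', `|z' - z| < r -> ocod b z' /\ p <> prm b z'.
Proof.
move=> oz pz.
have [r1 r10 H1] := open_normP (ocod_open b) oz.
have oC : open (~` [set p]).
  by rewrite openC; apply: accessible_closed_set1; apply: hausdorff_accessible; exact: space_hausdorff.
have N : nbhs (prm b z) (~` [set p]).
  by apply: open_nbhs_nbhs; split=> // /esym.
have /nbhs_ballP[r2 r20 H2] := param_continuous oz N.
exists (Num.min r1 r2); first by rewrite lt_min r10.
move=> z'; rewrite lt_min => /andP[h1 h2]; split; first exact: H1.
have := H2 z'; rewrite -ball_normE /= distrC => /(_ h2) H E; exact: H (esym E).
Qed.

Lemma arrival_energy p b z : cod (chart_of b) z -> p <> prm b z ->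
  gG b z (arrival p b z) (arrival p b z) = gdist p (prm b z) ^+ 2.
Proof.
move=> cz pz; have [[c A] _] := conv p (prm b z).
have c1 : c 1 = prm b z by case: A.
have tt : times b c 1.
  split; first by rewrite /= in_itv /= ler01 lexx.
  by rewrite /= c1; exact: chart_param_dom.
have := arc_energy conv pz A tt.
by rewrite /lc c1 chart_paramK// (arrival_arc conv cz A).
Qed.

Section Curved.
Variable (k : R).
Hypothesis k0 : 0 < k.
Hypothesis curv : sectional_le M (- k ^+ 2).

(** By uniqueness of arcs the field built locally in [fan] is [arrival p b] near z, so this single
    map is differentiable at every such z. The first identity compares two derivatives of its
    squared norm. *)
Lemma fan_gdist p b z : ~ boundary p -> ocod b z -> p <> prm b z ->
  exists L : 'M[R]_n, Qdiff z (arrival p b) L /\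
  forall eta (q D : R), q = gG b z eta (arrival p b z) -> D = gdist p (prm b z) ->
   gG b z (eta *m L + Gam b z eta (arrival p b z)) (arrival p b z) = q /\
   k * D * ch (k * D) * (gG b z eta eta - q ^+ 2 / D ^+ 2) <=
   sh (k * D) * (gG b z eta (eta *m L + Gam b z eta (arrival p b z)) - q ^+ 2 / D ^+ 2).
Proof.
move=> ip oz pz; have cz := ocod_cod oz.
have [[c0 A] _] := conv p (prm b z); have [_ c00 c01 _] := A.
have dy : dm b (prm b z) by exact: chart_param_dom.
have crdz : crd b (prm b z) = z by rewrite chart_paramK.
have iy : ~ boundary (prm b z) by apply: (ocod_interior dy); rewrite crdz.
have inter (t : R) : 0 <= t <= 1 -> ~ boundary (c0 t).
  move=> /andP[]; rewrite le_eqVlt => /predU1P[<-|t0]; first by rewrite c00.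
  rewrite le_eqVlt => /predU1P[->|t1]; first by rewrite c01.
  by apply: (arc_interior conv pz A); rewrite t0.
have g0 := gdist_gt0 conv pz.
have w0n : local_velocity (index_at p) c0 0 != 0.
  have tt : times (index_at p) c0 0.
    by split; [rewrite /= in_itv /= lexx ler01|rewrite /= c00; exact: index_atP].
  have E := arc_energy conv pz A tt; apply/eqP => w0; move: E; rewrite w0 /gG bf0l.
  by move=> /esym/eqP; rewrite expf_eq0 (gt_eqF g0) andbF.
have [V [L [e [e0 V1 Varc QV H]]]] := fan k0 curv A inter w0n dy.
rewrite crdz in V1 Varc QV H.
have [r r0 rP] := near_regular oz pz.
pose e' := Num.min e r.
have e'0 : 0 < e' by rewrite lt_min e0.
have VE z' : `|z' - z| < e' -> V z' = arrival p b z'.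
  rewrite lt_min => /andP[/Varc[c Ac vc] /rP[oz' _]].
  by rewrite (arrival_arc conv (ocod_cod oz') Ac).
have Vz : V z = arrival p b z by apply: VE; rewrite subrr normr0.
exists L; split; first exact: Qdiff_near e'0 VE QV.
move=> eta q D Eq ED.
have ED2 : gG b z (arrival p b z) (arrival p b z) = D ^+ 2.
  by rewrite ED; exact: arrival_energy.
have D0 : 0 <= D by rewrite ED ltW.
have Ek : k * D = k * Num.sqrt (gG b z (arrival p b z) (arrival p b z)).
  by rewrite ED2 sqrtr_sqr ger0_norm.
have Ev : arrival p b z = local_velocity b c0 1 by rewrite -Vz V1.
have [D1] := H eta _ q (k * D) Ev Eq Ek; rewrite ED2 => D2; split; last exact: D2.
have DV := Qdiff_derive eta QV.
have D3 := is_derive_gG (a := b) (z := fun z => z) (x := z) oz (is_derive_id z eta) DV DV.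
have E : gG b z (eta *m L + Gam b z eta (V z)) (V z) +
  gG b z (V z) (eta *m L + Gam b z eta (V z)) = 2 * q.
  by have [_ <-] := D3; have [_ <-] := D1.
move: E; rewrite (gGC (V z) _ cz) Vz; set X := gG _ _ _ _; lra.
Qed.

(** First and second variation of D(p, .) along a curve. The witness [X] is the Hessian of half the
    squared distance, evaluated on the velocity, and [dd + Gam b (zt s) (z1 s) (z1 s)] is the
    covariant acceleration of the curve. The last inequality is the Hessian comparison. *)
Lemma gdist_curve p b (zt z1 : R -> 'rV[R]_n) (s r : R) dd : ~ boundary p -> 0 < r ->
  (forall t : R, `|t - s| < r -> [/\ ocod b (zt t), p <> prm b (zt t) &
     is_derive t 1 zt (z1 t)]) ->
  is_derive s 1 z1 dd ->
  let D t := gdist p (prm b (zt t)) in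
  let q t := gG b (zt t) (z1 t) (arrival p b (zt t)) in
  (forall t : R, `|t - s| < r -> is_derive t 1 D (q t / D t)) /\
  exists X : R, is_derive s 1 (fun t => q t / D t)
    ((gG b (zt s) (dd + Gam b (zt s) (z1 s) (z1 s)) (arrival p b (zt s)) + X) / D s
      - q s ^+ 2 / D s ^+ 3) /\
   k * D s * ch (k * D s) * (gG b (zt s) (z1 s) (z1 s) - q s ^+ 2 / D s ^+ 2) <=
   sh (k * D s) * (X - q s ^+ 2 / D s ^+ 2).
Proof.
move=> ip r0 H Dd D q.
have HD (t : R) : `|t - s| < r -> is_derive t 1 D (q t / D t) /\ 0 < D t.
  move=> tr; have [oz pz dz] := H t tr; have cz := ocod_cod oz.
  have D0 : 0 < D t := gdist_gt0 conv pz.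
  split=> //; have [L [QL HL]] := fan_gdist ip oz pz.
  have DV := Qdiff_curve QL dz.
  have D1 := is_derive_gG oz dz DV DV.
  have [E _] := HL (z1 t) (q t) (D t) erefl erefl.
  have D2 := is_derive_cast D1 (df' := 2 * q t).
  have {}D2 : is_derive t 1 (fun s => gG b (zt s) (arrival p b (zt s)) (arrival p b (zt s))) (2 * q t).
    by apply: D2; rewrite (gGC (arrival _ _ _) _ cz) E mulrDl !mul1r.
  have e0 : 0 < r - `|t - s| by rewrite subr_gt0.
  have D3 : is_derive t 1 (fun s => D s ^+ 2) (2 * q t).
    apply: near_eq_is_derive D2; apply: (dist_near e0) => t' t'r.
    have t's : `|t' - s| < r.
      by move: t'r; rewrite ltrBrDr; apply: le_lt_trans; exact: ler_distD.
    by have [oz' pz' _] := H t' t's; rewrite arrival_energy//; exact: ocod_cod.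
  (* The squared distance is what the arrival velocity allows to differentiate; it is positive here,
     so its square root is derivable too. *)
  have p2 : 0 < D t ^+ 2 by rewrite exprn_gt0.
  have D4 := is_derive_comp1 D3 (is_derive1_sqrt p2).
  have ES (u : R) : Num.sqrt (D u ^+ 2) = D u by rewrite sqrtr_sqr ger0_norm//; exact: gdist_ge0.
  have D5 := is_derive_cast D4 (df' := q t / D t).
  have FE : (fun y : R => Num.sqrt (D y ^+ 2)) = D by apply/funext => u; exact: ES.
  rewrite FE in D5; apply: D5; rewrite ES.
  have Dn : D t != 0 by rewrite gt_eqF.
  by field.
split; first by move=> t /HD[].
have sr : `|s - s| < r by rewrite subrr normr0.
have [oz pz dz] := H s sr; have [dD D0] := HD s sr.
have [L [QL HL]] := fan_gdist ip oz pz.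
have DV := Qdiff_curve QL dz.
have [_ K] := HL (z1 s) (q s) (D s) erefl erefl.
exists (gG b (zt s) (z1 s) (z1 s *m L + Gam b (zt s) (z1 s) (arrival p b (zt s)))).
split; last exact: K.
have Dq := is_derive_gG oz dz Dd DV.
have Dn : D s != 0 by rewrite gt_eqF.
have DI := is_derive_inv dD Dn.
apply: (is_derive_cast (is_derive_mul Dq DI)).
by rewrite -/(q s); set A := gG _ _ _ _; set B := gG _ _ _ _; field.
Qed.

End Curved.

End DistanceDerivatives.

Lemma Ck1_mx_bound (R : realType) m n q (A : 'rV[R]_m -> 'M[R]_(n, q)) (U : set 'rV[R]_m) z0 :
  open U -> Ck 1 U A -> U z0 ->
  exists r B : R, [/\ 0 < r, 0 <= B & forall z, `|z - z0| < r ->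
    [/\ U z, `|A z| <= B & forall v, `|'D_v A z| <= B * `|v|]].
Proof.
move=> oU cA Uz; have [r1 r10 H1] := open_normP oU Uz.
have [r2 r20 H2] := cvg_normP (Ck_cont cA Uz) ltr01.
pose e_ (l : 'I_m) : 'rV[R]_m := delta_mx 0 l.
pose C := 1 + \sum_l `|'D_(e_ l) A z0|.
have S0 : 0 <= \sum_l `|'D_(e_ l) A z0| by apply: sumr_ge0.
have C0 : 0 <= C by rewrite addr_ge0.
have [r3 r30 H3] : exists2 r : R, 0 < r & forall y, `|y - z0| < r ->
    forall l, `|'D_(e_ l) A y| <= C.
  apply: (fin_radius (P := fun l y => `|'D_(e_ l) A y| <= C)) => l.
  have [r r0 rP] := cvg_normP (Ck_cont (Ck_derive (e_ l) cA) Uz) ltr01.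
  exists r => // y /rP h.
  have : `|'D_(e_ l) A y| <= `|'D_(e_ l) A y - 'D_(e_ l) A z0| + `|'D_(e_ l) A z0|.
    by rewrite -[X in `|X| <= _](subrK ('D_(e_ l) A z0)) ler_normD.
  move/le_trans; apply; apply: lerD; first exact: ltW.
  by rewrite (bigD1 l)//= lerDl sumr_ge0.
pose B := 1 + `|A z0| + m%:R * C.
have B1 : 1 + `|A z0| <= B by rewrite lerDl mulr_ge0.
have B2 : m%:R * C <= B by rewrite lerDr addr_ge0.
have B0 : 0 <= B by apply: le_trans B1; rewrite addr_ge0.
exists (Num.min r1 (Num.min r2 r3)), B; split=> //; first by rewrite !lt_min r10 r20.
move=> z /lt_min3[/H1 Uz' /H2 h2 /H3 h3]; split=> //.
  apply: le_trans B1; rewrite -[X in `|X| <= _](subrK (A z0)).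
  by apply: le_trans (ler_normD _ _) _; rewrite lerD2r ltW.
move=> v; apply: mxnorm_le => [|i j]; first by rewrite mulr_ge0.
have dA u : derivable A z u by exact: Ck_derivable cA Uz'.
have cij : Ck 1 U (fun y => A y i j) by have /(Ck_mx 1 A oU) := cA; apply.
have Dij u : ('D_u A z) i j = 'D_u (fun y => A y i j) z.
  by rewrite (derive_mx (dA u)) mxE.
rewrite Dij (derive_coord v oU cij Uz').
apply: le_trans (@sum_norm_le _ _ _ (C * `|v|) _) _; last first.
  by rewrite mulrA ler_wpM2r.
move=> l; rewrite normrM mulrC -Dij; apply: ler_pM => //.
  by apply: le_trans (h3 l); exact: mxnorm_coord.
exact: mxnorm_coord.
Qed.

(** * Estimates uniform up to the boundary *)

Section ChartBounds.
Context {R : realType} {n : nat} (M : riemannianManifold R n).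
Implicit Types (a b : atlas M) (z u v w eta : 'rV[R]_n) (x y p q : M) (c : R -> M).

Local Notation crd a := (Defs.coord (chart_of a)).
Local Notation prm a := (param (chart_of a)).
Local Notation dm a := (dom (chart_of a)).

Lemma cod_near b z0 : cod (chart_of b) z0 -> exists2 r : R, 0 < r &
  forall z, `|z - z0| < r -> halfspaceR z -> cod (chart_of b) z.
Proof.
move=> cz; have [W oW E] := chart_open_cod (chart_of b).
have Wz : W z0 by move: cz; rewrite E => -[].
have [r r0 H] := open_normP oW Wz.
by exists r => // z /H Wz' hz; rewrite E; split.
Qed.

Lemma gG_le b z u w (B : R) : `|metric b z| <= B ->
  `|gG b z u w| <= n%:R * (n%:R * (B * `|u| * `|w|)).
Proof.
move=> h; apply: le_trans (bf_norm _ _ _) _.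
by rewrite !ler_wpM2l// -!mulrA ler_wpM2r// mulr_ge0.
Qed.

(** z0 may lie on the boundary, and the constants serve all interior points near it. The Christoffel
    form is estimated through the Koszul formula with a smooth extension [Mt] of the metric, so that
    bounds of [Mt], of its inverse and of its derivative around z0 suffice. *)
Lemma chart_bounds b z0 : cod (chart_of b) z0 -> exists r K : R, [/\ 0 < r, 0 < K &
  forall z, `|z - z0| < r -> halfspaceR z -> cod (chart_of b) z /\ (ocod b z ->
   forall u v, gG b z u u <= K ^+ 2 * `|u| ^+ 2 /\
   forall D : R, 0 <= D -> gG b z v v = D ^+ 2 ->
     `|gG b z (Gam b z u u) v| <= K * `|u| ^+ 2 * D)].
Proof.
move=> cz; have [r0 r00 H0] := cod_near cz.
have [U [Mt [oU Uz cM ME]]] := metric_smooth cz.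
have [r1 [B [r10 B0 H1]]] := Ck1_mx_bound oU (cM 1%N) Uz.
(* The extension [Mt] is known to be invertible on [cod] only; elsewhere a nonzero determinant has
   to be imposed. *)
pose U' := U `&` [set z | \det (Mt z) != 0].
have oU' : open U'.
  rewrite openE => z [Uz' dz]; apply: filterI; first by apply: open_nbhs_nbhs.
  have cd : {for z, continuous (fun z => \det (Mt z))}.
    apply: Ck_cont Uz'; apply: Ck_det => // i j.
    by have /(Ck_mx 1 Mt oU) := cM 1%N; apply.
  by apply: (cd [set x | x != 0]); apply: open_nbhs_nbhs; split=> //; exact: open_neq.
have Uz' : U' z0.
  by split=> //=; rewrite (ME _ Uz cz) -unitfE -unitmxE; exact: metric_unit.
have cI : Ck 1 U' (fun z => invmx (Mt z)).
  apply/(Ck_mx 1 _ oU') => i j; apply: Ck_invmx => //.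
    move=> i' j'; apply: Ck_sub (_ : Ck 1 U _); last first.
      by have /(Ck_mx 1 Mt oU) := cM 1%N; apply.
    by move=> z [].
  by move=> z [_ dz]; rewrite unitmxE unitfE.
have [r2 [B2 [r20 B20 H2]]] := Ck1_mx_bound oU' cI Uz'.
pose N : R := n%:R.
have N0 : 0 <= N by [].
pose K1 := N * (N * B) + 1.
have K10 : 1 <= K1 by rewrite lerDr !mulr_ge0.
pose K2 := N * (N * B) * 3 * (N * B2 * K1).
have K20 : 0 <= K2 by rewrite !mulr_ge0// (le_trans ler01).
exists (Num.min r0 (Num.min r1 r2)), (K1 + K2); split.
- by rewrite !lt_min r00 r10.
- by rewrite ltr_wpDr// (lt_le_trans ltr01).
move=> z /lt_min3[h0 h1 h2] hz; have cz' := H0 z h0 hz; split=> // oz u v.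
have [Uz1 MB DB] := H1 z h1; have [[_ dz] IB _] := H2 z h2.
have Mz : Mt z = metric b z by exact: ME.
rewrite Mz in MB IB.
have gle e w : `|gG b z e w| <= N * (N * B) * (`|e| * `|w|).
  by have := gG_le e w MB; rewrite !mulrA.
have K12 : 1 <= K1 + K2 by apply: le_trans K10 _; rewrite lerDl.
have K120 : 0 <= K1 + K2 by exact: le_trans ler01 K12.
have K1K : K1 <= (K1 + K2) ^+ 2.
  apply: (@le_trans _ _ (K1 + K2)); first by rewrite lerDl.
  by rewrite expr2 ler_peMr.
split.
  apply: le_trans (ler_norm _) _; apply: le_trans (gle u u) _.
  rewrite -expr2 ler_wpM2r ?exprn_ge0//; apply: le_trans K1K.
  by rewrite lerDl.
move=> D D0 vD.
(* The coordinate norm is bounded by the Riemannian one: the entries of [v *m metric b z] are inner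
   products with basis vectors, estimated by the Cauchy-Schwarz inequality. *)
have vle : `|v| <= N * B2 * K1 * D.
  have uz : metric b z \in unitmx by exact: metric_unit.
  have -> : v = (v *m metric b z) *m invmx (metric b z) by rewrite mulmxK.
  apply: le_trans (mulmx_norm _ _) _.
  have l1 : `|v *m metric b z| <= K1 * D.
    apply: mxnorm_le => [|i j]; first by rewrite mulr_ge0// (le_trans ler01).
    have -> : (v *m metric b z) i j = gG b z v (delta_mx 0 j).
      by rewrite /gG /bf trmx_delta -colE [RHS]mxE ord1.
    have dn : `|delta_mx 0 j : 'rV[R]_n| <= 1.
      apply: mxnorm_le => // i' j'; rewrite mxE; case: (_ && _); by rewrite ?normr1 ?normr0.
    have := gG_cauchy v (delta_mx 0 j) cz'; rewrite vD => CS.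
    have ee : gG b z (delta_mx 0 j) (delta_mx 0 j) <= K1.
      apply: le_trans (ler_norm _) _; apply: le_trans (gle _ _) _.
      apply: (@le_trans _ _ (N * (N * B) * 1)); last by rewrite mulr1 lerDl.
      by rewrite ler_wpM2l ?mulr_ge0// mulr_ile1.
    have K1D : 0 <= K1 * D by rewrite mulr_ge0// (le_trans ler01).
    rewrite -ler_sqr ?nnegrE// real_normK ?num_real//.
    apply: le_trans CS _; rewrite mulrC exprMn ler_wpM2r ?sqr_ge0//.
    by apply: le_trans ee _; rewrite expr2 ler_peMr// (le_trans ler01).
  have : N * `|invmx (metric b z)| <= N * B2 by rewrite ler_wpM2l.
  move=> l2; have := ler_pM _ _ l2 l1; rewrite !mulrA; apply => //.
  by rewrite mulr_ge0.
have gd e : 'D_e (metric b) z = 'D_e Mt z.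
  apply: near_eq_derive; have oo : open (U `&` ocod b) by apply: openI => //; exact: ocod_open.
  apply: (@filterS _ (nbhs z) _ (U `&` ocod b)); last exact: open_nbhs_nbhs.
  by move=> y [Uy oy]; rewrite ME//; exact: ocod_cod.
have De e w1 w2 : 'D_e (fun z => gG b z w1 w2) z = bf ('D_e Mt z) w1 w2.
  by have [_ ->] := derive_bf e w1 w2 (ocod_open b) (metric_Ck 1 b) oz; rewrite gd.
have dle e w1 w2 : `|bf ('D_e Mt z) w1 w2| <= N * (N * B) * (`|e| * `|w1| * `|w2|).
  apply: le_trans (bf_norm _ _ _) _; rewrite -!mulrA !ler_wpM2l// !mulrA.
  by apply: ler_wpM2r => //; apply: ler_wpM2r => //; exact: DB.
have L := Gam_lowered u u v oz; rewrite !De in L.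
have : `|2 * gG b z (Gam b z u u) v| <= N * (N * B) * 3 * (`|u| ^+ 2 * `|v|).
  rewrite L; apply: le_trans (ler_normB _ _) _.
  apply: (@le_trans _ _ (`|bf ('D_u Mt z) u v| + `|bf ('D_u Mt z) u v| + `|bf ('D_v Mt z) u u|)).
    by rewrite lerD2r ler_normD.
  have := dle u u v; have := dle v u u; rewrite !expr2; lra.
rewrite normrM ger0_norm// => h.
have h3 : `|gG b z (Gam b z u u) v| <= N * (N * B) * 3 * (`|u| ^+ 2 * `|v|).
  by apply: le_trans h; rewrite ler_peMl// ler1n.
apply: le_trans h3 _.
have : N * (N * B) * 3 * (`|u| ^+ 2 * `|v|) <= N * (N * B) * 3 * (`|u| ^+ 2 * (N * B2 * K1 * D)).
  by rewrite ler_wpM2l ?mulr_ge0// ler_wpM2l ?exprn_ge0.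
move/le_trans; apply.
have -> : N * (N * B) * 3 * (`|u| ^+ 2 * (N * B2 * K1 * D)) = K2 * (`|u| ^+ 2 * D).
  by rewrite /K2; ring.
by rewrite -mulrA ler_wpM2r ?mulr_ge0 ?exprn_ge0// lerDr (le_trans ler01).
Qed.

End ChartBounds.

Lemma semiconvex_bound (R : realType) (f f1 f2 : R -> R) (C : R) :
  (forall t : R, 0 <= t <= 1 -> is_derive t (1 : R) f (f1 t)) ->
  (forall t : R, 0 <= t <= 1 -> is_derive t (1 : R) f1 (f2 t) /\ - C <= f2 t) ->
  0 <= C -> f 0 + f1 0 - C <= f 1.
Proof.
move=> H1 H2 C0.
have M (t : R) : 0 <= t <= 1 -> f1 0 + C * 0 <= f1 t + C * t.
  move=> /andP[t0 t1].
  apply: (within_nondecr t0 (f := fun t => f1 t + C * t) (df := fun t => f2 t + C)) => u /andP[u0 ut].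
  have [D L] : is_derive u 1 f1 (f2 u) /\ - C <= f2 u by apply: H2; rewrite u0 (le_trans ut t1).
  split; last by lra.
  have := is_derive_add D (is_derive_affine C 0 u); congr is_derive.
  by apply/funext => s; rewrite addr0.
suff : f 0 - (f1 0 - C) * 0 <= f 1 - (f1 0 - C) * 1 by lra.
apply: (within_nondecr ler01 (f := fun t => f t - (f1 0 - C) * t)
  (df := fun t => f1 t - (f1 0 - C))) => u uI; split.
  have := is_derive_sub (H1 u uI) (is_derive_affine (f1 0 - C) 0 u); congr is_derive.
  by apply/funext => s; rewrite addr0.
by have := M u uI; move: uI => /andP[u0 u1]; nra.
Qed.

Section Lines.
Context {R : realType} {n : nat} (M : riemannianManifold R n).
Implicit Types (a b : atlas M) (z u v w eta : 'rV[R]_n) (x y p q : M) (c : R -> M).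

Local Notation crd a := (Defs.coord (chart_of a)).
Local Notation prm a := (param (chart_of a)).
Local Notation dm a := (dom (chart_of a)).

Hypothesis conv : convex_manifold M.
Variable (k : R).
Hypothesis k0 : 0 < k.
Hypothesis curv : sectional_le M (- k ^+ 2).

(** A coordinate segment has covariant acceleration [Gam] of eta with itself, whose pairing with the
    arrival velocity is bounded. The Hessian of D(p, .) is nonnegative by the comparison, so the
    acceleration is the only negative contribution to the second derivative. *)
Lemma line_gdist p b z eta (K : R) : ~ boundary p -> 0 <= K ->
  (forall t : R, 0 <= t <= 1 -> [/\ ocod b (t *: eta + z), p <> prm b (t *: eta + z),
     gG b (t *: eta + z) eta eta <= K ^+ 2 * `|eta| ^+ 2 &
     forall v (D : R), 0 <= D -> gG b (t *: eta + z) v v = D ^+ 2 ->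
     `|gG b (t *: eta + z) (Gam b (t *: eta + z) eta eta) v| <= K * `|eta| ^+ 2 * D]) ->
  `|gdist p (prm b (eta + z)) - gdist p (prm b z)| <= K * `|eta| /\
  gdist p (prm b z) + gG b z eta (arrival p b z) / gdist p (prm b z) - K * `|eta| ^+ 2
    <= gdist p (prm b (eta + z)).
Proof.
move=> ip K0 H.
pose zt (t : R) := t *: eta + z.
have dzt (t : R) : is_derive t 1 zt eta.
  exact: (is_derive_line (f := id) (is_derive_id (t *: eta + z) eta)).
have dz1 (t : R) : is_derive t 1 (fun=> eta) (0 : 'rV[R]_n) by exact: is_derive_cst.
pose D (t : R) := gdist p (prm b (zt t)).
pose q (t : R) := gG b (zt t) eta (arrival p b (zt t)).
have near_t (s : R) : 0 <= s <= 1 -> exists2 r : R, 0 < r & forall t : R, `|t - s| < r ->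
    [/\ ocod b (zt t), p <> prm b (zt t) & is_derive t 1 zt eta].
  move=> /H[oz pz _ _]; have [r r0 rP] := near_regular oz pz.
  have e1 : 0 < `|eta| + 1 by rewrite ltr_wpDl.
  exists (r / (`|eta| + 1)); first by rewrite divr_gt0.
  move=> t; rewrite (ltr_pdivlMr _ _ e1) => tr.
  have : `|zt t - zt s| < r.
    rewrite /zt opprD addrACA subrr addr0 -scalerBl normrZ; apply: le_lt_trans tr.
    by rewrite ler_wpM2l// lerDl.
  by move=> /rP[].
have CRV (s : R) : 0 <= s <= 1 -> is_derive s 1 D (q s / D s) /\
    exists f2 : R, is_derive s 1 (fun t => q t / D t) f2 /\ - (K * `|eta| ^+ 2) <= f2.
  move=> sI; have [r r0 rP] := near_t s sI.
  have [H1 [X [H2 H3]]] := gdist_curve conv k0 curv ip r0 rP (dz1 s).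
  have sr : `|s - s| < r by rewrite subrr normr0.
  split; first exact: H1.
  eexists; split; first exact: H2.
  have [oz pz _ GB] := H s sI; have cz := ocod_cod oz.
  have D0 : 0 < D s := gdist_gt0 conv pz.
  have AE := arrival_energy conv cz pz.
  have CS := gG_cauchy eta (arrival p b (zt s)) cz.
  have GL := GB _ _ (ltW D0) AE.
  rewrite -/(zt s) -/(D s) -/(q s) in H3 CS AE GL *.
  rewrite AE in CS.
  rewrite add0r.
  have X0 : q s ^+ 2 / D s ^+ 2 <= X.
    have sk : 0 < sh (k * D s) by apply: sh_gt0; rewrite mulr_gt0.
    rewrite -subr_ge0 -(pmulr_rge0 _ sk); apply: le_trans H3.
    apply: mulr_ge0; first by rewrite mulr_ge0 ?(ltW (ch_gt0 _))// mulr_ge0// ltW.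
    by rewrite subr_ge0 ler_pdivrMr ?exprn_gt0.
  have Dn : D s != 0 by rewrite gt_eqF.
  set Y := gG b (zt s) (Gam _ _ _ _) _ in GL *.
  have -> : (Y + X) / D s - q s ^+ 2 / D s ^+ 3 = (Y + (X - q s ^+ 2 / D s ^+ 2)) / D s by field.
  rewrite ler_pdivlMr// mulNr.
  move: GL; rewrite ler_norml => /andP[GL _].
  have : 0 <= X - q s ^+ 2 / D s ^+ 2 by rewrite subr_ge0.
  lra.
have E0 : zt 0 = z by rewrite /zt scale0r add0r.
have E1 : zt 1 = eta + z by rewrite /zt scale1r.
have D01 : D 0 = gdist p (prm b z) /\ D 1 = gdist p (prm b (eta + z)) by rewrite /D E0 E1.
have [D0E D1E] := D01; rewrite -D0E -D1E.
split; last first.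
  have /choice[f2 f2P] : forall s : R, exists f2 : R, 0 <= s <= 1 ->
      is_derive s 1 (fun t => q t / D t) f2 /\ - (K * `|eta| ^+ 2) <= f2.
    move=> s; have [sI|sI] := boolP (0 <= s <= 1); last by exists 0.
    by have [_ [f2 f2P]] := CRV s sI; exists f2.
  have Cge : 0 <= K * `|eta| ^+ 2 by rewrite mulr_ge0// exprn_ge0.
  have := semiconvex_bound (fun t tI => proj1 (CRV t tI)) f2P Cge.
  by rewrite /q E0.
have [||u] := @MVT_segment R D (fun t => q t / D t) 0 1 ler01.
- move=> u; rewrite in_itv /= => /andP[/ltW u0 /ltW u1].
  by have [] := CRV u _; rewrite ?u0.
- apply: derivable_within_continuous => u; rewrite in_itv /= => uI.
  by have [[]] := CRV u uI.
rewrite in_itv /= => uI ->; rewrite subr0 mulr1.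
have [oz pz GU _] := H u uI; have cz := ocod_cod oz.
have D0 : 0 < D u := gdist_gt0 conv pz.
have AE := arrival_energy conv cz pz.
have CS := gG_cauchy eta (arrival p b (zt u)) cz.
rewrite -[gG b _ eta (arrival p b (zt u))]/(q u) AE -[gdist p _]/(D u) in CS.
rewrite normrM normfV [`|D u|]gtr0_norm// ler_pdivrMr//.
have KD : 0 <= K * `|eta| * D u by rewrite !mulr_ge0// ltW.
rewrite -ler_sqr ?nnegrE// real_normK ?num_real//.
apply: le_trans CS _; rewrite !exprMn ler_wpM2r ?exprn_ge0 ?(ltW D0)//.
Qed.

(** The half-space is convex, so a coordinate segment between interior points stays interior; r and
    K depend only on the chart and on z0, which may be a boundary point. *)
Lemma chart_lines b z0 : cod (chart_of b) z0 -> exists r K : R, [/\ 0 < r, 0 < K &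
  forall p z z' (e : R), e <= r -> ~ boundary p -> ocod b z -> ocod b z' ->
  `|z - z0| < e -> `|z' - z0| < e ->
  (forall w, `|w - z0| < e -> ocod b w -> p <> prm b w) ->
  `|gdist p (prm b z') - gdist p (prm b z)| <= K * `|z' - z| /\
  gdist p (prm b z) + gG b z (z' - z) (arrival p b z) / gdist p (prm b z)
    - K * `|z' - z| ^+ 2 <= gdist p (prm b z')].
Proof.
move=> cz; have [r [K [r0 K0 H]]] := chart_bounds cz.
exists r, K; split=> // p z z' e er ip oz oz' zr zr' pw.
have [_ hz] := (ocodP _ _).1 oz; have [_ hz'] := (ocodP _ _).1 oz'.
suff : `|gdist p (prm b (z' - z + z)) - gdist p (prm b z)| <= K * `|z' - z| /\
  gdist p (prm b z) + gG b z (z' - z) (arrival p b z) / gdist p (prm b z)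
    - K * `|z' - z| ^+ 2 <= gdist p (prm b (z' - z + z)) by rewrite subrK.
apply: line_gdist => //; first exact: ltW.
move=> t /andP[t0 t1]; pose w := t *: (z' - z) + z.
have wE : w = t *: z' + (1 - t) *: z.
  by apply/matrixP => i j; rewrite /w !mxE; ring.
have s0 : 0 <= 1 - t by lra.
have wr : `|w - z0| < e.
  have -> : w - z0 = t *: (z' - z0) + (1 - t) *: (z - z0).
    rewrite wE !scalerBr !scalerBl !scale1r; apply/matrixP => i j; rewrite !mxE; ring.
  apply: le_lt_trans (ler_normD _ _) _; rewrite !normrZ !ger0_norm//.
  have [t_gt|t_le] := ltP 0 t.
    have : t * `|z' - z0| < t * e by rewrite ltr_pM2l.
    have : (1 - t) * `|z - z0| <= (1 - t) * e by rewrite ler_wpM2l// ltW.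
    lra.
  have -> : t = 0 by apply/eqP; rewrite eq_le t_le.
  by rewrite mul0r add0r subr0 mul1r.
have wpos (i : 'I_n) : i = 0%N :> nat -> 0 < w 0 i.
  move=> i0; rewrite wE !mxE; have p1 := hz i i0; have p2 := hz' i i0; nra.
have [cw Hw] := H w (lt_le_trans wr er) (fun i i0 => ltW (wpos i i0)).
have ow : ocod b w by apply/ocodP.
split; [exact: ow|exact: pw| |].
  by have [] := Hw ow (z' - z) 0.
by move=> v D D0 vD; have [_] := Hw ow (z' - z) v; apply.
Qed.

Lemma param_near b x (A : set M) : nbhs x A -> dm b x ->
  exists2 r : R, 0 < r & forall z, `|z - crd b x| < r -> cod (chart_of b) z -> A (prm b z).
Proof.
move=> nA bx; have /subspace_continuousP H := chart_param_continuous (c := chart_of b).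
have nA' : nbhs (prm b (crd b x)) A by rewrite chart_coordK.
have N : within (cod (chart_of b)) (nbhs (crd b x)) (fun z => A (prm b z)) :=
  H (crd b x) (chart_coord_cod bx) A nA'.
have /nbhs_ballP[r r0 rP] : nbhs (crd b x) (fun z => cod (chart_of b) z -> A (prm b z)) := N.
exists r => // z zr cz; apply: (rP z) => //.
by rewrite -ball_normE /= distrC.
Qed.

Lemma chart_separated a b x y : x <> y -> dm a x -> dm b y -> exists2 r : R, 0 < r &
  forall z w, `|z - crd a x| < r -> `|w - crd b y| < r -> cod (chart_of a) z ->
    cod (chart_of b) w -> prm a z <> prm b w.
Proof.
move=> xy ax by_; have := space_hausdorff (r := M); rewrite open_hausdorff => /(_ x y).
case; first exact/eqP.
move=> [A B] /= [xA yB] [oA oB /eqP AB].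
have nA : nbhs x A by apply: open_nbhs_nbhs; split=> //; exact: set_mem.
have nB : nbhs y B by apply: open_nbhs_nbhs; split=> //; exact: set_mem.
have [r1 r10 H1] := param_near nA ax; have [r2 r20 H2] := param_near nB by_.
exists (Num.min r1 r2); first by rewrite lt_min r10.
move=> z w; rewrite !lt_min => /andP[zr _] /andP[_ wr] cz cw E.
have : (A `&` B) (prm a z) by split; [exact: H1|rewrite E; exact: H2].
by rewrite AB.
Qed.

Lemma gdist_lip2 a b x y : x <> y -> dm a x -> dm b y -> exists r K : R, [/\ 0 < r, 0 < K,
  forall z w, `|z - crd a x| < r -> `|w - crd b y| < r -> cod (chart_of a) z ->
    cod (chart_of b) w -> prm a z <> prm b w &
  forall z z' w w', ocod a z -> ocod a z' -> ocod b w -> ocod b w' ->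
    `|z - crd a x| < r -> `|z' - crd a x| < r -> `|w - crd b y| < r -> `|w' - crd b y| < r ->
  `|gdist (prm a z) (prm b w) - gdist (prm a z') (prm b w')| <= K * (`|z - z'| + `|w - w'|)].
Proof.
move=> xy ax by_.
have [r1 [K1 [r10 K10 H1]]] := chart_lines (chart_coord_cod ax).
have [r2 [K2 [r20 K20 H2]]] := chart_lines (chart_coord_cod by_).
have [r3 r30 H3] := chart_separated xy ax by_.
pose r := Num.min r1 (Num.min r2 r3).
have rr (e : R) : e < r -> [/\ e < r1, e < r2 & e < r3] by exact: lt_min3.
have r_gt0 : 0 < r by rewrite !lt_min r10 r20.
have r_1 : r <= r1 by rewrite ge_min lexx.
have r_2 : r <= r2 by rewrite /r !ge_min lexx orbT.
exists r, (K1 + K2); split.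
- exact: r_gt0.
- by rewrite addr_gt0.
- by move=> z w /rr[_ _ zr] /rr[_ _ wr]; exact: H3.
have inta z : ocod a z -> ~ boundary (prm a z).
  move=> oz; have cz := ocod_cod oz.
  by apply: (ocod_interior (chart_param_dom cz)); rewrite chart_paramK.
have intb z : ocod b z -> ~ boundary (prm b z).
  move=> oz; have cz := ocod_cod oz.
  by apply: (ocod_interior (chart_param_dom cz)); rewrite chart_paramK.
move=> z z' w w' oz oz' ow ow' zr zr' wr wr'.
have [_ _ z3] := rr _ zr; have [_ _ z3'] := rr _ zr'.
have [_ _ w3] := rr _ wr; have [_ _ w3'] := rr _ wr'.
have e1 : `|gdist (prm a z) (prm b w) - gdist (prm a z) (prm b w')| <= K2 * `|w - w'|.
  have [|] := H2 (prm a z) w' w r r_2 (inta z oz) ow' ow wr' wr => // u ur ou.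
  by have [_ _ u3] := rr _ ur; apply: H3 => //; exact: ocod_cod.
have e2 : `|gdist (prm a z) (prm b w') - gdist (prm a z') (prm b w')| <= K1 * `|z - z'|.
  rewrite ![gdist _ (prm b w')](gdistC conv).
  have [|] := H1 (prm b w') z' z r r_1 (intb w' ow') oz' oz zr' zr => // u ur ou.
  by have [_ _ u3] := rr _ ur; apply/nesym/H3 => //; exact: ocod_cod.
apply: le_trans (ler_distD (gdist (prm a z) (prm b w')) _ _) _.
have n1 := normr_ge0 (z - z'); have n2 := normr_ge0 (w - w').
move: e1 e2 n1 n2 K10 K20; set A1 := `|_|; set A2 := `|_|; set n1 := `|_|; set n2 := `|_|; nra.
Qed.

(** Both points are taken on the arc [x, y] itself, where [gdist_sub] gives [gdist] exactly.
    Continuity of [gdist] at boundary points is not yet known; it is deduced from this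
    approximation. *)
Lemma arc_approx a b x y (e : R) : x <> y -> dm a x -> dm b y -> 0 < e ->
  exists z w, [/\ ocod a z, ocod b w, `|z - crd a x| < e, `|w - crd b y| < e &
    `|gdist (prm a z) (prm b w) - gdist x y| < e].
Proof.
move=> xy ax by_ e0; have [[c A] _] := conv x y; have [_ c0 c1 _] := A.
have cont (t : R) d : 0 <= t <= 1 -> dm d (c t) -> exists2 r : R, 0 < r &
    forall s : R, 0 <= s <= 1 -> `|s - t| < r -> dm d (c s) /\ `|crd d (c s) - crd d (c t)| < e.
  move=> t01 dt; have tt : times d c t by split=> //; rewrite /= in_itv.
  have [r [F [r0 cF FP]]] := arc_local A tt.
  have bt : ball t r t by exact: ballxx.
  have [r' r'0 H] := cvg_normP (proj1 (cF 0%N) t bt) e0.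
  exists (Num.min r r'); first by rewrite lt_min r0.
  move=> s s01; rewrite lt_min => /andP[sr /H h].
  have [[_ ds] E _ _] := FP s s01 sr.
  have td : `|t - t| < r by rewrite subrr normr0.
  have [_ Et _ _] := FP t t01 td.
  by split; [exact: ds|rewrite -/(lc d c s) -/(lc d c t) E Et].
have ac0 : dm a (c 0) by rewrite c0.
have bc1 : dm b (c 1) by rewrite c1.
have I0 : 0 <= (0 : R) <= 1 by rewrite lexx ler01.
have I1 : 0 <= (1 : R) <= 1 by rewrite lexx ler01.
have [r1 r10 H1] := cont 0 a I0 ac0; have [r2 r20 H2] := cont 1 b I1 bc1.
have g0 := gdist_gt0 conv xy.
pose m := Num.min (Num.min r1 r2) (Num.min (e / (gdist x y)) 1) / 4.
have m4 : 0 < Num.min (Num.min r1 r2) (Num.min (e / (gdist x y)) 1).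
  by rewrite !lt_min r10 r20 divr_gt0//= ltr01.
have m0 : 0 < m by rewrite divr_gt0.
have : 2 * m < Num.min (Num.min r1 r2) (Num.min (e / (gdist x y)) 1) by rewrite /m; lra.
clearbody m; rewrite !lt_min => /andP[/andP[mr1 mr2] /andP[me m1]].
have mI : 0 <= m <= 1 by apply/andP; split; lra.
have mI' : 0 <= 1 - m <= 1 by apply/andP; split; lra.
have s1 : `|m - 0| < r1 by rewrite subr0 gtr0_norm//; lra.
have s2 : `|1 - m - 1| < r2 by rewrite addrAC subrr add0r normrN gtr0_norm//; lra.
have [d1 n1] := H1 m mI s1; have [d2 n2] := H2 (1 - m) mI' s2.
rewrite c0 in n1; rewrite c1 in n2.
have inter := arc_interior conv xy A.
have i1 : 0 < m < 1 by apply/andP; split; lra.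
have i2 : 0 < 1 - m < 1 by apply/andP; split; lra.
exists (crd a (c m)), (crd b (c (1 - m))); split=> //.
- exact: interior_ocod (inter _ i1) d1.
- exact: interior_ocod (inter _ i2) d2.
rewrite !chart_coordK//.
have mE : 1 - m = (1 - 2 * m) + m by lra.
have mI2 : 0 <= (1 - 2 * m) + m <= 1 by rewrite -mE.
have := gdist_sub conv xy A mI mI2; rewrite -mE => ->.
have m2 : 0 <= 1 - 2 * m by lra.
rewrite [`|1 - 2 * m|]ger0_norm//.
have -> : (1 - 2 * m) * gdist x y - gdist x y = - (2 * m * gdist x y) by ring.
by rewrite normrN ger0_norm ?mulr_ge0 ?ltW// -ltr_pdivlMr.
Qed.

(** The Lipschitz bound of [gdist_lip2] between interior points is carried over to x, y and x', y'
    by [arc_approx], up to an arbitrary e. *)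
Lemma gdist_cont a b x y : x <> y -> dm a x -> dm b y -> exists r K : R, [/\ 0 < r, 0 < K &
  forall x' y', dm a x' -> dm b y' -> `|crd a x' - crd a x| < r -> `|crd b y' - crd b y| < r ->
  x' <> y' /\ `|gdist x' y' - gdist x y| <= K * (`|crd a x' - crd a x| + `|crd b y' - crd b y|)].
Proof.
move=> xy ax by_; have [r [K [r0 K0 S L]]] := gdist_lip2 xy ax by_.
have r2 : 0 < r / 2 by rewrite divr_gt0.
exists (r / 2), K; split=> // x' y' ax' by' xr yr.
have xr' : `|crd a x' - crd a x| < r by lra.
have yr' : `|crd b y' - crd b y| < r by lra.
have xy' : x' <> y'.
  have := S _ _ xr' yr' (chart_coord_cod ax') (chart_coord_cod by').
  by rewrite !chart_coordK.
split=> //; apply/ler_addgt0Pr => e e0.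
(* The two approximations change [gdist] by at most 2 * d, and the coordinate distances by at most 4
   * d in total. *)
pose d := Num.min (r / 2) (e / (2 + 4 * K)).
have K4 : 0 < 2 + 4 * K by lra.
have d0 : 0 < d by rewrite lt_min r2 divr_gt0.
have [dr de] : d <= r / 2 /\ d <= e / (2 + 4 * K) by rewrite /d !ge_min !lexx orbT.
rewrite ler_pdivlMr// in de.
clearbody d; have [z [w [oz ow zx wy gz]]] := arc_approx xy' ax' by' d0.
have [z1 [w1 [oz1 ow1 zx1 wy1 gz1]]] := arc_approx xy ax by_ d0.
have tri (u1 u2 u3 : 'rV[R]_n) : `|u1 - u3| <= `|u1 - u2| + `|u2 - u3| by exact: ler_distD.
have t1 : `|z - crd a x| < r by have := tri z (crd a x') (crd a x); lra.
have t2 : `|w - crd b y| < r by have := tri w (crd b y') (crd b y); lra.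
have t3 : `|z1 - crd a x| < r by lra.
have t4 : `|w1 - crd b y| < r by lra.
have H := L _ _ _ _ oz oz1 ow ow1 t1 t3 t2 t4.
have zz : `|z - z1| <= `|crd a x' - crd a x| + 2 * d.
  have h1 := tri z (crd a x') z1; have h2 := tri (crd a x') (crd a x) z1.
  by rewrite [`|crd a x - z1|]distrC in h2; lra.
have ww : `|w - w1| <= `|crd b y' - crd b y| + 2 * d.
  have h1 := tri w (crd b y') w1; have h2 := tri (crd b y') (crd b y) w1.
  by rewrite [`|crd b y - w1|]distrC in h2; lra.
have KK : K * (`|z - z1| + `|w - w1|) <=
    K * (`|crd a x' - crd a x| + `|crd b y' - crd b y|) + K * (4 * d).
  by rewrite -mulrDr ler_wpM2l ?(ltW K0)//; lra.
move: gz gz1; rewrite !ltr_norml => /andP[g1 g2] /andP[g3 g4].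
move: H; rewrite ler_norml => /andP[h1 h2].
rewrite ler_norml.
set X := K * (`|crd a x' - crd a x| + _) in KK *.
have dd : 2 * d + K * (4 * d) <= e by move: de; lra.
by apply/andP; split; lra.
Qed.

End Lines.

Lemma within_unit_continuous (R : realType) (f : R -> R) :
  (forall t e : R, 0 <= t <= 1 -> 0 < e -> exists2 r : R, 0 < r &
     forall s : R, 0 <= s <= 1 -> `|s - t| < r -> `|f s - f t| < e) ->
  {within `[0, 1], continuous f}.
Proof.
move=> H; apply/subspace_continuousP => t; rewrite /= in_itv /= => t01.
apply/cvgrPdist_lt => e e0; have [r r0 rP] := H t e t01 e0.
have N : nbhs t (fun s : R => s \in `[0, 1] -> `|f t - f s| < e).
  apply: (dist_near r0) => s sr; rewrite in_itv /= => s01.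
  by rewrite distrC; exact: rP.
exact: N.
Qed.

Section Convexity.
Context {R : realType} {n : nat} (M : riemannianManifold R n).
Implicit Types (a b : atlas M) (z u v w eta : 'rV[R]_n) (x y p q : M) (c : R -> M).

Local Notation crd a := (Defs.coord (chart_of a)).
Local Notation prm a := (param (chart_of a)).
Local Notation dm a := (dom (chart_of a)).

Hypothesis conv : convex_manifold M.
Variable (k : R).
Hypothesis k0 : 0 < k.
Hypothesis curv : sectional_le M (- k ^+ 2).

(* A closed arc coincides with its reversal, so its velocity vanishes midway. *)
Lemma gdist_xx x : gdist x x = 0.
Proof.
have [[c A] _] := conv x x; have [_ c0 c1 _] := A.
have I1 : 0 <= (1 : R) <= 1 by rewrite ler01 lexx.
have I0 : 0 <= - 1 + (1 : R) <= 1 by rewrite addNr lexx ler01.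
have [A' V] := arc_affine A I1 I0.
rewrite c1 addNr c0 in A'.
have h : (2^-1 : R) \in `[0, 1] by rewrite in_itv /=; apply/andP; split; lra.
pose b := index_at (c 2^-1).
have tt : times b c 2^-1 by split; [exact: h|exact: index_atP].
have [tt' E] := arc_unique_velocity A A' (arc_uniq conv A A') tt.
have [_ E2] := V b _ tt'.
have E3 : 2^-1 * - 1 + 1 = 2^-1 :> R by lra.
rewrite E3 scaleN1r E in E2.
have v0 : velocity c 2^-1 = 0.
  have : velocity c 2^-1 = - velocity c 2^-1 by exact: E2.
  move: (velocity _ _) => v /eqP; rewrite -subr_eq0 opprK -mulr2n -scaler_nat scaler_eq0.
  by rewrite pnatr_eq0 /= => /eqP.
by rewrite (gdist_arc conv A) v0 /tnorm -[inner _ _ _]/(bf _ _ _) bf0l sqrtr0.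
Qed.

Lemma ch_gdist_near a b x y (e : R) : x <> y -> dm a x -> dm b y -> 0 < e ->
  exists2 r : R, 0 < r & forall x' y', dm a x' -> dm b y' ->
    `|crd a x' - crd a x| < r -> `|crd b y' - crd b y| < r ->
    x' <> y' /\ `|ch (k * gdist x' y') - ch (k * gdist x y)| < e.
Proof.
move=> xy ax by_ e0; have [r [K [r0 K0 H]]] := gdist_cont conv k0 curv xy ax by_.
have cch : {for k * gdist x y, continuous (@ch R)} by exact: derive_continuous (is_derive_ch _).
have [r1 r10 H1] := cvg_normP cch e0.
pose r2 := r1 / (k * K * 2).
have kK : 0 < k * K * 2 by rewrite !mulr_gt0.
have r20 : 0 < r2 by rewrite divr_gt0.
exists (Num.min r r2); first by rewrite lt_min r0.
move=> x' y' ax' by'; rewrite !lt_min => /andP[xr xr2] /andP[yr yr2].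
have [ne L] := H x' y' ax' by' xr yr; split=> //; apply: H1.
rewrite -mulrBr normrM gtr0_norm//.
apply: (@le_lt_trans _ _ (k * (K * (`|crd a x' - crd a x| + `|crd b y' - crd b y|)))).
  by rewrite ler_wpM2l// ltW.
have : `|crd a x' - crd a x| + `|crd b y' - crd b y| < r2 * 2 by lra.
move=> h; have : k * K * (`|crd a x' - crd a x| + `|crd b y' - crd b y|) < k * K * (r2 * 2).
  by rewrite ltr_pM2l// mulr_gt0.
move=> hh; rewrite [k * (K * _)]mulrA; apply: lt_le_trans hh _.
rewrite le_eqVlt; apply/orP; left; apply/eqP.
rewrite /r2; have kn : k != 0 by rewrite gt_eqF.
have Kn : K != 0 by rewrite gt_eqF.
by field; rewrite kn Kn.
Qed.

Lemma arc_coord_near p q c b (t e : R) : geodesic_arc p q c -> 0 <= t <= 1 ->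
  dm b (c t) -> 0 < e -> exists2 r : R, 0 < r & forall s : R, 0 <= s <= 1 -> `|s - t| < r ->
    dm b (c s) /\ `|crd b (c s) - crd b (c t)| < e.
Proof.
move=> A t01 bt e0; have tt : times b c t by split=> //; rewrite /= in_itv.
have [r [F [r0 cF FP]]] := arc_local A tt.
have bt' : ball t r t by exact: ballxx.
have [r' r'0 H] := cvg_normP (proj1 (cF 0%N) t bt') e0.
exists (Num.min r r'); first by rewrite lt_min r0.
move=> s s01; rewrite lt_min => /andP[sr /H h].
have [[_ ds] E _ _] := FP s s01 sr.
have td : `|t - t| < r by rewrite subrr normr0.
have [_ Et _ _] := FP t t01 td.
by split; [exact: ds|rewrite -/(lc b c s) -/(lc b c t) E Et].
Qed.

Lemma ch_gdist_continuous x p q c : geodesic_arc p q c ->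
  (forall t : R, 0 <= t <= 1 -> c t <> x) ->
  {within `[0, 1], continuous (fun s => ch (k * gdist x (c s)))}.
Proof.
move=> A nx; apply: within_unit_continuous => t e t01 e0.
have xa : dm (index_at x) x by exact: index_atP.
have ca : dm (index_at (c t)) (c t) by exact: index_atP.
have xc : x <> c t by exact/nesym/nx.
have [r r0 H] := ch_gdist_near xc xa ca e0.
have [r' r'0 H'] := arc_coord_near A t01 ca r0.
exists r' => // s s01 sr; have [ds h] := H' s s01 sr.
by have [|_] := H x (c s) xa ds _ h; rewrite ?subrr ?normr0.
Qed.

Lemma ch_gdist_convex_interior x p q c : p <> q -> geodesic_arc p q c -> ~ boundary x ->
  (forall t : R, 0 <= t <= 1 -> c t <> x) ->
  forall t : R, 0 <= t <= 1 -> ch (k * gdist x (c t)) * sh (k * gdist p q) <=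
    ch (k * gdist x (c 0)) * sh (- (k * gdist p q) * t + k * gdist p q) +
    ch (k * gdist x (c 1)) * sh (k * gdist p q * t + 0).
Proof.
move=> pq A ix nx.
have g0 := gdist_gt0 conv pq.
have kap0 : 0 < k * gdist p q by rewrite mulr_gt0.
pose f (s : R) := ch (k * gdist x (c s)).
have inter := arc_interior conv pq A.
have G (s : R) : 0 < s < 1 -> geoat c s by move=> sI; have [] := arc_geoat A sI inter.
have W (s : R) : 0 < s < 1 -> exists f1 f2 : R, [/\ is_derive s 1 f f1,
    is_derive s 1 ('D_1 f) f2 & (k * gdist p q) ^+ 2 * f s <= f2].
  move=> sI; pose b := index_at (c s).
  have bs : dm b (c s) by exact: index_atP.
  have [m m0 mP] := itv_ballin sI.
  have Gs : \forall t \near s, geoat c t by apply: (dist_near m0) => t /mP; exact: G.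
  have [r r0 rP] := near_dist (geoat_near Gs bs).
  pose e := Num.min m r.
  have e0 : 0 < e by rewrite lt_min m0.
  have He (t : R) : `|t - s| < e -> [/\ ocod b (lc b c t), x <> prm b (lc b c t) &
     is_derive t 1 (lc b c) (lv b c t)].
    rewrite lt_min => /andP[/mP tI /rP gt].
    have dt : dm b (c t) := geoin_dom gt.
    have [oz _ /derivableP D _] := gt; split=> //.
    rewrite /lc chart_coordK//; apply/nesym/nx.
    by case/andP: tI => /ltW -> /ltW ->.
  have ss : `|s - s| < r by rewrite subrr normr0.
  have [_ _ _ D2] := rP s ss.
  pose D (t : R) := gdist x (prm b (lc b c t)).
  pose q' (t : R) := gG b (lc b c t) (lv b c t) (arrival x b (lc b c t)).
  have [H1 [X [H2 H3]]] : (forall t : R, `|t - s| < e -> is_derive t 1 D (q' t / D t)) /\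
    exists X : R, is_derive s 1 (fun t => q' t / D t)
      ((gG b (lc b c s) (- Gam b (lc b c s) (lv b c s) (lv b c s)
          + Gam b (lc b c s) (lv b c s) (lv b c s)) (arrival x b (lc b c s)) + X) / D s
        - q' s ^+ 2 / D s ^+ 3) /\
    k * D s * ch (k * D s) * (gG b (lc b c s) (lv b c s) (lv b c s) - q' s ^+ 2 / D s ^+ 2) <=
    sh (k * D s) * (X - q' s ^+ 2 / D s ^+ 2) := gdist_curve conv k0 curv ix e0 He D2.
  (* The covariant acceleration of the geodesic c vanishes. *)
  rewrite addNr [X in (X + _) / _]/gG bf0l add0r in H2.
  have DE (t : R) : `|t - s| < e -> D t = gdist x (c t).
    by rewrite lt_min => /andP[_ /rP gt]; rewrite /D /lc chart_coordK//; exact: geoin_dom gt.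
  have df (t : R) : `|t - s| < e -> is_derive t 1 f (k * sh (k * D t) * (q' t / D t)).
    move=> te; have DD := is_derive_comp1 (is_derive_scal k (H1 t te)) (is_derive_ch _).
    have DD' := is_derive_cast DD (df' := k * sh (k * D t) * (q' t / D t)).
    apply: near_eq_is_derive (DD' _); last by ring.
    have e1 : 0 < e - `|t - s| by rewrite subr_gt0.
    apply: (dist_near e1) => t' t't; rewrite /f -DE//.
    by move: t't; rewrite ltrBrDr; apply: le_lt_trans; exact: ler_distD.
  have se : `|s - s| < e by rewrite subrr normr0.
  have dsh := is_derive_comp1 (is_derive_scal k (H1 s se)) (is_derive_sh _).
  have d2 := is_derive_mul (is_derive_scal k dsh) H2.
  do 2 eexists; split; [exact: df s se|apply: near_eq_is_derive d2|].
    by apply: (dist_near e0) => t /df[].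
  have Cs : gG b (lc b c s) (lv b c s) (lv b c s) = gdist p q ^+ 2.
    have [_ V] := arc_geoat A sI inter.
    by rewrite (V b bs); exact: (arc_energy_interior conv pq A sI bs).
  have [_ pz _] := He s se.
  have D0 : 0 < D s := gdist_gt0 conv pz.
  rewrite Cs in H3.
  have -> : f s = ch (k * D s) by rewrite /f (DE s se).
  have Dn : D s != 0 by rewrite gt_eqF.
  move: H3 D0 Dn; move: (gdist p q) (q' s) (D s) => l Q Ds H3 D0 Dn.
  set C := ch _ in H3 *; set S := sh _ in H3 *.
  (* The second derivative of f and [(k * l) ^+ 2 * C] are split alike: a common contribution of the
     radial speed Q / Ds, and k / Ds times one side of the Hessian comparison [H3]. *)
  have -> : k * (k * (Q / Ds) * C) * (Q / Ds) + k * S * (X / Ds - Q ^+ 2 / Ds ^+ 3) =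
     (k ^+ 2 * C * (Q ^+ 2 / Ds ^+ 2)) + k / Ds * (S * (X - Q ^+ 2 / Ds ^+ 2)) by field.
  have -> : (k * l) ^+ 2 * C = k ^+ 2 * C * (Q ^+ 2 / Ds ^+ 2) +
      k / Ds * (k * Ds * C * (l ^+ 2 - Q ^+ 2 / Ds ^+ 2)) by field.
  by rewrite lerD2l ler_wpM2l// divr_ge0// ltW.
have /choice[f2 f2P] : forall s : R, exists f2 : R, 0 < s < 1 -> [/\ is_derive s 1 f ('D_1 f s),
    is_derive s 1 ('D_1 f) f2 & (k * gdist p q) ^+ 2 * f s <= f2].
  move=> s; have [sI|sI] := boolP (0 < s < 1); last by exists 0.
  have [f1 [f2 [d1 d2 L]]] := W s sI; exists f2 => _; split=> //.
exact: (sinh_convex kap0 (ch_gdist_continuous A nx) f2P).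
Qed.

Lemma arc_closed p q c : geodesic_arc p q c -> closed (c @` `[0, 1]).
Proof.
move=> [[cc _] _ _ _]; apply: compact_closed; first exact: space_hausdorff.
by apply: continuous_compact cc _; exact: segment_compact.
Qed.

(** A boundary point x is replaced by interior points [al s] of the arc [x, c 0]. Those close to x
    avoid the closed set traced by c, and each of the three values of the distance function is
    continuous as they tend to x. *)
Lemma ch_gdist_convex x p q c : p <> q -> geodesic_arc p q c ->
  (forall t : R, 0 <= t <= 1 -> c t <> x) ->
  forall t : R, 0 <= t <= 1 -> ch (k * gdist x (c t)) * sh (k * gdist p q) <=
    ch (k * gdist x (c 0)) * sh (- (k * gdist p q) * t + k * gdist p q) +
    ch (k * gdist x (c 1)) * sh (k * gdist p q * t + 0).
Proof.
move=> pq A nx t t01.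
have I0 : 0 <= (0 : R) <= 1 by rewrite lexx ler01.
have I1 : 0 <= (1 : R) <= 1 by rewrite lexx ler01.
have xp : x <> c 0 by exact/nesym/nx.
have [[al Al] _] := conv x (c 0); have [_ al0 _ _] := Al.
pose a := index_at x; have ax : dm a x by exact: index_atP.
have oC : nbhs x (~` (c @` `[0, 1])).
  apply: open_nbhs_nbhs; split; first by rewrite openC; exact: arc_closed A.
  by move=> [s]; rewrite /= in_itv /= => s01; exact: nx.
have [r0 r00 H0] := param_near oC ax.
set S0 := sh _; set S1 := sh (_ + _); set S2 := sh (_ + _).
have near_u (u e : R) : 0 <= u <= 1 -> 0 < e -> exists2 r : R, 0 < r & forall x', dm a x' ->
    `|crd a x' - crd a x| < r -> `|ch (k * gdist x' (c u)) - ch (k * gdist x (c u))| < e.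
  move=> u01 e0; have xu : x <> c u by exact/nesym/nx.
  have du : dm (index_at (c u)) (c u) by exact: index_atP.
  have [r rp H] := ch_gdist_near xu ax du e0; exists r => // x' ax' xr.
  by have [|_] := H x' (c u) ax' du xr; rewrite ?subrr ?normr0.
apply/ler_addgt0Pr => e e0.
pose N := `|S0| + `|S1| + `|S2| + 1.
have N0 : 0 < N by rewrite ltr_wpDl// !addr_ge0.
have eN : 0 < e / N by rewrite divr_gt0.
have [r1 r10 H1] := near_u t _ t01 eN; have [r2 r20 H2] := near_u 0 _ I0 eN.
have [r3 r30 H3] := near_u 1 _ I1 eN.
pose r := Num.min r0 (Num.min r1 (Num.min r2 r3)).
have rp : 0 < r by rewrite !lt_min r00 r10 r20.
have al0a : dm a (al 0) by rewrite al0.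
have [d d0 Hd] := arc_coord_near Al I0 al0a rp.
have [s sd sI] := unit_interior I0 d0.
have s01 : 0 <= s <= 1 by case/andP: sI => /ltW -> /ltW ->.
have [as_ xs] := Hd s s01 sd.
have ix : ~ boundary (al s) := arc_interior conv xp Al sI.
rewrite al0 in xs; move: xs; rewrite /r lt_min => /andP[xs0 /lt_min3[xs1 xs2 xs3]].
have nx' (u : R) : 0 <= u <= 1 -> c u <> al s.
  move=> u01 E; have := H0 _ xs0 (chart_coord_cod as_); rewrite chart_coordK//; apply.
  by exists u => //; rewrite /= in_itv.
have := ch_gdist_convex_interior pq A ix nx' t01; rewrite -/S0 -/S1 -/S2.
move: (H1 _ as_ xs1) (H2 _ as_ xs2) (H3 _ as_ xs3).
set X := ch _; set X' := ch _; set Y := ch _; set Y' := ch _; set Z := ch _; set Z' := ch _.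
move=> hX hY hZ K.
have b1 : `|(X - X') * S0| <= e / N * `|S0| by rewrite normrM ler_wpM2r// ltW.
have b2 : `|(Y - Y') * S1| <= e / N * `|S1| by rewrite normrM ler_wpM2r// ltW.
have b3 : `|(Z - Z') * S2| <= e / N * `|S2| by rewrite normrM ler_wpM2r// ltW.
have E : e / N * `|S0| + e / N * `|S1| + e / N * `|S2| <= e.
  have : e / N * (`|S0| + `|S1| + `|S2|) <= e / N * N.
    by rewrite ler_wpM2l// ?(ltW eN)// lerDl.
  by rewrite divfK ?gt_eqF// !mulrDr.
move: b1 b2 b3; rewrite !ler_norml => /andP[b1 b1'] /andP[b2 b2'] /andP[b3 b3'].
move: E; set E0 := e / N * `|S0|; set E1 := e / N * `|S1|; set E2 := e / N * `|S2| => E.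
by rewrite -/E0 -/E1 -/E2 in b1 b1' b2 b2' b3 b3'; lra.
Qed.

End Convexity.

(** * The law of cosines *)

Lemma curve_taylor (R : realType) n (F F1 : R -> 'rV[R]_n) (t d : R) F2 : 0 < d ->
  (forall u : R, `|u - t| < d -> is_derive u (1 : R) F (F1 u)) ->
  is_derive t (1 : R) F1 F2 ->
  exists r C : R, [/\ 0 < r, 0 <= C & forall h : R, 0 <= h < r ->
    `|F (h + t) - F t - h *: F1 t| <= C * h ^+ 2].
Proof.
move=> d0 H D; have [r [K [r0 K0 L]]] := derive_lip D.
exists (Num.min d r), K; split=> //; first by rewrite lt_min d0.
move=> h /andP[h0]; rewrite lt_min => /andP[hd hr].
pose g (u : R) := F u - u *: F1 t.
have dg (u : R) : `|u - t| < d -> is_derive u (1 : R) g (F1 u - F1 t).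
  move=> ud; have D2 : is_derive u (1 : R) (fun s : R => s *: F1 t) (F1 t).
    have := is_derive_line (f := id) (is_derive_id (u *: F1 t + 0) (F1 t)).
    by congr is_derive; apply/funext => s; rewrite addr0.
  exact: is_deriveB (H u ud) D2.
have ut (u : R) : t <= u <= h + t -> `|u - t| < d /\ `|u - t| < r /\ `|u - t| <= h.
  move=> /andP[u1 u2]; have u0 : 0 <= u - t by rewrite subr_ge0.
  have uh : u - t <= h by rewrite lerBlDr.
  by rewrite ger0_norm//; split; [exact: le_lt_trans hd|split=> //; exact: le_lt_trans hr].
have ht : t <= h + t by rewrite lerDr.
have -> : F (h + t) - F t - h *: F1 t = g (h + t) - g t.
  rewrite /g scalerDl; move: (h *: _) (t *: _) => A B.
  by apply/matrixP => i j; rewrite !mxE; ring.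
have := @MVI R n g (fun u => F1 u - F1 t) t (h + t) (K * h) ht.
rewrite addrK -mulrA -expr2; apply.
  apply: derivable_within_continuous => u; rewrite in_itv /= => /ut[/dg[]] //.
move=> u /andP[/ltW u1 /ltW u2]; have [|ud [ur uh]] := ut u; first by rewrite u1.
by split; [exact: dg|apply: le_trans (L u ur) _; rewrite ler_wpM2l].
Qed.

Lemma continuous_le (R : realType) (f : R -> R) (t C : R) : {for t, continuous f} ->
  (forall e, 0 < e -> exists2 s : R, `|s - t| < e & f s <= C) -> f t <= C.
Proof.
move=> cf H; rewrite leNgt -subr_gt0; apply/negP => e0.
have [r r0 rP] := cvg_normP cf e0.
have [s sr sC] := H r r0; have := rP s sr; rewrite ltr_norml => /andP[h _]; lra.
Qed.

Section Cosines.
Context {R : realType} {n : nat} (M : riemannianManifold R n).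
Implicit Types (a b : atlas M) (z u v w eta : 'rV[R]_n) (x y p q : M) (c : R -> M).

Local Notation crd a := (Defs.coord (chart_of a)).
Local Notation prm a := (param (chart_of a)).
Local Notation dm a := (dom (chart_of a)).

Hypothesis conv : convex_manifold M.
Variable (k : R).
Hypothesis k0 : 0 < k.
Hypothesis curv : sectional_le M (- k ^+ 2).

Let I0 : 0 <= (0 : R) <= 1. Proof. by rewrite lexx ler01. Qed.
Let I1 : 0 <= (1 : R) <= 1. Proof. by rewrite lexx ler01. Qed.
Let T01 (s : R) : 0 < s < 1 -> 0 <= s <= 1. Proof. by case/andP => /ltW -> /ltW ->. Qed.

(* chart_lines gives this at the points of c before x, with the same K. *)
Lemma subgradient p x c b : ~ boundary p -> p <> x -> geodesic_arc p x c -> dm b x ->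
  exists r K : R, [/\ 0 < r, 0 <= K & forall z', ocod b z' -> `|z' - crd b x| < r ->
    gdist p x + gG b (crd b x) (z' - crd b x) (local_velocity b c 1) / gdist p x
     - K * `|z' - crd b x| ^+ 2 <= gdist p (prm b z')].
Proof.
move=> ip px A bx; have [_ c0 c1 _] := A.
have cz := chart_coord_cod bx.
have [r1 [K [r10 K0 H1]]] := chart_lines conv k0 curv cz.
have pa : dm (index_at p) p by exact: index_atP.
have [r3 r30 H3] := chart_separated px pa bx.
pose r := Num.min r1 r3.
have rr1 : r <= r1 by rewrite ge_min lexx.
have r0 : 0 < r by rewrite lt_min r10.
have pw w : `|w - crd b x| < r -> ocod b w -> p <> prm b w.
  rewrite lt_min => /andP[_ w3] ow.
  have := H3 (crd (index_at p) p) w; rewrite subrr normr0 => /(_ r30 w3).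
  by rewrite chart_coordK//; apply; [exact: chart_coord_cod|exact: ocod_cod].
exists r, K; split=> //; first exact: ltW.
move=> z' oz' zr'.
have g0 := gdist_gt0 conv px.
have tt : times b c 1 by split; [rewrite /= in_itv|rewrite /= c1].
have [d [F [d0 cF FP]]] := arc_local A tt.
have td : `|(1 : R) - 1| < d by rewrite subrr normr0.
have [_ E1 E2 _] := FP 1 I1 td.
have F1 : F 1 = crd b x by rewrite -E1 /lc c1.
have b1 : ball (1 : R) d 1 by exact: ballxx.
have [U [Mt [oU Uz cM ME]]] := metric_smooth cz.
have dF : is_derive (1 : R) 1 F ('D_1 F 1) by apply: derivableP; exact: Ck_derivable (cF 1%N) b1.
have dF2 : is_derive (1 : R) 1 ('D_1 F) ('D_1 ('D_1 F) 1).
  by apply: derivableP; exact: Ck_derivable (Ck_derive (1 : R) (cF 2%N)) b1.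
have cFc : {for (1 : R), continuous F} by exact: (proj1 (cF 0%N) 1 b1).
have UF : U (F 1) by rewrite F1.
have dzF : is_derive (1 : R) 1 (fun s => z' - F s) (- 'D_1 F 1).
  by have := is_deriveB (is_derive_cst z' (1 : R) 1) dF; rewrite sub0r.
have dbf := is_derive_bf oU (cM 1%N) UF dF dzF dF2.
(* [psi s] is the lower bound that [chart_lines] gives with base point c s. There the distance is
   [s * gdist p x] and the arrival velocity is s times that of c, so s cancels in their quotient and
   the bound passes continuously to s = 1. *)
pose psi (s : R) := s * gdist p x + bf (Mt (F s)) (z' - F s) ('D_1 F s) / gdist p x
   - K * `|z' - F s| ^+ 2.
have cpsi : {for (1 : R), continuous psi}.
  apply: cvgB.
    have D := is_derive_add (is_derive_lin (gdist p x) (is_derive_id (1 : R) (1 : R)))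
      (is_derive_lin (gdist p x)^-1 dbf).
    exact: derive_continuous D.
  have cN : `|z' - F s| @[s --> (1 : R)] --> `|z' - F 1|.
    by apply: cvg_norm; apply: cvgB; [exact: cvg_cst|exact: cFc].
  by apply: cvgM; [exact: cvg_cst|exact: (cvgM cN cN)].
have -> : gdist p x + gG b (crd b x) (z' - crd b x) (local_velocity b c 1) / gdist p x
     - K * `|z' - crd b x| ^+ 2 = psi 1.
  by rewrite /psi mul1r F1 E2 (ME _ Uz cz).
apply: (continuous_le cpsi) => e e0.
have [r4 r40 H4] := open_normP oU Uz.
have re0 : 0 < Num.min r r4 by rewrite lt_min r0.
have [e1 e10 He1] := cvg_normP cFc re0.
have m0 : 0 < Num.min d (Num.min e e1) by rewrite !lt_min d0 e0.
have [s /lt_min3[sd se se1] sI] := unit_interior I1 m0; exists s; first exact: se.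
have [[_ bs] F1s F2s _] := FP s (T01 sI) sd.
have := He1 s se1; rewrite F1 lt_min => /andP[Fr F4].
have oF : ocod b (F s).
  by rewrite -F1s; apply: interior_ocod => //; exact: (arc_interior conv px A sI).
have [_] := H1 p (F s) z' r rr1 ip oF oz' Fr zr' pw.
have prmF : prm b (F s) = c s by rewrite -F1s /lc chart_coordK.
have s0 : 0 < s by case/andP: sI.
have gs : gdist p (c s) = s * gdist p x.
  have sI0 : 0 <= s + 0 <= 1 by rewrite addr0; exact: T01.
  have := gdist_sub conv px A I0 sI0; rewrite c0 addr0 => ->.
  by rewrite gtr0_norm.
have arr : arrival p b (F s) = s *: 'D_1 F s.
  by rewrite -F2s -(arrival_sub conv A (T01 sI) bs) -F1s.
rewrite prmF gs arr [gG b (F s) _ _]bfZr.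
apply: le_trans; rewrite /psi lerD2r lerD2l.
rewrite (ME _ (H4 _ F4) (ocod_cod oF)).
set X := bf _ _ _; rewrite le_eqVlt; apply/orP; left; apply/eqP.
have sn : s != 0 by rewrite gt_eqF.
have gn : gdist p x != 0 by rewrite gt_eqF.
by field; rewrite sn gn.
Qed.

(* If p were on the arc c, the arc from p to x would be a reversed piece of c,
   which would arrive at x with velocity opposite to that of c. *)
Lemma apex_notin p x y al c b : p <> x -> x <> y -> geodesic_arc p x al ->
  geodesic_arc x y c -> dm b x ->
  0 <= gG b (crd b x) (local_velocity b c 0) (local_velocity b al 1) ->
  forall t : R, 0 <= t <= 1 -> c t <> p.
Proof.
move=> px xy Al A bx ang t t01 E; have [_ c0 c1 _] := A; have [_ al0 al1 _] := Al.
have t_gt0 : 0 < t.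
  have /andP[+ _] := t01; rewrite le_eqVlt => /predU1P[t0|//].
  by case: px; rewrite -E -t0.
have mt : 0 <= - t + t <= 1 by rewrite addNr.
have [A' V] := arc_affine A t01 mt.
rewrite addNr E c0 in A'.
have tt : times b al 1 by split; [rewrite /= in_itv|rewrite /= al1].
have [tt' Vu] := arc_unique_velocity Al A' (arc_uniq conv Al A') tt.
have [_ V1] := V b 1 tt'; rewrite mul1r addNr in V1.
have t0 : times b c 0 by split; [rewrite /= in_itv|rewrite /= c0].
have En := arc_energy conv xy A t0; rewrite /lc c0 in En.
move: ang; rewrite -Vu V1 [gG _ _ _ _]bfZr -/(gG b (crd b x) _ _) En => ang.
have g0 := gdist_gt0 conv xy.
have : 0 < t * gdist x y ^+ 2 by rewrite mulr_gt0 ?exprn_gt0.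
by rewrite mulNr oppr_ge0 leNgt in ang; rewrite (negPf ang).
Qed.

(** Along c the first-order term of the subgradient inequality is nonnegative by the angle
    condition, so D(p, c s) >= D(p, x) - C2 * s ^+ 2 for small s. This is the quadratic lower bound
    from which [cosh_growth] concludes. *)
Lemma cosine_law_interior p x y al c b : ~ boundary p -> p <> x -> x <> y ->
  geodesic_arc p x al -> geodesic_arc x y c -> dm b x ->
  0 <= gG b (crd b x) (local_velocity b c 0) (local_velocity b al 1) ->
  ch (k * gdist p x) * ch (k * gdist x y) <= ch (k * gdist p y).
Proof.
move=> ip px xy Al A bx ang; have [_ c0 c1 _] := A.
have np := apex_notin px xy Al A bx ang.
have CV := ch_gdist_convex conv k0 curv xy A np.
have [r [K [r0 K0 SG]]] := subgradient ip px Al bx.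
have g0 := gdist_gt0 conv px.
have gxy := gdist_gt0 conv xy.
have tt : times b c 0 by split; [rewrite /= in_itv|rewrite /= c0].
have [d [F [d0 cF FP]]] := arc_local A tt.
have td : `|(0 : R) - 0| < d by rewrite subrr normr0.
have [_ E1 E2 _] := FP 0 I0 td.
have F0 : F 0 = crd b x by rewrite -E1 /lc c0.
have dF (u : R) : `|u - 0| < d -> is_derive u (1 : R) F ('D_1 F u).
  by move=> ud; apply: derivableP; apply: Ck_derivable (cF 1%N) _; rewrite -ball_normE /= distrC.
have dF2 : is_derive (0 : R) (1 : R) ('D_1 F) ('D_1 ('D_1 F) 0).
  by apply: derivableP; apply: Ck_derivable (Ck_derive (1 : R) (cF 2%N)) _; exact: ballxx.
have [r1 [C [r10 C0 TY]]] := curve_taylor d0 dF dF2.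
have [r2 [K2 [r20 K20 LP]]] := derive_lip (dF 0 td).
set w := 'D_1 F 0 in E2 TY; set v := local_velocity b al 1 in ang SG.
rewrite E2 in ang.
pose B := n%:R * (n%:R * (`|metric b (crd b x)| * C * `|v|)) / gdist p x.
have B0 : 0 <= B by rewrite divr_ge0 ?(ltW g0)// !mulr_ge0.
(* [B] absorbs the Taylor remainder of the arc, paired with v, and [K * K2 ^+ 2] the quadratic loss
   in [subgradient], as K2 bounds the growth of the arc from x. *)
pose C2 := B + K * K2 ^+ 2.
have C20 : 0 <= C2 by rewrite addr_ge0// mulr_ge0// exprn_ge0.
pose C3 := sh (k * gdist p x) * (k * C2).
pose del := Num.min (Num.min d 1) (Num.min (Num.min r1 r2) (r / (K2 + 1))).
have k21 : 0 < K2 + 1 by rewrite ltr_wpDl.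
have del0 : 0 < del by rewrite !lt_min d0 ltr01 r10 r20 divr_gt0.
have del1 : del <= 1 by rewrite /del !ge_min lexx orbT.
have key (s : R) : 0 < s < del -> gdist p x - C2 * s ^+ 2 <= gdist p (c s).
  move=> /andP[s0]; rewrite !lt_min => /andP[/andP[sd s1] /andP[/andP[sr1 sr2] sr]].
  have sI : 0 < s < 1 by rewrite s0.
  have ns : `|s - 0| = s by rewrite subr0 gtr0_norm.
  have [[_ bs] F1s _ _] := FP s (T01 sI) ltac:(rewrite ns; exact: sd).
  have oF : ocod b (F s).
    by rewrite -F1s; apply: interior_ocod => //; exact: (arc_interior conv xy A sI).
  have lip : `|F s - crd b x| <= K2 * s by have := LP s; rewrite ns F0; apply.
  have Fr : `|F s - crd b x| < r.
    apply: le_lt_trans lip _; move: sr; rewrite ltr_pdivlMr//; apply: le_lt_trans.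
    by rewrite mulrC ler_wpM2l ?(ltW s0)// lerDl.
  have prmF : prm b (F s) = c s by rewrite -F1s /lc chart_coordK.
  have := SG (F s) oF Fr; rewrite prmF; apply: le_trans.
  have sI2 : 0 <= s < r1 by rewrite ltW.
  have TS := TY s sI2; rewrite addr0 F0 in TS.
  have gE : gG b (crd b x) (F s - crd b x) v = s * gG b (crd b x) w v
      + gG b (crd b x) (F s - crd b x - s *: w) v.
    have gsplit A1 A2 : gG b (crd b x) A1 v = gG b (crd b x) A2 v + gG b (crd b x) (A1 - A2) v.
      by rewrite /gG -bfDl addrC subrK.
    by rewrite (gsplit _ (s *: w)) [X in X + _]bfZl.
  have gB : `|gG b (crd b x) (F s - crd b x - s *: w) v| <= B * gdist p x * s ^+ 2.
    apply: le_trans (bf_norm _ _ _) _; rewrite /B divfK ?gt_eqF//.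
    have -> : n%:R * (n%:R * (`|metric b (crd b x)| * C * `|v|)) * s ^+ 2 =
      n%:R * (n%:R * (`|metric b (crd b x)| * (C * s ^+ 2) * `|v|)) by ring.
    by apply: ler_wpM2l => //; apply: ler_wpM2l => //; apply: ler_wpM2r => //; exact: ler_wpM2l.
  have gL : - (B * s ^+ 2) <= gG b (crd b x) (F s - crd b x) v / gdist p x.
    rewrite ler_pdivlMr// gE mulNr.
    move: gB; rewrite ler_norml => /andP[gB _].
    have : 0 <= s * gG b (crd b x) w v by rewrite mulr_ge0// ltW.
    by move: gB; set X := gG _ _ _ v; set Y := gG _ _ w v; lra.
  have kL : K * `|F s - crd b x| ^+ 2 <= K * K2 ^+ 2 * s ^+ 2.
    by rewrite -mulrA -exprMn ler_wpM2l// ler_sqr ?nnegrE// mulr_ge0// ltW.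
  by rewrite /C2 mulrDl; lra.
have L (t : R) : 0 < t < del -> ch (k * gdist p (c 0)) - C3 * t ^+ 2 <= ch (k * gdist p (c t)).
  move=> tI; have Kt := key t tI; rewrite c0.
  apply: le_trans (ch_tangent (k * gdist p x) _).
  have sk : 0 <= sh (k * gdist p x) by apply/ltW/sh_gt0; rewrite mulr_gt0.
  have h : - (C2 * t ^+ 2) <= gdist p (c t) - gdist p x by lra.
  have := ler_wpM2l sk (ler_wpM2l (ltW k0) h).
  by rewrite /C3; set S := sh _; lra.
have := cosh_growth (f := fun s => ch (k * gdist p (c s))) del0 del1 CV _ L.
by rewrite c0 c1; apply; rewrite mulr_gt0.
Qed.

(** p is replaced by points [al s] of [p, x], which are off the boundary. The arc from [al s]
    arrives at x with a positive multiple of the same velocity, so the angle condition persists, and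
    s tends to 0. *)
Lemma cosine_law p x y al c b : p <> x -> x <> y ->
  geodesic_arc p x al -> geodesic_arc x y c -> dm b x ->
  0 <= gG b (crd b x) (local_velocity b c 0) (local_velocity b al 1) ->
  p <> y /\ ch (k * gdist p x) * ch (k * gdist x y) <= ch (k * gdist p y).
Proof.
move=> px xy Al A bx ang; have [_ c0 c1 _] := A; have [_ al0 al1 _] := Al.
have py : p <> y by apply/nesym; rewrite -c1; exact: (apex_notin px xy Al A bx ang I1).
split=> //.
have g0 := gdist_gt0 conv px.
(* The first factor is cosh k D(al s, x), since D(al s, x) = (1 - s) * D(p, x); it is written as an
   affine expression in s for the limit. *)
have step (s : R) : 0 < s < 1 ->
    ch (- (k * gdist p x) * s + k * gdist p x) * ch (k * gdist x y) <= ch (k * gdist (al s) y).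
  move=> sI; have /andP[s0 s1] := sI.
  have m01 : 0 <= (1 - s) + s <= 1 by rewrite subrK.
  have gs := gdist_sub conv px Al (T01 sI) m01; rewrite subrK al1 in gs.
  have s1' : 0 < 1 - s by rewrite subr_gt0.
  rewrite gtr0_norm// in gs.
  have [A' V] := arc_affine Al (T01 sI) m01; rewrite subrK al1 in A'.
  have ne : al s <> x.
    move=> E; move: gs; rewrite E (gdist_xx conv) => /esym/eqP.
    by rewrite mulf_eq0 !gt_eqF.
  have t1 : times b (fun u : R => al (u * (1 - s) + s)) 1.
    by split; [rewrite /= in_itv|rewrite /= mul1r subrK al1].
  have [_ V1] := V b 1 t1; rewrite mul1r subrK in V1.
  have := cosine_law_interior (arc_interior conv px Al sI) ne xy A' A bx.
  rewrite V1 [gG _ _ _ _]bfZr -/(gG b (crd b x) _ _) gs.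
  have -> : - (k * gdist p x) * s + k * gdist p x = k * ((1 - s) * gdist p x) by ring.
  by apply; rewrite mulr_ge0// ltW.
have lim : {for 0, continuous (fun s : R =>
    ch (- (k * gdist p x) * s + k * gdist p x) * ch (k * gdist x y))}.
  exact: derive_continuous (is_derive_lin _ (is_derive_ch_affine _ _ 0)).
apply/ler_addgt0Pr => e e0; have e2 : 0 < e / 2 by rewrite divr_gt0.
have pa : dm (index_at p) p by exact: index_atP.
have ya : dm (index_at y) y by exact: index_atP.
have [r r0 H] := ch_gdist_near conv k0 curv py pa ya e2.
have pa0 : dm (index_at p) (al 0) by rewrite al0.
have [r1 r10 H1] := arc_coord_near Al I0 pa0 r0; rewrite al0 in H1.
have [r2 r20 H2] := cvg_normP lim e2.
have m0 : 0 < Num.min r1 r2 by rewrite lt_min r10.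
have [s] := unit_interior I0 m0; rewrite lt_min => /andP[sr1 sr2] sI.
have [ds xs] := H1 s (T01 sI) sr1.
have [|_ h1] := H (al s) y ds ya xs; first by rewrite subrr normr0.
have := H2 s sr2; rewrite mulr0 add0r => h2.
have := step s sI; move: h1 h2; rewrite !ltr_norml => /andP[a1 a2] /andP[a3 a4].
set X := ch _ * _ in a3 a4 *; set Y := ch (k * gdist p x) * _ in a3 a4 *.
by set Z := ch _ in a1 a2 *; set W := ch _ in a1 a2 *; lra.
Qed.

End Cosines.

(** * Lengths of curves, angles and conclusion *)

Section Final.
Context {R : realType} {n : nat} (M : riemannianManifold R n).
Implicit Types (a b : atlas M) (z u v w : 'rV[R]_n) (x y p q : M) (c : R -> M).

Local Notation crd a := (Defs.coord (chart_of a)).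
Local Notation dm a := (dom (chart_of a)).

Lemma curve_length_ge0 c : 0 <= curve_length c.
Proof. by apply: Rintegral_ge0 => t _; exact: sqrtr_ge0. Qed.

Lemma joined_ge0 x y l : joined_by_length x y l -> 0 <= l.
Proof. by elim=> // c y' l' _ _ IH; rewrite addr_ge0// curve_length_ge0. Qed.

Lemma dist_le x y l : joined_by_length x y l -> dist x y <= l.
Proof.
move=> J; apply: ge_inf; last exact: J.
by exists 0 => l' /joined_ge0.
Qed.

Lemma dist_xx x : dist x x <= 0.
Proof. exact: dist_le (Joined_nil x). Qed.

Lemma arc_length p q c : convex_manifold M -> p <> q -> geodesic_arc p q c ->
  curve_length c = gdist p q.
Proof.
move=> conv pq A; rewrite /curve_length.
rewrite (@eq_Rintegral _ _ _ _ _ (fun=> gdist p q)); last first.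
  by move=> t; rewrite inE /= in_itv /= => t01; exact: arc_tnorm.
rewrite Rintegral_cst//= lebesgue_measure_itv/= lte_fin ltr01 sube0 /=.
by rewrite mulr1.
Qed.

Lemma dist_le_gdist x y : convex_manifold M -> x <> y -> dist x y <= gdist x y.
Proof.
move=> conv xy; have [[c A] _] := conv x y; have [sc c0 c1 _] := A.
apply: dist_le; rewrite -(arc_length conv xy A) -[curve_length c]addr0 -c0.
by apply: Joined_cons => //; rewrite c1; exact: Joined_nil.
Qed.

(** [acos] is inverted by [cos] on [-1, 1], where the Cauchy-Schwarz inequality puts the quotient.
    If the inner product is negative, neither norm can vanish, so the division is harmless. *)
Lemma angle_le_pihalf x u v : angle x u v <= pi / 2 -> 0 <= inner x u v.
Proof.
move=> ang; rewrite leNgt; apply/negP => neg.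
have cx : cod (chart_of (index_at x)) (crd (index_at x) x).
  by apply: chart_coord_cod; exact: index_atP.
have CS : inner x u v ^+ 2 <= inner x u u * inner x v v := gG_cauchy u v cx.
have uu : 0 <= inner x u u := gG_ge0 u cx.
have vv : 0 <= inner x v v := gG_ge0 v cx.
pose P := tnorm x u * tnorm x v.
have P0 : 0 <= P by rewrite mulr_ge0 ?sqrtr_ge0.
have P2 : P ^+ 2 = inner x u u * inner x v v by rewrite exprMn !sqr_sqrtr.
rewrite -P2 in CS.
have i2 : 0 < inner x u v ^+ 2 by rewrite exprn_even_gt0//= lt_eqF.
have Pp : 0 < P.
  rewrite lt_neqAle P0 andbT eq_sym; apply/eqP => E.
  by have := lt_le_trans i2 CS; rewrite E expr0n ltxx.
have iP : - P <= inner x u v.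
  have nn : 0 <= - inner x u v by rewrite oppr_ge0 ltW.
  by rewrite lerNl -ler_sqr ?nnegrE// sqrrN.
have rI : -1 <= inner x u v / P <= 1.
  rewrite ler_pdivlMr// mulN1r iP ler_pdivrMr// mul1r.
  exact: le_trans (ltW neg) P0.
have : 0 <= cos (acos (inner x u v / P)).
  apply: cos_ge0_pihalf; rewrite ang andbT.
  by apply: le_trans (acos_ge0 rI); rewrite oppr_le0 divr_ge0// pi_ge0.
rewrite acosK ?in_itv//= ler_pdivlMr// mul0r.
by rewrite leNgt neg.
Qed.

End Final.

Theorem theorem2 (R : realType) (n : nat) (M : riemannianManifold R n) (k : R)
    (k_gt0 : 0 < k) (M_convex : convex_manifold M)
    (M_curv : sectional_le M (- k ^+ 2)) :
  let r0 := k^-1 * ln (Num.sqrt 2 + 1) in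
  forall (x p : M) (v_p : 'rV[R]_n), x <> p -> arrival_vector p x v_p ->
    halfspace x v_p `<=` [set q | segment p q `&` rball x r0 !=set0].
Proof.
move=> r0 x p v_p xp [al Al ->] y.
have [_ al0 al1 _] := Al.
have r0_ge0 : 0 <= r0.
  by rewrite mulr_ge0 ?invr_ge0 ?(ltW k_gt0)// ln_ge0// lerDr sqrtr_ge0.
have px : p <> x by exact/nesym.
have I0 : 0 <= (0 : R) <= 1 by rewrite lexx ler01.
have I1 : 0 <= (1 : R) <= 1 by rewrite lexx ler01.
have at_x q c (t : R) : geodesic_arc p q c -> 0 <= t <= 1 -> c t = x ->
    segment p q `&` rball x r0 !=set0.
  move=> A t01 E; exists x; split.
    by exists c => //; exists t; rewrite ?in_itv.
  by apply: le_trans r0_ge0; exact: dist_xx.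
have [->|xy] := pselect (y = x); first by move=> _; exact: at_x Al I1 al1.
move=> [//|[c A]].
move=> /angle_le_pihalf; rewrite -[inner _ _ _]/(gG _ _ _ _) [gG _ _ _ _]bfZr.
have bx : dom (chart_of (index_at x)) x by exact: index_atP.
have [_ c0 c1 _] := A.
have E1 : tnorm x (velocity al 1) = gdist p x.
  by have := arc_tnorm M_convex px Al I1; rewrite al1.
have g0 := gdist_gt0 M_convex px.
rewrite E1 pmulr_rge0 ?invr_gt0// /velocity c0 al1 => ang.
have [py LOC] := cosine_law M_convex k_gt0 M_curv px (nesym xy) Al A bx ang.
have [[s S] _] := M_convex p y; have [_ s0 s1 _] := S.
(* The comparison along [p, y] requires x to be off this arc; if it is on it, x itself is a common
   point of the arc and the ball. *)
have [[t [t01 st]]|ns] := pselect (exists t : R, 0 <= t <= 1 /\ s t = x).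
  exact: at_x S t01 st.
have nx (t : R) : 0 <= t <= 1 -> s t <> x by move=> t01 E; apply: ns; exists t.
have gpy := gdist_gt0 M_convex py.
have CV := ch_gdist_convex M_convex k_gt0 M_curv py S nx.
have kap0 : 0 < k * gdist p y by rewrite mulr_gt0.
rewrite (gdistC M_convex p x) in LOC.
(* The end values are cosh k D(x, p) and cosh k D(x, y); the law of cosines at x bounds their
   product. *)
have [t t01 tmin] := sinh_min kap0 (ch_ge1 _) (ch_ge1 _) LOC.
have xst : x <> s t by exact/nesym/nx.
exists (s t); split; first by exists s => //; exists t; rewrite ?in_itv.
apply: le_trans (dist_le_gdist M_convex xst) _.
have := CV t t01; rewrite s0 s1 => /le_trans/(_ tmin).
rewrite ler_pM2r ?sh_gt0// -(ch_r0 k_gt0) ch_le.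
- by rewrite ler_pM2l.
- by rewrite mulr_ge0 ?(ltW k_gt0)// gdist_ge0.
- by rewrite mulr_ge0 ?(ltW k_gt0).
Qed.
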